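(* Consider a family in prenormal form $(x^2-\epsilon)y'=B(\epsilon,x)y$, with $r$ and then $\rho$ sufficiently small, and let $s\in\{D,U\}$. There exists a fundamental matrix of solutions of this system that can be written as $$W_s(\hat\epsilon,x)=H_s(\hat\epsilon,x)F_s(\hat\epsilon,x),\qquad \hat\epsilon\in S,\ x\in\Omega_s^{\hat\epsilon},$$ with $H_s$ analytic in $(\hat\epsilon,x)$ for $\hat\epsilon\in S$, $x\in\Omega_s^{\hat\epsilon}$, satisfying: (1) there is $c\in\mathbb{R}_+$ with $|H_s(\bar\epsilon,0)-H_s(\tilde\epsilon,0)|\le c|\bar\epsilon|$ for all $\bar\epsilon,\ \tilde\epsilon=\bar\epsilon e^{2\pi i}\in S_\cap\cup\{0\}$; (2) $|H_s(\hat\epsilon,0)|$ and $|H_s(\hat\epsilon,0)^{-1}|$ are bounded for $\hat\epsilon\in S_\cap$; (3) for every $\hat\epsilon\in S$ and $l\in\{L,R\}$, $\lim_{x\to\hat x_l,\ x\in\Omega_s^{\hat\epsilon}}H_s(\hat\epsilon,x)=\hat{\mathcal K}_l$, where $\hat{\mathcal K}_l$ is an invertible diagonal matrix depending analytically on $\hat\epsilon\in S$, with a nonsingular limit at $\epsilon=0$, and independent of $s$.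
   Context: Systems. A family in prenormal form is a family $(x^2-\epsilon)y'=B(\epsilon,x)y$, $y\in\mathbb{C}^n$, $n\ge2$, $'=d/dx$, with $B=\Lambda(\epsilon,x)+(x^2-\epsilon)R(\epsilon,x)$, $\Lambda(\epsilon,x)=\mathrm{diag}\{\lambda_1(\epsilon,x),\dots,\lambda_n(\epsilon,x)\}=\Lambda_0(\epsilon)+\Lambda_1(\epsilon)x$, $\Lambda_0,\Lambda_1$ diagonal and analytic in $\epsilon$ near $0$, $R$ a matrix of germs of analytic functions of $(\epsilon,x)$ at the origin, and $\Re(\lambda_q(0,0)-\lambda_j(0,0))>0$ for $q<j$. Model system: $(x^2-\epsilon)z'=\Lambda(\epsilon,x)z$. Parameter sector. Let $\theta_0$ be the largest angle (supremum) in $(0,\frac\pi2)$ with $\Re(e^{\pm i\theta_0}(\lambda_q(0,0)-\lambda_j(0,0)))\ge0$ for $q<j$. Fix $\gamma>0$ with $\gamma(1+\frac{2\gamma}{\pi})<\theta_0$ and let $S=\{\hat\epsilon:0<|\hat\epsilon|<\rho,\ \arg\hat\epsilon\in(\pi-2\gamma,3\pi+2\gamma)\}$ (on the universal covering of $\mathbb{C}^*$; $\epsilon$ is the projection of $\hat\epsilon$). Put $\arg\sqrt{\hat\epsilon}=\frac12\arg\hat\epsilon$, $\hat x_L=\sqrt{\hat\epsilon}$, $\hat x_R=-\sqrt{\hat\epsilon}$. The radius $\rho>0$ is small, in particular so that for some $C>0$, $\Re(e^{\pm i\gamma(1+2\gamma/\pi)}(\lambda_q(\epsilon,\hat x_l)-\lambda_j(\epsilon,\hat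 x_l)))>C$ for $q<j$, $l=L,R$, $\hat\epsilon\in S$. $S_\cap$ is the auto-intersection of $S$: it consists of the pairs $\bar\epsilon$, $\tilde\epsilon=\bar\epsilon e^{2\pi i}$ both in $S$. Sectorial domains. Fix $r>0$ small, $\mathbb{D}_r=\{|x|<r\}$, $\delta>0$ small, $\Omega_D=\{|x|<r,\,-(\pi+\delta)<\arg x<\delta\}$, $\Omega_U=\{|x|<r,\,-\delta<\arg x<\pi+\delta\}$, such that the closure of $\Omega_D$ (resp. $\Omega_U$) contains no ray $\Re((\lambda_q(0,0)-\lambda_j(0,0))/x)=0$, $q\ne j$, of the upper (resp. lower) half-plane. Use the time $t$ of $\dot x=x^2-\epsilon$: $x(t)=-\sqrt{\hat\epsilon}\coth(\sqrt{\hat\epsilon}\,t)$ if $\epsilon\neq0$ (period $\pi i/\sqrt{\hat\epsilon}$), $x(t)=-1/t$ if $\epsilon=0$. Fix small constants $c_0>0$, $h\in(0,1/r)$, $\kappa\in(0,\frac12)$ independent of $\hat\epsilon$. Let $N_{\hat\epsilon}$ be the connected component containing $t=0$ of $\{t:|x(t)|\ge r\}$, $P=-\pi i/\sqrt{\hat\epsilon}$, $\hat\theta=\frac{2\gamma}{\pi}(\pi-\arg\sqrt{\hat\epsilon})$, and $\sigma(u)=0$ if $|u|\le c_0/\sqrt{|\epsilon|}$, $\sigma(u)=(u-\mathrm{sgn}(u)c_0/\sqrt{|\epsilon|})\tan\hat\theta$ otherwise. $\Gamma_D^{\hat\epsilon}$ is the set of $t\notin N_{\hat\epsilon}$ with $\Im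 t<h+\sigma(\Re t)$ lying above the line $-(\frac12+\kappa)P+\mathbb{R}e^{i\hat\theta}$; $\Gamma_U^{\hat\epsilon}$ is the set of $t\notin N_{\hat\epsilon}$ with $\Im t>-h+\sigma(\Re t)$ lying below the line $(\frac12+\kappa)P+\mathbb{R}e^{i\hat\theta}$. For $\epsilon=0$: $\Gamma_D^0=\{|t|>1/r,\Im t<h\}$, $\Gamma_U^0=\{|t|>1/r,\Im t>-h\}$. $\Omega_s^{\hat\epsilon}=x(\Gamma_s^{\hat\epsilon})$, $s=D,U$ (with $\Omega^0_s\subset\Omega_s$). $\Omega_D^{\hat\epsilon}\cap\Omega_U^{\hat\epsilon}$ has three connected components $\Omega_L^{\hat\epsilon},\Omega_R^{\hat\epsilon},\Omega_C^{\hat\epsilon}$, images of the right and left components of $\Gamma_D^{\hat\epsilon}\cap\Gamma_U^{\hat\epsilon}$ and of $\Gamma_D^{\hat\epsilon}\cap(\Gamma_U^{\hat\epsilon}-P)$; their closures contain respectively $\hat x_L$, $\hat x_R$, and both; $0\in\Omega_C^{\hat\epsilon}$. Model solutions. For $l=L,R$, $\mathcal U_l=\frac1{2\hat x_l}\Lambda(\epsilon,\hat x_l)$. $F(\epsilon,x)=(x-\hat x_R)^{\mathcal U_R}(x-\hat x_L)^{\mathcal U_L}$ for $\epsilon\ne0$ and $F(0,x)=x^{\Lambda_1(0)}e^{-\Lambda_0(0)/x}$ is a fundamental matrix of the model. $F_D(\hat\epsilon,\cdot)$ is its branch on $\Omega_D^{\hat\epsilon}$ (namely $e^{t\Lambda_0}(x^2-\epsilon)^{\Lambda_1/2}$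 with $x=x(t)$, $t\in\Gamma_D^{\hat\epsilon}$, converging as $\hat\epsilon\to0$ to $F(0,x)$ with $-(\pi+\delta)<\arg x<\delta$), and $F_U(\hat\epsilon,\cdot)$ is the analytic continuation of $F_D$ to $\Omega_U^{\hat\epsilon}$ through $\Omega_R^{\hat\epsilon}$. At $\bar\epsilon=0$ one uses $H_s(0,0)=I$, so that (1) is trivial there. *)

(* Defs.v *)
From HB Require Import structures.
From mathcomp Require Import all_boot all_order all_algebra.
From mathcomp Require Import complex.
From mathcomp Require Import all_classical all_reals all_analysis.
Set Implicit Arguments.
Unset Strict Implicit.
Unset Printing Implicit Defensive.
Import Order.TTheory GRing.Theory Num.Theory.
Import numFieldNormedType.Exports.
Local Open Scope classical_set_scope.
Local Open Scope complex_scope.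
Local Open Scope ring_scope.

(* A named copy of R[i]: its head constant lets R[i] inherit the topology and
   the normed-module structure (over itself) of a numFieldType, so that
   [differentiable] and ['D_1] below are complex differentiability. *)
Definition cplx (R : realType) : numClosedFieldType := R[i].

Inductive sector := D | U.
Inductive singpt := SL | SR.

Section ComplexFunctions.
Context {R : realType}.
Local Notation C := (cplx R).

Definition Rc (u : R) : C := u%:C.
Definition re (z : C) : R := complex.Re z.
Definition im (z : C) : R := complex.Im z.
Definition ci : C := 0 +i* 1.

Definition cis (u : R) : C := cos u +i* sin u.
Definition cexp (z : C) : C := Rc (expR (re z)) * cis (im z).
Definition ccosh (z : C) : C := (cexp z + cexp (- z)) / 2.
Definition csinh (z : C) : C := (cexp z - cexp (- z)) / 2.

(* Holomorphic near p: complex (Frechet) differentiable in a neighbourhood.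
   Functions of two complex variables are taken on C * C. *)
Definition analytic_at {V W : normedModType C} (f : V -> W) (p : V) : Prop :=
  \forall q \near p, differentiable f q.

End ComplexFunctions.

Section Families.
Variables (R : realType) (n : nat).
Local Notation C := (cplx R).

Record prenormal := Prenormal {
  Lam0 : C -> 'rV[C]_n;
  Lam1 : C -> 'rV[C]_n;
  Rem : C -> C -> 'M[C]_n;
  Lam0_analytic : analytic_at Lam0 0;
  Lam1_analytic : analytic_at Lam1 0;
  Rem_analytic : analytic_at (fun p : C * C => Rem p.1 p.2) (0, 0);
  Lam_ordered : forall q j : 'I_n, (q < j)%N ->
    0 < re (Lam0 0 0 q - Lam0 0 0 j)
}.

Variable A : prenormal.

Definition lam (eps x : C) : 'rV[C]_n := Lam0 A eps + x *: Lam1 A eps.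

Definition Bmx (eps x : C) : 'M[C]_n :=
  diag_mx (lam eps x) + (x ^+ 2 - eps) *: Rem A eps x.

(* lambda_q(0,0) - lambda_j(0,0) *)
Definition gap (q j : 'I_n) : C := lam 0 0 0 q - lam 0 0 0 j.

Definition theta0 : R :=
  sup [set th : R | 0 < th < pi / 2 /\
        forall q j : 'I_n, (q < j)%N ->
          0 <= re (cis th * gap q j) /\ 0 <= re (cis (- th) * gap q j)].

End Families.

(* The universal covering of C^* is the exponential map cexp : C -> C^*, so a
   point hat-epsilon of the covering is given by its logarithm z:
     epsilon = cexp z,  |epsilon| = expR (re z),  arg hat-epsilon = im z,
     sqrt hat-epsilon = cexp (z / 2),  hat-epsilon e^{2 pi i} = z + turn. *)
Section Covering.
Context {R : realType}.
Local Notation C := (cplx R).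

Definition eps_of (z : C) : C := cexp z.
Definition sqrte (z : C) : C := cexp (z / 2).
Definition turn : C := ci * Rc (2 * pi).

Definition param_sector (gamma rho : R) : set C :=
  [set z | expR (re z) < rho /\ pi - 2 * gamma < im z < 3 * pi + 2 * gamma].

(* hat-epsilon -> 0 inside the set S of the covering *)
Definition eps_to0 (S : set C) : set_system C :=
  [set P | \forall e \near (0 : C), forall z, S z -> eps_of z = e -> P z].

Definition xsing (l : singpt) (z : C) : C :=
  match l with SL => sqrte z | SR => - sqrte z end.

(* The solution of x' = x^2 - epsilon; its poles are the zeros of
   csinh (sqrte z * t), where the division below returns a junk value. *)
Definition xtime (z t : C) : C :=
  - sqrte z * (ccosh (sqrte z * t) / csinh (sqrte z * t)).
Definition pole (z t : C) : Prop := csinh (sqrte z * t) = 0.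

Definition period (z : C) : C := - (Rc pi * ci) / sqrte z.

End Covering.

Section Domains.
Context {R : realType}.
Local Notation C := (cplx R).
Variables (gamma r h kappa c0 : R).

(* At a pole |x(t)| is infinite, hence >= r. *)
Definition Nset (z : C) : set C :=
  connected_component [set t | pole z t \/ Rc r <= `|xtime z t|] 0.

Definition hat_theta (z : C) : R := 2 * gamma / pi * (pi - im z / 2).

Definition sigma (z : C) (u : R) : R :=
  let a := c0 / Num.sqrt (expR (re z)) in
  if `|u| <= a then 0 else (u - Num.sg u * a) * tan (hat_theta z).

Definition above_line (a : C) (th : R) (t : C) : Prop :=
  0 < im ((t - a) * cis (- th)).
Definition below_line (a : C) (th : R) (t : C) : Prop :=
  im ((t - a) * cis (- th)) < 0.

Definition Gam (s : sector) (z : C) : set C :=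
  match s with
  | D => [set t | [/\ ~ Nset z t, im t < h + sigma z (re t) &
           above_line (- (Rc (2^-1 + kappa) * period z)) (hat_theta z) t]]
  | U => [set t | [/\ ~ Nset z t, - h + sigma z (re t) < im t &
           below_line (Rc (2^-1 + kappa) * period z) (hat_theta z) t]]
  end.

Definition Omega (s : sector) (z : C) : set C := xtime z @` Gam s z.

Definition left_part (A : set C) : set C :=
  [set t | A t /\ connected_component A t `<=` [set t' | re t' < 0]].

Definition OmegaR (z : C) : set C :=
  xtime z @` left_part (Gam D z `&` Gam U z).

Definition Gam0 (s : sector) : set C :=
  match s with
  | D => [set t | Rc r^-1 < `|t| /\ im t < h]
  | U => [set t | Rc r^-1 < `|t| /\ - h < im t]
  end.

Definition Omega0 (s : sector) : set C := (fun t : C => - t^-1) @` Gam0 s.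

End Domains.

Section SectorsAtZero.
Context {R : realType}.
Local Notation C := (cplx R).
Variables (r delta : R).

Definition Sect (s : sector) : set C :=
  [set x | exists m a : R, [/\ 0 < m < r,
      match s with
      | D => - (pi + delta) < a < delta
      | U => - delta < a < pi + delta
      end & x = Rc m * cis a]].

(* No point of the closure of Omega_D (resp. Omega_U) in the upper (resp.
   lower) half-plane lies on a ray Re ((lambda_q - lambda_j) / x) = 0. *)
Definition avoids_rays (n : nat) (A : prenormal R n) : Prop :=
  forall q j : 'I_n, q != j ->
    (forall x, closure (Sect D) x -> 0 < im x -> re (gap A q j / x) != 0) /\
    (forall x, closure (Sect U) x -> im x < 0 -> re (gap A q j / x) != 0).

End SectorsAtZero.

Section Solutions.
Variables (R : realType) (n : nat) (A : prenormal R n).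
Local Notation C := (cplx R).
Variables (gamma r delta h kappa c0 rho : R).

Local Notation S := (param_sector gamma rho).
Local Notation Gam := (Gam gamma r h kappa c0).
Local Notation Omega := (Omega gamma r h kappa c0).
Local Notation OmegaR := (OmegaR gamma r h kappa c0).

(* F z (x(t)) = exp(t Lambda_0) (x^2 - epsilon)^(Lambda_1 / 2) for t in Gamma_s,
   where L z t is an analytic branch of log (x(t)^2 - epsilon) / 2.  As
   exp(2 sqrt(eps) t) = (x - sqrt(eps)) / (x + sqrt(eps)), this is a branch of
   (x - x_R)^(U_R) (x - x_L)^(U_L). *)
Definition model_branch (s : sector) (L : C -> C -> C) (F : C -> C -> 'M[C]_n)
    : Prop :=
  forall z t, S z -> Gam s z t ->
    [/\ analytic_at (fun p : C * C => L p.1 p.2) (z, t),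
        cexp (2 * L z t) = xtime z t ^+ 2 - eps_of z &
        F z (xtime z t) =
          diag_mx (\row_i cexp (t * Lam0 A (eps_of z) 0 i
                                + L z t * Lam1 A (eps_of z) 0 i))].

(* The branch is fixed by the limit hat-epsilon -> 0: at fixed t, L tends to
   log x for x = -1/t, -(pi + delta) < arg x < delta. *)
Definition model_FD (FD : C -> C -> 'M[C]_n) : Prop :=
  exists2 L : C -> C -> C, model_branch D L FD &
    forall t, Gam0 r h D t ->
      exists l0 : C, [/\ cexp l0 = - t^-1, - (pi + delta) < im l0 < delta &
                         L z t @[z --> eps_to0 S] --> l0].

Definition model_FU (FD FU : C -> C -> 'M[C]_n) : Prop :=
  (exists L : C -> C -> C, model_branch U L FU) /\
  (forall z x, S z -> OmegaR z x -> FU z x = FD z x).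

Definition fundamental_on (eps : C) (O : set C) (W : C -> 'M[C]_n) : Prop :=
  forall x, O x ->
    [/\ derivable W x 1,
        (x ^+ 2 - eps) *: 'D_1 W x = Bmx A eps x *m W x &
        W x \in unitmx].

(* The pairs (z, z + turn) of S_cap, and S_cap as a set of points. *)
Definition cap_pair (z : C) : Prop := S z /\ S (z + turn).
Definition Scap : set C := [set z | cap_pair z \/ cap_pair (z - turn)].

End Solutions.

(* Main.v *)
(* Put x = sqrt(eps) tanh w: the singular points x_L, x_R go to Re w = +oo, -oo
   and x = 0 to w = 0.  Dividing the j-th column of a fundamental matrix by the
   j-th model solution gives a system with diagonal exponents
   (lambda_j - lambda_i) / sqrt(eps), perturbed by terms of size
   O(|sqrt(eps)| e^(-|Re w|)).  Along the lines w = u (1 + i v), with v close to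
   the slope determined by the tilt of the spiralling domains, the hypothesis on
   theta_0 makes each exponent with i <> j grow or decay at a rate
   const / |sqrt(eps)|.  There is then exactly one solution with j-th component
   1 at w = 0 that stays bounded at both ends; it is the limit of solutions of
   two-point boundary value problems on finite segments, hence analytic in the
   parameter.  Its value at w = 0 is the j-th unit vector up to O(|eps|), which
   yields (1) and (2), and at the two ends it tends to K_j e_j with
   K_j = 1 + O(|sqrt(eps)|); these limits only involve the line through w = 0,
   so they do not depend on the sector.

   In the time t each sectorial domain lies in a tilted strip minus a disc around
   0.  The strip is narrower than a period, so x determines w, and the strip minus
   the disc is covered by a lower half-strip and two star-shaped fans through which
   the solution can be continued.  By Gronwall's inequality on vertical segments
   the limits along the line are limits in the whole domain. *)
From Pilot Require Import Defs.
From HB Require Import structures.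
From mathcomp Require Import all_boot all_order all_algebra.
From mathcomp Require Import complex.
From mathcomp Require Import all_classical all_reals all_analysis.
From mathcomp Require Import ring lra.
Set Implicit Arguments.
Unset Strict Implicit.
Unset Printing Implicit Defensive.
Import Order.TTheory GRing.Theory Num.Theory.
Import numFieldNormedType.Exports.
Local Open Scope classical_set_scope.
Local Open Scope ring_scope.

(** * Holomorphic functions of one and two variables *)

Section ComplexCalculus.
Context {R : realType}.
Local Notation C := (cplx R).
Implicit Types (z w a b l : C) (u v e d M : R).

(** Conclusion (1) compares two sheets of the covering, yet no relation between the constructions on
    them is needed: on every sheet a forcing of size |sqrt(eps)| meets rates of size 1/|sqrt(eps)|,
    so each of the two values differs from the identity by O(|eps|), and the triangle inequality
    concludes. The diagonal of [H z 0] is 1 by normalization; only the other entries are estimated.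
    Growing components are controlled from one end of the line and decaying ones from the other, so
    no initial value problem gives bounds. Most estimates therefore have the same form: a bound M,
    known to exist by compactness, is improved to B + M/2. Holomorphy in the parameter is visible on
    finite segments, where the column is read off an inverse matrix, and it survives because bounded
    limits of holomorphic functions are holomorphic. The line must turn with eps; this is compatible
    with holomorphy because the bounded solution is the same for all admissible directions. In the
    continuation the obstacles are the poles of x(t), which are the zeros of cosh w, and the disc
    around t = 0: overlaps of the charts have to be joined by segments to exclude monodromy. *)

Definition cm z : R := re `|z|.

(** The order of [C] compares only numbers with equal imaginary part, so a norm, being nonnegative,
    is a real number; all estimates can then be made in [R] through [cm]. *)
Lemma normE z : `|z| = Rc (cm z).
Proof.
have : 0 <= `|z| by exact: normr_ge0.
rewrite /cm /re /Rc; case: (`|z|) => x y; rewrite lecE /= => /andP[/eqP -> _].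
by [].
Qed.

Lemma Rc_le u v : (Rc u <= Rc v :> C) = (u <= v).
Proof. by rewrite lecE /= eqxx. Qed.

Lemma Rc_lt u v : (Rc u < Rc v :> C) = (u < v).
Proof. by rewrite ltcE /= eqxx. Qed.

Lemma re0 : re (0 : C) = 0. Proof. by []. Qed.
Lemma im0 : im (0 : C) = 0. Proof. by []. Qed.
Lemma re1 : re (1 : C) = 1. Proof. by []. Qed.
Lemma reD z w : re (z + w) = re z + re w. Proof. by case: z w => ? ? []. Qed.
Lemma imD z w : im (z + w) = im z + im w. Proof. by case: z w => ? ? []. Qed.
Lemma reN z : re (- z) = - re z. Proof. by case: z. Qed.
Lemma imN z : im (- z) = - im z. Proof. by case: z. Qed.
Lemma reB z w : re (z - w) = re z - re w. Proof. by rewrite reD reN. Qed.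
Lemma imB z w : im (z - w) = im z - im w. Proof. by rewrite imD imN. Qed.
Lemma reM z w : re (z * w) = re z * re w - im z * im w.
Proof. by case: z w => ? ? []. Qed.
Lemma imM z w : im (z * w) = re z * im w + im z * re w.
Proof. by case: z w => ? ? []. Qed.
Lemma re_Rc u : re (Rc u : C) = u. Proof. by []. Qed.
Lemma im_Rc u : im (Rc u : C) = 0. Proof. by []. Qed.
Lemma re_ci : re (ci : C) = 0. Proof. by []. Qed.
Lemma im_ci : im (ci : C) = 1. Proof. by []. Qed.
Lemma Rc0 : Rc 0 = 0 :> C. Proof. by []. Qed.
Lemma Rc1 : Rc 1 = 1 :> C. Proof. by []. Qed.
Lemma C_eqP z w : re z = re w -> im z = im w -> z = w.
Proof. by case: z w => [? ?] [? ?] /= -> ->. Qed.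
Lemma RcD u v : Rc (u + v) = Rc u + Rc v :> C.
Proof. by apply: C_eqP; rewrite ?(reD, imD) //= addr0. Qed.
Lemma RcN u : Rc (- u) = - Rc u :> C.
Proof. by apply: C_eqP; rewrite ?(reN, imN) //= oppr0. Qed.
Lemma RcB u v : Rc (u - v) = Rc u - Rc v :> C.
Proof. by rewrite RcD RcN. Qed.
Lemma RcM u v : Rc (u * v) = Rc u * Rc v :> C.
Proof. by apply: C_eqP; rewrite ?(reM, imM) /=; ring. Qed.
Lemma Rc_eq0 u : (Rc u == 0 :> C) = (u == 0).
Proof. by apply/eqP/eqP => [/(congr1 re)|->]. Qed.
Lemma RcV u : Rc u^-1 = (Rc u)^-1 :> C.
Proof.
have [->|u0] := eqVneq u 0; first by rewrite invr0 !Rc0 invr0.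
have u0' : (Rc u : C) != 0 by rewrite Rc_eq0.
by apply: (mulfI u0'); rewrite -RcM !divff.
Qed.
Lemma Rc_nat k : Rc k%:R = k%:R :> C.
Proof. by elim: k => // k IH; rewrite -!natr1 RcD IH. Qed.

Lemma cm_ge0 z : 0 <= cm z.
Proof. by rewrite -Rc_le -normE normr_ge0. Qed.
Lemma cmM z w : cm (z * w) = cm z * cm w.
Proof. by have := normrM z w; rewrite !normE -RcM => /(congr1 re). Qed.
Lemma cmD z w : cm (z + w) <= cm z + cm w.
Proof. by rewrite -Rc_le RcD -!normE ler_normD. Qed.
Lemma cm0 : cm 0 = 0. Proof. by rewrite /cm normr0. Qed.
Lemma cm1 : cm 1 = 1. Proof. by rewrite /cm normr1. Qed.
Lemma cmN z : cm (- z) = cm z. Proof. by rewrite /cm normrN. Qed.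
Lemma cmBC z w : cm (z - w) = cm (w - z). Proof. by rewrite /cm distrC. Qed.
Lemma cm_eq0 z : (cm z == 0) = (z == 0).
Proof. by rewrite -(normr_eq0 z) normE Rc_eq0. Qed.
Lemma cm_gt0 z : (0 < cm z) = (z != 0).
Proof. by rewrite lt_def cm_ge0 cm_eq0 andbT. Qed.
Lemma cmV z : cm z^-1 = (cm z)^-1.
Proof. by have := normfV z; rewrite !normE -RcV => /(congr1 re). Qed.
Lemma cmX z k : cm (z ^+ k) = cm z ^+ k.
Proof. by elim: k => [|k IH]; rewrite ?expr0 ?cm1 // !exprS cmM IH. Qed.
Lemma cmB z w : cm (z - w) <= cm z + cm w.
Proof. by rewrite -(cmN w) cmD. Qed.
Lemma cm_dist z w : cm z - cm w <= cm (z - w).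
Proof. by rewrite lerBlDr -{1}(subrK w z) cmD. Qed.
Lemma cm_tri z w a : cm (z - w) <= cm (z - a) + cm (a - w).
Proof. by rewrite -(subrKA a) cmD. Qed.
Lemma cm_sqr z : cm z ^+ 2 = re z ^+ 2 + im z ^+ 2.
Proof.
rewrite /cm /re /im; case: z => x y; rewrite normc_def /=.
by rewrite sqr_sqrtr // addr_ge0 // sqr_ge0.
Qed.
Lemma cm_le_sqr z M : 0 <= M -> (cm z <= M) = (re z ^+ 2 + im z ^+ 2 <= M ^+ 2).
Proof. by move=> M0; rewrite -cm_sqr ler_pXn2r // nnegrE ?cm_ge0. Qed.
Lemma re_le_cm z : `|re z| <= cm z.
Proof.
rewrite -(ler_pXn2r (n := 2)) ?nnegrE ?cm_ge0 //.
by rewrite cm_sqr real_normK ?num_real // lerDl sqr_ge0.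
Qed.
Lemma im_le_cm z : `|im z| <= cm z.
Proof.
rewrite -(ler_pXn2r (n := 2)) ?nnegrE ?cm_ge0 //.
by rewrite cm_sqr real_normK ?num_real // lerDr sqr_ge0.
Qed.
Lemma cm_le_reim z : cm z <= `|re z| + `|im z|.
Proof.
rewrite cm_le_sqr ?addr_ge0 // sqrrD !real_normK ?num_real //.
by rewrite addrAC lerDl mulrn_wge0 // mulr_ge0.
Qed.
Lemma cm_Rc u : cm (Rc u) = `|u|.
Proof.
apply/eqP; rewrite eq_le; apply/andP; split; last exact: (re_le_cm (Rc u)).
by apply: le_trans (cm_le_reim _) _; rewrite im_Rc normr0 addr0.
Qed.
Lemma cm_ci : cm ci = 1.
Proof. by apply/eqP; rewrite -(eqrXn2 (n := 2)) ?cm_ge0 // cm_sqr /= expr0n add0r. Qed.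
Lemma cm_sum (I : Type) (r : seq I) (F : I -> C) :
  cm (\sum_(i <- r) F i) <= \sum_(i <- r) cm (F i).
Proof.
elim/big_ind2: _ => [|x1 x2 y1 y2 h1 h2|//]; first by rewrite cm0.
by apply: le_trans (cmD _ _) _; rewrite lerD.
Qed.

(* [j] is the identity of [C] for a complex derivative, and [Rc] for the
   derivative of a path. *)
Definition gder (T : zmodType) (j : T -> C) (f : T -> C) (x : T) l :=
  forall e, 0 < e -> exists2 d, 0 < d &
    forall k, cm (j k) < d -> cm (f (x + k) - f x - l * j k) <= e * cm (j k).

Definition cder (f : C -> C) (w l : C) := gder id f w l.
Definition pder (g : R -> C) (u : R) (l : C) := gder (fun v => Rc v) g u l.

Section Gder.
Context {T : zmodType} (j : T -> C).
Implicit Types (f g : T -> C) (x : T).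

Lemma gder_cst c x : gder j (fun=> c) x 0.
Proof.
move=> e e0; exists 1 => // k _.
by rewrite subrr mul0r subrr cm0 mulr_ge0 ?cm_ge0 // ltW.
Qed.

Lemma gder_cont f x l : gder j f x l -> forall e, 0 < e ->
  exists2 d, 0 < d & forall k, cm (j k) < d -> cm (f (x + k) - f x) <= e.
Proof.
move=> /(_ 1 ltr01)[d d0 H] e e0.
have L0 : 0 < cm l + 1 by rewrite ltr_wpDl ?cm_ge0.
exists (Num.min d (e / (cm l + 1))); first by rewrite lt_min d0 divr_gt0.
move=> k; rewrite lt_min => /andP[kd ke].
have -> : f (x + k) - f x = (f (x + k) - f x - l * j k) + l * j k by ring.
apply: le_trans (cmD _ _) _; apply: le_trans (lerD (H _ kd) (lexx _)) _.
by rewrite cmM -mulrDl addrC mulrC -ler_pdivlMr // ltW.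
Qed.

Lemma gder_lip f x l : gder j f x l -> exists2 d, 0 < d &
  forall k, cm (j k) < d -> cm (f (x + k) - f x) <= (cm l + 1) * cm (j k).
Proof.
move=> /(_ 1 ltr01)[d d0 H]; exists d => // k kd.
have -> : f (x + k) - f x = (f (x + k) - f x - l * j k) + l * j k by ring.
apply: le_trans (cmD _ _) _; apply: le_trans (lerD (H _ kd) (lexx _)) _.
by rewrite cmM -mulrDl addrC.
Qed.

Lemma gderD f g x l m : gder j f x l -> gder j g x m ->
  gder j (fun y => f y + g y) x (l + m).
Proof.
move=> F G e e0; have e2 : 0 < e / 2 by rewrite divr_gt0.
have [d1 d10 H1] := F _ e2; have [d2 d20 H2] := G _ e2.
exists (Num.min d1 d2); first by rewrite lt_min d10.
move=> k; rewrite lt_min => /andP[k1 k2].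
have -> : f (x + k) + g (x + k) - (f x + g x) - (l + m) * j k =
  (f (x + k) - f x - l * j k) + (g (x + k) - g x - m * j k) by ring.
apply: le_trans (cmD _ _) _; apply: le_trans (lerD (H1 _ k1) (H2 _ k2)) _.
by rewrite -mulrDl -splitr.
Qed.

Lemma gderM f g x l m : gder j f x l -> gder j g x m ->
  gder j (fun y => f y * g y) x (l * g x + f x * m).
Proof.
move=> F G e e0.
set K := cm (g x) + 1 + cm l + cm (f x) + 1.
have K0 : 0 < K by rewrite /K ltr_wpDl // !addr_ge0 ?cm_ge0.
have e2 : 0 < e / K by rewrite divr_gt0.
have [d1 d10 H1] := F _ e2; have [d2 d20 H2] := G _ e2.
have [d3 d30 H3] := gder_cont G e2; have [d4 d40 H4] := gder_cont G ltr01.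
exists (Num.min (Num.min d1 d2) (Num.min d3 d4)); first by rewrite !lt_min d10 d20 d30.
move=> k; rewrite !lt_min => /andP[/andP[k1 k2] /andP[k3 k4]].
have -> : f (x + k) * g (x + k) - f x * g x - (l * g x + f x * m) * j k =
  (f (x + k) - f x - l * j k) * g (x + k) + (l * j k * (g (x + k) - g x)
   + f x * (g (x + k) - g x - m * j k)) by ring.
have gb : cm (g (x + k)) <= cm (g x) + 1.
  by rewrite -(subrK (g x) (g (x + k))) (le_trans (cmD _ _)) // addrC lerD2l H4.
apply: le_trans (cmD _ _) _; rewrite cmM.
apply: le_trans (lerD (ler_pM (cm_ge0 _) (cm_ge0 _) (H1 _ k1) gb) (cmD _ _)) _.
rewrite !cmM.
have kk := cm_ge0 (j k).
have h3 : cm l * cm (j k) * cm (g (x + k) - g x) <= cm l * cm (j k) * (e / K).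
  by apply: ler_wpM2l (H3 _ k3); rewrite mulr_ge0 ?cm_ge0.
have h2 : cm (f x) * cm (g (x + k) - g x - m * j k) <= cm (f x) * (e / K * cm (j k)).
  by apply: ler_wpM2l (H2 _ k2); rewrite cm_ge0.
apply: le_trans (lerD (lexx _) (lerD h3 h2)) _.
rewrite (_ : _ + _ = (e / K) * (K - 1) * cm (j k)); last by rewrite /K; ring.
rewrite ler_wpM2r // -[leRHS](divfK (lt0r_neq0 K0)) ler_wpM2l ?(ltW e2) //.
by rewrite lerBlDr lerDl.
Qed.

Lemma gder_comp (f : C -> C) g x l m : cder f (g x) l -> gder j g x m ->
  gder j (fun y => f (g y)) x (l * m).
Proof.
move=> F G e e0.
have L0 : 0 < cm l + 1 by rewrite ltr_wpDl ?cm_ge0.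
have M0 : 0 < cm m + 1 by rewrite ltr_wpDl ?cm_ge0.
have e1 : 0 < e / 2 / (cm m + 1) by rewrite !divr_gt0.
have e2 : 0 < e / 2 / (cm l + 1) by rewrite !divr_gt0.
have [d1 d10 H1] := F _ e1; have [d2 d20 H2] := G _ e2.
have [d3 d30 H3] := gder_lip G.
have d1' : 0 < d1 / (cm m + 1) by rewrite divr_gt0.
exists (Num.min (Num.min d2 d3) (d1 / (cm m + 1))); first by rewrite !lt_min d20 d30.
move=> k; rewrite !lt_min => /andP[/andP[k2 k3] k1].
set q := g (x + k) - g x.
have qk : cm q <= (cm m + 1) * cm (j k) by exact: H3.
have q1 : cm q < d1.
  by apply: le_lt_trans qk _; rewrite mulrC -ltr_pdivlMr.
have := H1 _ q1; rewrite (_ : g x + q = g (x + k)); last by rewrite /q addrC subrK.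
move=> A; have B := H2 _ k2.
have -> : f (g (x + k)) - f (g x) - l * m * j k =
  (f (g (x + k)) - f (g x) - l * q) + l * (g (x + k) - g x - m * j k)
  by rewrite /q; ring.
apply: le_trans (cmD _ _) _; rewrite cmM [leRHS](_ : _ = e / 2 * cm (j k) + e / 2 * cm (j k)); last first.
  by rewrite -mulrDl -splitr.
apply: lerD.
  apply: le_trans A _; rewrite -mulrA ler_wpM2l ?divr_ge0 ?(ltW e0) //.
  by rewrite mulrC ler_pdivrMr // mulrC.
apply: le_trans (ler_wpM2l (cm_ge0 _) B) _.
rewrite mulrA ler_wpM2r ?cm_ge0 // mulrCA -[leRHS]mulr1 ler_wpM2l ?divr_ge0 ?(ltW e0) //.
by rewrite ler_pdivrMr // mul1r lerDl.
Qed.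

Lemma gder_ext f g x l : (exists2 d, 0 < d & forall k, cm (j k) < d -> f (x + k) = g (x + k)) ->
  j 0 = 0 -> gder j f x l -> gder j g x l.
Proof.
move=> [d d0 E] j0 F e e0; have [d1 d10 H] := F _ e0.
exists (Num.min d d1); first by rewrite lt_min d0.
move=> k; rewrite lt_min => /andP[kd k1].
have E0 : f x = g x by have := E 0; rewrite addr0; apply; rewrite j0 cm0.
by rewrite -E // -E0; exact: H.
Qed.

End Gder.

Lemma gder_eq (T : zmodType) (j : T -> C) f x l m : gder j f x l -> l = m -> gder j f x m.
Proof. by move=> ? <-. Qed.

Lemma cder_id w : cder id w 1.
Proof.
move=> e e0; exists 1 => // k _.
by rewrite mul1r (addrC w) addrK subrr cm0 mulr_ge0 ?cm_ge0 // ltW.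
Qed.

Lemma pder_Rc u : pder (fun v => Rc v) u 1.
Proof.
move=> e e0; exists 1 => // k _.
by rewrite mul1r RcD (addrC (Rc u)) addrK subrr cm0 mulr_ge0 ?cm_ge0 // ltW.
Qed.

Lemma cderV w : w != 0 -> cder (fun z => z^-1) w (- w ^- 2).
Proof.
move=> w0 e e0; have cw : 0 < cm w by rewrite cm_gt0.
pose K := cm w ^+ 3 / 2.
have K0 : 0 < K by rewrite divr_gt0 // exprn_gt0.
(* The first bound keeps |w + k| above |w| / 2, the second makes the remainder k^2 / (w^2 (w + k))
   at most e |k|. *)
exists (Num.min (cm w / 2) (e * K)); first by rewrite lt_min divr_gt0 //= mulr_gt0.
move=> k /=; rewrite lt_min => /andP[k1 k2].
have wk : cm w / 2 <= cm (w + k).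
  have := cm_dist w (- k); rewrite opprK cmN => h; lra.
have wk0 : w + k != 0 by rewrite -cm_gt0; lra.
have -> : (w + k)^-1 - w^-1 - - w ^- 2 * k = k * k / (w ^+ 2 * (w + k)) by field; rewrite ?w0 ?wk0.
rewrite !cmM cmV cmM cmX mulrAC ler_wpM2r ?cm_ge0 //.
have D0 : 0 < cm w ^+ 2 * cm (w + k) by rewrite mulr_gt0 ?exprn_gt0 //; lra.
rewrite ler_pdivrMr //; apply: le_trans (ltW k2) _.
rewrite ler_wpM2l ?(ltW e0) // /K (_ : cm w ^+ 3 / 2 = cm w ^+ 2 * (cm w / 2)); last by field.
by rewrite ler_wpM2l ?sqr_ge0.
Qed.

(** The link with real analysis: through real and imaginary parts it brings in the mean value
    theorem, the extreme value theorem and the fundamental theorem of calculus. *)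
Lemma is_derive_epsP (f : R -> R) (u l : R) : is_derive u 1 f l <->
  (forall e, 0 < e -> exists2 d, 0 < d &
    forall v, `|v| < d -> `|f (u + v) - f u - l * v| <= e * `|v|).
Proof.
split=> [D e e0|H].
  have [df dv] : derivable f u 1 /\ 'D_1 f u = l by split=> //; exact: derive_val.
  have /cvgrPdist_le/(_ e e0) : h^-1 *: (f (h *: 1 + u) - f u) @[h --> 0^'] --> l.
    by rewrite -dv; exact: df.
  rewrite /at_right near_withinE => /nbhs_ballP[d /= d0 Hd]; exists d => // v vd.
  have [->|v0] := eqVneq v 0; first by rewrite addr0 subrr mulr0 subrr normr0 mulr0.
  have := Hd v; rewrite /ball /= sub0r normrN => /(_ vd v0).
  have -> : l - v^-1 *: (f (v *: 1 + u) - f u) = - (f (u + v) - f u - l * v) / v.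
    by rewrite /GRing.scale /= mulr1 (addrC v); field.
  by rewrite normrM normrN normfV ler_pdivrMr ?normr_gt0.
have E : h^-1 *: (f (h *: 1 + u) - f u) @[h --> 0^'] --> l.
  apply/cvgrPdist_le => e e0; have [d d0 Hd] := H _ e0.
  rewrite near_withinE; apply/nbhs_ballP; exists d => //= v.
  rewrite /ball /= sub0r normrN => vd v0.
  have -> : l - v^-1 *: (f (v *: 1 + u) - f u) = - (f (u + v) - f u - l * v) / v.
    by rewrite /GRing.scale /= mulr1 (addrC v); field.
  by rewrite normrM normrN normfV ler_pdivrMr ?normr_gt0 //; exact: Hd.
apply: DeriveDef; first by apply/cvg_ex; exists l.
exact: cvg_lim E.
Qed.

Lemma pder_re (g : R -> C) u l : pder g u l -> is_derive u 1 (fun v => re (g v)) (re l).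
Proof.
move=> H; apply/is_derive_epsP => e e0; have [d d0 Hd] := H _ e0.
exists d => // v; rewrite -cm_Rc => /Hd; apply: le_trans.
apply: le_trans (re_le_cm _); rewrite !reB reM re_Rc im_Rc mulr0 subr0.
exact: lexx.
Qed.

Lemma pder_im (g : R -> C) u l : pder g u l -> is_derive u 1 (fun v => im (g v)) (im l).
Proof.
move=> H; apply/is_derive_epsP => e e0; have [d d0 Hd] := H _ e0.
exists d => // v; rewrite -cm_Rc => /Hd; apply: le_trans.
apply: le_trans (im_le_cm _); rewrite !imB imM re_Rc im_Rc mulr0 add0r.
exact: lexx.
Qed.

Lemma pder_reim (g : R -> C) u l : is_derive u 1 (fun v => re (g v)) (re l) ->
  is_derive u 1 (fun v => im (g v)) (im l) -> pder g u l.
Proof.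
move=> /is_derive_epsP A /is_derive_epsP B e e0.
have e2 : 0 < e / 2 by rewrite divr_gt0.
have [d1 d10 H1] := A _ e2; have [d2 d20 H2] := B _ e2.
exists (Num.min d1 d2); first by rewrite lt_min d10.
move=> k; rewrite cm_Rc lt_min => /andP[k1 k2].
apply: le_trans (cm_le_reim _) _.
rewrite !reB !imB reM imM re_Rc im_Rc !mulr0 subr0 add0r.
by apply: le_trans (lerD (H1 _ k1) (H2 _ k2)) _; rewrite -mulrDl -splitr.
Qed.

Lemma pder_line a b u : pder (fun v => a + Rc v * b) u b.
Proof.
apply: gder_eq (gderD (gder_cst _ _ _) (gderM (pder_Rc u) (gder_cst _ b _))) _.
by rewrite mulr0 addr0 mul1r add0r.
Qed.

Lemma cder_line (f : C -> C) a b u l : cder f (a + Rc u * b) l ->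
  pder (fun v => f (a + Rc v * b)) u (l * b).
Proof. by move=> F; apply: (gder_comp (g := fun v => a + Rc v * b) F (pder_line a b u)). Qed.

Lemma is_derive_cont (f : R -> R) (u l : R) : is_derive u 1 f l -> {for u, continuous f}.
Proof. by move=> D; apply: differentiable_continuous; apply/derivable1_diffP. Qed.

(** Mean value inequality with a varying majorant [p]; exponential choices of [p] give the Picard,
    Gronwall and decay estimates directly. *)
Lemma pder_bound (g dg : R -> C) (p dp : R -> R) (a b : R) : a <= b ->
  (forall u, a <= u <= b -> pder g u (dg u)) ->
  (forall u, a <= u <= b -> is_derive u 1 p (dp u)) ->
  (forall u, a <= u <= b -> cm (dg u) <= dp u) ->
  cm (g b - g a) <= p b - p a.
Proof.
move=> ab G P B; have [z0|z0] := eqVneq (g b - g a) 0.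
  have [->|ab'] := eqVneq a b; first by rewrite !subrr cm0.
  have lt_ab : a < b by rewrite lt_neqAle ab' ab.
  have [||c cab ->] := @MVT _ p dp a b lt_ab.
  - by move=> x; rewrite in_itv /= => /andP[/ltW ? /ltW ?]; apply: P; apply/andP.
  - apply: continuous_in_subspaceT => x; rewrite inE /= in_itv /= => xab.
    exact: is_derive_cont (P _ xab).
  rewrite z0 cm0 mulr_ge0 ?subr_ge0 //; apply: le_trans (cm_ge0 _) (B _ _).
  by move: cab; rewrite in_itv /= => /andP[/ltW -> /ltW ->].
have [ab'|ab'] := eqVneq a b; first by rewrite ab' subrr eqxx in z0.
have lt_ab : a < b by rewrite lt_neqAle ab' ab.
pose Z := g b - g a; have Z0 : 0 < cm Z by rewrite cm_gt0.
(* rotate so that the increment is a positive real *)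
pose c := Rc (cm Z) / Z; have cc : cm c = 1.
  by rewrite cmM cmV cm_Rc ger0_norm ?cm_ge0 // divff // gt_eqF.
pose q u := re (c * g u) - p u.
have Dq u : a <= u <= b -> is_derive u 1 q (re (c * dg u) - dp u).
  move=> ab1; apply: is_deriveB; last exact: P.
  apply: pder_re; apply: gder_eq (gderM (gder_cst _ c _) (G _ ab1)) _.
  by rewrite mul0r add0r.
have [||x xab E] := @MVT _ q (fun u => re (c * dg u) - dp u) a b lt_ab.
- by move=> x; rewrite in_itv /= => /andP[/ltW ? /ltW ?]; apply: Dq; apply/andP.
- apply: continuous_in_subspaceT => x; rewrite inE /= in_itv /= => xab.
  exact: is_derive_cont (Dq _ xab).
have xab' : a <= x <= b by move: xab; rewrite in_itv /= => /andP[/ltW -> /ltW ->].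
have : q b - q a <= 0.
  rewrite E mulr_le0_ge0 ?subr_ge0 // subr_le0; apply: le_trans (B _ xab').
  by apply: le_trans (ler_norm _) _; apply: le_trans (re_le_cm _) _; rewrite cmM cc mul1r.
rewrite /q -/Z; have -> : cm Z = re (c * g b) - re (c * g a).
  by rewrite -reB -mulrBr -/Z /c divfK ?re_Rc.
lra.
Qed.

Lemma pder_bound_cst (g dg : R -> C) (M a b : R) : a <= b ->
  (forall u, a <= u <= b -> pder g u (dg u)) ->
  (forall u, a <= u <= b -> cm (dg u) <= M) ->
  cm (g b - g a) <= M * (b - a).
Proof.
move=> ab G B; rewrite mulrBr.
apply: (pder_bound (p := fun u => M * u) (dp := fun=> M) ab G _ B) => u _.
apply/is_derive_epsP => e e0; exists 1 => // v _.
have -> : M * (u + v) - M * u - M * v = 0 by ring.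
by rewrite normr0 mulr_ge0 // ltW.
Qed.

Lemma cder_bound (f df : C -> C) a b M :
  (forall u, 0 <= u <= 1 -> cder f (a + Rc u * (b - a)) (df (a + Rc u * (b - a)))) ->
  (forall u, 0 <= u <= 1 -> cm (df (a + Rc u * (b - a))) <= M) ->
  cm (f b - f a) <= M * cm (b - a).
Proof.
move=> F B; have := @pder_bound_cst (fun u => f (a + Rc u * (b - a)))
  (fun u => df (a + Rc u * (b - a)) * (b - a)) (M * cm (b - a)) 0 1 ler01.
rewrite Rc1 Rc0 mul1r mul0r addr0 subr0 mulr1 (addrC a) subrK; apply.
  by move=> u u01; apply: cder_line; apply: F.
by move=> u u01; rewrite cmM ler_wpM2r ?cm_ge0 // B.
Qed.

(** * Maximum principles along a path *)

Lemma is_derive_rmax (p : R -> R) (a b l : R) : a < b -> is_derive a 1 p l ->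
  (forall u, a <= u <= b -> p u <= p a) -> l <= 0.
Proof.
move=> ab /is_derive_epsP D Hm; rewrite leNgt; apply/negP => l0.
have l2 : 0 < l / 2 by rewrite divr_gt0.
have [d d0 Hd] := D _ l2.
pose v := Num.min (d / 2) (b - a).
have v0 : 0 < v by rewrite lt_min divr_gt0 // subr_gt0.
have vd : `|v| < d.
  by rewrite gtr0_norm // gt_min ltr_pdivrMr // mulr_natr mulr2n ltrDl d0.
have := Hd _ vd; rewrite (gtr0_norm v0) ler_norml => /andP[h _].
have vb : v <= b - a by rewrite ge_min lexx orbT.
have : p (a + v) <= p a by apply: Hm; lra.
have : l / 2 * v < l * v by rewrite ltr_pM2r //; lra.
lra.
Qed.

(** The real inner product of C = R^2: half the derivative of |g|^2 along a path is [dotc g g'], so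
    growth and decay can be read off its sign. *)
Definition dotc z w : R := re z * re w + im z * im w.

Lemma dotcDr z w a : dotc z (w + a) = dotc z w + dotc z a.
Proof. by rewrite /dotc reD imD; ring. Qed.
Lemma dotcMr z a : dotc z (a * z) = re a * cm z ^+ 2.
Proof. by rewrite /dotc cm_sqr reM imM; ring. Qed.
Lemma dotc_le z w : `|dotc z w| <= cm z * cm w.
Proof.
have -> : dotc z w = re ((re z -i* im z)%C * w).
  by rewrite /dotc; case: z w => [? ?] [? ?] /=; ring.
apply: le_trans (re_le_cm _) _; rewrite cmM.
suff -> : cm ((re z -i* im z)%C) = cm z by [].
apply/eqP; rewrite -(eqrXn2 (n := 2)) ?cm_ge0 // !cm_sqr /=.
by rewrite sqrrN.
Qed.

Lemma pder_sqr (g : R -> C) u l : pder g u l ->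
  is_derive u 1 (fun v => cm (g v) ^+ 2) (2 * dotc (g u) l).
Proof.
move=> G; rewrite (_ : (fun v => _) = fun v => re (g v) * re (g v) + im (g v) * im (g v)).
  have A := pder_re G; have B := pder_im G.
  apply: is_derive_eq; rewrite /dotc /GRing.scale /=; ring.
by apply/funext => v; rewrite cm_sqr.
Qed.

(* At a point of [a, b[ where |g| is maximal, |g|^2 has a nonpositive right
   derivative. *)
Lemma pder_max_right (g dg : R -> C) (k F a b : R) : a <= b -> 0 < k -> 0 <= F ->
  (forall u, a <= u <= b -> pder g u (dg u)) ->
  (forall u, a <= u <= b -> k * cm (g u) ^+ 2 - F * cm (g u) <= dotc (g u) (dg u)) ->
  forall u, a <= u <= b -> cm (g u) <= Num.max (cm (g b)) (F / k).
Proof.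
move=> ab k0 F0 G D u uab; pose p v := cm (g v) ^+ 2.
have pc : {within `[a, b], continuous p}.
  apply: continuous_in_subspaceT => x; rewrite inE /= in_itv /= => xab.
  exact: is_derive_cont (pder_sqr (G _ xab)).
have [c cab cmax] := EVT_max ab pc.
have cab' : a <= c <= b by move: cab; rewrite in_itv.
have uc : cm (g u) <= cm (g c).
  rewrite -(ler_pXn2r (n := 2)) ?nnegrE ?cm_ge0 //; apply: cmax.
  by rewrite in_itv.
apply: le_trans uc _; rewrite le_max; have [->|cb] := eqVneq c b; first by rewrite lexx.
have ltcb : c < b by rewrite lt_neqAle cb; case/andP: cab'.
have L : 2 * dotc (g c) (dg c) <= 0.
  apply: is_derive_rmax ltcb (pder_sqr (G _ cab')) _ => v vcb; apply: cmax.
  by rewrite in_itv /=; case/andP: cab' vcb => ? ? /andP[? ->]; rewrite andbT; lra.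
have := D _ cab'; have := cm_ge0 (g c); move: (cm (g c)) => t t0 E.
apply/orP; right; rewrite ler_pdivlMr //.
have [->|t1] := eqVneq t 0; first by rewrite mul0r.
have tp : 0 < t by rewrite lt_def t1.
have : t * (k * t - F) <= 0 by rewrite mulrBr; lra.
by rewrite pmulr_rle0 // subr_le0 mulrC.
Qed.

Lemma pder_rev (g : R -> C) (v0 u : R) l : pder g (v0 - u) l -> pder (fun v => g (v0 - v)) u (- l).
Proof.
move=> G e /G[d d0 H]; exists d => // k kd.
have := H (- k); rewrite RcN cmN => /(_ kd).
by rewrite opprD addrA mulrN mulNr.
Qed.

Lemma pder_max_left (g dg : R -> C) (k F a b : R) : a <= b -> 0 < k -> 0 <= F ->
  (forall u, a <= u <= b -> pder g u (dg u)) ->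
  (forall u, a <= u <= b -> dotc (g u) (dg u) <= - (k * cm (g u) ^+ 2 - F * cm (g u))) ->
  forall u, a <= u <= b -> cm (g u) <= Num.max (cm (g a)) (F / k).
Proof.
move=> ab k0 F0 G D u uab.
have E x : a <= x <= b -> a <= (a + b) - x <= b by lra.
have := @pder_max_right (fun v => g (a + b - v)) (fun v => - dg (a + b - v)) k F a b ab k0 F0.
move=> /(_ _ _ (a + b - u) (E _ uab)).
rewrite subKr addrK; apply.
  by move=> v vab; apply: pder_rev; apply: G; exact: E.
move=> v vab; have := D _ (E _ vab); rewrite /dotc reN imN; lra.
Qed.

Definition pcont (g : R -> C) := forall u e, 0 < e -> exists2 d, 0 < d &
  forall v, `|v| < d -> cm (g (u + v) - g u) <= e.

Lemma pcont_re g : pcont g -> continuous (fun u => re (g u)) /\ continuous (fun u => im (g u)).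
Proof.
move=> H; split=> u; apply/cvgrPdist_le => e e0; have [d d0 Hd] := H u e e0;
  apply/nbhs_ballP; exists d => //= v; rewrite /ball /= distrC => /Hd; rewrite (addrC u) subrK => h.
  by rewrite -reB; apply: le_trans (re_le_cm _) _; rewrite cmBC.
by rewrite -imB; apply: le_trans (im_le_cm _) _; rewrite cmBC.
Qed.

(** The integral starts at -1 rather than 0, so that the primitive has a two-sided derivative at
    every point of [0, 1], end points included. *)
Lemma prim_real (f : R -> R) : continuous f ->
  exists F : R -> R, forall x : R, -1 < x -> is_derive x 1 F (f x).
Proof.
move=> cf; exists (fun x => \int[@lebesgue_measure R]_(t in [set` Interval (BLeft (-1)) (BRight x)]) f t).
move=> x x1; have xx : x < x + 1 by rewrite ltrDl.
have fi : (@lebesgue_measure R).-integrable [set` Interval (BLeft (-1)) (BRight (x+1))] (EFin \o f).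
  apply: continuous_compact_integrable; first exact: segment_compact.
  exact: continuous_subspaceT.
have [||A B] := @continuous_FTC1 R f (BLeft (-1)) x (x + 1) xx fi.
- by rewrite lte_fin.
- exact: cf.
by apply: DeriveDef; [exact: A|rewrite -derive1E; exact: B].
Qed.

Lemma prim_path (g : R -> C) : pcont g -> exists G : R -> C, forall u : R, -1 < u -> pder G u (g u).
Proof.
move=> /pcont_re[c1 c2]; have [F HF] := prim_real c1; have [G HG] := prim_real c2.
exists (fun u => F u +i* G u)%C => u u1.
by apply: pder_reim => /=; [exact: HF|exact: HG].
Qed.

Lemma gder_pcont (g : R -> C) : (forall u, exists l, pder g u l) -> pcont g.
Proof.
move=> H u e e0; have [l /gder_cont/(_ e e0)[d d0 Hd]] := H u.
by exists d => // v vd; apply: Hd; rewrite cm_Rc.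
Qed.

(** * The complex exponential *)

Lemma re_cexp z : re (cexp z) = expR (re z) * cos (im z).
Proof. by rewrite /cexp reM /= mul0r subr0. Qed.
Lemma im_cexp z : im (cexp z) = expR (re z) * sin (im z).
Proof. by rewrite /cexp imM /= mul0r addr0. Qed.

Lemma cexpD z w : cexp (z + w) = cexp z * cexp w.
Proof.
apply: C_eqP; rewrite ?(re_cexp (z + w)) ?(im_cexp (z + w)) reD imD expRD ?cosD ?sinD.
  rewrite (reM (cexp z)) !re_cexp !im_cexp; ring.
rewrite (imM (cexp z)) !re_cexp !im_cexp; ring.
Qed.

Lemma cexp0 : cexp (0 : C) = 1.
Proof. by apply: C_eqP; rewrite ?re_cexp ?im_cexp /= expR0 ?cos0 ?sin0 mul1r. Qed.

Lemma cm_cexp z : cm (cexp z) = expR (re z).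
Proof.
apply/eqP; rewrite -(eqrXn2 (n := 2)) ?cm_ge0 ?expR_ge0 // cm_sqr re_cexp im_cexp.
by rewrite !exprMn -mulrDr cos2Dsin2 mulr1.
Qed.

Lemma cexp_neq0 z : cexp z != 0.
Proof. by rewrite -cm_gt0 cm_cexp expR_gt0. Qed.

Lemma cexpN z : cexp (- z) = (cexp z)^-1.
Proof. by apply: (mulfI (cexp_neq0 z)); rewrite -cexpD subrr cexp0 divff ?cexp_neq0. Qed.

Lemma pder_cexp_line z u : pder (fun v => cexp (Rc v * z)) u (z * cexp (Rc u * z)).
Proof.
have D1 (c : R) : is_derive u 1 (fun v : R => v * c) c.
  by apply: is_derive_eq; rewrite /GRing.scale /= mulr0 add0r mulr1.
have E1 := @is_derive1_comp R expR (fun v => v * re z) u _ _ (is_derive_expR _) (D1 (re z)).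
have C1 := @is_derive1_comp R cos (fun v => v * im z) u _ _ (is_derive_cos _) (D1 (im z)).
have S1 := @is_derive1_comp R sin (fun v => v * im z) u _ _ (is_derive_sin _) (D1 (im z)).
apply: pder_reim.
  rewrite (_ : (fun v => _) = (expR \o (fun v => v * re z)) * (cos \o (fun v => v * im z))).
    apply: is_derive_eq; rewrite reM re_cexp im_cexp !(reM, imM) re_Rc im_Rc !mul0r subr0 addr0.
    by rewrite /GRing.scale /=; ring.
  by apply/funext => v; rewrite re_cexp !(reM, imM) re_Rc im_Rc !mul0r subr0 addr0.
rewrite (_ : (fun v => _) = (expR \o (fun v => v * re z)) * (sin \o (fun v => v * im z))).
  apply: is_derive_eq; rewrite imM re_cexp im_cexp !(reM, imM) re_Rc im_Rc !mul0r subr0 addr0.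
  by rewrite /GRing.scale /=; ring.
by apply/funext => v; rewrite im_cexp !(reM, imM) re_Rc im_Rc !mul0r subr0 addr0.
Qed.

Lemma cexp_lip z : cm z <= 1 -> cm (cexp z - 1) <= expR 1 * cm z.
Proof.
move=> z1; have := @pder_bound_cst (fun v => cexp (Rc v * z)) (fun v => z * cexp (Rc v * z))
  (expR 1 * cm z) 0 1 ler01 (fun u _ => pder_cexp_line z u).
rewrite subr0 mulr1 Rc0 Rc1 mul0r mul1r cexp0; apply=> u /andP[u0 u1].
rewrite cmM mulrC ler_wpM2r ?cm_ge0 // cm_cexp ler_expR reM re_Rc im_Rc mul0r subr0.
apply: le_trans (ler_norm _) _; rewrite normrM ger0_norm //.
by rewrite -[leRHS]mulr1 ler_pM // (le_trans (re_le_cm _)).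
Qed.

(** The derivative of e^(uz) - uz is integrated over 0 <= u <= 1. Combined with the addition law
    this gives the complex derivative of [cexp], so far known along real lines only. *)
Lemma cexp_quad z : cm z <= 1 -> cm (cexp z - 1 - z) <= expR 1 * cm z ^+ 2.
Proof.
move=> z1; have D u : 0 <= u <= 1 ->
    pder (fun v => cexp (Rc v * z) - Rc v * z) u (z * cexp (Rc u * z) - z).
  move=> _; apply: gderD (pder_cexp_line z u) _.
  have := pder_line 0 (- z) u; apply: gder_ext; rewrite ?Rc0 //.
  by exists 1 => // k _; rewrite add0r mulrN.
have := @pder_bound_cst _ _ (expR 1 * cm z ^+ 2) 0 1 ler01 D.
rewrite subr0 mulr1 Rc0 Rc1 mul0r mul1r cexp0 subr0 addrAC; apply=> u /andP[u0 u1].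
have zu : cm (Rc u * z) <= cm z.
  by rewrite cmM cm_Rc ger0_norm // ler_piMl ?cm_ge0.
rewrite -[X in _ - X]mulr1 -mulrBr cmM expr2 mulrCA ler_wpM2l ?cm_ge0 //.
apply: le_trans (cexp_lip (le_trans zu z1)) _.
by rewrite ler_wpM2l ?expR_ge0.
Qed.

Lemma cder_cexp z : cder cexp z (cexp z).
Proof.
move=> e e0; pose K : R := cm (cexp z) * expR 1.
have K0 : 0 < K by rewrite mulr_gt0 ?expR_gt0 // cm_gt0 cexp_neq0.
exists (Num.min 1 (e / K)); first by rewrite lt_min divr_gt0 // ltr01.
move=> k /=; rewrite lt_min => /andP[/ltW k1 k2].
rewrite cexpD -[X in _ - X - _]mulr1 -mulrBr -mulrBr cmM.
apply: le_trans (ler_wpM2l (cm_ge0 _) (cexp_quad k1)) _.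
rewrite mulrA expr2 mulrA ler_wpM2r ?cm_ge0 // mulrC -ler_pdivlMr //.
exact: ltW.
Qed.

Definition ccont (f : C -> C) w := forall e, 0 < e -> exists2 d, 0 < d &
  forall k, cm k < d -> cm (f (w + k) - f w) <= e.

Lemma cder_ccont f w l : cder f w l -> ccont f w.
Proof. by move=> F e e0; have [d d0 H] := gder_cont F e0; exists d. Qed.

Lemma sum_geom2 k : \sum_(i < k) (2^-1 : R) ^+ i <= 2.
Proof.
suff -> : \sum_(i < k) (2^-1 : R) ^+ i = 2 - 2 * 2^-1 ^+ k by rewrite gerBl mulr_ge0.
elim: k => [|k IH]; first by rewrite big_ord0 expr0 mulr1 subrr.
by rewrite big_ord_recr /= IH exprS; field.
Qed.

Lemma cauchy_half (s : nat -> C) (B : R) : 0 <= B ->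
  (forall k, cm (s k.+1 - s k) <= B * 2^-1 ^+ k) ->
  exists l, forall k, cm (s k - l) <= 2 * B * 2^-1 ^+ k.
Proof.
move=> B0 H.
have HD k m : cm (s (k + m)%N - s k) <= 2 * B * 2^-1 ^+ k.
  have A : cm (s (k + m)%N - s k) <= \sum_(i < m) B * 2^-1 ^+ (k + i).
    elim: m => [|m IH]; first by rewrite addn0 subrr cm0 big_ord0.
    rewrite big_ord_recr /= addnS; apply: le_trans (cm_tri _ _ (s (k + m)%N)) _.
    by rewrite addrC; apply: lerD.
  apply: le_trans A _.
  rewrite (eq_bigr (fun i : 'I_m => B * 2^-1 ^+ k * 2^-1 ^+ i)); last first.
    by move=> i _; rewrite exprD mulrA.
  rewrite -mulr_sumr mulrC -[leRHS]mulrA ler_wpM2r ?mulr_ge0 ?exprn_ge0 //.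
  exact: sum_geom2.
have E0 (e : R) : 0 < e -> exists k0, forall k, (k0 <= k)%N -> 2 * B * 2^-1 ^+ k < e.
  move=> e0; have : 2^-1 ^+ k @[k --> \oo] --> (0 : R).
    by apply: cvg_expr; rewrite ger0_norm // invf_lt1 // ltr1n.
  have B1 : 0 < 2 * B + 1 by rewrite ltr_wpDl ?mulr_ge0.
  move=> /cvgrPdist_lt/(_ (e / (2 * B + 1))).
  rewrite divr_gt0 // => /(_ isT)[k0 _ Hk]; exists k0 => k kk.
  have := Hk k kk; rewrite /= sub0r normrN ger0_norm ?exprn_ge0 //.
  rewrite ltr_pdivlMr // mulrC => h; apply: le_lt_trans h.
  by rewrite ler_wpM2r ?exprn_ge0 // lerDl.
have CR (g : C -> R) : (forall z w, `|g z - g w| <= cm (z - w)) ->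
    exists l : R, forall e, 0 < e -> exists k0, forall k, (k0 <= k)%N -> `|g (s k) - l| <= e.
  move=> gl; have : cvg (g (s k) @[k --> \oo]).
    apply: R_complete; apply: cauchy_exP => e e0; have [k0 Hk0] := E0 _ e0.
    exists (g (s k0)); exists k0 => // k /= kk; rewrite /ball /= distrC.
    apply: le_lt_trans (gl _ _) _; rewrite -(subnKC kk).
    by apply: le_lt_trans (HD _ _) (Hk0 _ _).
  move=> /cvg_ex[l /cvgrPdist_le L]; exists l => e /L[k0 _ Hk]; exists k0 => k /Hk.
  by rewrite /= distrC.
have [l1 L1] := CR re (fun z w => ltac:(by rewrite -reB; exact: re_le_cm)).
have [l2 L2] := CR im (fun z w => ltac:(by rewrite -imB; exact: im_le_cm)).
exists (l1 +i* l2)%C => k; apply/ler_addgt0Pr => e e0.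
have e2 : 0 < e / 2 by rewrite divr_gt0.
have [k1 K1] := L1 _ e2; have [k2 K2] := L2 _ e2.
apply: le_trans (cm_tri _ _ (s (k + (k1 + k2))%N)) _; rewrite cmBC lerD //.
apply: le_trans (cm_le_reim _) _; rewrite reB imB /= [leRHS]splitr lerD //.
  by apply: K1; rewrite addnCA leq_addr.
by apply: K2; rewrite addnA leq_addl.
Qed.

Lemma gderZ (T : zmodType) (j : T -> C) f x c l : gder j f x l ->
  gder j (fun y => c * f y) x (c * l).
Proof.
move=> H; apply: gder_eq (gderM (gder_cst _ c _) H) _.
by rewrite mul0r add0r.
Qed.

Lemma gderN (T : zmodType) (j : T -> C) f x l : gder j f x l ->
  gder j (fun y => - f y) x (- l).
Proof.
move=> H e e0; have [d d0 Hd] := H e e0; exists d => // k kd.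
have := Hd _ kd; congr (_ <= _); rewrite -cmN; congr cm; ring.
Qed.

Lemma gderB (T : zmodType) (j : T -> C) f g x l m : gder j f x l -> gder j g x m ->
  gder j (fun y => f y - g y) x (l - m).
Proof. by move=> F G; apply: gderD F _; exact: gderN. Qed.

(** * Integrals along segments *)

Definition segp a b u := a + Rc u * (b - a).

Lemma segp0 a b : segp a b 0 = a. Proof. by rewrite /segp Rc0 mul0r addr0. Qed.
Lemma segp1 a b : segp a b 1 = b. Proof. by rewrite /segp Rc1 mul1r addrC subrK. Qed.

Definition seg_cont (f : C -> C) a b := forall u, 0 <= u <= 1 -> ccont f (segp a b u).

Definition is_segint f a b I := exists G : R -> C,
  (forall u, 0 <= u <= 1 -> pder G u (f (segp a b u))) /\ I = (b - a) * (G 1 - G 0).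

(** The integral of f over the segment from a to b, defined as b - a times the increment of some
    primitive along the segment, and 0 by default where there is none. By [J_path] any primitive
    gives the same value when f is continuous along the segment. *)
Definition J (f : C -> C) a b : C := xget 0 [set I | is_segint f a b I].

(** Extends the segment by constants to a path on the whole line, since [prim_path] asks for
    continuity everywhere. *)
Definition clamp u : R := Num.max 0 (Num.min u 1).

Lemma clamp01 u : 0 <= clamp u <= 1.
Proof. by rewrite /clamp le_max lexx /= ge_max ler01 ge_min lexx orbT. Qed.

Lemma clamp_id u : 0 <= u <= 1 -> clamp u = u.
Proof. by move=> /andP[u0 u1]; rewrite /clamp (min_idPl u1) (max_idPr u0). Qed.

Lemma clamp_lip u v : `|clamp u - clamp v| <= `|u - v|.
Proof.
have h1 := ler_norm (u - v); have := ler_norm (v - u); rewrite distrC => h2.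
rewrite ler_norml /clamp /Num.min; case: (ltP u 1) => ?; case: (ltP v 1) => ?;
  rewrite /Num.max ?ltr01;
  [case: (ltP 0 u) => ?; case: (ltP 0 v) => ?|case: (ltP 0 u) => ?|case: (ltP 0 v) => ?|];
  by apply/andP; split; lra.
Qed.

Lemma segintP f a b : seg_cont f a b -> is_segint f a b (J f a b).
Proof.
move=> fc; suff : exists I, is_segint f a b I.
  by move=> [I HI]; apply: (@xgetPex _ 0 [set I | is_segint f a b I]); exists I.
have [|G HG] := @prim_path (fun u => f (segp a b (clamp u))).
  move=> u e e0; have [d d0 Hd] := fc _ (clamp01 u) _ e0.
  have b0 : 0 < cm (b - a) + 1 by rewrite ltr_wpDl ?cm_ge0.
  exists (d / (cm (b - a) + 1)); first by rewrite divr_gt0.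
  move=> v vd; rewrite (_ : segp a b (clamp (u + v)) =
    segp a b (clamp u) + Rc (clamp (u + v) - clamp u) * (b - a)); last first.
    by rewrite /segp RcB; ring.
  apply: Hd; rewrite cmM cm_Rc; apply: le_lt_trans (ler_wpM2r (cm_ge0 _) (clamp_lip _ _)) _.
  rewrite (addrC u) addrK; apply: le_lt_trans (_ : `|v| * (cm (b - a) + 1) < _).
    by rewrite ler_wpM2l // lerDl.
  by rewrite -ltr_pdivlMr.
exists ((b - a) * (G 1 - G 0)), G; split => // u u01.
by have := HG u; rewrite clamp_id //; apply; lra.
Qed.

(** The one comparison behind the calculus of [J]: with M = 0 it identifies the integral, with P
    constant it bounds it, and with P a primitive of the first-order Taylor polynomial it is the
    local step of Goursat's theorem. *)
Lemma J_approx f a b (P : R -> C) (p : R -> C) M : seg_cont f a b ->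
  (forall u, 0 <= u <= 1 -> pder P u (p u)) ->
  (forall u, 0 <= u <= 1 -> cm ((b - a) * f (segp a b u) - p u) <= M) ->
  cm (J f a b - (P 1 - P 0)) <= M.
Proof.
move=> /segintP[G [HG ->]] HP HM.
have := @pder_bound_cst (fun u => (b - a) * G u - P u)
  (fun u => (b - a) * f (segp a b u) - p u) M 0 1 ler01.
rewrite subr0 mulr1.
have -> : (b - a) * (G 1 - G 0) - (P 1 - P 0) =
  (b - a) * G 1 - P 1 - ((b - a) * G 0 - P 0) by ring.
by apply=> // u u01; apply: gderB (HP _ u01); apply: gderZ; exact: HG.
Qed.

Lemma J_path f a b (P : R -> C) : seg_cont f a b ->
  (forall u, 0 <= u <= 1 -> pder P u ((b - a) * f (segp a b u))) ->
  J f a b = P 1 - P 0.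
Proof.
move=> fc HP; apply/eqP; rewrite -subr_eq0 -cm_eq0 eq_le cm_ge0 andbT.
by apply: (J_approx fc HP) => u _; rewrite subrr cm0.
Qed.

Lemma J_bound f a b M : seg_cont f a b ->
  (forall u, 0 <= u <= 1 -> cm (f (segp a b u)) <= M) -> cm (J f a b) <= M * cm (b - a).
Proof.
move=> fc B; have := @J_approx f a b (fun=> 0) (fun=> 0) (M * cm (b - a)) fc.
rewrite subrr subr0; apply=> u u01; first exact: gder_cst.
by rewrite subr0 cmM mulrC ler_wpM2r ?cm_ge0 // B.
Qed.

Lemma J_approxc f a b (P p : C -> C) M : seg_cont f a b ->
  (forall u, 0 <= u <= 1 -> cder P (segp a b u) (p (segp a b u))) ->
  (forall u, 0 <= u <= 1 -> cm (f (segp a b u) - p (segp a b u)) <= M) ->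
  cm (J f a b - (P b - P a)) <= M * cm (b - a).
Proof.
move=> fc HP HM; have := @J_approx f a b (fun u => P (segp a b u))
  (fun u => p (segp a b u) * (b - a)) (M * cm (b - a)) fc.
rewrite segp0 segp1; apply=> u u01; first by apply: cder_line; exact: HP.
by rewrite mulrC -mulrBl cmM ler_wpM2r ?cm_ge0 // HM.
Qed.

Lemma segp_sub a b s t u : segp (segp a b s) (segp a b t) u = segp a b (s + u * (t - s)).
Proof. by rewrite /segp RcD RcM RcB; ring. Qed.

Lemma pder_affine (G : R -> C) (s t u : R) l : pder G (s + u * t) l ->
  pder (fun v => G (s + v * t)) u (Rc t * l).
Proof.
move=> H e e0; have t0 : 0 < `|t| + 1 by rewrite ltr_wpDl.
have [d d0 Hd] := H (e / (`|t| + 1)) (divr_gt0 e0 t0).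
exists (d / (`|t| + 1)); first by rewrite divr_gt0.
move=> k; rewrite cm_Rc => kd; have := Hd (k * t).
rewrite cm_Rc normrM mulrDl addrA RcM => h.
rewrite (_ : Rc t * l * Rc k = l * (Rc k * Rc t)); last by ring.
have kt : `|k| * `|t| <= `|k| * (`|t| + 1) by rewrite ler_wpM2l // lerDl.
apply: le_trans (h _) _.
  by apply: le_lt_trans kt _; rewrite -ltr_pdivlMr.
by rewrite mulrAC ler_pdivrMr // -mulrA ler_wpM2l // ltW.
Qed.

(** A single primitive along the segment computes the integrals over all its subsegments, so
    reversal and splitting become identities between increments. *)
Lemma J_sub f a b : seg_cont f a b ->
  exists G : R -> C, (forall u, 0 <= u <= 1 -> pder G u (f (segp a b u))) /\
  forall s t, 0 <= s <= 1 -> 0 <= t <= 1 ->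
    J f (segp a b s) (segp a b t) = (b - a) * (G t - G s).
Proof.
move=> fc; have [G [HG _]] := segintP fc; exists G; split=> // s t s01 t01.
have E u : 0 <= u <= 1 -> 0 <= s + u * (t - s) <= 1.
  case/andP: s01 t01 => ? ? /andP[? ?] /andP[u0 u1].
  have -> : s + u * (t - s) = s * (1 - u) + u * t by ring.
  have u1' : 0 <= 1 - u by lra.
  apply/andP; split; first by rewrite addr_ge0 // mulr_ge0.
  rewrite -[leRHS](subrK u) addrC [leRHS]addrC lerD //; first by rewrite ler_piMr.
  by rewrite ler_piMl.
rewrite (@J_path _ _ _ (fun u => (b - a) * G (s + u * (t - s)))).
- by rewrite mul1r mul0r addr0 (addrC s) subrK -mulrBr.
- by move=> u u01; rewrite segp_sub; apply: fc; exact: E.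
move=> u u01; rewrite segp_sub.
apply: gder_eq (gderZ _ (pder_affine (HG _ (E _ u01)))) _.
by rewrite /segp RcB; ring.
Qed.

Lemma J_rev f a b : seg_cont f a b -> J f b a = - J f a b.
Proof.
have i0 : 0 <= (0 : R) <= 1 by rewrite lexx ler01.
have i1 : 0 <= (1 : R) <= 1 by rewrite lexx ler01.
move=> fc; have [G [_ H]] := J_sub fc.
have := H 0 1 i0 i1; have := H 1 0 i1 i0.
by rewrite segp0 segp1 => -> ->; ring.
Qed.

Lemma J_split f a b t : seg_cont f a b -> 0 <= t <= 1 ->
  J f a b = J f a (segp a b t) + J f (segp a b t) b.
Proof.
have i0 : 0 <= (0 : R) <= 1 by rewrite lexx ler01.
have i1 : 0 <= (1 : R) <= 1 by rewrite lexx ler01.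
move=> fc t01; have [G [_ H]] := J_sub fc.
have := H 0 1 i0 i1; have := H 0 t i0 t01; have := H t 1 t01 i1.
by rewrite segp0 segp1 => -> -> ->; ring.
Qed.

Lemma half_le (B e : R) : 0 < e -> 0 <= B -> exists k, B * 2^-1 ^+ k < e.
Proof.
move=> e0 B0; have : 2^-1 ^+ k @[k --> \oo] --> (0 : R).
  by apply: cvg_expr; rewrite ger0_norm // invf_lt1 // ltr1n.
have B1 : 0 < B + 1 by rewrite ltr_wpDl.
move=> /cvgrPdist_lt/(_ (e / (B + 1))); rewrite divr_gt0 // => /(_ isT)[k _ /(_ k (leqnn k))].
rewrite /= sub0r normrN ger0_norm ?exprn_ge0 // ltr_pdivlMr // mulrC => h.
by exists k; apply: le_lt_trans h; rewrite ler_wpM2r ?exprn_ge0 // lerDl.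
Qed.

Lemma ge0_half (x B : R) : 0 <= B -> (forall k, - (B * 2^-1 ^+ k) <= x) -> 0 <= x.
Proof.
move=> B0 H; rewrite leNgt; apply/negP => x0.
have [|k Hk] := @half_le B (- x) _ B0; first by rewrite oppr_gt0.
have := H k; lra.
Qed.

Lemma segp_near a b p u d : 0 <= u <= 1 -> cm (a - p) <= d -> cm (b - p) <= d ->
  cm (segp a b u - p) <= d.
Proof.
move=> /andP[u0 u1] A B; have u1' : 0 <= 1 - u by rewrite subr_ge0.
have -> : segp a b u - p = Rc (1 - u) * (a - p) + Rc u * (b - p).
  by rewrite /segp RcB Rc1; ring.
apply: le_trans (cmD _ _) _; rewrite !cmM !cm_Rc !ger0_norm //.
have -> : d = (1 - u) * d + u * d by ring.
by rewrite lerD // ler_wpM2l.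
Qed.

(** * Goursat's theorem on triangles *)

Section Goursat.
Variables (f : C -> C) (a b c : C).
(** Subdivision takes place in the standard triangle 0, 1, i and is carried over by this affine map:
    diameters halve by the same computation whatever the shape, and degenerate triangles are
    included. *)
Let phi (x : C) := a + Rc (re x) * (b - a) + Rc (im x) * (c - a).
Let std (x : C) := [/\ 0 <= re x, 0 <= im x & re x + im x <= 1].
Hypothesis f_der : forall x, std x -> exists l, cder f (phi x) l.
Let T (t : C * C * C) :=
  J f (phi t.1.1) (phi t.1.2) + J f (phi t.1.2) (phi t.2) + J f (phi t.2) (phi t.1.1).
Let std3 (t : C * C * C) := [/\ std t.1.1, std t.1.2 & std t.2].
Let diam (t : C * C * C) d :=
  [/\ cm (t.1.1 - t.1.2) <= d, cm (t.1.2 - t.2) <= d & cm (t.2 - t.1.1) <= d].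

Let phi_seg x y u : segp (phi x) (phi y) u = phi (segp x y u).
Proof. by rewrite /phi /segp !(reD, imD, reM, imM, reB, imB) !(re_Rc, im_Rc) !mul0r !(subr0, addr0) !(RcD, RcM, RcB); ring. Qed.

Let std_seg x y u : 0 <= u <= 1 -> std x -> std y -> std (segp x y u).
Proof.
move=> /andP[u0 u1] [x1 x2 x3] [y1 y2 y3].
have v0 : 0 <= 1 - u by rewrite subr_ge0.
have E1 : re (segp x y u) = (1 - u) * re x + u * re y.
  by rewrite /segp !(reD, reM, reB) re_Rc im_Rc mul0r subr0; ring.
have E2 : im (segp x y u) = (1 - u) * im x + u * im y.
  by rewrite /segp !(imD, imM, imB) re_Rc im_Rc mul0r addr0; ring.
split; rewrite ?E1 ?E2 ?addr_ge0 ?mulr_ge0 //.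
rewrite addrACA -!mulrDr.
apply: le_trans (lerD (ler_wpM2l v0 x3) (ler_wpM2l u0 y3)) _; lra.
Qed.

Let segc x y : std x -> std y -> seg_cont f (phi x) (phi y).
Proof.
move=> sx sy u u01; rewrite phi_seg; have [l Hl] := f_der (std_seg u01 sx sy).
exact: cder_ccont Hl.
Qed.

Let half01 : 0 <= (2^-1 : R) <= 1.
Proof. by rewrite invr_ge0 ler0n /= invf_le1 // ler1n. Qed.

(** The implication stands inside the existential so that [choice] yields a total function, which
    can be iterated. *)
Let step : forall t, exists t', std3 t -> [/\ std3 t', cm (T t) <= 4 * cm (T t') &
  forall d, 0 <= d -> diam t d -> diam t' (d / 2) /\ cm (t'.1.1 - t.1.1) <= d].
Proof.
move=> [[x y] z]; have [[sx sy sz]|ns] := pselect (std3 (x, y, z)); last first.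
  by exists (x, y, z).
pose m1 := segp x y 2^-1; pose m2 := segp y z 2^-1; pose m3 := segp z x 2^-1.
have s1 : std m1 := std_seg half01 sx sy.
have s2 : std m2 := std_seg half01 sy sz.
have s3 : std m3 := std_seg half01 sz sx.
(* The midpoints cut the triangle into four; the three inner edges are traversed in both directions
   and cancel. *)
have E : T (x, y, z) = T (x, m1, m3) + T (m1, y, m2) + (T (m3, m2, z) + T (m1, m2, m3)).
  rewrite /T /= (J_split (segc sx sy) half01) (J_split (segc sy sz) half01).
  rewrite (J_split (segc sz sx) half01) !phi_seg -/m1 -/m2 -/m3.
  rewrite (J_rev (segc s3 s1)) (J_rev (segc s1 s2)) (J_rev (segc s2 s3)); ring.
have Rh : Rc 2^-1 = 2^-1 :> C by rewrite RcV Rc_nat.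
have cmh w : cm (w / 2) = cm w / 2 by rewrite cmM -Rh cm_Rc ger0_norm.
have D t' : t' \in [:: (x, m1, m3); (m1, y, m2); (m3, m2, z); (m1, m2, m3)] ->
  std3 t' /\ forall d, 0 <= d -> diam (x, y, z) d -> diam t' (d / 2) /\ cm (t'.1.1 - x) <= d.
  have e1 : x - m1 = (x - y) / 2 by rewrite /m1 /segp Rh; field.
  have e2 : y - m2 = (y - z) / 2 by rewrite /m2 /segp Rh; field.
  have e3 : z - m3 = (z - x) / 2 by rewrite /m3 /segp Rh; field.
  have e4 : m1 - y = (x - y) / 2 by rewrite /m1 /segp Rh; field.
  have e5 : m2 - z = (y - z) / 2 by rewrite /m2 /segp Rh; field.
  have e6 : m3 - x = (z - x) / 2 by rewrite /m3 /segp Rh; field.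
  have e7 : m1 - m3 = (y - z) / 2 by rewrite /m1 /m3 /segp Rh; field.
  have e8 : m2 - m1 = (z - x) / 2 by rewrite /m1 /m2 /segp Rh; field.
  have e9 : m3 - m2 = (x - y) / 2 by rewrite /m3 /m2 /segp Rh; field.
  have F d w : cm w <= d -> cm (w / 2) <= d / 2.
    by rewrite cmh ler_pM2r // invr_gt0.
  rewrite !inE => /or4P[] /eqP ->; split; try by split.
  - move=> d d0 [/= A B G]; rewrite /diam /= e1 e7 e6 subrr cm0.
    by rewrite !F.
  - move=> d d0 [/= A B G]; rewrite /diam /= e4 e2 e8.
    by rewrite !F // -opprB e1 cmN (le_trans (F _ _ A)) // ler_pdivrMr // ler_peMr // ler1n.
  - move=> d d0 [/= A B G]; rewrite /diam /= e9 e5 e3.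
    by rewrite !F // e6 (le_trans (F _ _ G)) // ler_pdivrMr // ler_peMr // ler1n.
  - move=> d d0 [/= A B G]; rewrite /diam /= -opprB e8 -(opprB m3) e9 -(opprB m1) e7 !cmN !F //.
    by rewrite -opprB e1 cmN (le_trans (F _ _ A)) // ler_pdivrMr // ler_peMr // ler1n.
suff [t' tin tT] : exists2 t', t' \in [:: (x, m1, m3); (m1, y, m2); (m3, m2, z); (m1, m2, m3)] &
    cm (T (x, y, z)) <= 4 * cm (T t').
  by exists t' => _; have [S1 S2] := D _ tin; split.
have : cm (T (x, y, z)) <= cm (T (x, m1, m3)) + cm (T (m1, y, m2)) +
   (cm (T (m3, m2, z)) + cm (T (m1, m2, m3))).
  by rewrite E; apply: le_trans (cmD _ _) _; rewrite lerD // cmD.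
move=> S; have [h1|h1] := leP (cm (T (x, y, z))) (4 * cm (T (x, m1, m3))).
  by exists (x, m1, m3); rewrite ?inE ?eqxx.
have [h2|h2] := leP (cm (T (x, y, z))) (4 * cm (T (m1, y, m2))).
  by exists (m1, y, m2); rewrite ?inE ?eqxx ?orbT.
have [h3|h3] := leP (cm (T (x, y, z))) (4 * cm (T (m3, m2, z))).
  by exists (m3, m2, z); rewrite ?inE ?eqxx ?orbT.
by exists (m1, m2, m3); rewrite ?inE ?eqxx ?orbT //; lra.
Qed.

Lemma goursat : J f a b + J f b c + J f c a = 0.
Proof.
have [F HF] := choice step.
pose t0 : C * C * C := (0, 1, ci).
have T0 : J f a b + J f b c + J f c a = T t0.
  rewrite /T /phi /=; have -> : a + Rc 0 * (b - a) + Rc 0 * (c - a) = a by rewrite Rc0; ring.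
  have -> : a + Rc 1 * (b - a) + Rc 0 * (c - a) = b by rewrite Rc0 Rc1; ring.
  by have -> : a + Rc 0 * (b - a) + Rc 1 * (c - a) = c by rewrite Rc0 Rc1; ring.
have std0 : std3 t0 by split; split; rewrite /= ?lexx ?ler01 ?addr0 ?add0r.
have diam0 : diam t0 2.
  have b1 : cm (1 - ci) <= 2 by apply: le_trans (cmB _ _) _; rewrite cm1 cm_ci.
  by split=> //=; rewrite ?sub0r ?subr0 ?cmN ?cm1 ?cm_ci ?ler1n.
pose s k := iter k F t0.
have S k : [/\ std3 (s k), cm (T t0) <= 4 ^+ k * cm (T (s k)),
    diam (s k) (2 * 2^-1 ^+ k) & cm ((s k.+1).1.1 - (s k).1.1) <= 2 * 2^-1 ^+ k].
  have p k' : 0 <= 2 * (2^-1 : R) ^+ k' by rewrite mulr_ge0 ?exprn_ge0.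
  elim: k => [|k [S1 S2 S3 S4]].
    rewrite !expr0 !mul1r mulr1; split => //.
    by have [_ _ /(_ 2 (ler0n _ _) diam0)[]] := HF _ std0.
  have [A B D] := HF _ S1; have [D1 D2] := D _ (p k) S3.
  have D1' : diam (s k.+1) (2 * 2^-1 ^+ k.+1) by rewrite exprSr mulrA.
  split => //.
    by apply: le_trans S2 _; rewrite exprSr -mulrA ler_wpM2l // exprn_ge0.
  by have [_ _ /(_ _ (p k.+1) D1')[]] := HF _ A.
have [||p Hp] := @cauchy_half (fun k => (s k).1.1) 2; [by []|by move=> k; have [] := S k|].
(* The inequalities that define the closed standard triangle survive the limit, up to errors of
   order 2^-k that vanish. *)
rewrite T0; have sp : std p.
  have B0 : 0 <= (2 * 2 : R) by rewrite mulr_ge0.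
  have Q (q : C -> R) : (forall x y, q x - q y <= cm (x - y)) ->
      (forall k, 0 <= q (s k).1.1) -> 0 <= q p.
    move=> ql q0; apply: (ge0_half B0) => k.
    have := ql (s k).1.1 p; have := q0 k; have := Hp k; lra.
  split.
  - apply: Q => [x y|k]; last by have [[[]]] := S k.
    by rewrite -reB; apply: le_trans (ler_norm _) (re_le_cm _).
  - apply: Q => [x y|k]; last by have [[[]]] := S k.
    by rewrite -imB; apply: le_trans (ler_norm _) (im_le_cm _).
  - rewrite -subr_ge0; apply: (ge0_half (B := 2 * (2 * 2))); first by rewrite mulr_ge0.
    move=> k; have [[[_ _ h] _ _] _ _ _] := S k.
    have h1 := le_trans (ler_norm _) (re_le_cm (p - (s k).1.1)).
    have h2 := le_trans (ler_norm _) (im_le_cm (p - (s k).1.1)).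
    move: h1 h2; rewrite reB imB cmBC; have := Hp k; lra.
have [l Hl] := f_der sp.
pose L := cm (b - a) + cm (c - a).
have L0 : 0 <= L by rewrite addr_ge0 ?cm_ge0.
have phil x y : cm (phi x - phi y) <= L * cm (x - y).
  have -> : phi x - phi y = Rc (re (x - y)) * (b - a) + Rc (im (x - y)) * (c - a).
    by rewrite /phi reB imB !RcB; ring.
  apply: le_trans (cmD _ _) _; rewrite !cmM !cm_Rc mulrDl.
  by rewrite lerD // mulrC ler_wpM2l ?cm_ge0 ?re_le_cm ?im_le_cm.
(* 36 L^2 h^2 is the sum over three edges of (6 L h)(2 L h), the distance to the limit point times
   the length of the edge; h^2 = 4^-k cancels the factor 4^k accumulated by the subdivisions. *)
have K0 : 0 < 36 * L ^+ 2 + 1 by rewrite ltr_wpDl // mulr_ge0 ?sqr_ge0.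
apply/eqP; rewrite -cm_eq0 eq_le cm_ge0 andbT; apply/ler_addgt0Pr => e e0.
rewrite add0r; have e1 : 0 < e / (36 * L ^+ 2 + 1) by rewrite divr_gt0.
have [d d0 Hd] := Hl _ e1.
have [k Hk] := @half_le (6 * L) d d0 (mulr_ge0 (ler0n _ _) L0).
have [[S1 S2 S3] S4 [D1 D2 D3] _] := S k.
set h := (2^-1 : R) ^+ k in Hk D1 D2 D3; have h0 : 0 <= h by rewrite exprn_ge0.
pose q := phi p.
pose pp w := f q + l * (w - q).
pose PP w := f q * w + l / 2 * (w - q) * (w - q).
have dPP w : cder PP w (pp w).
  have dq : cder (fun x => x - q) w 1.
    by apply: gder_eq (gderB (cder_id w) (gder_cst _ q _)) _; rewrite subr0.
  apply: gder_eq (gderD (gderZ (f q) (cder_id w)) (gderM (gderZ (l / 2) dq) dq)) _.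
  by rewrite /pp; field.
have edge x y : std x -> std y -> cm (x - p) <= 6 * h -> cm (y - p) <= 6 * h ->
    cm (x - y) <= 2 * h ->
    cm (J f (phi x) (phi y) - (PP (phi y) - PP (phi x))) <=
    e / (36 * L ^+ 2 + 1) * (L * (6 * h)) * (L * (2 * h)).
  move=> sx sy xp yp xy; apply: le_trans (J_approxc (segc sx sy) _ _) _ => [u _|u u01|].
  - exact: dPP.
  - have := segp_near u01 xp yp; rewrite phi_seg; move: (segp x y u) => w wp.
    have wq : cm (phi w - q) <= L * (6 * h).
      by apply: le_trans (phil _ _) _; rewrite ler_wpM2l.
    have := Hd (phi w - q); rewrite -/q (addrC q) subrK => A.
    have -> : f (phi w) - pp (phi w) = f (phi w) - f q - l * (phi w - q) by rewrite /pp; ring.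
    apply: le_trans (A _) _; first by apply: le_lt_trans wq _; rewrite mulrA (mulrC L).
    by apply: ler_wpM2l wq; exact: ltW.
  apply: ler_wpM2l; first by rewrite mulr_ge0 ?(ltW e1) // mulr_ge0 // mulr_ge0.
  by apply: le_trans (phil _ _) _; rewrite ler_wpM2l // cmBC.
have v1 : cm ((s k).1.1 - p) <= 4 * h by have := Hp k; rewrite -/h; lra.
have v2 : cm ((s k).1.2 - p) <= 6 * h.
  apply: le_trans (cm_tri _ _ (s k).1.1) _; rewrite cmBC; lra.
have v3 : cm ((s k).2 - p) <= 6 * h.
  apply: le_trans (cm_tri _ _ (s k).1.1) _; lra.
have v1' : cm ((s k).1.1 - p) <= 6 * h by lra.
have TT : cm (T (s k)) <= e / (36 * L ^+ 2 + 1) * (36 * L ^+ 2) * h ^+ 2.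
  have -> : T (s k) = (J f (phi (s k).1.1) (phi (s k).1.2) - (PP (phi (s k).1.2) - PP (phi (s k).1.1)))
    + (J f (phi (s k).1.2) (phi (s k).2) - (PP (phi (s k).2) - PP (phi (s k).1.2)))
    + (J f (phi (s k).2) (phi (s k).1.1) - (PP (phi (s k).1.1) - PP (phi (s k).2))).
    by rewrite /T; ring.
  apply: le_trans (cmD _ _) _; apply: le_trans (lerD (cmD _ _) (lexx _)) _.
  apply: le_trans (lerD (lerD (edge _ _ S1 S2 v1' v2 D1) (edge _ _ S2 S3 v2 v3 D2)) (edge _ _ S3 S1 v3 v1' D3)) _.
  rewrite le_eqVlt; apply/orP; left; apply/eqP; ring.
apply: le_trans S4 _.
have -> : e = e / (36 * L ^+ 2 + 1) * (36 * L ^+ 2 + 1) by rewrite divfK // gt_eqF.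
have hh : 4 ^+ k * h ^+ 2 = 1.
  by rewrite /h -exprM mulnC exprM -exprMn (_ : 4 * _ = 1) ?expr1n //; field.
apply: le_trans (ler_wpM2l _ TT) _; first by rewrite exprn_ge0.
rewrite mulrCA -mulrA [X in X <= _](_ : _ = e / (36 * L ^+ 2 + 1) * (36 * L ^+ 2) * (4 ^+ k * h ^+ 2)); last by ring.
by rewrite hh mulr1 ler_wpM2l ?(ltW e1) // lerDl.
Qed.

End Goursat.

Definition cdiff (f : C -> C) w := exists l, cder f w l.

Lemma cdiff_ccont f w : cdiff f w -> ccont f w.
Proof. by move=> [l]; exact: cder_ccont. Qed.

Lemma cder_uniq f w l m : cder f w l -> cder f w m -> l = m.
Proof.
move=> A B; apply/eqP; rewrite -subr_eq0 -cm_eq0 eq_le cm_ge0 andbT.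
apply/ler_addgt0Pr => e e0; rewrite add0r; have e2 : 0 < e / 2 by rewrite divr_gt0.
have [d1 d10 H1] := A _ e2; have [d2 d20 H2] := B _ e2.
pose k := Num.min d1 d2 / 2.
have k0 : 0 < k by rewrite divr_gt0 // lt_min d10.
have kk : k < Num.min d1 d2 by rewrite /k ltr_pdivrMr // ltr_pMr ?lt_min ?d10 // ltr1n.
have ck : cm (Rc k) = k by rewrite cm_Rc gtr0_norm.
move: kk; rewrite lt_min => /andP[k1 k2].
have := H1 (Rc k); have := H2 (Rc k); rewrite /= ck => /(_ k2) h2 /(_ k1) h1.
rewrite -(ler_pM2r k0) -{1}ck -cmM.
have -> : (l - m) * Rc k = (f (w + Rc k) - f w - m * Rc k) - (f (w + Rc k) - f w - l * Rc k) by ring.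
apply: le_trans (cmB _ _) _; rewrite [leRHS](_ : _ = e / 2 * k + e / 2 * k) ?lerD //.
by rewrite -mulrDl -splitr.
Qed.

Lemma J_refl f a : ccont f a -> J f a a = 0.
Proof.
move=> fc; have [|G [_ ->]] := @segintP f a a; last by rewrite subrr mul0r.
by move=> u _; rewrite /segp subrr mulr0 addr0.
Qed.

(** * Primitives on star-shaped domains *)

Section StarPrim.
Variables (V : C -> Prop) (f : C -> C).
Hypothesis V_open : forall w, V w -> exists2 d, 0 < d & forall k, cm k < d -> V (w + k).
Hypothesis V_star : forall w u, V w -> 0 <= u <= 1 -> V (Rc u * w).
Hypothesis f_cont : forall w, V w -> ccont f w.
Hypothesis f_diff : forall w, V w -> w != 0 -> cdiff f w.

Let V0 w : V w -> V 0.
Proof. by move=> Vw; have := V_star Vw (u := 0); rewrite Rc0 mul0r; apply; rewrite lexx ler01. Qed.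

Lemma star_seg0 w : V w -> seg_cont f 0 w.
Proof.
by move=> Vw u u01; apply: f_cont; rewrite /segp add0r subr0; exact: V_star.
Qed.

(** Goursat's theorem does not apply to the triangle 0, w, w + k, as f need not be differentiable at
    0. Cutting off that corner at scale e leaves a quadrilateral made of two triangles that avoid 0;
    |k| < |w| keeps the edge from w to w + k away from 0. *)
Let tri w k e : V w -> w != 0 -> cm k < cm w -> (forall u, 0 <= u <= 1 -> V (w + Rc u * k)) ->
  0 < e -> e < 1 -> J f 0 (w + k) - J f 0 w - J f w (w + k) =
   J f 0 (Rc e * (w + k)) - J f 0 (Rc e * w) + J f (Rc e * (w + k)) (Rc e * w).
Proof.
move=> Vw w0 kw Vk e0 e1.
have e01 : 0 <= e <= 1 by rewrite !ltW.
have Vwk : V (w + k) by have := Vk 1; rewrite Rc1 mul1r; apply; rewrite ler01 lexx.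
have nz u : 0 <= u <= 1 -> w + Rc u * k != 0.
  move=> /andP[u0 u1]; rewrite -cm_gt0; have := cm_dist w (- (Rc u * k)).
  rewrite opprK cmN cmM cm_Rc ger0_norm //; apply: lt_le_trans; rewrite subr_gt0.
  by apply: le_lt_trans kw; rewrite ler_piMl ?cm_ge0.
have good t u : 0 < t -> t <= 1 -> 0 <= u <= 1 -> cdiff f (Rc t * (w + Rc u * k)).
  move=> t0 t1 u01; apply: f_diff; first by apply: V_star; [exact: Vk|rewrite ltW].
  by rewrite mulf_neq0 ?nz // Rc_eq0 gt_eqF.
have good2 p q : 0 <= p -> 0 <= q -> 0 < p + q -> p + q <= 1 -> cdiff f (Rc p * w + Rc q * (w + k)).
  move=> p0 q0 pq0 pq1.
  have -> : Rc p * w + Rc q * (w + k) = Rc (p + q) * (w + Rc (q / (p + q)) * k).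
    have qe : Rc q = Rc (p + q) * Rc (q / (p + q)).
      by rewrite -RcM mulrCA divff ?gt_eqF ?mulr1.
    by rewrite [RHS]mulrDr mulrA -qe RcD; ring.
  apply: good => //; rewrite divr_ge0 ?(ltW pq0) //= ler_pdivrMr // mul1r.
  by rewrite lerDr.
have sg p q p' q' : 0 <= p -> 0 <= q -> 0 < p + q -> p + q <= 1 ->
    0 <= p' -> 0 <= q' -> 0 < p' + q' -> p' + q' <= 1 ->
    seg_cont f (Rc p * w + Rc q * (w + k)) (Rc p' * w + Rc q' * (w + k)).
  move=> p0 q0 pq0 pq1 p0' q0' pq0' pq1' u /andP[u0 u1].
  have -> : segp (Rc p * w + Rc q * (w + k)) (Rc p' * w + Rc q' * (w + k)) u =
    Rc ((1 - u) * p + u * p') * w + Rc ((1 - u) * q + u * q') * (w + k).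
    by rewrite /segp !RcD !RcM !RcB !Rc1; ring.
  have v0 : 0 <= 1 - u by rewrite subr_ge0.
  have E : (1 - u) * p + u * p' + ((1 - u) * q + u * q') = (1 - u) * (p + q) + u * (p' + q') by ring.
  apply: cdiff_ccont; apply: good2; rewrite ?E ?addr_ge0 ?mulr_ge0 //.
    have [->|un0] := eqVneq u 0; first by rewrite mul0r addr0 subr0 mul1r.
    by rewrite ltr_wpDl ?mulr_ge0 ?(ltW pq0) // mulr_gt0 // lt_def un0.
  by apply: le_trans (lerD (ler_wpM2l v0 pq1) (ler_wpM2l u0 pq1')) _; lra.
pose A := Rc e * w; pose B := Rc e * (w + k).
have EA : A = Rc e * w + Rc 0 * (w + k) by rewrite Rc0 mul0r addr0.
have EB : B = Rc 0 * w + Rc e * (w + k) by rewrite Rc0 mul0r add0r.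
have Ew : w = Rc 1 * w + Rc 0 * (w + k) by rewrite Rc0 Rc1 mul1r mul0r addr0.
have Ew' : w + k = Rc 0 * w + Rc 1 * (w + k) by rewrite Rc0 Rc1 mul1r mul0r add0r.
have T1 : J f A w + J f w (w + k) + J f (w + k) A = 0.
  apply: goursat => x [x1 x2 x3].
  have -> : A + Rc (re x) * (w - A) + Rc (im x) * (w + k - A) =
     Rc ((1 - re x - im x) * e + re x) * w + Rc (im x) * (w + k).
    by rewrite /A !(RcD, RcM, RcB) Rc1; ring.
  have y0 : 0 <= 1 - re x - im x by lra.
  have ye : 0 <= (1 - re x - im x) * e by rewrite mulr_ge0 ?(ltW e0).
  apply: good2 => //; first by rewrite addr_ge0.
    have [y1|y1] := eqVneq (1 - re x - im x) 0; first by rewrite y1 mul0r; lra.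
    have : 0 < (1 - re x - im x) * e by rewrite mulr_gt0 // lt_def y1.
    lra.
  have : (1 - re x - im x) * e <= 1 - re x - im x by rewrite ler_piMr ?(ltW e1).
  lra.
have T2 : J f A (w + k) + J f (w + k) B + J f B A = 0.
  apply: goursat => x [x1 x2 x3].
  have -> : A + Rc (re x) * (w + k - A) + Rc (im x) * (B - A) =
     Rc ((1 - re x - im x) * e) * w + Rc (re x + im x * e) * (w + k).
    by rewrite /A /B !(RcD, RcM, RcB) Rc1; ring.
  have y0 : 0 <= 1 - re x - im x by lra.
  have ye : 0 <= (1 - re x - im x) * e by rewrite mulr_ge0 ?(ltW e0).
  have ie : 0 <= im x * e by rewrite mulr_ge0 ?(ltW e0).
  have h1 : (1 - re x - im x) * e <= 1 - re x - im x by rewrite ler_piMr ?(ltW e1).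
  have h2 : im x * e <= im x by rewrite ler_piMr ?(ltW e1).
  apply: good2 => //; [lra| |lra].
  have : e * 1 <= e * (1 - re x - im x + re x / e + im x).
    rewrite ler_wpM2l ?(ltW e0) // -lerBlDr.
    have : re x <= re x / e by rewrite ler_peMr // invf_ge1 // ltW.
    lra.
  rewrite !mulrDr mulrCA divff ?gt_eqF // mulr1 mulrN; lra.
have sAw : seg_cont f A w.
  have := sg e 0 1 0; rewrite -EA -Ew; apply;
  by rewrite ?addr0 ?add0r ?lexx ?ler01 ?ltr01 ?(ltW e0) ?(ltW e1).
have sBw : seg_cont f B (w + k).
  have := sg 0 e 0 1; rewrite -EB -Ew'; apply;
  by rewrite ?addr0 ?add0r ?lexx ?ler01 ?ltr01 ?(ltW e0) ?(ltW e1).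
have sAw' : seg_cont f A (w + k).
  have := sg e 0 0 1; rewrite -EA -Ew'; apply;
  by rewrite ?addr0 ?add0r ?lexx ?ler01 ?ltr01 ?(ltW e0) ?(ltW e1).
have S1 : J f 0 w = J f 0 A + J f A w.
  by rewrite (J_split (star_seg0 Vw) e01) /segp add0r subr0.
have S2 : J f 0 (w + k) = J f 0 B + J f B (w + k).
  by rewrite (J_split (star_seg0 Vwk) e01) /segp add0r subr0.
move: T1 T2; rewrite (J_rev sAw') (J_rev sBw) -/A -/B S1 S2 => T1 T2.
apply/eqP; rewrite -subr_eq0; apply/eqP.
transitivity (- (J f A w + J f w (w + k) - J f A (w + k)) - (J f A (w + k) - J f B (w + k) + J f B A)).
  by ring.
by rewrite T1 T2; ring.
Qed.

(** Mere continuity at the centre is the generality needed for Cauchy's formula, whose integrand is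
    a difference quotient extended to its singular point by continuity. *)
Lemma star_prim w : V w -> cder (J f 0) w (f w).
Proof.
move=> Vw e e0; have [d1 d10 H1] := V_open Vw; have [d2 d20 H2] := f_cont Vw e0.
have [w0|w0] := eqVneq w 0.
  exists (Num.min d1 d2); first by rewrite lt_min d10.
  move=> k /=; rewrite lt_min => /andP[k1 k2].
  have Vk := H1 _ k1; rewrite w0 add0r in Vk H2 *.
  rewrite (J_refl (f_cont (V0 Vw))) subr0.
  have := @J_approxc f 0 k (fun x => f 0 * x) (fun=> f 0) e (star_seg0 Vk).
  rewrite mulr0 !subr0; apply=> u u01.
    by apply: gder_eq (gderZ _ (cder_id _)) _; rewrite mulr1.
  rewrite /segp add0r subr0 -{1}(add0r (Rc u * k)); apply: H2.
  case/andP: u01 => u0 u1.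
  by apply: le_lt_trans k2; rewrite cmM cm_Rc ger0_norm // ler_piMl ?cm_ge0.
exists (Num.min (Num.min d1 d2) (cm w)); first by rewrite !lt_min d10 d20 cm_gt0.
move=> k /=; rewrite !lt_min => /andP[/andP[k1 k2] kw].
have uk u : 0 <= u <= 1 -> cm (Rc u * k) <= cm k.
  by move=> /andP[u0 u1]; rewrite cmM cm_Rc ger0_norm // ler_piMl ?cm_ge0.
have Vk u : 0 <= u <= 1 -> V (w + Rc u * k).
  by move=> u01; apply: H1; apply: le_lt_trans (uk _ u01) k1.
have Vwk : V (w + k) by exact: H1.
(* The truncation scale t tends to 0: each of the three integrals left by [tri] is at most M t L. *)
have E : J f 0 (w + k) - J f 0 w - J f w (w + k) = 0.
  apply/eqP; rewrite -cm_eq0 eq_le cm_ge0 andbT; apply/ler_addgt0Pr => e' e'0; rewrite add0r.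
  have [d3 d30 H3] := f_cont (V0 Vw) ltr01.
  pose M := cm (f 0) + 1; have M0 : 0 < M by rewrite ltr_wpDl ?cm_ge0.
  pose L := cm w + cm k; have L0 : 0 < L by rewrite ltr_wpDr ?cm_ge0 ?cm_gt0.
  pose t := Num.min 2^-1 (Num.min (d3 / (2 * L)) (e' / (3 * M * L))).
  have t0 : 0 < t by rewrite !lt_min invr_gt0 ltr0n /= !divr_gt0 // !mulr_gt0.
  have t1 : t < 1 by rewrite gt_min invf_lt1 ?ltr1n.
  have t3 : t * L < d3.
    apply: le_lt_trans (_ : d3 / 2 < _); last by rewrite ltr_pdivrMr // ltr_pMr // ltr1n.
    have : t <= d3 / (2 * L) by rewrite !ge_min lexx orbT.
    by rewrite ler_pdivlMr ?mulr_gt0 // => h; rewrite ler_pdivlMr //; lra.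
  have te : 3 * M * (t * L) <= e'.
    have : t <= e' / (3 * M * L) by rewrite !ge_min lexx !orbT.
    by rewrite ler_pdivlMr ?mulr_gt0 // => h; rewrite [leLHS](_ : _ = t * (3 * M * L)) //; ring.
  rewrite (tri Vw w0 kw Vk t0 t1).
  have t01 : 0 <= t <= 1 by rewrite !ltW.
  have wL : cm (Rc t * w) <= t * L.
    by rewrite cmM cm_Rc gtr0_norm // ler_wpM2l ?(ltW t0) // lerDl cm_ge0.
  have wkL : cm (Rc t * (w + k)) <= t * L.
    by rewrite cmM cm_Rc gtr0_norm // ler_wpM2l ?(ltW t0) // cmD.
  have fM x : cm x <= t * L -> cm (f x) <= M.
    move=> xL; have := H3 x (le_lt_trans xL t3); rewrite add0r => h.
    by rewrite -(subrK (f 0) (f x)) (le_trans (cmD _ _)) // addrC lerD2l.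
  have b0 : 0 <= t * L by rewrite mulr_ge0 ?ltW.
  have s0 x : V x -> cm x <= t * L -> cm (J f 0 x) <= M * (t * L).
    move=> Vx xL; apply: le_trans (J_bound (M := M) (star_seg0 Vx) _) _ => [u u01|].
      apply: fM; rewrite /segp add0r subr0; case/andP: u01 => u0 u1.
      by rewrite cmM cm_Rc ger0_norm //; apply: le_trans xL; rewrite ler_piMl ?cm_ge0.
    by rewrite subr0 ler_wpM2l ?(ltW M0).
  have s1 : cm (J f (Rc t * (w + k)) (Rc t * w)) <= M * (t * L).
    apply: le_trans (J_bound (M := M) _ _) _ => [u u01|u u01|].
    - have -> : segp (Rc t * (w + k)) (Rc t * w) u = Rc t * (w + Rc (1 - u) * k).
        by rewrite /segp RcB Rc1; ring.
      by apply: f_cont; apply: V_star t01; apply: Vk; lra.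
    - by apply: fM; rewrite -[X in cm X]subr0; apply: segp_near; rewrite ?subr0.
    - rewrite ler_wpM2l ?(ltW M0) // -mulrBr opprD addrA subrr sub0r.
      by rewrite cmM cmN cm_Rc gtr0_norm // ler_wpM2l ?(ltW t0) // lerDr cm_ge0.
  apply: le_trans (cmD _ _) _; apply: le_trans (lerD (cmB _ _) (lexx _)) _.
  apply: le_trans te; apply: le_trans (lerD (lerD (s0 _ _ wkL) (s0 _ _ wL)) s1) _.
  - exact: V_star.
  - exact: V_star.
  - by rewrite le_eqVlt; apply/orP; left; apply/eqP; ring.
have -> : J f 0 (w + k) - J f 0 w - f w * k = J f w (w + k) - (f w * (w + k) - f w * w).
  by have /eqP := E; rewrite subr_eq0 => /eqP ->; ring.
have := @J_approxc f w (w + k) (fun x => f w * x) (fun=> f w) e.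
rewrite (_ : w + k - w = k); last by ring.
have sp u : segp w (w + k) u = w + Rc u * k by rewrite /segp; ring.
apply=> u u01; rewrite sp.
- by apply: f_cont; exact: Vk.
- by apply: gder_eq (gderZ _ (cder_id _)) _; rewrite mulr1.
- by apply: H2; apply: le_lt_trans (uk _ u01) k2.
Qed.

End StarPrim.

Opaque cexp.

(** * Cauchy's formula on a disc *)

Lemma cexp_2pi : cexp (Rc (2 * pi) * ci) = 1 :> C.
Proof.
have E : 2 * pi = pi *+ 2 :> R by rewrite mulr_natl.
apply: C_eqP; rewrite ?re_cexp ?im_cexp reM imM re_Rc im_Rc re_ci im_ci !(mulr0, mul0r, subr0, mulr1, addr0) expR0 mul1r E.
  by rewrite cos2pi.
by rewrite sin2pi.
Qed.

Lemma circle_der s x u : pder (fun v => s * cexp (Rc v * x)) u (x * (s * cexp (Rc u * x))).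
Proof. by apply: gder_eq (gderZ s (pder_cexp_line x u)) _; ring. Qed.

Section CauchyFormula.
Variables (f : C -> C) (rho : R).
Hypothesis rho0 : 0 < rho.
Hypothesis f_diff : forall w, cm w < rho -> cdiff f w.
Let sig := rho / 2.
Let q (u : R) : C := Rc sig * cexp (Rc u * ci).

Let sig0 : 0 < sig. Proof. by rewrite divr_gt0. Qed.

Lemma cm_circle u : cm (q u) = sig.
Proof.
rewrite /q cmM cm_Rc cm_cexp reM re_Rc im_Rc re_ci im_ci mulr0 mul0r subr0 expR0 mulr1.
by rewrite gtr0_norm.
Qed.

Let qn0 u : q u != 0. Proof. by rewrite -cm_gt0 cm_circle. Qed.

(* Since (f w - f y)/(w - y) has a primitive on the disc, its integral over the
   circle vanishes. *)
Lemma cauchy_formula y : cm y <= rho / 4 -> exists P : R -> C,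
  (forall u, pder P u (f (q u) * q u / (q u - y))) /\
  P (2 * pi) - P 0 = Rc (2 * pi) * f y.
Proof.
move=> y4; have yr : cm y < rho by have := rho0; lra.
have ys : cm y < sig by rewrite /sig; have := rho0; lra.
have [fy Hfy] := f_diff yr.
have qy u : q u - y != 0.
  by rewrite -cm_gt0; have := cm_dist (q u) y; rewrite cm_circle; lra.
pose g w := if w == 0 then fy else (f (y + w) - f y) / w.
pose V w := cm (y + w) < rho.
have gV w : V w -> w != 0 -> cdiff g w.
  move=> Vv w0; have [l Hl] := f_diff Vv.
  have D : cder (fun x => (f (y + x) - f y) * x^-1) w (l * w^-1 + (f (y + w) - f y) * (- w ^- 2)).
    apply: gderM (cderV w0); apply: gder_eq (gderB _ (gder_cst _ (f y) _)) (subr0 _).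
    have Hs : cder (fun x => y + x) w 1.
      by apply: gder_eq (gderD (gder_cst _ y _) (cder_id w)) (add0r _).
    by apply: gder_eq (gder_comp Hl Hs) (mulr1 _).
  eexists; apply: gder_ext D => //; exists (cm w); first by rewrite cm_gt0.
  move=> k kv; rewrite /g; case: eqP => // vk.
  have kw : k = - w by apply/eqP; rewrite -addr_eq0 addrC vk.
  by move: kv; rewrite kw cmN ltxx.
have gc w : V w -> ccont g w.
  have [->|w0] := eqVneq w 0; last by move=> Vv; apply: cdiff_ccont; exact: gV.
  move=> _ e e0; have [d d0 Hd] := Hfy e e0; exists d => // k kd; rewrite add0r /g eqxx.
  case: eqP => [|/eqP k0]; first by rewrite subrr cm0 ltW.
  have -> : (f (y + k) - f y) / k - fy = (f (y + k) - f y - fy * k) / k by field.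
  by rewrite cmM cmV ler_pdivrMr ?cm_gt0 // Hd.
have Vo w : V w -> exists2 d, 0 < d & forall k, cm k < d -> V (w + k).
  move=> Vv; exists (rho - cm (y + w)); first by rewrite subr_gt0.
  move=> k kd; rewrite /V addrA; apply: le_lt_trans (cmD _ _) _; lra.
have Vs w u : V w -> 0 <= u <= 1 -> V (Rc u * w).
  move=> Vv u01; have := @segp_near y (y + w) 0 u (Num.max (cm y) (cm (y + w))) u01.
  rewrite !subr0 !le_max !lexx orbT => /(_ isT isT).
  rewrite (_ : segp y (y + w) u = y + Rc u * w); last by rewrite /segp; ring.
  by rewrite /V => /orP[] h; apply: le_lt_trans h _.
have DG w := star_prim Vo Vs gc gV (w := w).
(* What remains is f(y) q/(q - y) = f(y) (1 + (y/q)/(1 - y/q)). In the variable 1/q the last term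
   involves y/(1 - y w), which is holomorphic on |y| |w| < 1 and has a primitive there; its
   contribution over the circle vanishes without any logarithm, and 2 pi f(y) is left. *)
pose V2 w := cm y * cm w < 1.
pose k w := y / (1 - y * w).
have nz w : V2 w -> 1 - y * w != 0.
  by move=> Vv; rewrite -cm_gt0; have := cm_dist 1 (y * w); rewrite cm1 cmM /V2 in Vv *; lra.
have kV w : V2 w -> cdiff k w.
  move=> Vv; eexists; apply: gderZ; apply: (gder_comp (f := fun x => x^-1)); first exact: cderV (nz _ Vv).
  apply: gderB (gder_cst _ 1 _) _; apply: gderZ; exact: cder_id.
have V2o w : V2 w -> exists2 d, 0 < d & forall k, cm k < d -> V2 (w + k).
  move=> Vv; have c0 : 0 < cm y + 1 by rewrite ltr_wpDl ?cm_ge0.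
  exists ((1 - cm y * cm w) / (cm y + 1)); first by rewrite divr_gt0 // subr_gt0.
  move=> x xd; rewrite /V2; apply: le_lt_trans (ler_wpM2l (cm_ge0 _) (cmD _ _)) _.
  rewrite mulrDr -ltrBrDl; apply: le_lt_trans (_ : (cm y + 1) * cm x < _).
    by rewrite ler_wpM2r ?cm_ge0 // lerDl.
  by rewrite mulrC -ltr_pdivlMr.
have V2s w u : V2 w -> 0 <= u <= 1 -> V2 (Rc u * w).
  rewrite /V2 => Vv /andP[u0 u1]; apply: le_lt_trans Vv.
  by rewrite cmM cm_Rc ger0_norm // ler_wpM2l ?cm_ge0 // ler_piMl ?cm_ge0.
have DK w := star_prim V2o V2s (fun x Vx => cdiff_ccont (kV x Vx)) (fun x Vx _ => kV x Vx) (w := w).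
pose qi (u : R) := (Rc sig)^-1 * cexp (Rc u * - ci).
have qiE u : qi u = (q u)^-1.
  by rewrite /qi /q mulrN cexpN; symmetry; exact: invfM.
pose P u := f y * Rc u + (f y * ci * J k 0 (qi u) - ci * J g 0 (q u - y)).
exists P; split=> [u|].
  have Dq := circle_der (Rc sig) ci u; rewrite -/q in Dq.
  have Dqi := circle_der (Rc sig)^-1 (- ci) u.
  have V2q : V2 (qi u).
    by rewrite /V2 qiE cmV cm_circle ltr_pdivrMr // mul1r.
  have Vq : V (q u - y) by rewrite /V addrC subrK cm_circle /sig; have := rho0; lra.
  have Dq2 : pder (fun t => q t - y) u (ci * q u).
    by apply: gder_eq (gderB Dq (gder_cst _ y _)) (subr0 _).
  have A := gder_comp (g := fun t => q t - y) (DG _ Vq) Dq2.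
  have B := gder_comp (g := qi) (DK _ V2q) Dqi.
  apply: gder_eq (gderD (gderZ (f y) (pder_Rc u)) (gderB (gderZ (f y * ci) B) (gderZ ci A))) _.
  rewrite /g (negPf (qy u)) (addrC y) subrK /k -/(qi u) qiE.
  have ci2 : ci * ci = -1 :> C by apply: C_eqP; rewrite ?reM ?imM /=; ring.
  have q1 : 1 - y / q u != 0 by rewrite -qiE; exact: nz.
  have -> : y / (1 - y / q u) = y * q u / (q u - y) by field; rewrite ?qn0 ?q1 ?qy.
  rewrite (_ : _ + _ = f y - ci * ci * (f y * (y / (q u - y)) + (f (q u) - f y) / (q u - y) * q u)); last first.
    by field; rewrite ?qn0 ?qy.
  by rewrite ci2; field; rewrite qy.
have q2 : q (2 * pi) = q 0 by rewrite /q cexp_2pi Rc0 mul0r cexp0.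
by rewrite /P !qiE q2 Rc0 mulr0; ring.
Qed.

(** Subtracting the formula at 0 and the linear term leaves f(q) k^2 / (q (q - k)) on the circle of
    radius rho/2, where |q - k| >= rho/4. The constants depend on rho and M only, so the estimate is
    uniform over bounded sequences of functions. *)
Lemma cauchy_quad M : (forall w, cm w < rho -> cm (f w) <= M) ->
  exists l, [/\ cder f 0 l, cm l <= 2 * M / rho &
   forall k, cm k <= rho / 4 -> cm (f k - f 0 - l * k) <= 8 * M / rho ^+ 2 * cm k ^+ 2].
Proof.
move=> fM; have M0 : 0 <= M by apply: le_trans (cm_ge0 (f 0)) (fM _ _); rewrite cm0.
have pi0 : 0 < 2 * pi :> R by rewrite mulr_gt0 // pi_gt0.
have fq u : cm (f (q u)) <= M.
  by apply: fM; rewrite cm_circle /sig; have := rho0; lra.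
have Dq u := circle_der (Rc sig) ci u.
have [P1 HP1] : exists G : R -> C, forall u : R, -1 < u -> pder G u (f (q u) / q u).
  apply: prim_path; apply: gder_pcont => u.
  have [l Hl] : cdiff f (q u) by apply: f_diff; rewrite cm_circle /sig; have := rho0; lra.
  eexists; apply: gderM; first exact: gder_comp Hl (Dq u).
  by apply: (gder_comp (f := fun x => x^-1)) (Dq u); exact: cderV (qn0 u).
pose l := (P1 (2 * pi) - P1 0) / Rc (2 * pi).
have R0 : Rc (2 * pi) != 0 :> C by rewrite Rc_eq0 gt_eqF.
have lM : cm l <= 2 * M / rho.
  rewrite /l cmM cmV cm_Rc gtr0_norm // ler_pdivrMr //.
  have := @pder_bound_cst P1 (fun u => f (q u) / q u) (2 * M / rho) 0 (2 * pi) (ltW pi0).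
  rewrite subr0; apply=> u /andP[u0 _].
    by apply: HP1; lra.
  rewrite cmM cmV cm_circle /sig invf_div.
  have -> : 2 * M / rho = M * (2 / rho) by ring.
  by rewrite ler_wpM2r // divr_ge0 // ltW.
have [|P0 [DP0 EP0]] := @cauchy_formula 0; first by rewrite cm0 divr_ge0 // ltW.
have Q k : cm k <= rho / 4 -> cm (f k - f 0 - l * k) <= 8 * M / rho ^+ 2 * cm k ^+ 2.
  move=> k4; have [P [DP EP]] := cauchy_formula k4.
  rewrite -(ler_pM2r pi0) -{1}(gtr0_norm pi0) -cm_Rc -cmM.
  have -> : (f k - f 0 - l * k) * Rc (2 * pi) =
     (P (2 * pi) - P0 (2 * pi) - k * P1 (2 * pi)) - (P 0 - P0 0 - k * P1 0).
    transitivity (Rc (2 * pi) * f k - Rc (2 * pi) * f 0 - k * (l * Rc (2 * pi))); first by ring.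
    by rewrite -EP -EP0 /l divfK //; ring.
  have D u : 0 <= u <= 2 * pi -> pder (fun u => P u - P0 u - k * P1 u) u
      (f (q u) * q u / (q u - k) - f (q u) * q u / (q u - 0) - k * (f (q u) / q u)).
    move=> /andP[u0 _]; apply: gderB (gderB (DP u) (DP0 u)) _.
    by apply: gderZ; apply: HP1; lra.
  have := @pder_bound_cst _ _ (8 * M / rho ^+ 2 * cm k ^+ 2) _ _ (ltW pi0) D.
  rewrite subr0; apply=> u _.
  have qk : sig / 2 <= cm (q u - k).
    by have := cm_dist (q u) k; rewrite cm_circle /sig; lra.
  have qk0 : q u - k != 0 by rewrite -cm_gt0; apply: lt_le_trans qk; rewrite divr_gt0.
  have -> : f (q u) * q u / (q u - k) - f (q u) * q u / (q u - 0) - k * (f (q u) / q u) =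
     f (q u) * k ^+ 2 / (q u * (q u - k)) by field; rewrite qn0 qk0.
  rewrite (cmM (f (q u) * k ^+ 2)) (cmM (f (q u))) cmX cmV (cmM (q u)) cm_circle ler_pdivrMr; last by rewrite mulr_gt0 // cm_gt0.
  have h : M * cm k ^+ 2 <= 8 * M / rho ^+ 2 * cm k ^+ 2 * (sig * (sig / 2)).
    by rewrite le_eqVlt; apply/orP; left; apply/eqP; rewrite /sig; field; rewrite gt_eqF.
  apply: le_trans (le_trans h _); first by rewrite ler_wpM2r ?sqr_ge0.
  have c0 : 0 <= 8 * M / rho ^+ 2 * cm k ^+ 2.
    by rewrite mulr_ge0 ?sqr_ge0 // divr_ge0 ?sqr_ge0 // mulr_ge0.
  by apply: ler_wpM2l => //; apply: ler_wpM2l => //; exact: ltW.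
exists l; split=> // e e0.
pose K := 8 * M / rho ^+ 2 + 1.
have K0 : 0 < K by rewrite ltr_wpDl // divr_ge0 ?sqr_ge0 // mulr_ge0.
exists (Num.min (rho / 4) (e / K)); first by rewrite lt_min !divr_gt0.
move=> k; rewrite lt_min => /andP[/ltW k4 ke]; rewrite add0r.
apply: le_trans (Q _ k4) _; rewrite expr2 mulrA ler_wpM2r ?cm_ge0 //.
apply: le_trans (_ : K * cm k <= _); first by rewrite ler_wpM2r ?cm_ge0 // lerDl.
by rewrite mulrC -ler_pdivlMr // ltW.
Qed.

End CauchyFormula.

Lemma cauchy_est (f : C -> C) w rho M : 0 < rho ->
  (forall k, cm k < rho -> cdiff f (w + k) /\ cm (f (w + k)) <= M) ->
  exists l, [/\ cder f w l, cm l <= 2 * M / rho &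
   forall k, cm k <= rho / 4 -> cm (f (w + k) - f w - l * k) <= 8 * M / rho ^+ 2 * cm k ^+ 2].
Proof.
move=> r0 H; have [||l [A B D]] := @cauchy_quad (fun k => f (w + k)) rho r0 _ M.
- move=> k /H[[l Hl] _]; exists l.
  have Hs : cder (fun x => w + x) k 1.
    by apply: gder_eq (gderD (gder_cst _ w _) (cder_id k)) (add0r _).
  by apply: gder_eq (gder_comp Hl Hs) (mulr1 _).
- by move=> k /H[].
exists l; split=> //; last by move=> k /D; rewrite addr0.
by move=> e /A[d d0 Hd]; exists d => // k /Hd; rewrite add0r addr0.
Qed.

(** * Bounded limits of holomorphic functions *)

Definition tends (s : nat -> C) l := forall e, 0 < e ->
  exists k0, forall k, (k0 <= k)%N -> cm (s k - l) <= e.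

Lemma cauchy_tends (s : nat -> C) :
  (forall e, 0 < e -> exists k0, forall k m, (k0 <= k)%N -> (k0 <= m)%N -> cm (s k - s m) <= e) ->
  exists l, tends s l.
Proof.
move=> H; have CR (g : C -> R) : (forall z w, `|g z - g w| <= cm (z - w)) ->
    exists l : R, forall e, 0 < e -> exists k0, forall k, (k0 <= k)%N -> `|g (s k) - l| <= e.
  move=> gl; have : cvg (g (s k) @[k --> \oo]).
    apply: R_complete; apply: cauchy_exP => e e0; have e2 : 0 < e / 2 by rewrite divr_gt0.
    have [k0 Hk0] := H _ e2.
    exists (g (s k0)); exists k0 => // k /= kk; rewrite /ball /= distrC.
    apply: le_lt_trans (gl _ _) _; apply: le_lt_trans (Hk0 _ _ kk (leqnn _)) _.
    by rewrite ltr_pdivrMr // ltr_pMr // ltr1n.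
  move=> /cvg_ex[l /cvgrPdist_le L]; exists l => e /L[k0 _ Hk]; exists k0 => k /Hk.
  by rewrite /= distrC.
have [l1 L1] := CR re (fun z w => ltac:(by rewrite -reB; exact: re_le_cm)).
have [l2 L2] := CR im (fun z w => ltac:(by rewrite -imB; exact: im_le_cm)).
exists (l1 +i* l2)%C => e e0.
have e2 : 0 < e / 2 by rewrite divr_gt0.
have [k1 K1] := L1 _ e2; have [k2 K2] := L2 _ e2.
exists (maxn k1 k2) => k; rewrite geq_max => /andP[kk1 kk2].
by apply: le_trans (cm_le_reim _) _; rewrite reB imB /= [leRHS]splitr lerD ?K1 ?K2.
Qed.

Lemma tends_uniq s l m : tends s l -> tends s m -> l = m.
Proof.
move=> A B; apply/eqP; rewrite -subr_eq0 -cm_eq0 eq_le cm_ge0 andbT.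
apply/ler_addgt0Pr => e e0; rewrite add0r; have e2 : 0 < e / 2 by rewrite divr_gt0.
have [k1 H1] := A _ e2; have [k2 H2] := B _ e2.
apply: le_trans (cm_tri _ _ (s (maxn k1 k2))) _; rewrite cmBC [leRHS]splitr.
by rewrite lerD ?H1 ?H2 ?leq_maxl ?leq_maxr.
Qed.

Lemma tends_le s l m M : tends s l -> (forall k, cm (s k - m) <= M) -> cm (l - m) <= M.
Proof.
move=> A B; apply/ler_addgt0Pr => e e0; have [k Hk] := A _ e0.
apply: le_trans (cm_tri _ _ (s k)) _; rewrite addrC lerD //.
by rewrite cmBC; exact: Hk.
Qed.

Lemma tends_cm_le s l M : tends s l -> (forall k, cm (s k) <= M) -> cm l <= M.
Proof.
by move=> A B; rewrite -(subr0 l); apply: (tends_le A) => k; rewrite subr0.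
Qed.

Lemma tends_D s t l m : tends s l -> tends t m -> tends (fun k => s k + t k) (l + m).
Proof.
move=> A B e e0; have e2 : 0 < e / 2 by rewrite divr_gt0.
have [k1 H1] := A _ e2; have [k2 H2] := B _ e2.
exists (maxn k1 k2) => k; rewrite geq_max => /andP[kk1 kk2].
have -> : s k + t k - (l + m) = (s k - l) + (t k - m) by ring.
by apply: le_trans (cmD _ _) _; rewrite [leRHS]splitr lerD ?H1 ?H2.
Qed.

Lemma tends_cst l : tends (fun=> l) l.
Proof. by move=> e e0; exists 0%N => k _; rewrite subrr cm0 ltW. Qed.

Lemma tends_Z c s l : tends s l -> tends (fun k => c * s k) (c * l).
Proof.
move=> A e e0; have c0 : 0 < cm c + 1 by rewrite ltr_wpDl ?cm_ge0.
have [k0 H] := A (e / (cm c + 1)) (divr_gt0 e0 c0); exists k0 => k kk.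
rewrite -mulrBr cmM; apply: le_trans (ler_wpM2l (cm_ge0 _) (H _ kk)) _.
by rewrite mulrCA ler_piMr ?(ltW e0) // ler_pdivrMr // mul1r lerDl.
Qed.

Lemma tends_sum (I : Type) (r : seq I) (s : I -> nat -> C) (l : I -> C) :
  (forall i, tends (s i) (l i)) ->
  tends (fun k => \sum_(i <- r) s i k) (\sum_(i <- r) l i).
Proof.
move=> H; elim: r => [|i r IH].
  rewrite big_nil; have -> : (fun k : nat => \sum_(i <- [::]) s i k) = fun=> 0.
    by apply/funext => k; rewrite big_nil.
  exact: tends_cst.
rewrite big_cons; have -> : (fun k : nat => \sum_(j <- i :: r) s j k) =
  fun k => s i k + \sum_(j <- r) s j k by apply/funext => k; rewrite big_cons.
exact: tends_D.
Qed.

Lemma cauchy_lip (f : C -> C) w rho M : 0 < rho ->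
  (forall k, cm k < rho -> cdiff f (w + k) /\ cm (f (w + k)) <= M) ->
  forall k, cm k <= rho / 4 -> cm (f (w + k) - f w) <= 4 * M / rho * cm k.
Proof.
move=> r0 H k k4; have [l [_ lM Q]] := cauchy_est r0 H.
have M0 : 0 <= M.
  by have [|_ h] := H 0; [rewrite cm0|apply: le_trans h; exact: cm_ge0].
have -> : f (w + k) - f w = (f (w + k) - f w - l * k) + l * k by ring.
apply: le_trans (cmD _ _) _; rewrite cmM.
apply: le_trans (lerD (Q _ k4) (ler_wpM2r (cm_ge0 k) lM)) _.
rewrite expr2 mulrA -mulrDl ler_wpM2r ?cm_ge0 //.
have : 8 * M / rho ^+ 2 * cm k <= 8 * M / rho ^+ 2 * (rho / 4).
  by rewrite ler_wpM2l // divr_ge0 ?sqr_ge0 // mulr_ge0.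
have -> : 8 * M / rho ^+ 2 * (rho / 4) = 2 * M / rho by field; rewrite gt_eqF.
have -> : 4 * M / rho = 2 * M / rho + 2 * M / rho by ring.
by rewrite lerD2r.
Qed.

(* By the quadratic estimate, difference quotients approximate the derivatives
   uniformly in k. *)
Lemma bounded_limit (F : nat -> C -> C) (f : C -> C) w rho M : 0 < rho ->
  (forall k x, cm x < rho -> cdiff (F k) (w + x) /\ cm (F k (w + x)) <= M) ->
  (forall x, cm x < rho -> tends (fun k => F k (w + x)) (f (w + x))) ->
  exists l, cder f w l /\ forall dF, (forall k, cder (F k) w (dF k)) -> tends dF l.
Proof.
move=> r0 H L.
have M0 : 0 <= M.
  by have [|_ h] := H 0%N 0; [rewrite cm0|apply: le_trans h; exact: cm_ge0].
pose K := 8 * M / rho ^+ 2; have K0 : 0 <= K by rewrite divr_ge0 ?sqr_ge0 // mulr_ge0.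
have [dF HdF] := choice (fun k => cauchy_est r0 (H k)).
have Q k x : cm x <= rho / 4 -> cm (F k (w + x) - F k w - dF k * x) <= K * cm x ^+ 2.
  by move=> x4; have [_ _ ] := HdF k; apply.
have L0 : tends (fun k => F k w) (f w).
  by have := L 0; rewrite cm0 addr0 => /(_ r0).
have [l Hl] : exists l, tends dF l.
  apply: cauchy_tends => e e0.
  (* With the step d fixed first, the two quadratic remainders K d^2 cost at most e d / 2 together;
     the other e d / 2 is paid by the convergence of the values at w and w + d. *)
  pose d := Num.min (rho / 4) (e / (4 * (K + 1))).
  have K1 : 0 < K + 1 by rewrite ltr_wpDl.
  have d0 : 0 < d by rewrite lt_min !divr_gt0 // mulr_gt0.
  have d4 : d <= rho / 4 by rewrite ge_min lexx.
  have cd : cm (Rc d) = d by rewrite cm_Rc gtr0_norm.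
  have dr : cm (Rc d) < rho.
    by rewrite cd; apply: le_lt_trans d4 _; rewrite ltr_pdivrMr // ltr_pMr // ltr1n.
  have Kd : K * d ^+ 2 <= e / 4 * d.
    rewrite expr2 mulrA ler_wpM2r ?(ltW d0) //.
    apply: le_trans (_ : (K + 1) * d <= _); first by rewrite ler_wpM2r ?(ltW d0) // lerDl.
    have : d <= e / (4 * (K + 1)) by rewrite ge_min lexx orbT.
    by rewrite ler_pdivlMr ?mulr_gt0 // => h; rewrite ler_pdivlMr //; lra.
  have e8 : 0 < e / 8 * d by rewrite mulr_gt0 // divr_gt0.
  have [k1 H1] := L _ dr _ e8; have [k2 H2] := L0 _ e8.
  exists (maxn k1 k2) => k m; rewrite !geq_max => /andP[kk1 kk2] /andP[mm1 mm2].
  rewrite -(ler_pM2r d0) -{1}cd -cmM.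
  have A := H1 _ kk1; have B := H1 _ mm1; have A' := H2 _ kk2; have B' := H2 _ mm2.
  have qk := Q k (Rc d); have qm := Q m (Rc d); rewrite cd in qk qm.
  have {}qk := qk d4; have {}qm := qm d4.
  have -> : (dF k - dF m) * Rc d =
    (F m (w + Rc d) - F m w - dF m * Rc d) - (F k (w + Rc d) - F k w - dF k * Rc d)
    + (((F k (w + Rc d) - f (w + Rc d)) - (F m (w + Rc d) - f (w + Rc d)))
       - ((F k w - f w) - (F m w - f w))) by ring.
  apply: le_trans (cmD _ _) _.
  apply: le_trans (lerD (cmB _ _) (cmB _ _)) _.
  apply: le_trans (lerD (lerD qm qk) (lerD (cmB _ _) (cmB _ _))) _.
  have := lerD (lerD A B) (lerD A' B'); lra.
have Ql x : cm x <= rho / 4 -> cm (f (w + x) - f w - l * x) <= K * cm x ^+ 2.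
  move=> x4; have xr : cm x < rho.
    by apply: le_lt_trans x4 _; rewrite ltr_pdivrMr // ltr_pMr // ltr1n.
  apply: (@tends_cm_le (fun k => F k (w + x) - F k w - dF k * x)); last by move=> k; exact: Q.
  have -> : (fun k => F k (w + x) - F k w - dF k * x) =
    fun k => F k (w + x) + (-1 * F k w + - x * dF k) by apply/funext => k; ring.
  have -> : f (w + x) - f w - l * x = f (w + x) + (-1 * f w + - x * l) by ring.
  by apply: tends_D (L _ xr) _; apply: tends_D; apply: tends_Z.
exists l; split.
  move=> e e0; have K1 : 0 < K + 1 by rewrite ltr_wpDl.
  exists (Num.min (rho / 4) (e / (K + 1))); first by rewrite lt_min !divr_gt0.
  move=> x; rewrite lt_min => /andP[/ltW x4 xe].
  apply: le_trans (Ql _ x4) _; rewrite expr2 mulrA ler_wpM2r ?cm_ge0 //.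
  apply: le_trans (_ : (K + 1) * cm x <= _); first by rewrite ler_wpM2r ?cm_ge0 // lerDl.
  by rewrite mulrC -ler_pdivlMr // ltW.
move=> dF' HdF'; rewrite (_ : dF' = dF) //; apply/funext => k.
by have [h _ _] := HdF k; exact: cder_uniq h.
Qed.

(** * Separately holomorphic functions of two variables *)

Definition opn2 (U : C -> C -> Prop) := forall p w, U p w -> exists2 d, 0 < d &
  forall x y, cm x < d -> cm y < d -> U (p + x) (w + y).

Definition lbnd (f : C -> C -> C) p w := exists d M, 0 < d /\
  forall x y, cm x < d -> cm y < d -> cm (f (p + x) (w + y)) <= M.

(* By Osgood's lemma this is joint holomorphy. *)
Definition hol2 (U : C -> C -> Prop) (f : C -> C -> C) := forall p w, U p w ->
  [/\ cdiff (fun x => f x w) p, cdiff (f p) w & lbnd f p w].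

Lemma hol2_tube U f p w : opn2 U -> hol2 U f -> U p w -> exists d M, [/\ 0 < d, 0 <= M &
  forall x y, cm x < d -> cm y < d -> U (p + x) (w + y) /\ cm (f (p + x) (w + y)) <= M].
Proof.
move=> oU hf Upw; have [d1 d10 H1] := oU _ _ Upw; have [_ _ [d2 [M [d20 H2]]]] := hf _ _ Upw.
exists (Num.min d1 d2), M; split; first by rewrite lt_min d10.
  by have := H2 0 0; rewrite cm0 => /(_ d20 d20); apply: le_trans; exact: cm_ge0.
by move=> x y; rewrite !lt_min => /andP[? ?] /andP[? ?]; split; [exact: H1|exact: H2].
Qed.

Lemma hol2_lip U f p w : opn2 U -> hol2 U f -> U p w -> exists d L, [/\ 0 < d, 0 <= L,
  (forall x y, cm x < d -> cm y < d -> U (p + x) (w + y)) &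
  forall x y x' y', cm x < d -> cm y < d -> cm x' < d -> cm y' < d ->
    cm (f (p + x) (w + y) - f (p + x') (w + y')) <= L * (cm (x - x') + cm (y - y'))].
Proof.
move=> oU hf Upw; have [d [M [d0 M0 H]]] := hol2_tube oU hf Upw.
pose d' := d / 16; have d'0 : 0 < d' by rewrite divr_gt0.
have dd' : d' < d by rewrite /d'; lra.
have r0 : 0 < d / 2 by rewrite divr_gt0.
exists d', (4 * M / (d / 2)); split=> //.
- by rewrite divr_ge0 ?(ltW r0) // mulr_ge0.
- by move=> x y xd yd; have [] := H x y (lt_trans xd dd') (lt_trans yd dd').
move=> x y x' y' xd yd x'd y'd.
have sm a b : cm a < d' -> cm b < d / 2 -> cm (a + b) < d.
  by move=> ad bd; apply: le_lt_trans (cmD _ _) _; move: ad; rewrite /d'; lra.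
have q4 a b : cm a < d' -> cm b < d' -> cm (a - b) <= d / 2 / 4.
  by move=> ad bd; apply: le_trans (cmB _ _) _; move: ad bd; rewrite /d'; lra.
rewrite mulrDr; apply: le_trans (cm_tri _ _ (f (p + x') (w + y))) _; apply: lerD.
  have -> : p + x = p + x' + (x - x') by ring.
  apply: (@cauchy_lip (fun s => f s (w + y)) (p + x') (d / 2) M r0) (q4 _ _ xd x'd) => k kd.
  rewrite -addrA; have [A B] := H (x' + k) y (sm _ _ x'd kd) (lt_trans yd dd').
  by have [] := hf _ _ A.
have -> : w + y = w + y' + (y - y') by ring.
apply: (@cauchy_lip (f (p + x')) (w + y') (d / 2) M r0) (q4 _ _ yd y'd) => k kd.
rewrite -addrA; have [A B] := H x' (y' + k) (lt_trans x'd dd') (sm _ _ y'd kd).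
by have [] := hf _ _ A.
Qed.

Definition cder2 (f : C -> C -> C) p w (l m : C) := forall e, 0 < e -> exists2 d, 0 < d &
  forall x y, cm x < d -> cm y < d ->
  cm (f (p + x) (w + y) - f p w - l * x - m * y) <= e * (cm x + cm y).

(** The w-derivative at p + x is recovered from a difference quotient, which the Lipschitz bound
    compares with the one at p: here separate holomorphy and local boundedness become joint
    differentiability. *)
Lemma hol2_der U f p w l m : opn2 U -> hol2 U f -> U p w ->
  cder (fun x => f x w) p l -> cder (f p) w m -> cder2 f p w l m.
Proof.
move=> oU hf Upw Dl Dm e e0.
have [d [M [d0 M0 H]]] := hol2_tube oU hf Upw.
have [d1 [L [d10 L0 _ HL]]] := hol2_lip oU hf Upw.
pose K := 8 * M / d ^+ 2; have K0 : 0 <= K by rewrite divr_ge0 ?sqr_ge0 // mulr_ge0.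
have E x : cm x < d -> exists lx, [/\ cder (f (p + x)) w lx, cm lx <= 2 * M / d &
    forall y, cm y <= d / 4 ->
    cm (f (p + x) (w + y) - f (p + x) w - lx * y) <= K * cm y ^+ 2].
  move=> xd; apply: cauchy_est d0 _ => k kd; have [A B] := H x k xd kd.
  by have [] := hf _ _ A.
have K1 : 0 < K + 1 by rewrite ltr_wpDl.
have L1 : 0 < L + 1 by rewrite ltr_wpDl.
(* the step b is chosen first, then x so small that the derivatives at p and
   p + x differ by less than e *)
pose b := Num.min (Num.min (d / 4) (d1 / 2)) (e / (8 * (K + 1))).
have b0 : 0 < b by rewrite !lt_min !divr_gt0 // mulr_gt0.
have b4 : b <= d / 4 by rewrite !ge_min lexx.
have b1 : b < d1.
  apply: le_lt_trans (_ : d1 / 2 < _); first by rewrite !ge_min lexx orbT.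
  by rewrite ltr_pdivrMr // ltr_pMr // ltr1n.
have be : (K + 1) * b <= e / 8.
  have : b <= e / (8 * (K + 1)) by rewrite ge_min lexx orbT.
  by rewrite ler_pdivlMr ?mulr_gt0 // => h; rewrite ler_pdivlMr //; lra.
have [d2 d20 H2] := Dl _ (divr_gt0 e0 (ltr0n _ 2)).
clearbody b.
pose t := Num.min (Num.min (Num.min d d1) (Num.min d2 b)) (e * b / (8 * (L + 1))).
exists t; first by rewrite !lt_min d0 d10 d20 b0 divr_gt0 // mulr_gt0.
move=> x y; rewrite !lt_min => /andP[/andP[/andP[xd xd1] /andP[xd2 xb]] xe] /andP[/andP[_ /andP[_ yb]] _].
have [lx [Dlx lxM Qx]] := E x xd.
have [|l0 [Dl0 _ Q0]] := E 0; first by rewrite cm0.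
have {Dl0} l0m : l0 = m by apply: cder_uniq Dl0 _; rewrite addr0.
rewrite l0m addr0 in Q0.
have cb : cm (Rc b) = b by rewrite cm_Rc gtr0_norm.
have lm : cm (lx - m) <= e / 2.
  rewrite -(ler_pM2r b0) -{1}cb -cmM.
  have q1 := Qx (Rc b); have q2 := Q0 (Rc b); rewrite cb in q1 q2.
  have {}q1 := q1 b4; have {}q2 := q2 b4.
  have c0 : cm (0 : C) < d1 by rewrite cm0.
  have l1 := HL x (Rc b) 0 (Rc b) xd1; rewrite cb in l1; have {}l1 := l1 b1 c0 b1.
  have l2 := HL x 0 0 0 xd1 c0 c0 c0.
  rewrite !(subrr, addr0, subr0, cm0) in l1 l2.
  have -> : (lx - m) * Rc b = (f p (w + Rc b) - f p w - m * Rc b)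
    - (f (p + x) (w + Rc b) - f (p + x) w - lx * Rc b)
    + ((f (p + x) (w + Rc b) - f p (w + Rc b)) - (f (p + x) w - f p w)) by ring.
  apply: le_trans (cmD _ _) _; apply: le_trans (lerD (cmB _ _) (cmB _ _)) _.
  apply: le_trans (lerD (lerD q2 q1) (lerD l1 l2)) _.
  have h1 : K * b ^+ 2 <= e / 8 * b.
    rewrite expr2 mulrA ler_wpM2r ?(ltW b0) //; apply: le_trans be.
    by rewrite ler_wpM2r ?(ltW b0) // lerDl.
  have h2 : L * cm x <= e * b / 8.
    apply: le_trans (_ : (L + 1) * cm x <= _); first by rewrite ler_wpM2r ?cm_ge0 // lerDl.
    by have := ltW xe; rewrite ler_pdivlMr ?mulr_gt0 // => h; rewrite ler_pdivlMr //; lra.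
  lra.
have -> : f (p + x) (w + y) - f p w - l * x - m * y = (f (p + x) (w + y) - f (p + x) w - lx * y)
   + ((lx - m) * y + (f (p + x) w - f p w - l * x)) by ring.
have y4 : cm y <= d / 4 by apply: le_trans (ltW yb) b4.
apply: le_trans (cmD _ _) _; apply: le_trans (lerD (Qx _ y4) (cmD _ _)) _.
have h1 : K * cm y ^+ 2 <= e / 8 * cm y.
  rewrite expr2 mulrA ler_wpM2r ?cm_ge0 //; apply: le_trans be.
  apply: ler_pM; rewrite ?cm_ge0 ?(ltW yb) //; by rewrite lerDl.
have h2 : cm ((lx - m) * y) <= e / 2 * cm y by rewrite cmM ler_wpM2r ?cm_ge0.
have h3 := H2 _ xd2.
apply: le_trans (lerD h1 (lerD h2 h3)) _.
have ey : 0 <= e * cm y by rewrite mulr_ge0 ?cm_ge0 ?(ltW e0).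
have ex : 0 <= e * cm x by rewrite mulr_ge0 ?cm_ge0 ?(ltW e0).
lra.
Qed.

Lemma hol2_der_ex U f p w : opn2 U -> hol2 U f -> U p w -> exists l m, cder2 f p w l m.
Proof.
move=> oU hf Upw; have [[l Hl] [m Hm] _] := hf _ _ Upw.
by exists l, m; exact: hol2_der hf Upw Hl Hm.
Qed.

Lemma cder2_comp (T : zmodType) (j : T -> C) (f : C -> C -> C) (a b : T -> C) x la lb l m :
  cder2 f (a x) (b x) l m -> gder j a x la -> gder j b x lb ->
  gder j (fun y => f (a y) (b y)) x (l * la + m * lb).
Proof.
move=> F A B e e0.
pose N := cm la + cm lb + 2; have N0 : 0 < N by rewrite ltr_wpDl // addr_ge0 ?cm_ge0.
pose N' := cm l + cm m + 1; have N'0 : 0 < N' by rewrite ltr_wpDl // addr_ge0 ?cm_ge0.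
have [d d0 Hd] := F _ (divr_gt0 (divr_gt0 e0 (ltr0n _ 2)) N0).
have [d1 d10 H1] := A _ (divr_gt0 (divr_gt0 e0 (ltr0n _ 2)) N'0).
have [d2 d20 H2] := B _ (divr_gt0 (divr_gt0 e0 (ltr0n _ 2)) N'0).
have [d3 d30 H3] := gder_lip A; have [d4 d40 H4] := gder_lip B.
exists (Num.min (Num.min (Num.min d1 d2) (Num.min d3 d4)) (d / N)).
  by rewrite !lt_min d10 d20 d30 d40 divr_gt0.
move=> k; rewrite !lt_min => /andP[/andP[/andP[k1 k2] /andP[k3 k4]] kd].
pose X := a (x + k) - a x; pose Y := b (x + k) - b x.
have X3 := H3 _ k3; have Y4 := H4 _ k4; rewrite -/X in X3; rewrite -/Y in Y4.
have kN : N * cm (j k) < d by rewrite mulrC -ltr_pdivlMr.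
have XN : cm X + cm Y <= N * cm (j k).
  by apply: le_trans (lerD X3 Y4) _; rewrite -mulrDl ler_wpM2r ?cm_ge0 // /N; lra.
have Xd : cm X < d by have := cm_ge0 Y; lra.
have Yd : cm Y < d by have := cm_ge0 X; lra.
have := Hd X Y Xd Yd; have -> : a x + X = a (x + k) by rewrite /X; ring.
have -> : b x + Y = b (x + k) by rewrite /Y; ring.
move=> G; have -> : f (a (x + k)) (b (x + k)) - f (a x) (b x) - (l * la + m * lb) * j k =
  (f (a (x + k)) (b (x + k)) - f (a x) (b x) - l * X - m * Y) +
  (l * (X - la * j k) + m * (Y - lb * j k)) by ring.
apply: le_trans (cmD _ _) _; apply: le_trans (lerD G (cmD _ _)) _; rewrite !cmM.
have e2 : 0 <= e / 2 by rewrite divr_ge0 ?ltW.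
have h1 : e / 2 / N * (cm X + cm Y) <= e / 2 * cm (j k).
  apply: le_trans (ler_wpM2l _ XN) _; first by rewrite divr_ge0 ?(ltW N0).
  by rewrite mulrA divfK // gt_eqF.
have h2 : cm l * cm (X - la * j k) + cm m * cm (Y - lb * j k) <= e / 2 * cm (j k).
  apply: le_trans (lerD (ler_wpM2l (cm_ge0 _) (H1 _ k1)) (ler_wpM2l (cm_ge0 _) (H2 _ k2))) _.
  rewrite -mulrDl mulrA ler_wpM2r ?cm_ge0 // mulrA.
  by rewrite ler_pdivrMr // mulrC ler_wpM2l // /N'; lra.
lra.
Qed.

Lemma hol2_sub (U V : C -> C -> Prop) f : (forall p w, U p w -> V p w) -> hol2 V f -> hol2 U f.
Proof. by move=> UV hf p w /UV; exact: hf. Qed.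

Lemma hol2_cst U c : hol2 U (fun _ _ => c).
Proof.
move=> p w _; split; [exists 0; exact: gder_cst|exists 0; exact: gder_cst|].
by exists 1, (cm c); split.
Qed.

Lemma hol1 (W : C -> Prop) (h : C -> C) : (forall x, W x -> cdiff h x) ->
  hol2 (fun x _ => W x) (fun x _ => h x).
Proof.
move=> H p w Wp; split; [exact: H|exists 0; exact: gder_cst|].
have [d d0 Hd] := cdiff_ccont (H _ Wp) ltr01.
exists d, (cm (h p) + 1); split=> // x y xd _.
by rewrite -(subrK (h p) (h (p + x))) (le_trans (cmD _ _)) // addrC lerD2l Hd.
Qed.

Lemma hol2_cont U f p w : opn2 U -> hol2 U f -> U p w -> forall e, 0 < e ->
  exists2 d, 0 < d & forall x y, cm x < d -> cm y < d -> cm (f (p + x) (w + y) - f p w) < e.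
Proof.
move=> oU hf Upw e e0; have [d [L [d0 L0 _ H]]] := hol2_lip oU hf Upw.
have L1 : 0 < L + 1 by rewrite ltr_wpDl.
exists (Num.min d (e / (4 * (L + 1)))); first by rewrite lt_min d0 divr_gt0 // mulr_gt0.
move=> x y; rewrite !lt_min => /andP[xd xe] /andP[yd ye].
have := H x y 0 0 xd yd; rewrite cm0 !addr0 !subr0 => /(_ d0 d0) h.
apply: le_lt_trans h _; apply: le_lt_trans (_ : (L + 1) * (cm x + cm y) < _).
  by rewrite ler_wpM2r ?addr_ge0 ?cm_ge0 // lerDl.
rewrite mulrC -ltr_pdivlMr //.
have -> : e / (L + 1) = 4 * (e / (4 * (L + 1))) by field; rewrite gt_eqF.
have := cm_ge0 x; lra.
Qed.

Lemma hol2_comp (U V : C -> C -> Prop) (f a b : C -> C -> C) : opn2 U -> opn2 V -> hol2 V f ->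
  hol2 U a -> hol2 U b -> (forall p w, U p w -> V (a p w) (b p w)) ->
  hol2 U (fun p w => f (a p w) (b p w)).
Proof.
move=> oU oV hf ha hb UV p w Upw.
have [l [m F]] := hol2_der_ex oV hf (UV _ _ Upw).
have [[a1 A1] [a2 A2] _] := ha _ _ Upw; have [[b1 B1] [b2 B2] _] := hb _ _ Upw.
split.
- by eexists; exact: (cder2_comp (a := fun x => a x w) (b := fun x => b x w) F A1 B1).
- by eexists; exact: (cder2_comp (a := a p) (b := b p) F A2 B2).
have [d [M [d0 M0 H]]] := hol2_tube oV hf (UV _ _ Upw).
have [d1 d10 H1] := hol2_cont oU ha Upw d0; have [d2 d20 H2] := hol2_cont oU hb Upw d0.
exists (Num.min d1 d2), M; split; first by rewrite lt_min d10.
move=> x y; rewrite !lt_min => /andP[x1 x2] /andP[y1 y2].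
have [_] := H _ _ (H1 x y x1 y1) (H2 x y x2 y2).
by rewrite (addrC (a p w)) subrK (addrC (b p w)) subrK.
Qed.

Lemma hol2_comp1 (U : C -> C -> Prop) (W : C -> Prop) (h : C -> C) (a : C -> C -> C) : opn2 U ->
  (forall x, W x -> exists2 d, 0 < d & forall k, cm k < d -> W (x + k)) ->
  (forall x, W x -> cdiff h x) -> hol2 U a -> (forall p w, U p w -> W (a p w)) ->
  hol2 U (fun p w => h (a p w)).
Proof.
move=> oU oW hh ha UW.
apply: (@hol2_comp U (fun x _ => W x) (fun x _ => h x) a (fun _ _ => 0)) => //.
- by move=> p w /oW[d d0 H]; exists d => // x y xd _; exact: H.
- exact: hol1.
- exact: hol2_cst.
Qed.

Lemma hol2_fst U : hol2 U (fun p _ => p).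
Proof.
by apply: hol2_sub (@hol1 (fun=> True) id _) => // x _; exists 1; exact: cder_id.
Qed.

Lemma hol2_snd U : hol2 U (fun _ w => w).
Proof.
move=> p w _; split; [by exists 0; exact: gder_cst|by exists 1; exact: cder_id|].
exists 1, (cm w + 1); split=> // x y _ /ltW y1.
by apply: le_trans (cmD _ _) _; rewrite lerD2l.
Qed.

Lemma hol2_D U f g : hol2 U f -> hol2 U g -> hol2 U (fun p w => f p w + g p w).
Proof.
move=> hf hg p w Upw; have [[a A] [b B] [d [M [d0 H]]]] := hf _ _ Upw.
have [[a' A'] [b' B'] [d' [M' [d'0 H']]]] := hg _ _ Upw; split.
- by eexists; exact: gderD A A'.
- by eexists; exact: gderD B B'.
exists (Num.min d d'), (M + M'); split; first by rewrite lt_min d0.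
move=> x y; rewrite !lt_min => /andP[? ?] /andP[? ?].
by apply: le_trans (cmD _ _) _; rewrite lerD ?H ?H'.
Qed.

Lemma hol2_M U f g : hol2 U f -> hol2 U g -> hol2 U (fun p w => f p w * g p w).
Proof.
move=> hf hg p w Upw; have [[a A] [b B] [d [M [d0 H]]]] := hf _ _ Upw.
have [[a' A'] [b' B'] [d' [M' [d'0 H']]]] := hg _ _ Upw; split.
- by eexists; exact: gderM A A'.
- by eexists; exact: gderM B B'.
exists (Num.min d d'), (M * M'); split; first by rewrite lt_min d0.
move=> x y; rewrite !lt_min => /andP[? ?] /andP[? ?].
by rewrite cmM ler_pM ?cm_ge0 ?H ?H'.
Qed.

Lemma hol2_N U f : hol2 U f -> hol2 U (fun p w => - f p w).
Proof.
move=> hf; have -> : (fun p w => - f p w) = fun p w => (-1) * f p w.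
  by apply/funext => p; apply/funext => w; rewrite mulN1r.
by apply: hol2_M hf; exact: hol2_cst.
Qed.

Lemma hol2_B U f g : hol2 U f -> hol2 U g -> hol2 U (fun p w => f p w - g p w).
Proof. by move=> hf hg; apply: hol2_D hf _; exact: hol2_N. Qed.

Lemma hol2_V U f : opn2 U -> hol2 U f -> (forall p w, U p w -> f p w != 0) ->
  hol2 U (fun p w => (f p w)^-1).
Proof.
move=> oU hf f0; apply: (hol2_comp1 (W := fun x => x != 0) oU _ _ hf f0).
  move=> x x0; exists (cm x); first by rewrite cm_gt0.
  by move=> k kx; rewrite -cm_gt0; have := cm_dist x (- k); rewrite opprK cmN; lra.
by move=> x x0; exists (- x ^- 2); exact: cderV.
Qed.

Lemma hol2_sum U (I : Type) (r : seq I) (P : pred I) (F : I -> C -> C -> C) :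
  (forall i, hol2 U (F i)) -> hol2 U (fun p w => \sum_(i <- r | P i) F i p w).
Proof.
move=> H; elim: r => [|i r IH].
  rewrite (_ : (fun p w => _) = fun _ _ => 0); first exact: hol2_cst.
  by apply/funext => p; apply/funext => w; rewrite big_nil.
rewrite (_ : (fun p w => _) = fun p w => (if P i then F i p w else 0) + \sum_(j <- r | P j) F j p w).
  by apply: hol2_D IH; case: (P i) => //; exact: hol2_cst.
by apply/funext => p; apply/funext => w; rewrite big_cons; case: (P i) => //; rewrite add0r.
Qed.

Lemma hol2_cexp U f : opn2 U -> hol2 U f -> hol2 U (fun p w => cexp (f p w)).
Proof.
move=> oU hf; apply: (hol2_comp1 (W := fun=> True) oU _ _ hf) => //.
  by move=> x _; exists 1.
by move=> x _; exists (cexp x); exact: cder_cexp.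
Qed.

Lemma hol2_limit U (F : nat -> C -> C -> C) f : opn2 U -> (forall k, hol2 U (F k)) ->
  (forall p w, U p w -> exists d M, 0 < d /\ forall k x y, cm x < d -> cm y < d ->
    cm (F k (p + x) (w + y)) <= M) ->
  (forall p w, U p w -> tends (fun k => F k p w) (f p w)) ->
  hol2 U f /\ forall p w dF l, U p w -> (forall k, cder (F k p) w (dF k)) ->
    tends dF l -> cder (f p) w l.
Proof.
move=> oU hF B L.
have Lw p w : U p w -> exists l, cder (f p) w l /\ forall dF, (forall k, cder (F k p) w (dF k)) -> tends dF l.
  move=> Upw; have [d1 d10 H1] := oU _ _ Upw; have [d2 [M [d20 H2]]] := B _ _ Upw.
  apply: (@bounded_limit (fun k => F k p) _ w (Num.min d1 d2) M); first by rewrite lt_min d10.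
    move=> k x; rewrite lt_min => /andP[x1 x2]; split.
      by have [] := hF k p (w + x) _ => //; rewrite -(addr0 p); apply: H1; rewrite ?cm0.
    by rewrite -(addr0 p); apply: H2; rewrite ?cm0.
  move=> x; rewrite lt_min => /andP[x1 _]; apply: L.
  by rewrite -(addr0 p); apply: H1; rewrite ?cm0.
split=> [p w Upw|p w dF l Upw HdF Hl].
  have [d1 d10 H1] := oU _ _ Upw; have [d2 [M [d20 H2]]] := B _ _ Upw; split.
  - have [|||l [Hl _]] := @bounded_limit (fun k x => F k x w) (fun x => f x w) p (Num.min d1 d2) M.
    + by rewrite lt_min d10.
    + move=> k x; rewrite lt_min => /andP[x1 x2]; split.
        by have [] := hF k (p + x) w _ => //; rewrite -(addr0 w); apply: H1; rewrite ?cm0.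
      by rewrite -(addr0 w); apply: H2; rewrite ?cm0.
    + move=> x; rewrite lt_min => /andP[x1 _]; apply: L.
      by rewrite -(addr0 w); apply: H1; rewrite ?cm0.
    + by exists l.
  - by have [l [Hl _]] := Lw _ _ Upw; exists l.
  - exists (Num.min d1 d2), M; split; first by rewrite lt_min d10.
    move=> x y; rewrite !lt_min => /andP[x1 x2] /andP[y1 y2].
    by apply: tends_cm_le (L _ _ (H1 x y x1 y1)) _ => k; exact: H2.
have [m [Hm HT]] := Lw _ _ Upw.
by rewrite (tends_uniq Hl (HT _ HdF)).
Qed.

(** Compactness of [0, 1] by a supremum argument, in a form suited to radii: with [Q v d] read as d
    being an admissible radius at v, local choices of d merge into a single one. *)
Lemma unit_compact (Q : R -> R -> Prop) :
  (forall v d d', Q v d -> d' <= d -> Q v d') ->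
  (forall u, 0 <= u <= 1 -> exists2 d, 0 < d & forall v, 0 <= v <= 1 -> `|v - u| < d -> Q v d) ->
  exists2 d, 0 < d & forall v, 0 <= v <= 1 -> Q v d.
Proof.
move=> mono H.
pose S := [set s : R | 0 <= s <= 1 /\ exists2 d, 0 < d & forall v, 0 <= v <= s -> Q v d].
have i0 : 0 <= (0 : R) <= 1 by rewrite lexx ler01.
have S0 : S 0.
  split=> //; have [d d0 Hd] := H 0 i0; exists d => // v v0.
  by apply: Hd; [lra|rewrite subr0 (_ : v = 0) ?normr0 //; lra].
have hS : has_sup S.
  by split; [exists 0|exists 1 => s [/andP[]]].
have sS1 : sup S <= 1 by apply: ge_sup => //; [exists 0|move=> s [/andP[]]].
have s0 : 0 <= sup S by apply: ub_le_sup => //; case: hS.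
have [d d0 Hd] := H (sup S) (introT andP (conj s0 sS1)).
have [x Sx xs] := sup_adherent d0 hS.
have [x01 [d1 d10 Hd1]] := Sx.
pose y := Num.min 1 (sup S + d / 2).
have y01 : 0 <= y <= 1 by rewrite /y le_min ler01 ge_min lexx /=; lra.
have yd : y <= sup S + d / 2 by rewrite /y ge_min lexx orbT.
have Sy : S y.
  split=> //; exists (Num.min d d1); first by rewrite lt_min d0.
  move=> v /andP[v0 vy]; have [vx|vx] := leP v x.
    by apply: mono (Hd1 v _) _; rewrite ?v0 // ge_min lexx orbT.
  apply: mono (Hd v _ _) _; last by rewrite ge_min lexx.
    by rewrite v0; case/andP: y01 => _ y1; exact: le_trans vy y1.
  by rewrite ltr_norml; apply/andP; split; lra.
have ys : y <= sup S by apply: ub_le_sup => //; case: hS.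
have y1 : y = 1.
  move: ys; rewrite /y /Num.min; case: ltP => // h1 h2; lra.
by have [_] := Sy; rewrite y1.
Qed.

(** * Primitives depending holomorphically on a parameter *)

Definition star2 (U : C -> C -> Prop) := forall p w u, U p w -> 0 <= u <= 1 -> U p (Rc u * w).

Lemma cm_Rc_mul u w : 0 <= u -> cm (Rc u * w) = u * cm w.
Proof. by move=> u0; rewrite cmM cm_Rc ger0_norm. Qed.

Lemma hol2_segment_tube U f p w : opn2 U -> star2 U -> hol2 U f -> U p w ->
  exists d M, [/\ 0 < d, 0 <= M & forall u x y, 0 <= u <= 1 -> cm x < d -> cm y < d ->
    U (p + x) (Rc u * w + y) /\ cm (f (p + x) (Rc u * w + y)) <= M].
Proof.
move=> oU sU hf Upw.
(* A single number d measures the radius and, through d^-1, the bound, so that the property is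
   monotone in d as [unit_compact] demands. *)
have [v d d' H dd x y xd yd|u u01|d d0 Hd] := @unit_compact (fun u d => forall x y, cm x < d ->
  cm y < d -> U (p + x) (Rc u * w + y) /\ cm (f (p + x) (Rc u * w + y)) <= d^-1).
- have [h1 h2] := H x y (lt_le_trans xd dd) (lt_le_trans yd dd); split=> //.
  apply: le_trans h2 _; have d'0 : 0 < d' by apply: le_lt_trans xd; exact: cm_ge0.
  by rewrite lef_pV2 // posrE; exact: lt_le_trans dd.
- have [d [M [d0 M0 H]]] := hol2_tube oU hf (sU _ _ _ Upw u01).
  have w1 : 0 < cm w + 1 by rewrite ltr_wpDl ?cm_ge0.
  have M1 : 0 < M + 1 by rewrite ltr_wpDl.
  exists (Num.min (d / (2 * (cm w + 1))) (M + 1)^-1).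
    by rewrite lt_min invr_gt0 M1 divr_gt0 // mulr_gt0.
  move=> v v01; rewrite lt_min => /andP[vd _] x y; rewrite !lt_min => /andP[xd _] /andP[yd _].
  have le1 : d / (2 * (cm w + 1)) <= d / 2.
    rewrite ler_pM2l // lef_pV2 ?posrE ?mulr_gt0 // ler_peMr // lerDr.
    exact: cm_ge0.
  have xd' : cm x < d by lra.
  have -> : Rc v * w + y = Rc u * w + (Rc (v - u) * w + y) by rewrite RcB; ring.
  have yd' : cm (Rc (v - u) * w + y) < d.
    apply: le_lt_trans (cmD _ _) _; rewrite cmM cm_Rc.
    have : `|v - u| * cm w <= d / (2 * (cm w + 1)) * (cm w + 1).
      by apply: ler_pM; rewrite ?cm_ge0 ?(ltW vd) // lerDl.
    have -> : d / (2 * (cm w + 1)) * (cm w + 1) = d / 2 by field; rewrite gt_eqF.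
    lra.
  have [h1 h2] := H _ _ xd' yd'; split=> //; apply: le_trans h2 _.
  have : M <= M + 1 by rewrite lerDl.
  move=> h; apply: le_trans h _; rewrite -[leLHS]invrK lef_pV2 ?posrE ?invr_gt0 //.
    by rewrite ge_min lexx orbT.
  by rewrite lt_min invr_gt0 M1 andbT divr_gt0 // mulr_gt0.
- exists d, d^-1; split; rewrite ?invr_ge0 ?(ltW d0) // => u x y u01.
  exact: Hd.
Qed.

Section Primitive.
Variables (U : C -> C -> Prop) (f : C -> C -> C).
Hypotheses (oU : opn2 U) (sU : star2 U) (hf : hol2 U f).

Lemma prim_cder p w : U p w -> cder (J (f p) 0) w (f p w).
Proof.
apply: (@star_prim (U p) (f p)).
- move=> x Ux; have [d d0 H] := oU Ux; exists d => // k kd.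
  by rewrite -(addr0 p); apply: H; rewrite ?cm0.
- by move=> x u Ux u01; exact: sU.
- by move=> x Ux; have [_ h _] := hf Ux; exact: cdiff_ccont h.
- by move=> x Ux _; have [_ h _] := hf Ux.
Qed.

Lemma prim_at0 p : U p 0 -> J (f p) 0 0 = 0.
Proof. by move=> Ux; have [_ h _] := hf Ux; apply: J_refl; exact: cdiff_ccont h. Qed.

Lemma prim_bound p w M : U p w -> (forall u, 0 <= u <= 1 -> cm (f p (Rc u * w)) <= M) ->
  cm (J (f p) 0 w) <= M * cm w.
Proof.
move=> Upw B; have := @J_bound (f p) 0 w M; rewrite subr0; apply => u u01; rewrite /segp add0r subr0.
  by have [_ h _] := hf (sU Upw u01); exact: cdiff_ccont h.
exact: B.
Qed.

(** Riemann sums are finite sums of functions holomorphic in p. As the primitive is their bounded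
    limit, [bounded_limit] gives holomorphy in p with no differentiation under an integral. *)
Lemma riemann_sum p w d M : 0 < d -> 0 <= M ->
  (forall u y, 0 <= u <= 1 -> cm y < d ->
    U p (Rc u * w + y) /\ cm (f p (Rc u * w + y)) <= M) ->
  tends (fun k => w / k.+1%:R * \sum_(i < k.+1) f p (Rc (i%:R / k.+1%:R) * w)) (J (f p) 0 w).
Proof.
move=> d0 M0 H.
have UT u : 0 <= u <= 1 -> U p (Rc u * w).
  by move=> u01; have [] := H u 0 u01; rewrite ?cm0 // addr0.
pose L := 4 * M / d; have L0 : 0 <= L by rewrite divr_ge0 ?(ltW d0) // mulr_ge0.
pose G (u : R) := J (f p) 0 (Rc u * w).
have DG u : 0 <= u <= 1 -> pder G u (f p (Rc u * w) * w).
  move=> u01; have := pder_line 0 w u => D.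
  have D' : pder (fun v => Rc v * w) u w.
    by apply: gder_ext D; rewrite ?Rc0 //; exists 1 => // k _; rewrite add0r.
  exact: (gder_comp (g := fun v => Rc v * w) (prim_cder (UT _ u01)) D').
move=> e e0.
(* Over a mesh of length b the Lipschitz constant L from Cauchy's estimate lets f vary by at most L
   b, and L b |w| <= e. *)
pose b := Num.min (d / 4) (e / (L * cm w + 1)).
have Lw1 : 0 < L * cm w + 1 by rewrite ltr_wpDl // mulr_ge0 ?cm_ge0.
have b0 : 0 < b by rewrite lt_min !divr_gt0.
have [k0 Hk0] : exists k0 : nat, cm w / b < k0%:R.
  exists (Num.bound (cm w / b)).
  by apply: archi_boundP; rewrite divr_ge0 ?cm_ge0 ?(ltW b0).
exists k0 => k kk; set K : R := k.+1%:R.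
have K0 : 0 < K by rewrite ltr0n.
have wK : cm w / K < b.
  rewrite ltr_pdivrMr // mulrC -ltr_pdivrMr //; apply: lt_le_trans Hk0 _.
  by rewrite ler_nat (leq_trans kk).
have KC : Rc K = k.+1%:R :> C by rewrite Rc_nat.
have step (m : nat) : (m < k.+1)%N ->
    cm (G (m.+1%:R / K) - G (m%:R / K) - w / k.+1%:R * f p (Rc (m%:R / K) * w)) <= e / K.
  move=> mk; have [q qE] : exists q, q = K^-1 by exists K^-1.
  have [u0 u0E] : exists u0, u0 = m%:R * q by exists (m%:R * q).
  rewrite -qE -u0E; have Ki : 0 < q by rewrite qE invr_gt0.
  have u00 : 0 <= u0 by rewrite u0E mulr_ge0 ?(ltW Ki).
  have u1E : m.+1%:R * q = u0 + q by rewrite u0E -natr1 mulrDl mul1r.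
  have u11 : u0 + q <= 1 by rewrite -u1E qE ler_pdivrMr // mul1r ler_nat.
  have u0le : u0 <= u0 + q by lra.
  pose g (u : R) := G u - Rc u * (f p (Rc u0 * w) * w).
  have Dg u : u0 <= u <= u0 + q -> pder g u (f p (Rc u * w) * w - f p (Rc u0 * w) * w).
    move=> uu; apply: gderB; first by apply: DG; lra.
    have := pder_line 0 (f p (Rc u0 * w) * w) u.
    by apply: gder_ext; rewrite ?Rc0 //; exists 1 => // x _; rewrite add0r.
  have := @pder_bound_cst g _ e u0 (u0 + q) u0le Dg.
  have -> : u0 + q - u0 = q by ring.
  have -> : g (u0 + q) - g u0 = G (m.+1%:R * q) - G u0 - w / k.+1%:R * f p (Rc u0 * w).
    by rewrite /g u1E RcD qE RcV KC; ring.
  apply=> u uu; rewrite -mulrBl cmM.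
  have uw : cm (Rc (u - u0) * w) < b.
    rewrite cm_Rc_mul; last by lra.
    by apply: le_lt_trans wK; rewrite mulrC -qE ler_wpM2l ?cm_ge0 //; lra.
  have bd : b <= d / 4 by rewrite ge_min lexx.
  have hl := @cauchy_lip (f p) (Rc u0 * w) d M d0 _ (Rc (u - u0) * w).
  have E : Rc u0 * w + Rc (u - u0) * w = Rc u * w by rewrite RcB; ring.
  rewrite E in hl.
  have {}hl := hl _ (le_trans (ltW uw) bd).
  have {}hl : cm (f p (Rc u * w) - f p (Rc u0 * w)) <= L * cm (Rc (u - u0) * w).
    apply: hl => y yd; have u001 : 0 <= u0 <= 1 by lra.
    have [A B] := H _ _ u001 yd; split=> //.
    by have [_ h _] := hf A.
  apply: le_trans (ler_wpM2r (cm_ge0 w) hl) _.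
  apply: le_trans (_ : L * b * cm w <= _).
    by rewrite ler_wpM2r ?cm_ge0 // ler_wpM2l // ltW.
  have be : b * (L * cm w + 1) <= e.
    by rewrite -ler_pdivlMr // ge_min lexx orbT.
  apply: le_trans be; rewrite mulrDr mulr1 mulrAC mulrC lerDl.
  exact: ltW.
have sum m : (m <= k.+1)%N -> cm (G (m%:R / K) -
    w / k.+1%:R * \sum_(i < m) f p (Rc (i%:R / K) * w)) <= m%:R * (e / K).
  elim: m => [|m IH] mk.
    rewrite big_ord0 mulr0 subr0 mul0r mul0r /G Rc0 mul0r prim_at0 ?cm0 //.
    by have := UT 0; rewrite Rc0 mul0r; apply; rewrite lexx ler01.
  rewrite big_ord_recr /= mulrDr.
  have -> : G (m.+1%:R / K) - (w / k.+1%:R * (\sum_(i < m) f p (Rc (i%:R / K) * w)) + w / k.+1%:R * f p (Rc (m%:R / K) * w))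
    = (G (m%:R / K) - w / k.+1%:R * \sum_(i < m) f p (Rc (i%:R / K) * w)) +
      (G (m.+1%:R / K) - G (m%:R / K) - w / k.+1%:R * f p (Rc (m%:R / K) * w)) by ring.
  have -> : m.+1%:R * (e / K) = m%:R * (e / K) + e / K by rewrite -natr1 mulrDl mul1r.
  apply: le_trans (cmD _ _) _.
  by apply: lerD; [apply: IH; exact: ltnW|exact: step].
have := sum k.+1 (leqnn _); rewrite -/K divff ?gt_eqF // [K * _]mulrC divfK ?gt_eqF //.
by rewrite /G Rc1 mul1r cmBC.
Qed.

Lemma hol2_prim : hol2 U (fun p w => J (f p) 0 w).
Proof.
move=> p w Upw; have [d [M [d0 M0 H]]] := hol2_segment_tube oU sU hf Upw.
have i1 : 0 <= (1 : R) <= 1 by rewrite ler01 lexx.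
have c0 : cm (0 : C) < d by rewrite cm0.
split.
- pose S (k : nat) x := w / k.+1%:R * \sum_(i < k.+1) f x (Rc (i%:R / k.+1%:R) * w).
  have ik (k : nat) (i : 'I_k.+1) : 0 <= (i%:R / k.+1%:R : R) <= 1.
    by rewrite divr_ge0 //= ler_pdivrMr // mul1r ler_nat ltnW.
  have [||l [Hl _]] := @bounded_limit S (fun x => J (f x) 0 w) p d (cm w * M) d0; last by exists l.
    move=> k x xd; split.
      have hd (i : 'I_k.+1) : cdiff (fun x => f x (Rc (i%:R / k.+1%:R) * w)) (p + x).
        have [A _] := H _ x 0 (ik k i) xd c0; rewrite addr0 in A.
        by have [] := hf A.
      have [ds Hds] := choice hd.
      suff [l Hl] : cdiff (fun x => \sum_(i < k.+1) f x (Rc (i%:R / k.+1%:R) * w)) (p + x).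
        by eexists; apply: gderZ Hl.
      elim: (index_enum _) => [|i r [l IH]].
        exists 0; apply: gder_ext (gder_cst _ 0 _) => //; exists 1 => // y _.
        by rewrite big_nil.
      eexists; apply: gder_ext (gderD (Hds i) IH) => //; exists 1 => // y _.
      by rewrite big_cons.
    rewrite /S cmM; have -> : cm (w / k.+1%:R) = cm w / k.+1%:R.
      by rewrite cmM cmV -Rc_nat cm_Rc ger0_norm.
    rewrite -mulrA ler_wpM2l ?cm_ge0 // mulrC ler_pdivrMr //.
    apply: le_trans (cm_sum _ _) _; rewrite mulrC mulr_natl.
    apply: le_trans (ler_sum _ (G := fun=> M) _) _ => [i _|].
      by have [_] := H _ x 0 (ik k i) xd c0; rewrite addr0.
    by rewrite sumr_const card_ord.
  move=> x xd; apply: (riemann_sum d0 M0) => u y u01 yd; exact: H.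
- by exists (f p w); exact: prim_cder.
exists d, (M * (cm w + d)); split=> // x y xd yd.
have UT u : 0 <= u <= 1 -> U (p + x) (Rc u * (w + y)) /\ cm (f (p + x) (Rc u * (w + y))) <= M.
  move=> u01; rewrite mulrDr; apply: H => //; case/andP: u01 => u0 u1.
  by rewrite cm_Rc_mul //; apply: le_lt_trans yd; rewrite ler_piMl ?cm_ge0.
apply: le_trans (prim_bound (M := M) _ _) _.
- by have [] := UT 1 i1; rewrite Rc1 mul1r.
- by move=> u /UT[].
by rewrite ler_wpM2l // (le_trans (cmD _ _)) // lerD2l ltW.
Qed.

End Primitive.

(** * Linear systems with a holomorphic parameter *)

Section LinearODE.
Variables (n : nat) (U : C -> C -> Prop).
Hypotheses (oU : opn2 U) (sU : star2 U).
Implicit Types (A Y : C -> C -> 'M[C]_n).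

Definition hol2mx Y := forall i j, hol2 U (fun p w => Y p w i j).

Definition picard A Y p w : 'M[C]_n := \matrix_(i, j)
  ((1%:M : 'M[C]_n) i j + J (fun x => \sum_k A p x i k * Y p x k j) 0 w).

Variable A : C -> C -> 'M[C]_n.
Hypothesis hA : hol2mx A.

Let Ys k := iter k (picard A) (fun _ _ => 1%:M).

Let hAY Y i j : hol2mx Y -> hol2 U (fun p w => \sum_k A p w i k * Y p w k j).
Proof. by move=> hY; apply: hol2_sum => k; apply: hol2_M. Qed.

Let hYs k : hol2mx (Ys k).
Proof.
elim: k => [|k IH] i j; first exact: hol2_cst.
rewrite (_ : (fun p w => _) = fun p w => (1%:M : 'M[C]_n) i j +
    J (fun x => \sum_l A p x i l * Ys k p x l j) 0 w).
  by apply: hol2_D; [exact: hol2_cst|apply: (hol2_prim oU sU); exact: hAY].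
by apply/funext => p; apply/funext => w; rewrite mxE.
Qed.

Let dYs k p w i j : U p w ->
  cder (fun x => Ys k.+1 p x i j) w (\sum_l A p w i l * Ys k p w l j).
Proof.
move=> Upw; rewrite (_ : (fun x => _) = fun x => (1%:M : 'M[C]_n) i j +
    J (fun x => \sum_l A p x i l * Ys k p x l j) 0 x).
  apply: gder_eq (gderD (gder_cst _ _ _) (prim_cder oU sU (hAY _ _ (hYs k)) Upw)) _.
  by rewrite add0r.
by apply/funext => x; rewrite mxE.
Qed.

Let Ys0 k p i j : U p 0 -> Ys k p 0 i j = (1%:M : 'M[C]_n) i j.
Proof.
by case: k => [//|k] Up0; rewrite [LHS]mxE (prim_at0 (hAY _ _ (hYs k)) Up0) addr0.
Qed.

Lemma hol2mx_tube p w : U p w -> exists d M, [/\ 0 < d, 0 <= M &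
  forall i j u x y, 0 <= u <= 1 -> cm x < d -> cm y < d ->
    U (p + x) (Rc u * w + y) /\ cm (A (p + x) (Rc u * w + y) i j) <= M].
Proof.
move=> Upw.
have [d0 [M0 [d00 _ H0]]] := hol2_segment_tube oU sU (hol2_cst 0) Upw.
suff [d [M [dp Mp H]]] : exists d M, [/\ 0 < d, 0 <= M &
  forall ij u x y, ij \in enum {: 'I_n * 'I_n} -> 0 <= u <= 1 -> cm x < d -> cm y < d ->
    cm (A (p + x) (Rc u * w + y) ij.1 ij.2) <= M].
  exists (Num.min d d0), M; split=> //; first by rewrite lt_min dp.
  move=> i j u x y u01; rewrite !lt_min => /andP[xd xd0] /andP[yd yd0].
  split; first by have [] := H0 u x y u01 xd0 yd0.
  by apply: (H (i, j)) => //; rewrite mem_enum.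
elim: (enum _) => [|[i j] s [d [M [dp Mp H]]]]; first by exists 1, 0.
have [d1 [M1 [d10 M10 H1]]] := hol2_segment_tube oU sU (hA i j) Upw.
exists (Num.min d d1), (Num.max M M1); split; first by rewrite lt_min dp.
  by rewrite le_max Mp.
move=> ij u x y; rewrite inE !lt_min => /orP[/eqP ->|ins] u01 /andP[xd xd1] /andP[yd yd1].
  by rewrite le_max; apply/orP; right; have [] := H1 u x y u01 xd1 yd1.
by rewrite le_max; apply/orP; left; apply: H.
Qed.

(* |Y_{k+1} - Y_k| <= 2^-k e^{2K|w|}: the exponential weight makes the Picard
   operator a contraction of ratio 1/2. *)
Let Ys_diff p w d M : 0 <= M -> (forall i j u y, 0 <= u <= 1 -> cm y < d ->
    U p (Rc u * w + y) /\ cm (A p (Rc u * w + y) i j) <= M) ->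
  forall k i j y, cm y < d -> cm (Ys k.+1 p (w + y) i j - Ys k p (w + y) i j) <=
    2^-1 ^+ k * expR (2 * (n%:R * M) * cm (w + y)).
Proof.
move=> M0 H k i j y yd; set K := n%:R * M.
have K0 : 0 <= K by rewrite mulr_ge0.
have n1 : (0 < n)%N by apply: leq_ltn_trans (ltn_ord i).
pose x := w + y.
have UT u i' j' : 0 <= u <= 1 -> U p (Rc u * x) /\ cm (A p (Rc u * x) i' j') <= M.
  move=> u01; rewrite /x mulrDr; apply: H => //; case/andP: u01 => u0 u1.
  by rewrite cm_Rc_mul //; apply: le_lt_trans yd; rewrite ler_piMl ?cm_ge0.
have i0 : 0 <= (0 : R) <= 1 by rewrite lexx ler01.
have Up0 : U p 0 by have [] := UT 0 i j i0; rewrite Rc0 mul0r.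
have pe (a b u : R) : is_derive u 1 (fun v => a * expR (v * b)) (a * (b * expR (u * b))).
  have D1 : is_derive u 1 (fun v : R => v * b) b.
    by apply: is_derive_eq; rewrite /GRing.scale /= mulr0 add0r mulr1.
  have E1 := @is_derive1_comp R expR (fun v => v * b) u _ _ (is_derive_expR _) D1.
  rewrite (_ : (fun v => _) = a *: (expR \o (fun v => v * b))) //.
  by apply: is_derive_eq; rewrite /GRing.scale /=; ring.
have linp (z' : C) u : pder (fun v => Rc v * z') u z'.
  have := pder_line 0 z' u; apply: gder_ext; rewrite ?Rc0 //.
  by exists 1 => // h _; rewrite add0r.
rewrite -/x; suff S u : 0 <= u <= 1 -> cm (Ys k.+1 p (Rc u * x) i j - Ys k p (Rc u * x) i j) <=
    2^-1 ^+ k * expR (u * (2 * K * cm x)).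
  by have := S 1; rewrite Rc1 !mul1r; apply; rewrite lexx ler01.
elim: k i j u => [|k IH] i j u /andP[u0 u1].
  rewrite expr0 mul1r [Ys 1 p _ i j]mxE addrAC subrr add0r.
  apply: le_trans (prim_bound sU (hAY i j (hYs 0)) (M := M) _ _) _.
  - by have [] := UT u i j; rewrite ?u0.
  - move=> v /andP[v0 v1]; rewrite mulrA -RcM.
    have uv : 0 <= v * u <= 1 by rewrite mulr_ge0 //= mulr_ile1.
    rewrite (bigD1 j) //= big1 ?addr0 => [|l lj]; last by rewrite mxE (negPf lj) mulr0.
    by rewrite mxE eqxx mulr1; have [] := UT _ i j uv.
  rewrite cm_Rc_mul //; apply: le_trans (expR_ge1Dx _).
  have : M * (u * cm x) <= u * (2 * K * cm x).
    rewrite mulrCA ler_wpM2l // ler_wpM2r ?cm_ge0 // /K.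
    have : M <= n%:R * M by rewrite ler_peMl // ler1n.
    lra.
  lra.
have Dg v : 0 <= v <= u -> pder (fun v => Ys k.+2 p (Rc v * x) i j - Ys k.+1 p (Rc v * x) i j) v
    ((\sum_l A p (Rc v * x) i l * (Ys k.+1 p (Rc v * x) l j - Ys k p (Rc v * x) l j)) * x).
  move=> /andP[v0 vu]; have v01 : 0 <= v <= 1 by rewrite v0 (le_trans vu).
  have [Uv _] := UT v i j v01.
  apply: gder_eq (gderB (gder_comp (g := fun v => Rc v * x) (dYs k.+1 i j Uv) (linp x v))
    (gder_comp (g := fun v => Rc v * x) (dYs k i j Uv) (linp x v))) _.
  rewrite -mulrBl -sumrB; congr (_ * _); apply: eq_bigr => l _; by rewrite mulrBr.
have := @pder_bound _ _ (fun v => 2^-1 ^+ k.+1 * expR (v * (2 * K * cm x))) _ 0 u u0 Dg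
  (fun v _ => pe _ _ v).
rewrite Rc0 mul0r !Ys0 // subrr subr0 => h.
apply: le_trans (h _) _; last by rewrite gerBl mulr_ge0 ?exprn_ge0 ?expR_ge0.
move=> v /andP[v0 vu]; have v01 : 0 <= v <= 1 by rewrite v0 (le_trans vu).
rewrite cmM; apply: le_trans (_ : (K * (2^-1 ^+ k * expR (v * (2 * K * cm x)))) * cm x <= _).
  rewrite ler_wpM2r ?cm_ge0 //; apply: le_trans (cm_sum _ _) _.
  rewrite /K -mulrA mulr_natl.
  apply: le_trans (ler_sum _ (G := fun=> M * (2^-1 ^+ k * expR (v * (2 * K * cm x)))) _) _ => [l _|].
    rewrite cmM ler_pM ?cm_ge0 //; first by have [] := UT v i l v01.
    exact: IH.
  by rewrite sumr_const card_ord.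
rewrite exprS; set E := expR _; set h2 := _ ^+ k.
by rewrite le_eqVlt; apply/orP; left; apply/eqP; field.
Qed.

(** Every Picard iterate is holomorphic in both variables, since the primitives start at the centre
    of star-shaped fibres. Convergence is geometric and locally uniform, so [hol2_limit] yields both
    the holomorphy of the limit and its differential equation. *)
Lemma linear_ode : exists Y, [/\ hol2mx Y,
  forall p, U p 0 -> Y p 0 = 1%:M &
  forall p w i j, U p w -> cder (fun x => Y p x i j) w ((A p w *m Y p w) i j)].
Proof.
pose Y p w : 'M[C]_n := \matrix_(i, j) xget 0 [set l | tends (fun k => Ys k p w i j) l].
have D0 p w : U p w -> exists d M, [/\ 0 < d, 0 <= M & forall k i j x y, cm x < d -> cm y < d ->
  cm (Ys k.+1 (p + x) (w + y) i j - Ys k (p + x) (w + y) i j) <= M * 2^-1 ^+ k].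
  move=> Upw; have [d [M [d0 M0 H]]] := hol2mx_tube Upw.
  exists d, (expR (2 * (n%:R * M) * (cm w + d))); split; rewrite ?expR_ge0 // => k i j x y xd yd.
  apply: le_trans (Ys_diff (d := d) M0 _ k i j yd) _.
    by move=> i' j' u z' u01 zd; apply: H.
  rewrite mulrC ler_wpM2r ?exprn_ge0 // ler_expR ler_wpM2l ?mulr_ge0 //.
  by apply: le_trans (cmD _ _) _; rewrite lerD2l ltW.
have TY p w i j : U p w -> tends (fun k => Ys k p w i j) (Y p w i j).
  move=> Upw; have [d [M [d0 M0 H]]] := D0 _ _ Upw.
  have [|l Hl] := @cauchy_half (fun k => Ys k p w i j) M M0.
    by move=> k; have := H k i j 0 0; rewrite cm0 !addr0; apply.
  rewrite mxE; apply: (@xgetPex _ 0 [set l | tends (fun k => Ys k p w i j) l]).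
  exists l => e e0; have [k0 Hk0] := half_le e0 (mulr_ge0 (ler0n _ 2) M0).
  exists k0 => k kk; apply: le_trans (Hl k) _; apply: le_trans (ltW Hk0).
  rewrite ler_wpM2l ?mulr_ge0 // -(subnK kk) exprD ler_piMl ?exprn_ge0 //.
  by rewrite exprn_ile1 // invf_le1 // ler1n.
have TB p w i j : U p w -> exists d M, 0 < d /\ forall k x y, cm x < d -> cm y < d ->
    cm (Ys k (p + x) (w + y) i j) <= M.
  move=> Upw; have [d [M [d0 M0 H]]] := D0 _ _ Upw.
  exists d, (1 + 2 * M); split=> // k x y xd yd.
  have S m : cm (Ys m (p + x) (w + y) i j - Ys 0 (p + x) (w + y) i j) <= \sum_(q < m) M * 2^-1 ^+ q.
    elim: m => [|m IH]; first by rewrite subrr cm0 big_ord0.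
    rewrite big_ord_recr /=; apply: le_trans (cm_tri _ _ (Ys m (p + x) (w + y) i j)) _.
    by rewrite addrC lerD // H.
  rewrite -(subrK (Ys 0 (p + x) (w + y) i j) (Ys k _ _ i j)).
  apply: le_trans (cmD _ _) _; rewrite addrC lerD //.
    by rewrite mxE; case: (i == j); rewrite ?cm1 ?cm0.
  by apply: le_trans (S k) _; rewrite -mulr_sumr mulrC ler_wpM2r // sum_geom2.
have TL i j := hol2_limit (f := fun p w => Y p w i j) oU (fun k => hYs k i j)
  (fun p w => @TB p w i j) (fun p w => @TY p w i j).
exists Y; split.
- by move=> i j; have [] := TL i j.
- move=> p Up0; apply/matrixP => i j; apply: tends_uniq (TY _ _ _ _ Up0) _.
  have -> : (fun k => Ys k p 0 i j) = fun=> (1%:M : 'M[C]_n) i j.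
    by apply/funext => k; exact: Ys0.
  exact: tends_cst.
move=> p w i j Upw; rewrite mxE.
have [||_ H] := hol2_limit (f := fun p w => Y p w i j) oU (fun k => hYs k.+1 i j).
- move=> p' w' Up'; have [d [M [d0 H]]] := TB _ _ i j Up'.
  by exists d, M; split=> // k x y xd yd; exact: H.
- move=> p' w' Up' e e0; have [k0 Hk] := TY _ _ i j Up' e e0.
  by exists k0 => k kk; apply: Hk; rewrite (leq_trans kk).
apply: (H p w _ _ Upw (fun k => dYs k i j Upw)).
apply: (@tends_sum _ _ (fun q k => A p w i q * Ys k p w q j) (fun q => A p w i q * Y p w q j)) => q.
by apply: tends_Z; exact: TY.
Qed.

End LinearODE.

End ComplexCalculus.

(** * Columns that stay bounded at both ends *)

Section ColumnEstimates.
Context {R : realType}.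
Local Notation C := (cplx R).
Implicit Types (z w a b l : C) (u v e d M : R).
Opaque cexp.

(** The bootstrap behind the estimates below: the a priori bound only has to exist, its value
    disappears when the improvement to B + M/2 is iterated. *)
Lemma contract_bound (I : Type) (S : I -> R) (B : R) : (exists M, forall i, S i <= M) ->
  (forall M, 0 <= M -> (forall i, S i <= M) -> forall i, S i <= B + M / 2) ->
  0 <= B -> forall i, S i <= 2 * B.
Proof.
move=> [M HM] H B0 i; apply/ler_addgt0Pr => e e0.
have M0 : 0 <= Num.max M 0 by rewrite le_max lexx orbT.
have [k Hk] := half_le e0 M0.
suff A m : forall i, S i <= 2 * B + Num.max M 0 * 2^-1 ^+ m.
  by apply: le_trans (A k i) _; rewrite lerD2l ltW.
elim: m => [|m IH] i'.
  have h : M <= Num.max M 0 by rewrite le_max lexx.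
  by rewrite expr0 mulr1; have := HM i'; lra.
have p0 : 0 <= 2 * B + Num.max M 0 * 2^-1 ^+ m by rewrite addr_ge0 ?mulr_ge0 ?exprn_ge0.
apply: le_trans (H _ p0 IH i') _; rewrite exprS.
by rewrite le_eqVlt; apply/orP; left; apply/eqP; field.
Qed.

Lemma is_derive_exp_scale (a b u : R) : is_derive u 1 (fun v => a * expR (v * b)) (a * (b * expR (u * b))).
Proof.
have D1 : is_derive u 1 (fun v : R => v * b) b.
  by apply: is_derive_eq; rewrite /GRing.scale /= mulr0 add0r mulr1.
have E1 := @is_derive1_comp R expR (fun v => v * b) u _ _ (is_derive_expR _) D1.
rewrite (_ : (fun v => _) = a *: (expR \o (fun v => v * b))) //.
by apply: is_derive_eq; rewrite /GRing.scale /=; ring.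
Qed.

Lemma is_derive_lin (a b u : R) : is_derive u 1 (fun v => a * v + b) a.
Proof.
apply/is_derive_epsP => e e0; exists 1 => // v _.
have -> : a * (u + v) + b - (a * u + b) - a * v = 0 by ring.
by rewrite normr0 mulr_ge0 // ltW.
Qed.

Lemma path_bounded (g : R -> C) (a b : R) : a <= b ->
  (forall u, a <= u <= b -> exists l, pder g u l) ->
  exists M, forall u, a <= u <= b -> cm (g u) <= M.
Proof.
move=> ab D; have [dg Hdg] : exists dg : R -> C, forall u, a <= u <= b -> pder g u (dg u).
  have E u : exists l, a <= u <= b -> pder g u l.
    by have [/D[l Hl]|nu] := pselect (a <= u <= b); [exists l|exists 0].
  by have [dg H] := choice E; exists dg.
have pc : {within `[a, b], continuous (fun u => cm (g u) ^+ 2)}.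
  apply: continuous_in_subspaceT => x; rewrite inE /= in_itv /= => xab.
  exact: is_derive_cont (pder_sqr (Hdg _ xab)).
have [c cab cmax] := EVT_max ab pc.
exists (cm (g c)) => u uab; rewrite -(ler_pXn2r (n := 2)) ?nnegrE ?cm_ge0 //.
by apply: cmax; rewrite in_itv.
Qed.

Lemma bounded_fin (n : nat) (T : Type) (S : 'I_n -> T -> R) :
  (forall i, exists M, forall x, S i x <= M) -> exists M, forall i x, S i x <= M.
Proof.
move=> H; have [M HM] := choice H.
exists (\sum_i Num.max (M i) 0) => i x; apply: le_trans (HM i x) _.
have h k : 0 <= Num.max (M k) 0 by rewrite le_max lexx orbT.
rewrite (bigD1 i) //=; apply: le_trans (_ : Num.max (M i) 0 <= _); first by rewrite le_max lexx.
by rewrite lerDl sumr_ge0.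
Qed.

(** The weight e^(-uK) turns the integral operator into a contraction of ratio 1/2, so
    [contract_bound] applies; the summand 1 keeps K positive when L = 0. *)
Lemma gronwall (n : nat) (g dg : 'I_n -> R -> C) (L e beta : R) : 0 <= L -> 0 <= e -> 0 <= beta ->
  (forall i u, 0 <= u <= 1 -> pder (g i) u (dg i u)) ->
  (forall i, cm (g i 0) <= beta) ->
  (forall i u, 0 <= u <= 1 -> cm (dg i u) <= L * (\sum_k cm (g k u)) + e) ->
  forall i u, 0 <= u <= 1 -> cm (g i u) <= 2 * (beta + e) * expR (2 * (n%:R * L) + 1).
Proof.
move=> L0 e0 b0 D B0 B i u u01.
pose K := 2 * (n%:R * L) + 1; have K1 : 1 <= K by rewrite /K lerDr !mulr_ge0.
have K0 : 0 < K by lra.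
pose I := ('I_n * {u : R | 0 <= u <= 1})%type.
pose S (p : I) := cm (g p.1 (sval p.2)) * expR (- (sval p.2 * K)).
suff H : forall p, S p <= 2 * (beta + e).
  have := H (i, exist _ u u01); rewrite /S /= expRN ler_pdivrMr ?expR_gt0 // => h.
  apply: le_trans h _; rewrite ler_wpM2l ?mulr_ge0 ?addr_ge0 // ler_expR.
  by case/andP: u01 => u0 u1; rewrite ler_piMl // ltW.
apply: contract_bound; last by rewrite addr_ge0.
  have [M HM] : exists M, forall i (x : {u : R | 0 <= u <= 1}), cm (g i (sval x)) <= M.
    apply: bounded_fin => k; have [|M HM] := @path_bounded (g k) 0 1 ler01.
      by move=> v v01; exists (dg k v); exact: D.
    by exists M => -[v v01]; exact: HM.
  exists M => -[k [v v01]]; rewrite /S /=; apply: le_trans (HM k (exist _ v v01)); rewrite /=.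
  rewrite ler_piMr ?cm_ge0 // -expR0 ler_expR oppr_le0 mulr_ge0 ?(ltW K0) //.
  by case/andP: v01.
move=> M M0 HM [k [v v01]]; rewrite /S /= expRN ler_pdivrMr ?expR_gt0 //.
have gM k' v' : 0 <= v' <= 1 -> cm (g k' v') <= M * expR (v' * K).
  move=> v'01; have := HM (k', exist _ v' v'01).
  by rewrite /S /= expRN ler_pdivrMr ?expR_gt0.
have /andP[v0 v1] := v01.
pose P x := M / 2 * expR (x * K) + (e * x + 0).
have DP (x : R) : is_derive x 1 P (M / 2 * (K * expR (x * K)) + e).
  by apply: is_deriveD; [exact: is_derive_exp_scale|exact: is_derive_lin].
have h := @pder_bound _ (g k) (dg k) P (fun x => M / 2 * (K * expR (x * K)) + e) 0 v v0.
have {}h : cm (g k v - g k 0) <= P v - P 0.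
  apply: h => [x /andP[x0 xv]|x /andP[x0 xv]]; first by apply: D; lra.
  have x01 : 0 <= x <= 1 by lra.
  apply: le_trans (B _ _ x01) _; rewrite lerD2r.
  apply: le_trans (ler_wpM2l L0 (ler_sum _ (G := fun=> M * expR (x * K)) _)) _ => [k' _|].
    exact: gM.
  rewrite sumr_const card_ord -[(M * _) *+ n]mulr_natl.
  have : 0 <= M * expR (x * K) by rewrite mulr_ge0 ?expR_ge0.
  have -> : M / 2 * (K * expR (x * K)) = L * (n%:R * (M * expR (x * K))) + (M * expR (x * K)) / 2.
    by rewrite /K; field.
  by move=> q; rewrite lerDl divr_ge0.
have E1 : 1 <= expR (v * K) by rewrite -expR0 ler_expR mulr_ge0 // ltW.
have -> : g k v = (g k v - g k 0) + g k 0 by ring.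
apply: le_trans (cmD _ _) _; apply: le_trans (lerD h (B0 k)) _.
rewrite /P mul0r expR0 mulr0 !addr0 mulr1.
have h1 : e * v <= e * expR (v * K) by rewrite ler_wpM2l // (le_trans v1).
have h2 : beta <= beta * expR (v * K) by rewrite ler_peMr.
rewrite mulrDl mulrDl; lra.
Qed.

(** Directions are normalized to real part 1, so that the parameter of the line is Re w, the
    variable in which the coefficients decay. *)
Definition dirv u : C := 1 + ci * Rc u.

Lemma re_dirv u v : re (Rc u * dirv v) = u.
Proof. by rewrite reM /dirv !(reD, imD, reM, imM) /=; ring. Qed.

Lemma im_dirv u v : im (Rc u * dirv v) = u * v.
Proof. by rewrite imM /dirv !(reD, imD, reM, imM) /=; ring. Qed.

Definition in_sect (T : R) w := `|im w| <= T * `|re w|.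

Lemma in_sect_dirv T u v : `|v| <= T -> in_sect T (Rc u * dirv v).
Proof. by move=> vT; rewrite /in_sect re_dirv im_dirv normrM mulrC ler_wpM2r. Qed.

Lemma in_sectN T w : in_sect T w -> in_sect T (- w).
Proof. by rewrite /in_sect reN imN !normrN. Qed.

(* Coefficients of the system for one column [j], along directions 1 + i v with
   v in [t1, t2]: components in [up] grow, those in [dn] decay, at rate [a]. *)
Record coldata (n : nat) (j : 'I_n) (up dn : pred 'I_n) (kap : 'I_n -> C -> C)
  (q : 'I_n -> 'I_n -> C -> C) (T a sg t1 t2 : R) : Prop := Coldata {
  cd_cover : forall i, [|| i == j, up i | dn i];
  cd_T : 0 <= T;
  cd_a : 2 <= a;
  cd_sg : 0 <= sg;
  cd_dir : forall v, t1 <= v <= t2 -> `|v| <= T;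
  cd_up : forall i v w, up i -> t1 <= v <= t2 -> in_sect T w -> a <= re (dirv v * kap i w);
  cd_dn : forall i v w, dn i -> t1 <= v <= t2 -> in_sect T w -> re (dirv v * kap i w) <= - a;
  cd_j : forall w, kap j w = 0;
  cd_q : forall i k w, in_sect T w -> cm (q i k w) <= sg * expR (- `|re w|);
  cd_small : 8 * ((1 + T) * (n%:R * sg)) <= 1 }.

Definition colsol (n : nat) (kap : 'I_n -> C -> C) (q : 'I_n -> 'I_n -> C -> C)
  (h : 'I_n -> C -> C) w :=
  forall i, cder (h i) w (kap i w * h i w + \sum_k q i k w * h k w).

(** The reflection w -> -w exchanges growing and decaying components; it reduces statements about Re
    w -> -oo to statements about +oo. *)
Lemma coldata_refl (n : nat) (j : 'I_n) up dn kap q (T a sg t1 t2 : R) :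
  coldata j up dn kap q T a sg t1 t2 ->
  coldata j dn up (fun i w => - kap i (- w)) (fun i k w => - q i k (- w)) T a sg t1 t2.
Proof.
case=> h1 h2 h3 h4 h5 h6 h7 h8 h9 h10; split=> //.
- by move=> i; rewrite [dn i || _]orbC.
- by move=> i v w ii vv ww; rewrite mulrN reN lerNr; apply: h7 => //; exact: in_sectN.
- by move=> i v w ii vv ww; rewrite mulrN reN lerN2; apply: h6 => //; exact: in_sectN.
- by move=> w; rewrite h8 oppr0.
- by move=> i k w ww; rewrite cmN -(normrN (re w)) -reN; apply: h9; exact: in_sectN.
Qed.

Lemma colsol_refl (n : nat) (kap : 'I_n -> C -> C) (q : 'I_n -> 'I_n -> C -> C) h w :
  colsol kap q h (- w) ->
  colsol (fun i w => - kap i (- w)) (fun i k w => - q i k (- w)) (fun i w => h i (- w)) w.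
Proof.
move=> H i; have D : cder (fun x => - x) w (- 1) by apply: gderN; exact: cder_id.
apply: gder_eq (gder_comp (g := fun x => - x) (H i) D) _.
rewrite mulrN1 opprD mulNr; congr (_ + _); rewrite -sumrN.
by apply: eq_bigr => k _; rewrite mulNr.
Qed.

Section Column.
Variables (n : nat) (j : 'I_n) (up dn : pred 'I_n) (kap : 'I_n -> C -> C)
  (q : 'I_n -> 'I_n -> C -> C) (T a sg t1 t2 : R).
Hypothesis cd : coldata j up dn kap q T a sg t1 t2.
Variable h : 'I_n -> C -> C.
Let F1 := (1 + T) * (n%:R * sg).

Let F10 : 0 <= F1.
Proof. by rewrite /F1 !mulr_ge0 ?addr_ge0 ?(cd_T cd) ?(cd_sg cd). Qed.

Let path_der b v u (i : 'I_n) : colsol kap q h (b + Rc u * dirv v) ->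
  pder (fun x => h i (b + Rc x * dirv v)) u
   (dirv v * kap i (b + Rc u * dirv v) * h i (b + Rc u * dirv v) +
    dirv v * \sum_k q i k (b + Rc u * dirv v) * h k (b + Rc u * dirv v)).
Proof. by move=> H; apply: gder_eq (cder_line (H i)) _; rewrite mulrC mulrDr mulrA. Qed.

Let forcing b v u i M : t1 <= v <= t2 -> 0 <= M -> in_sect T (b + Rc u * dirv v) ->
  (forall k, cm (h k (b + Rc u * dirv v)) <= M) ->
  cm (dirv v * \sum_k q i k (b + Rc u * dirv v) * h k (b + Rc u * dirv v)) <=
    F1 * M * expR (- `|re b + u|).
Proof.
move=> vv M0 ww hM; rewrite cmM.
have d1 : cm (dirv v) <= 1 + T.
  apply: le_trans (cmD _ _) _; rewrite cm1 cmM cm_ci mul1r cm_Rc lerD2l.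
  exact: cd_dir cd _ vv.
have -> : F1 * M * expR (- `|re b + u|) = (1 + T) * (n%:R * (sg * expR (- `|re b + u|) * M)).
  by rewrite /F1; ring.
apply: ler_pM; rewrite ?cm_ge0 //; apply: le_trans (cm_sum _ _) _.
apply: le_trans (ler_sum _ (G := fun=> sg * expR (- `|re b + u|) * M) _) _ => [k _|]; last first.
  by rewrite sumr_const card_ord -[leLHS]mulr_natl.
rewrite cmM ler_pM ?cm_ge0 //; have := cd_q cd i k ww.
by rewrite reD re_dirv.
Qed.

Let weight_der (g : R -> C) c u l : pder g u l ->
  pder (fun x => Rc (expR (x * c)) * g x) u (Rc (expR (u * c)) * (Rc c * g u + l)).
Proof.
move=> G; have E : pder (fun x => Rc (expR (x * c))) u (Rc (c * expR (u * c))).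
  apply: pder_reim.
    have := is_derive_exp_scale 1 c u; rewrite mul1r.
    by congr (is_derive _ _ _ _); apply/funext => x; rewrite mul1r.
  by apply/is_derive_epsP => e e0; exists 1 => // v _; rewrite !im_Rc mul0r !subr0 normr0 mulr_ge0 // ltW.
by apply: gder_eq (gderM E G) _; rewrite RcM; ring.
Qed.

Let cm_weight c u z : cm (Rc (expR (u * c)) * z) = expR (u * c) * cm z.
Proof. by rewrite cm_Rc_mul // expR_ge0. Qed.

(** At a maximum of the weighted modulus other than the right end, growth must be balanced by the
    forcing. Weight and base point stay free: c = 0 serves for bounds, c = 1 for decay, c = -1 for
    uniqueness, and b different from 0 for segments inside a cone. *)
Lemma est_up b v (i : 'I_n) c Phi M u0 u1 : up i -> t1 <= v <= t2 -> -1 <= c -> u0 <= u1 -> 0 <= M ->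
  (forall u, u0 <= u <= u1 -> [/\ in_sect T (b + Rc u * dirv v), colsol kap q h (b + Rc u * dirv v) &
    forall k, cm (h k (b + Rc u * dirv v)) <= M]) ->
  (forall u, u0 <= u <= u1 -> expR (u * c) * (F1 * M * expR (- `|re b + u|)) <= Phi) ->
  forall u, u0 <= u <= u1 -> expR (u * c) * cm (h i (b + Rc u * dirv v)) <=
    Num.max (expR (u1 * c) * cm (h i (b + Rc u1 * dirv v))) (2 * Phi / a).
Proof.
move=> ui vv c1 u01 M0 H P u uu; rewrite -!cm_weight.
(* The weight shifts the rate by c >= -1; since a >= 2, the rate a + c is still at least a / 2. *)
have a2 := cd_a cd; have a0 : 0 < a / 2 by lra.
have Phi0 : 0 <= Phi.
  apply: le_trans (P u0 _); last by rewrite lexx u01.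
  by rewrite mulr_ge0 ?expR_ge0 // mulr_ge0 ?expR_ge0 // mulr_ge0.
have -> : 2 * Phi / a = Phi / (a / 2) by field; rewrite gt_eqF //; lra.
pose w x := b + Rc x * dirv v.
apply: (@pder_max_right _ (fun x => Rc (expR (x * c)) * h i (w x)) _ (a / 2) Phi u0 u1 u01 a0 Phi0
  (fun x xx => weight_der c (path_der i (let: And3 _ s _ := H x xx in s)))) => // x xx.
have [ws _ hM] := H x xx; rewrite -/(w x) in ws hM *.
set E := Rc (expR (x * c)); set g := h i (w x).
have -> : E * (Rc c * g + (dirv v * kap i (w x) * g + dirv v * \sum_k q i k (w x) * h k (w x))) =
  (Rc c + dirv v * kap i (w x)) * (E * g) + E * (dirv v * \sum_k q i k (w x) * h k (w x)) by ring.
rewrite dotcDr dotcMr reD re_Rc.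
set r := E * (dirv v * _).
have rP : cm r <= Phi.
  rewrite /r cm_weight; apply: le_trans (P x xx); rewrite ler_wpM2l ?expR_ge0 //.
  exact: forcing.
have := dotc_le (E * g) r; rewrite ler_norml => /andP[d1 _].
have k1 := cd_up cd ui vv ws.
have s0 := sqr_ge0 (cm (E * g)).
have e0 := cm_ge0 (E * g).
have m1 : a / 2 * cm (E * g) ^+ 2 <= (c + re (dirv v * kap i (w x))) * cm (E * g) ^+ 2.
  by rewrite ler_wpM2r //; lra.
have m2 : cm (E * g) * cm r <= Phi * cm (E * g) by rewrite mulrC ler_wpM2r.
lra.
Qed.

Lemma est_dn b v (i : 'I_n) c Phi M u0 u1 : dn i -> t1 <= v <= t2 -> c <= 1 -> u0 <= u1 -> 0 <= M ->
  (forall u, u0 <= u <= u1 -> [/\ in_sect T (b + Rc u * dirv v), colsol kap q h (b + Rc u * dirv v) &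
    forall k, cm (h k (b + Rc u * dirv v)) <= M]) ->
  (forall u, u0 <= u <= u1 -> expR (u * c) * (F1 * M * expR (- `|re b + u|)) <= Phi) ->
  forall u, u0 <= u <= u1 -> expR (u * c) * cm (h i (b + Rc u * dirv v)) <=
    Num.max (expR (u0 * c) * cm (h i (b + Rc u0 * dirv v))) (2 * Phi / a).
Proof.
move=> ui vv c1 u01 M0 H P u uu; rewrite -!cm_weight.
have a2 := cd_a cd; have a0 : 0 < a / 2 by lra.
have Phi0 : 0 <= Phi.
  apply: le_trans (P u0 _); last by rewrite lexx u01.
  by rewrite mulr_ge0 ?expR_ge0 // mulr_ge0 ?expR_ge0 // mulr_ge0.
have -> : 2 * Phi / a = Phi / (a / 2) by field; rewrite gt_eqF //; lra.
pose w x := b + Rc x * dirv v.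
apply: (@pder_max_left _ (fun x => Rc (expR (x * c)) * h i (w x)) _ (a / 2) Phi u0 u1 u01 a0 Phi0
  (fun x xx => weight_der c (path_der i (let: And3 _ s _ := H x xx in s)))) => // x xx.
have [ws _ hM] := H x xx; rewrite -/(w x) in ws hM *.
set E := Rc (expR (x * c)); set g := h i (w x).
have -> : E * (Rc c * g + (dirv v * kap i (w x) * g + dirv v * \sum_k q i k (w x) * h k (w x))) =
  (Rc c + dirv v * kap i (w x)) * (E * g) + E * (dirv v * \sum_k q i k (w x) * h k (w x)) by ring.
rewrite dotcDr dotcMr reD re_Rc.
set r := E * (dirv v * _).
have rP : cm r <= Phi.
  rewrite /r cm_weight; apply: le_trans (P x xx); rewrite ler_wpM2l ?expR_ge0 //.
  exact: forcing.
have := dotc_le (E * g) r; rewrite ler_norml => /andP[_ d1].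
have k1 := cd_dn cd ui vv ws.
have s0 := sqr_ge0 (cm (E * g)).
have e0 := cm_ge0 (E * g).
have m1 : (c + re (dirv v * kap i (w x))) * cm (E * g) ^+ 2 <= - (a / 2) * cm (E * g) ^+ 2.
  by rewrite ler_wpM2r //; lra.
have m2 : cm (E * g) * cm r <= Phi * cm (E * g) by rewrite mulrC ler_wpM2r.
lra.
Qed.

(** The j-th exponent is 0, so this component merely integrates the forcing, which is of size
    e^(-u). *)
Lemma est_mid v M u0 u1 : t1 <= v <= t2 -> 0 <= u0 <= u1 -> 0 <= M ->
  (forall u, u0 <= u <= u1 -> [/\ in_sect T (Rc u * dirv v), colsol kap q h (Rc u * dirv v) &
    forall k, cm (h k (Rc u * dirv v)) <= M]) ->
  cm (h j (Rc u1 * dirv v) - h j (Rc u0 * dirv v)) <= F1 * M * (expR (- u0) - expR (- u1)).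
Proof.
move=> vv /andP[u00 u01] M0 H.
have H' u : u0 <= u <= u1 -> [/\ in_sect T (0 + Rc u * dirv v), colsol kap q h (0 + Rc u * dirv v) &
    forall k, cm (h k (0 + Rc u * dirv v)) <= M] by rewrite add0r; exact: H.
pose P x := - (F1 * M) * expR (x * - 1).
have DP (x : R) : is_derive x 1 P (- (F1 * M) * (- 1 * expR (x * - 1))) by exact: is_derive_exp_scale.
have := @pder_bound _ _ _ P _ u0 u1 u01 (fun x xx => path_der j (let: And3 _ s _ := H' x xx in s))
  (fun x _ => DP x).
rewrite !add0r /P !mulrN1 => /(_ _) A; apply: le_trans (A _) _; last first.
  by rewrite le_eqVlt; apply/orP; left; apply/eqP; ring.
move=> x xx; rewrite (cd_j cd) mulr0 mul0r add0r mulN1r mulrNN mulrN1.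
have [s1 s2 s3] := H' x xx; have := forcing j vv M0 s1 s3.
by have -> : `|re 0 + x| = x by rewrite re0 add0r ger0_norm //; lra.
Qed.

End Column.

(** Size of the forcing per unit of the solution: 1 + T bounds |1 + i v| and n sg bounds a row of
    coefficients. By [cd_small] it is at most 1/8. *)
Definition Fc (n : nat) (T sg : R) : R := (1 + T) * (n%:R * sg).

Lemma expRN_le1 u : 0 <= u -> expR (- u) <= 1.
Proof. by move=> u0; rewrite -expR0 ler_expR oppr_le0. Qed.

Lemma expRN_inv u : 0 <= u -> expR (- u) <= (1 + u)^-1.
Proof. by move=> u0; rewrite expRN lef_pV2 ?posrE ?expR_gt0 ?expR_ge1Dx //; lra. Qed.

(** * Estimates along a line through 0 *)

Section Line.
Variables (n : nat) (j : 'I_n) (up dn : pred 'I_n) (kap : 'I_n -> C -> C)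
  (q : 'I_n -> 'I_n -> C -> C) (T a sg t1 t2 : R).
Hypothesis cd : coldata j up dn kap q T a sg t1 t2.
Variables (h : 'I_n -> C -> C) (v : R).
Hypothesis vv : t1 <= v <= t2.
Let F1 := Fc n T sg.
Let w u := Rc u * dirv v.

Lemma Fc_ge0 : 0 <= F1.
Proof. by rewrite /F1 /Fc !mulr_ge0 ?addr_ge0 ?(cd_T cd) ?(cd_sg cd). Qed.

Lemma Fc_small M : 0 <= M -> F1 * M <= M / 8.
Proof.
have h8 : F1 <= 8^-1 by have := cd_small cd; rewrite /F1 /Fc; lra.
by move=> M0; rewrite mulrC ler_wpM2l.
Qed.

Lemma Phi_a P : 0 <= P -> 2 * P / a <= P.
Proof.
move=> P0; have a2 := cd_a cd; rewrite ler_pdivrMr; last by lra.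
by rewrite mulrC ler_wpM2l.
Qed.

Let sect u : in_sect T (w u).
Proof. by apply: in_sect_dirv; exact: cd_dir cd _ vv. Qed.

Lemma line_up i M u0 u1 : up i -> u0 <= u1 -> 0 <= M ->
  (forall u, u0 <= u <= u1 -> colsol kap q h (w u) /\ forall k, cm (h k (w u)) <= M) ->
  cm (h i (w u0)) <= Num.max (cm (h i (w u1))) (2 * (F1 * M) / a).
Proof.
move=> ui u01 M0 H.
have S x : u0 <= x <= u1 -> [/\ in_sect T (0 + w x), colsol kap q h (0 + w x) &
    forall k, cm (h k (0 + w x)) <= M].
  by move=> /H[A B]; rewrite add0r; split=> //; exact: sect.
have P x : u0 <= x <= u1 -> expR (x * 0) * (F1 * M * expR (- `|re (0 : C) + x|)) <= F1 * M.
  move=> _; rewrite mulr0 expR0 mul1r -[leRHS]mulr1 ler_wpM2l ?expRN_le1 //.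
  by rewrite mulr_ge0 // Fc_ge0.
have c0 : -1 <= 0 :> R by lra.
have uu : u0 <= u0 <= u1 by rewrite lexx u01.
by have := est_up cd ui vv c0 u01 M0 S P uu; rewrite !mulr0 !expR0 !mul1r !add0r.
Qed.

Lemma line_dn i M u0 u1 : dn i -> u0 <= u1 -> 0 <= M ->
  (forall u, u0 <= u <= u1 -> colsol kap q h (w u) /\ forall k, cm (h k (w u)) <= M) ->
  cm (h i (w u1)) <= Num.max (cm (h i (w u0))) (2 * (F1 * M) / a).
Proof.
move=> ui u01 M0 H.
have S x : u0 <= x <= u1 -> [/\ in_sect T (0 + w x), colsol kap q h (0 + w x) &
    forall k, cm (h k (0 + w x)) <= M].
  by move=> /H[A B]; rewrite add0r; split=> //; exact: sect.
have P x : u0 <= x <= u1 -> expR (x * 0) * (F1 * M * expR (- `|re (0 : C) + x|)) <= F1 * M.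
  move=> _; rewrite mulr0 expR0 mul1r -[leRHS]mulr1 ler_wpM2l ?expRN_le1 //.
  by rewrite mulr_ge0 // Fc_ge0.
have c0 : 0 <= 1 :> R by lra.
have uu : u0 <= u1 <= u1 by rewrite lexx u01.
by have := est_dn cd ui vv c0 u01 M0 S P uu; rewrite !mulr0 !expR0 !mul1r !add0r.
Qed.

Lemma line_mid M u0 u1 : 0 <= u0 <= u1 -> 0 <= M ->
  (forall u, u0 <= u <= u1 -> colsol kap q h (w u) /\ forall k, cm (h k (w u)) <= M) ->
  cm (h j (w u1) - h j (w u0)) <= F1 * M * (expR (- u0) - expR (- u1)).
Proof.
move=> u01 M0 H; apply: (est_mid cd vv u01 M0) => u /H[A B]; split=> //; exact: sect.
Qed.

(* The weight e^u turns the decay of the coefficients into decay of h. *)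
Lemma line_decay i M N : 0 <= M ->
  (forall u, 0 <= u <= N -> colsol kap q h (w u) /\ forall k, cm (h k (w u)) <= M) ->
  (up i /\ h i (w N) = 0) \/ dn i ->
  forall u, 0 <= u <= N -> cm (h i (w u)) <= expR (- u) * M.
Proof.
move=> M0 H Hi u uN; have /andP[u0 uN'] := uN; have N0 : 0 <= N by lra.
rewrite expRN mulrC ler_pdivlMr ?expR_gt0 // mulrC.
have FM := Fc_small M0; have FM0 : 0 <= F1 * M by rewrite mulr_ge0 ?Fc_ge0.
have S x : 0 <= x <= N -> [/\ in_sect T (0 + w x), colsol kap q h (0 + w x) &
    forall k, cm (h k (0 + w x)) <= M].
  by move=> /H[A B]; rewrite add0r; split=> //; exact: sect.
have P x : 0 <= x <= N -> expR (x * 1) * (F1 * M * expR (- `|re (0 : C) + x|)) <= F1 * M.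
  move=> /andP[x0 _]; rewrite mulr1 re0 add0r ger0_norm // mulrCA -expRD subrr expR0 mulr1.
  exact: lexx.
have PM := Phi_a FM0.
case: Hi => [[ui hN]|di].
  have c1 : -1 <= 1 :> R by lra.
  have := est_up cd ui vv c1 N0 M0 S P uN.
  rewrite !mulr1 !add0r hN cm0 mulr0 => h1; apply: le_trans h1 _.
  by rewrite ge_max M0 /=; lra.
have := est_dn cd di vv (lexx 1) N0 M0 S P uN.
rewrite !mulr1 !add0r expR0 mul1r => h1; apply: le_trans h1 _.
rewrite ge_max; apply/andP; split; last by lra.
by have [|_ B] := H 0; [rewrite lexx|exact: B].
Qed.

End Line.

Section TwoSided.
Variables (n : nat) (j : 'I_n) (up dn : pred 'I_n) (kap : 'I_n -> C -> C)
  (q : 'I_n -> 'I_n -> C -> C) (T a sg t1 t2 : R).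
Hypothesis cd : coldata j up dn kap q T a sg t1 t2.
Variables (h : 'I_n -> C -> C) (v : R).
Hypothesis vv : t1 <= v <= t2.
Let w u := Rc u * dirv v.
Let F1 := Fc n T sg.

Let wN u : - (Rc (- u) * dirv v) = w u.
Proof. by rewrite RcN mulNr opprK. Qed.

Lemma line_mid2 M u : 0 <= M ->
  (forall x, - `|u| <= x <= `|u| -> colsol kap q h (w x) /\ forall k, cm (h k (w x)) <= M) ->
  cm (h j (w u) - h j 0) <= F1 * M.
Proof.
move=> M0 H; have F0 : 0 <= F1 * M by rewrite mulr_ge0 // (Fc_ge0 cd).
have w0 : w 0 = 0 by rewrite /w Rc0 mul0r.
have [u0|u0] := leP 0 u.
  have := @line_mid n j up dn kap q T a sg t1 t2 cd h v vv M 0 u.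
  rewrite -/(w 0) w0 lexx u0 oppr0 expR0 => /(_ isT M0) A; apply: le_trans (A _) _.
    by move=> x xx; apply: H; rewrite ger0_norm //; lra.
  by rewrite -[leRHS]mulr1 ler_wpM2l // gerBl expR_ge0.
have u0' : 0 <= - u by lra.
have := @line_mid n j dn up _ _ T a sg t1 t2 (coldata_refl cd) (fun i x => h i (- x)) v vv M 0 (- u).
rewrite lexx u0' Rc0 mul0r !oppr0 expR0 wN => /(_ isT M0) A; apply: le_trans (A _) _.
  move=> x xx; split.
    apply: colsol_refl; rewrite -(opprK x) wN; have [|B _] := H (- x); last exact: B.
    by rewrite ltr0_norm //; lra.
  move=> k; rewrite -{1}(opprK x) wN; have [|_ B] := H (- x); last exact: B.
  by rewrite ltr0_norm //; lra.
by rewrite -[leRHS]mulr1 ler_wpM2l // gerBl expR_ge0.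
Qed.

(** Growing components are prescribed at +N, decaying ones at -N, the j-th at 0. The bound is
    uniform in N, and for beta = 0 it is the injectivity of the boundary value problem. *)
Lemma bvp_bound N beta : 0 <= N -> 0 <= beta ->
  (forall u, - N <= u <= N -> colsol kap q h (w u)) ->
  (forall i, up i -> cm (h i (w N)) <= beta) ->
  (forall i, dn i -> cm (h i (w (- N))) <= beta) ->
  cm (h j 0) <= beta ->
  forall i u, - N <= u <= N -> cm (h i (w u)) <= 2 * beta.
Proof.
move=> N0 b0 S Hu Hd Hj i u uN.
pose I := ('I_n * {u : R | - N <= u <= N})%type.
suff H : forall p : I, cm (h p.1 (w (sval p.2))) <= 2 * beta by exact: (H (i, exist _ u uN)).
have NN : - N <= N by lra.
apply: contract_bound => //.
  have [M HM] : exists M, forall i (x : {u : R | - N <= u <= N}), cm (h i (w (sval x))) <= M.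
    apply: bounded_fin => k; have [|M HM] := @path_bounded (fun u => h k (w u)) _ _ NN.
      move=> x xx; have := S x xx k; rewrite /w -{1}(add0r (Rc x * dirv v)) => D.
      exists ((kap k (w x) * h k (w x) + \sum_k0 q k k0 (w x) * h k0 (w x)) * dirv v).
      have := cder_line D; apply: gder_ext; rewrite ?Rc0 //.
      by exists 1 => // y _; rewrite add0r.
    by exists M => -[x xx]; exact: HM.
  by exists M => -[k [x xx]]; exact: (HM k (exist _ x xx)).
move=> M M0 HM [k [x xx]] /=; have /andP[x1 x2] := xx.
have B y : - N <= y <= N -> colsol kap q h (w y) /\ forall k, cm (h k (w y)) <= M.
  by move=> yy; split; [exact: S|move=> k'; exact: (HM (k', exist _ y yy))].
have FM := Fc_small cd M0; have FM0 : 0 <= F1 * M by rewrite mulr_ge0 ?(Fc_ge0 cd).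
have PM := Phi_a cd FM0; rewrite -/F1 in FM PM.
have := cd_cover cd k => /or3P[/eqP ->|uk|dk].
- have hx : cm (h j (w x) - h j 0) <= F1 * M.
    apply: line_mid2 => // y yy; apply: B; move: yy; have : `|x| <= N by rewrite ler_norml x1.
    lra.
  have -> : h j (w x) = (h j (w x) - h j 0) + h j 0 by ring.
  apply: le_trans (cmD _ _) _; rewrite addrC lerD //; lra.
- apply: le_trans (line_up cd vv uk x2 M0 _) _.
    by move=> y yy; apply: B; lra.
  by rewrite ge_max; apply/andP; split; [have := Hu k uk; lra|rewrite -/F1; lra].
- apply: le_trans (line_dn cd vv dk x1 M0 _) _.
    by move=> y yy; apply: B; lra.
  by rewrite ge_max; apply/andP; split; [have := Hd k dk; lra|rewrite -/F1; lra].
Qed.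

Lemma line_decay2 i M N : 0 <= M ->
  (forall u, - N <= u <= N -> colsol kap q h (w u) /\ forall k, cm (h k (w u)) <= M) ->
  (forall i, up i -> h i (w N) = 0) -> (forall i, dn i -> h i (w (- N)) = 0) -> i != j ->
  forall u, - N <= u <= N -> cm (h i (w u)) <= expR (- `|u|) * M.
Proof.
move=> M0 H Hu Hd ij u /andP[u1 u2].
have := cd_cover cd i; rewrite (negPf ij) /= => ud.
have [u0|u0] := leP 0 u.
  rewrite ?ger0_norm //; apply: (line_decay cd vv (N := N)) => //; last by rewrite u0.
    by move=> x xx; apply: H; lra.
  by case/orP: ud => [ui|di]; [left; split=> //; exact: Hu|right].
rewrite ltr0_norm //; have u0' : 0 <= - u <= N by lra.
have := line_decay (coldata_refl cd) (h := fun i x => h i (- x)) vv (i := i) (N := N) M0 _ _ u0'.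
rewrite wN; apply.
  move=> x xx; rewrite -(opprK x) wN; have [|A B] := H (- x); first by lra.
  by split=> //; apply: colsol_refl; rewrite wN.
case/orP: ud => [ui|di]; [by right|left; split=> //].
by rewrite -(opprK N) wN; exact: Hd.
Qed.

(** On the whole line boundedness replaces boundary values: with the weight e^(-u), the far end of a
    segment of length 7 contributes at most M'/8, because e^(-7) <= 1/(1 + 7). For decaying
    components the segment runs the other way. *)
Lemma line_uniq M : (forall u, colsol kap q h (w u) /\ forall k, cm (h k (w u)) <= M) ->
  h j 0 = 0 -> forall i u, h i (w u) = 0.
Proof.
move=> H hj0 i u; apply/eqP; rewrite -cm_eq0 eq_le cm_ge0 andbT.
have -> : 0 = 2 * 0 :> R by rewrite mulr0.
suff S : forall p : 'I_n * R, cm (h p.1 (w p.2)) <= 2 * 0 by exact: (S (i, u)).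
apply: contract_bound => //; first by exists M => -[k x]; have [_] := H x; apply.
move=> {i u} M' M'0 HM [i u] /=; rewrite add0r.
have B x : colsol kap q h (w x) /\ forall k, cm (h k (w x)) <= M'.
  by split; [have [] := H x|move=> k; exact: (HM (k, x))].
have FM := Fc_small cd M'0; have FM0 : 0 <= F1 * M' by rewrite mulr_ge0 ?(Fc_ge0 cd).
have PM := Phi_a cd FM0; rewrite -/F1 in FM PM.
have e7 : expR (- 7) <= 8^-1 :> R.
  by apply: le_trans (expRN_inv _) _ => //; lra.
have T_up (up' dn' : pred 'I_n) kap' q' (h' : 'I_n -> C -> C) u' :
    coldata j up' dn' kap' q' T a sg t1 t2 -> up' i ->
    (forall x, colsol kap' q' h' (w x) /\ forall k, cm (h' k (w x)) <= M') ->
    cm (h' i (w u')) <= M' / 2.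
  move=> cd' ui' H'.
  have u7 : u' <= u' + 7 by rewrite lerDl.
  have sx x : in_sect T (0 + w x).
    by rewrite add0r; apply: in_sect_dirv; exact: cd_dir cd _ vv.
  have A := @est_up n j up' dn' kap' q' T a sg t1 t2 cd' h' 0 v i (- 1)
    (expR (- u') * (F1 * M')) M' u' (u' + 7) ui' vv (lexx _) u7 M'0 _ _ u' _.
  have {}A : expR (u' * -1) * cm (h' i (0 + w u')) <=
    Num.max (expR ((u' + 7) * -1) * cm (h' i (0 + w (u' + 7)))) (2 * (expR (- u') * (F1 * M')) / a).
    apply: A => [x _|x /andP[x1 _]|]; last by rewrite lexx.
      by have [X Y] := H' x; split; rewrite ?add0r //; have := sx x; rewrite add0r.
    rewrite mulrN1; apply: ler_pM; [exact: expR_ge0| |by rewrite ler_expR lerN2|].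
      by rewrite (mulr_ge0 FM0) ?expR_ge0.
    by rewrite -[leRHS]mulr1 (ler_wpM2l FM0) // expRN_le1.
  move: A; rewrite !mulrN1 !add0r opprD expRD => A.
  rewrite -(ler_pM2l (expR_gt0 (- u'))); apply: le_trans A _.
  rewrite ge_max; apply/andP; split.
    rewrite -mulrA ler_wpM2l ?expR_ge0 //.
    apply: le_trans (ler_pM (expR_ge0 _) (cm_ge0 _) e7 (proj2 (H' (u' + 7)) i)) _; lra.
  rewrite mulrCA -mulrA ler_wpM2l ?expR_ge0 //; lra.
have := cd_cover cd i => /or3P[/eqP ->|ui|di].
- have := @line_mid2 M' u M'0; rewrite hj0 subr0 => A; apply: le_trans (A _) _; last by lra.
  by move=> x _; exact: B.
- exact: (T_up up dn kap q h u cd ui B).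
have := T_up dn up _ _ (fun i x => h i (- x)) (- u) (coldata_refl cd) di.
rewrite wN; apply=> x; rewrite -(opprK x) wN; have [X Y] := B (- x).
by split=> //; apply: colsol_refl; rewrite wN.
Qed.

End TwoSided.

(** Two applications of [unit_compact], one for each side of the square; d^-1 again plays the role
    of the bound. *)
Lemma square_bounded (f : C -> C) (g : R -> R -> C) (L : R) : 0 <= L ->
  (forall x y, 0 <= x <= 1 -> 0 <= y <= 1 -> ccont f (g x y)) ->
  (forall x y x' y', 0 <= x <= 1 -> 0 <= y <= 1 -> 0 <= x' <= 1 -> 0 <= y' <= 1 ->
    cm (g x y - g x' y') <= L * (`|x - x'| + `|y - y'|)) ->
  exists M, forall x y, 0 <= x <= 1 -> 0 <= y <= 1 -> cm (f (g x y)) <= M.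
Proof.
move=> L0 fc gl.
have mono (z : C) d d' : cm z <= d^-1 -> 0 < d' -> d' <= d -> cm z <= d'^-1.
  move=> h d'0 dd; apply: le_trans h _; rewrite lef_pV2 // posrE.
  exact: lt_le_trans dd.
have [x d d' H dd d'0 y yy|x0 x01|d d0 Hd] := @unit_compact R (fun x d => 0 < d ->
  forall y, 0 <= y <= 1 -> cm (f (g x y)) <= d^-1).
- exact: mono (H (lt_le_trans d'0 dd) y yy) d'0 dd.
- have [y d d' H dd d'0 x xx xd|y0 y01|d d0 Hd] := @unit_compact R (fun y d => 0 < d ->
    forall x, 0 <= x <= 1 -> `|x - x0| < d -> cm (f (g x y)) <= d^-1).
  + exact: mono (H (lt_le_trans d'0 dd) x xx (lt_le_trans xd dd)) d'0 dd.
  + have [d1 d10 H1] := fc x0 y0 x01 y01 1 ltr01.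
    pose N := cm (f (g x0 y0)) + 1; have N0 : 0 < N by rewrite ltr_wpDl ?cm_ge0.
    have L1 : 0 < L + 1 by lra.
    exists (Num.min (d1 / (2 * (L + 1))) N^-1).
      by rewrite lt_min invr_gt0 N0 divr_gt0 // mulr_gt0.
    move=> y yy; rewrite lt_min => /andP[y1 _] m0 x xx; rewrite lt_min => /andP[x1 _].
    apply: (mono _ N^-1) => //; last by rewrite ge_min lexx orbT.
    rewrite invrK; have := H1 (g x y - g x0 y0).
    rewrite (addrC (g x0 y0)) subrK => h; have {}h : cm (f (g x y) - f (g x0 y0)) <= 1.
      apply: h; apply: le_lt_trans (gl _ _ _ _ xx yy x01 y01) _.
      apply: le_lt_trans (_ : (L + 1) * (`|x - x0| + `|y - y0|) < _).
        by rewrite ler_wpM2r ?addr_ge0 // lerDl.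
      rewrite mulrC -ltr_pdivlMr //.
      have -> : d1 / (L + 1) = d1 / (2 * (L + 1)) + d1 / (2 * (L + 1)) by field; rewrite gt_eqF.
      by rewrite ltrD.
    by rewrite -(subrK (f (g x0 y0)) (f (g x y))) (le_trans (cmD _ _)) // addrC lerD2l.
  exists d => // x xx xd _ y yy; exact: Hd.
by exists d^-1 => x y xx yy; exact: Hd.
Qed.

(** * Estimates in a cone of directions *)

Section Cone.
Variables (n : nat) (j : 'I_n) (up dn : pred 'I_n) (kap : 'I_n -> C -> C)
  (q : 'I_n -> 'I_n -> C -> C) (T a sg t1 t2 : R).
Hypothesis cd : coldata j up dn kap q T a sg t1 t2.
Variables (h : 'I_n -> C -> C).
Let F1 := Fc n T sg.
Hypothesis t12 : t1 <= t2.
Hypothesis hsol : forall x v, 0 <= x -> t1 <= v <= t2 -> colsol kap q h (Rc x * dirv v).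

Let cone z := 0 <= re z /\ t1 * re z <= im z <= t2 * re z.

Let coneP z : cone z -> exists x v, [/\ 0 <= x, t1 <= v <= t2 & z = Rc x * dirv v].
Proof.
move=> [z0 /andP[z1 z2]]; have [e|ne] := eqVneq (re z) 0.
  exists 0, t1; split; rewrite ?lexx // Rc0 mul0r.
  by apply: C_eqP; rewrite ?re0 ?im0 //; move: z1 z2; rewrite e !mulr0; lra.
have zp : 0 < re z by rewrite lt_def ne.
exists (re z), (im z / re z); split=> //.
  by rewrite ler_pdivlMr // z1 ler_pdivrMr.
by apply: C_eqP; rewrite ?re_dirv ?im_dirv // mulrC divfK.
Qed.

Let cone_dirv x v : 0 <= x -> t1 <= v <= t2 -> cone (Rc x * dirv v).
Proof.
move=> x0 /andP[v1 v2]; rewrite /cone re_dirv im_dirv; split=> //.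
by rewrite [t1 * x]mulrC [t2 * x]mulrC !ler_wpM2l.
Qed.

Let coneD z w : cone z -> cone w -> cone (z + w).
Proof.
move=> [z0 /andP[z1 z2]] [w0 /andP[w1 w2]]; rewrite /cone reD imD !mulrDr.
by split; [rewrite addr_ge0|rewrite !lerD].
Qed.

Let cone_sol z : cone z -> colsol kap q h z.
Proof. by move=> /coneP[x [v [x0 vv ->]]]; exact: hsol. Qed.

Let cone_sect z : cone z -> in_sect T z.
Proof. by move=> /coneP[x [v [x0 vv ->]]]; apply: in_sect_dirv; exact: cd_dir cd _ vv. Qed.

Let cone_trunc_bounded N (i : 'I_n) : 0 <= N ->
  exists M, forall z, cone z -> re z <= N -> cm (h i z) <= M.
Proof.
move=> N0; pose g x y := Rc (N * x) * dirv (t1 + y * (t2 - t1)).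
have vy y : 0 <= y <= 1 -> t1 <= t1 + y * (t2 - t1) <= t2.
  move=> /andP[y0 y1]; have t0 : 0 <= t2 - t1 by rewrite subr_ge0.
  have : y * (t2 - t1) <= t2 - t1 by rewrite ler_piMl.
  have : 0 <= y * (t2 - t1) by rewrite mulr_ge0.
  lra.
have T0 := cd_T cd.
have L0 : 0 <= N * (1 + T + (t2 - t1)) by rewrite mulr_ge0 // addr_ge0 ?subr_ge0 // addr_ge0.
have [x y xx yy|x y x' y' xx yy xx' yy'|M HM] := @square_bounded (h i) g _ L0.
- apply: cder_ccont (hsol _ (vy _ yy) i); rewrite mulr_ge0 //; by case/andP: xx.
- have -> : g x y - g x' y' = Rc (N * (x - x')) * dirv (t1 + y * (t2 - t1)) +
      Rc (N * x' * ((y - y') * (t2 - t1))) * ci.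
    by rewrite /g /dirv !(RcM, RcD, RcB); ring.
  apply: le_trans (cmD _ _) _; rewrite !cmM !cm_Rc cm_ci mulr1.
  have d1 : cm (dirv (t1 + y * (t2 - t1))) <= 1 + T.
    apply: le_trans (cmD _ _) _; rewrite cm1 cmM cm_ci mul1r cm_Rc lerD2l.
    by apply: (cd_dir cd); exact: vy.
  have h1 : `|N * (x - x')| * cm (dirv (t1 + y * (t2 - t1))) <= N * (1 + T) * `|x - x'|.
    rewrite normrM (ger0_norm N0) -!mulrA ler_wpM2l // mulrC ler_wpM2r //.
  have h2 : `|N * x' * ((y - y') * (t2 - t1))| <= N * (t2 - t1) * `|y - y'|.
    have /andP[x0' x1'] := xx'.
    rewrite normrM normrM (normrM (y - y')) (ger0_norm N0) (ger0_norm x0') (@ger0_norm _ (t2 - t1)) ?subr_ge0 //.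
    rewrite [leRHS](_ : _ = N * 1 * (`|y - y'| * (t2 - t1))); last by ring.
    by rewrite ler_wpM2r ?mulr_ge0 ?subr_ge0 // ler_wpM2l.
  have t0 : 0 <= t2 - t1 by rewrite subr_ge0.
  apply: le_trans (lerD h1 h2) _.
  have := normr_ge0 (x - x'); have := normr_ge0 (y - y'); move: (`|x - x'|) (`|y - y'|) => A B B0 A0.
  have p1 : 0 <= N * (t2 - t1) * A by rewrite !mulr_ge0.
  have p2 : 0 <= N * (1 + T) * B by rewrite !mulr_ge0 // addr_ge0.
  lra.
exists M => z /coneP[x [v [x0 vv ->]]]; rewrite re_dirv => xN.
have [N00|N00] := eqVneq N 0.
  have -> : x = 0 by lra.
  have := HM 0 0; rewrite /g mulr0 Rc0 !mul0r; apply; by rewrite lexx ler01.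
have Np : 0 < N by rewrite lt_def N00.
have Ex : N * (x / N) = x by rewrite mulrC divfK.
have x01 : 0 <= x / N <= 1 by rewrite divr_ge0 //= ler_pdivrMr // mul1r.
have [t00|t00] := eqVneq t2 t1.
  have := HM (x / N) 0; rewrite /g Ex mul0r addr0.
  have -> : v = t1 by move: vv; rewrite t00; lra.
  by apply; rewrite ?lexx ?ler01.
have tp : 0 < t2 - t1 by rewrite subr_gt0 lt_neqAle eq_sym t00.
have Ev : (v - t1) / (t2 - t1) * (t2 - t1) = v - t1 by rewrite divfK // gt_eqF.
have := HM (x / N) ((v - t1) / (t2 - t1)); rewrite /g Ex Ev.
rewrite (addrC t1) subrK; apply=> //.
by rewrite divr_ge0 ?(ltW tp) //= ?ler_pdivrMr ?mul1r //; lra.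
Qed.

(* Points z of the kite with apexes 0 and N(1 + i v0) are joined to both apexes
   by segments with admissible directions, so the bound on the axis spreads. *)
Lemma cone_bound v0 B : t1 < v0 < t2 -> 0 <= B ->
  (forall i x, 0 <= x -> cm (h i (Rc x * dirv v0)) <= B) ->
  forall i z, cone z -> cm (h i z) <= 2 * B.
Proof.
move=> /andP[v1 v2] B0 hB i z cz.
have v0t : t1 <= v0 <= t2 by rewrite !ltW.
(* The abscissas from which on z lies in the backward cone of the apex N (1 + i v0), with respect to
   the lower and to the upper edge. *)
pose N1 := (im z - t1 * re z) / (v0 - t1); pose N2 := (t2 * re z - im z) / (t2 - v0).
pose N := re z + `|N1| + `|N2|.
have [z0 /andP[z1 z2]] := cz.
have [l1 l2] : N1 <= N /\ N2 <= N.
  have := ler_norm N1; have := ler_norm N2; have := normr_ge0 N1; have := normr_ge0 N2.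
  by rewrite /N; move: (`|N1|) (`|N2|) => A1 A2 *; split; lra.
have Nz : re z <= N by rewrite /N -addrA lerDl addr_ge0.
have N0 : 0 <= N by rewrite !addr_ge0.
pose ap := Rc N * dirv v0.
pose K := {y : C | cone y /\ cone (ap - y)}.
have capz : cone (ap - z).
  rewrite /cone /ap reB imB re_dirv im_dirv; split; first by lra.
  have b1 : im z - t1 * re z <= N * (v0 - t1).
    have -> : im z - t1 * re z = N1 * (v0 - t1) by rewrite /N1 divfK // gt_eqF // subr_gt0.
    by rewrite ler_wpM2r // subr_ge0 ltW.
  have b2 : t2 * re z - im z <= N * (t2 - v0).
    have -> : t2 * re z - im z = N2 * (t2 - v0) by rewrite /N2 divfK // gt_eqF // subr_gt0.
    by rewrite ler_wpM2r // subr_ge0 ltW.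
  lra.
suff S : forall p : 'I_n * K, cm (h p.1 (sval p.2)) <= 2 * B by exact: (S (i, exist _ z (conj cz capz))).
have hap k : cm (h k ap) <= B by exact: hB.
have h0 k : cm (h k 0) <= B by have := hB k 0; rewrite Rc0 mul0r; apply.
apply: contract_bound => //.
  have [M HM] : exists M, forall k (x : K), cm (h k (sval x)) <= M.
    apply: bounded_fin => k; have [M HM] := cone_trunc_bounded k N0.
    exists M => -[y [cy [ry _]]] /=; apply: HM => //.
    by move: ry; rewrite /ap reB re_dirv subr_ge0.
  by exists M => -[k y]; exact: HM.
move=> M M0 HM [k [y [cy cay]]] /=.
have hM y' : cone y' -> cone (ap - y') -> forall k, cm (h k y') <= M.
  by move=> c1 c2 k'; exact: (HM (k', exist _ y' (conj c1 c2))).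
have FM := Fc_small cd M0; have FM0 : 0 <= F1 * M by rewrite mulr_ge0 ?(Fc_ge0 cd).
have PM := Phi_a cd FM0; rewrite -/F1 in FM PM.
have P0 (x r : R) : expR (x * 0) * (F1 * M * expR (- `|r|)) <= F1 * M.
  by rewrite mulr0 expR0 mul1r -[leRHS]mulr1 (ler_wpM2l FM0) // expRN_le1.
have from0 : exists x v, [/\ 0 <= x, t1 <= v <= t2, y = Rc x * dirv v &
    forall u, 0 <= u <= x -> [/\ in_sect T (Rc u * dirv v), colsol kap q h (Rc u * dirv v) &
    forall k, cm (h k (Rc u * dirv v)) <= M]].
  have [x [v [x0 vv yE]]] := coneP cy; exists x, v; split=> // u /andP[u0 ux].
  have c1 := cone_dirv u0 vv; split; [exact: cone_sect|exact: cone_sol|].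
  apply: hM => //; have -> : ap - Rc u * dirv v = (ap - y) + Rc (x - u) * dirv v.
    by rewrite yE RcB; ring.
  by apply: coneD => //; apply: cone_dirv => //; rewrite subr_ge0.
have := cd_cover cd k => /or3P[/eqP ->|uk|dk].
- have [x [v [x0 vv yE S]]] := from0.
  have hx : cm (h j y - h j 0) <= F1 * M.
    have x00 : 0 <= (0 : R) <= x by rewrite lexx.
    have := est_mid cd vv x00 M0 S; rewrite -yE Rc0 mul0r oppr0 expR0 => A.
    by apply: le_trans A _; rewrite -[leRHS]mulr1 (ler_wpM2l FM0) // gerBl expR_ge0.
  have -> : h j y = (h j y - h j 0) + h j 0 by ring.
  apply: le_trans (cmD _ _) _; rewrite addrC lerD //; lra.
- have [x [v [x0 vv dE]]] := coneP cay.
  have S u : 0 <= u <= x -> [/\ in_sect T (y + Rc u * dirv v), colsol kap q h (y + Rc u * dirv v) &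
      forall k, cm (h k (y + Rc u * dirv v)) <= M].
    move=> /andP[u0 ux]; have c1 := coneD cy (cone_dirv u0 vv).
    split; [exact: cone_sect|exact: cone_sol|]; apply: hM => //.
    have -> : ap - (y + Rc u * dirv v) = Rc (x - u) * dirv v by rewrite opprD addrA dE RcB; ring.
    by apply: cone_dirv => //; rewrite subr_ge0.
  have c0 : -1 <= 0 :> R by lra.
  have uu : 0 <= (0 : R) <= x by rewrite lexx.
  have := est_up cd uk vv c0 x0 M0 S (fun u _ => P0 u _) uu.
  have E0 : y + Rc 0 * dirv v = y by rewrite Rc0 (mul0r (dirv v)) addr0.
  have Ex : y + Rc x * dirv v = ap by rewrite -dE; ring.
  rewrite E0 Ex !mulr0 !expR0 !mul1r => A.
  apply: le_trans A _; rewrite ge_max; apply/andP; split; last by lra.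
  have := hap k; lra.
- have [x [v [x0 vv yE S]]] := from0.
  have S' u : 0 <= u <= x -> [/\ in_sect T (0 + Rc u * dirv v), colsol kap q h (0 + Rc u * dirv v) &
      forall k, cm (h k (0 + Rc u * dirv v)) <= M] by rewrite add0r; exact: S.
  have c0 : 0 <= 1 :> R by lra.
  have uu : 0 <= x <= x by rewrite lexx x0.
  have := est_dn cd dk vv c0 x0 M0 S' (fun u _ => P0 u _) uu.
  have E0 : 0 + Rc 0 * dirv v = 0 by rewrite Rc0 (mul0r (dirv v)) addr0.
  have Ex : 0 + Rc x * dirv v = y by rewrite yE add0r.
  rewrite E0 Ex !mulr0 !expR0 !mul1r => A.
  apply: le_trans A _; rewrite ge_max; apply/andP; split; last by lra.
  have := h0 k; lra.
Qed.

Let small_exp B e : 0 <= B -> 0 < e -> forall x, 1 <= x -> 4 * B / e <= x -> B * expR (- x) * x <= e.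
Proof.
move=> B0 e0 x x1 xb; have x0 : 0 < x by lra.
have E2 : x ^+ 2 / 4 <= expR x.
  have -> : expR x = expR (x / 2) ^+ 2 by rewrite expr2 -expRD -splitr.
  have -> : x ^+ 2 / 4 = (x / 2) ^+ 2 by field.
  have hx : x / 2 <= expR (x / 2).
    have := expR_ge1Dx (x / 2); move: (expR (x / 2)) => E hE; lra.
  by rewrite ler_pXn2r ?nnegrE ?expR_ge0 // divr_ge0 // ltW.
have h1 : 4 * B <= e * x by rewrite [e * x]mulrC -ler_pdivrMr.
rewrite expRN mulrAC ler_pdivrMr ?expR_gt0 //.
apply: le_trans (ler_wpM2l (ltW e0) E2).
have : 4 * B * x <= e * x * x by rewrite ler_wpM2r // ltW.
by rewrite expr2; lra.
Qed.

(** Along each direction the j-th component has an integrable derivative. At abscissa x two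
    directions differ by O(x e^(-x)), the length of a vertical segment times the size of the
    coefficients there, so all directions share one limit. *)
Lemma cone_limit M : 0 <= M ->
  (forall i x v, 0 <= x -> t1 <= v <= t2 -> cm (h i (Rc x * dirv v)) <= M) ->
  exists K, forall x v, 0 <= x -> t1 <= v <= t2 ->
    cm (h j (Rc x * dirv v) - K) <= F1 * M * expR (- x).
Proof.
move=> M0 hM; have FM0 : 0 <= F1 * M by rewrite mulr_ge0 ?(Fc_ge0 cd).
have mid v x y : t1 <= v <= t2 -> 0 <= x <= y ->
    cm (h j (Rc y * dirv v) - h j (Rc x * dirv v)) <= F1 * M * expR (- x).
  move=> vv /andP[x0 xy]; have xy' : 0 <= x <= y by rewrite x0.
  apply: le_trans (est_mid cd vv xy' M0 _) _ => [u /andP[u1 u2]|].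
    have u0 : 0 <= u by lra.
    split; [by apply: in_sect_dirv; exact: cd_dir cd _ vv|exact: hsol|].
    by move=> k; exact: hM.
  by rewrite (ler_wpM2l FM0) // gerBl expR_ge0.
have side v x : 0 <= x -> t1 <= v <= t2 ->
    cm (h j (Rc x * dirv v) - h j (Rc x * dirv t1)) <= n%:R * (sg * expR (- x) * M) * (x * (v - t1)).
  move=> x0 /andP[v1 v2].
  have E (u : R) : Rc x * dirv t1 + Rc u * ci = Rc x * dirv t1 + Rc u * ci by [].
  pose g (u : R) := h j (Rc x * dirv (t1 + u * (v - t1))).
  have -> : h j (Rc x * dirv v) - h j (Rc x * dirv t1) = g 1 - g 0.
    by rewrite /g mul1r mul0r addr0 (addrC t1) subrK.
  have vu u : 0 <= u <= 1 -> t1 <= t1 + u * (v - t1) <= t2.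
    move=> /andP[u0 u1]; have p0 : 0 <= v - t1 by lra.
    have : u * (v - t1) <= v - t1 by rewrite ler_piMl.
    have : 0 <= u * (v - t1) by rewrite mulr_ge0.
    lra.
  have lE u : Rc x * dirv (t1 + u * (v - t1)) = Rc x * dirv t1 + Rc u * (ci * Rc (x * (v - t1))).
    by rewrite /dirv !(RcM, RcD, RcB); ring.
  have -> : n%:R * (sg * expR (- x) * M) * (x * (v - t1)) =
    (n%:R * (sg * expR (- x) * M) * (x * (v - t1))) * (1 - 0) by rewrite subr0 mulr1.
  apply: pder_bound_cst => // u u01.
    rewrite /g; have := hsol x0 (vu u u01) j; rewrite lE => D.
    have := cder_line D; apply: gder_ext; rewrite ?lE //.
    by exists 1 => // y _; rewrite lE.
  rewrite cmM (cd_j cd) mul0r add0r cmM cm_ci mul1r cm_Rc -lE.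
  rewrite ger0_norm; last by rewrite mulr_ge0 // subr_ge0.
  rewrite ler_wpM2r ?mulr_ge0 ?subr_ge0 //.
  apply: le_trans (cm_sum _ _) _.
  apply: le_trans (ler_sum _ (G := fun=> sg * expR (- x) * M) _) _ => [k _|]; last first.
    by rewrite sumr_const card_ord -[leLHS]mulr_natl.
  rewrite cmM ler_pM ?cm_ge0 //; last exact: hM (vu _ u01).
  have ws : in_sect T (Rc x * dirv (t1 + u * (v - t1))).
    by apply: in_sect_dirv; exact: cd_dir cd _ (vu _ u01).
  by have := cd_q cd j k ws; rewrite re_dirv (ger0_norm x0).
have t1t : t1 <= t1 <= t2 by rewrite lexx.
have FM1 : 0 <= 4 * (F1 * M) by lra.
have [e e0|K HK] := @cauchy_tends R (fun k => h j (Rc k%:R * dirv t1)).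
  have E0 : 0 <= F1 * M / e by rewrite divr_ge0 // ltW.
  have hb := archi_boundP E0; set N := Num.bound _ in hb.
  have W k m : (N <= k)%N -> (k <= m)%N -> cm (h j (Rc m%:R * dirv t1) - h j (Rc k%:R * dirv t1)) <= e.
    move=> Nk km; have kR : N%:R <= k%:R :> R by rewrite ler_nat.
    have km' : 0 <= (k%:R : R) <= m%:R by rewrite ler0n ler_nat.
    apply: le_trans (mid _ _ _ t1t km') _.
    rewrite expRN ler_pdivrMr ?expR_gt0 //; apply: le_trans (ler_wpM2l (ltW e0) (expR_ge1Dx _)).
    rewrite [e * _]mulrC -ler_pdivrMr //; move: hb kR; move: (F1 * M / e) => P; lra.
  exists N => k m Nk Nm; have [km|mk] := leqP k m; first by rewrite cmBC; exact: W.
  by apply: W => //; exact: ltnW.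
exists K => x v x0 vv; apply/ler_addgt0Pr => e e0.
have e2 : 0 < e / 2 by lra.
have [k0 Hk0] := HK _ e2.
pose B := n%:R * (sg * M) * (v - t1).
have B0 : 0 <= B by rewrite /B !mulr_ge0 ?(cd_sg cd) //; case/andP: vv => ? _; rewrite subr_ge0.
have E0 : 0 <= 4 * B / (e / 2) by rewrite divr_ge0 ?(ltW e2) // mulr_ge0.
have hb := archi_boundP E0; have hx := archi_boundP x0.
pose k := maxn k0 (maxn 1 (maxn (Num.bound (4 * B / (e / 2))) (Num.bound x))).
have k_k0 : (k0 <= k)%N by rewrite leq_maxl.
have k1 : 1 <= k%:R :> R by rewrite ler1n /k !leq_max leqnn !orbT.
have kB : 4 * B / (e / 2) <= k%:R.
  by apply: ltW (lt_le_trans hb _); rewrite ler_nat /k !leq_max leqnn !orbT.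
have xk : 0 <= x <= k%:R.
  by rewrite x0 /=; apply: ltW (lt_le_trans hx _); rewrite ler_nat /k !leq_max leqnn !orbT.
have k0' : 0 <= k%:R :> R by rewrite ler0n.
have h1 := mid _ _ _ vv xk; have h2 := side v k%:R k0' vv; have h3 := Hk0 k k_k0.
have h4 := small_exp B0 e2 k1 kB.
have h5 : n%:R * (sg * expR (- k%:R) * M) * (k%:R * (v - t1)) = B * expR (- k%:R) * k%:R.
  by rewrite /B; ring.
rewrite h5 in h2; move: h1 h2 h3.
set p := h j (Rc x * dirv v); set p1 := h j (Rc k%:R * dirv v); set p2 := h j (Rc k%:R * dirv t1) => h1 h2 h3.
apply: le_trans (cm_tri p K p1) _; have := cm_tri p1 K p2; rewrite (cmBC p); lra.
Qed.

End Cone.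

End ColumnEstimates.

(** * Dependence of the columns on the parameter *)

Section ColumnFamily.
Context {R : realType}.
Local Notation C := (cplx R).
Implicit Types (z w a b l : C) (u v e d M : R).
Opaque cexp.

Lemma gder_sum (T : zmodType) (jj : T -> C) (I : Type) (r : seq I) (F : I -> T -> C) (l : I -> C) x :
  (forall i, gder jj (F i) x (l i)) ->
  gder jj (fun y => \sum_(i <- r) F i y) x (\sum_(i <- r) l i).
Proof.
move=> H; elim: r => [|i r IH].
  have E : (fun y => \sum_(i <- [::]) F i y) = (fun=> 0) by apply/funext => y; rewrite big_nil.
  by rewrite E big_nil; exact: gder_cst.
have E : (fun y => \sum_(i <- i :: r) F i y) = (fun y => F i y + \sum_(i <- r) F i y).
  by apply/funext => y; rewrite big_cons.
by rewrite E big_cons; exact: gderD.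
Qed.

Lemma cdiffM (f g : C -> C) z : cdiff f z -> cdiff g z -> cdiff (fun y => f y * g y) z.
Proof. by move=> [l Hl] [m Hm]; eexists; exact: gderM Hl Hm. Qed.

Lemma cdiffD (f g : C -> C) z : cdiff f z -> cdiff g z -> cdiff (fun y => f y + g y) z.
Proof. by move=> [l Hl] [m Hm]; eexists; exact: gderD Hl Hm. Qed.

Lemma cdiff_cst c z : cdiff (fun=> c) z.
Proof. by exists 0; exact: gder_cst. Qed.

Lemma cdiff_sum (I : Type) (r : seq I) (P : pred I) (F : I -> C -> C) z : (forall i, cdiff (F i) z) ->
  cdiff (fun y => \sum_(i <- r | P i) F i y) z.
Proof.
move=> H; elim: r => [|i r IH].
  by under eq_fun do rewrite big_nil; exact: cdiff_cst.
under eq_fun do rewrite big_cons; case: (P i) => //.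
exact: cdiffD.
Qed.

Lemma cdiff_prod (I : Type) (r : seq I) (P : pred I) (F : I -> C -> C) z : (forall i, cdiff (F i) z) ->
  cdiff (fun y => \prod_(i <- r | P i) F i y) z.
Proof.
move=> H; elim: r => [|i r IH].
  by under eq_fun do rewrite big_nil; exact: cdiff_cst.
under eq_fun do rewrite big_cons; case: (P i) => //.
exact: cdiffM.
Qed.

Lemma cdiff_ext (f g : C -> C) z : (exists2 d, 0 < d & forall k, cm k < d -> f (z + k) = g (z + k)) ->
  cdiff f z -> cdiff g z.
Proof. by move=> H [l Hl]; exists l; apply: gder_ext Hl. Qed.

Lemma cdiff_det (n : nat) (B : C -> 'M[C]_n) z : (forall i k, cdiff (fun y => B y i k) z) ->
  cdiff (fun y => \det (B y)) z.
Proof.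
move=> H; apply: cdiff_sum => s; apply: cdiffM; first exact: cdiff_cst.
by apply: cdiff_prod => i; exact: H.
Qed.

Lemma cdiff_invmx (n : nat) (B : C -> 'M[C]_n) z : (forall i k, cdiff (fun y => B y i k) z) ->
  (exists2 d, 0 < d & forall k, cm k < d -> B (z + k) \in unitmx) ->
  forall i k, cdiff (fun y => invmx (B y) i k) z.
Proof.
move=> H [d d0 U] i k.
apply: (@cdiff_ext (fun y => (\det (B y))^-1 * cofactor (B y) k i)).
  by exists d => // x xd; rewrite /invmx U // !mxE.
apply: cdiffM.
  have [l Hl] := cdiff_det H.
  have n0 : \det (B z) != 0.
    by have := U 0; rewrite cm0 addr0 unitmxE unitfE; apply.
  by eexists; exact: (gder_comp (g := fun y => \det (B y)) (cderV n0) Hl).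
apply: cdiffM; first exact: cdiff_cst.
apply: cdiff_det => i' k'.
by apply: (@cdiff_ext (fun y => B y (lift k i') (lift i k'))) => //; exists 1 => // y _; rewrite !mxE.
Qed.

Section Family.
Variables (n : nat) (j : 'I_n) (up dn : pred 'I_n) (kap : C -> 'I_n -> C -> C)
  (q : C -> 'I_n -> 'I_n -> C -> C) (T : R) (a sg t1 t2 : C -> R)
  (Z : C -> Prop) (U : C -> C -> Prop) (Y : C -> C -> 'M[C]_n).
Hypothesis Z_open : forall z, Z z -> exists2 d, 0 < d & forall x, cm x < d -> Z (z + x).
Hypothesis cd : forall z, Z z -> coldata j up dn (kap z) (q z) T (a z) (sg z) (t1 z) (t2 z).
Hypothesis t12 : forall z, Z z -> t1 z < t2 z.
Hypothesis slope : forall z v, Z z -> t1 z < v < t2 z ->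
  exists2 d, 0 < d & forall x, cm x < d -> t1 (z + x) < v < t2 (z + x).
Hypothesis U_cone : forall z u v, Z z -> t1 z <= v <= t2 z -> U z (Rc u * dirv v).
Hypothesis hY : hol2mx U Y.
Hypothesis Y0 : forall z, Z z -> Y z 0 = 1%:M.
Hypothesis dY : forall z w i k, U z w -> cder (fun x => Y z x i k) w
  (kap z i w * Y z w i k + \sum_l q z i l w * Y z w l k).

Definition ysol (V : 'I_n -> C) z i w := \sum_k Y z w i k * V k.

Lemma ysol_sol V z w : U z w -> colsol (kap z) (q z) (ysol V z) w.
Proof.
move=> Uw i; apply: gder_eq (gder_sum _ _) _ => [k|].
  by apply: gderM; [exact: dY|exact: gder_cst].
rewrite /= mulr_sumr.
under [X in _ = _ + X]eq_bigr do rewrite mulr_sumr.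
rewrite exchange_big -big_split /=; apply: eq_bigr => k _.
rewrite mulr0 addr0 mulrDl mulrA; congr (_ + _).
by rewrite mulr_suml; apply: eq_bigr => l _; rewrite mulrA.
Qed.

Lemma ysol0 V z i : Z z -> ysol V z i 0 = V i.
Proof.
move=> Zz; rewrite /ysol Y0 // (bigD1 i) //= mxE eqxx mul1r big1 ?addr0 // => k ki.
by rewrite mxE eq_sym (negPf ki) mul0r.
Qed.

Lemma ysolB V W z i w : ysol (fun k => V k - W k) z i w = ysol V z i w - ysol W z i w.
Proof. by rewrite /ysol -sumrB; apply: eq_bigr => k _; rewrite mulrBr. Qed.

Let upj z : Z z -> ~~ up j.
Proof.
move=> Zz; apply/negP => uj; have c := cd Zz.
have := cd_up c uj (_ : t1 z <= t1 z <= t2 z) (_ : in_sect T 0).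
rewrite (cd_j c) mulr0 re0 lexx ltW ?t12 // /in_sect !normr0 mulr0 lexx => /(_ isT isT).
by have := cd_a c; lra.
Qed.

Let dnj z : Z z -> ~~ dn j.
Proof.
move=> Zz; apply/negP => uj; have c := cd Zz.
have := cd_dn c uj (_ : t1 z <= t1 z <= t2 z) (_ : in_sect T 0).
rewrite (cd_j c) mulr0 re0 lexx ltW ?t12 // /in_sect !normr0 mulr0 lexx => /(_ isT isT).
by have := cd_a c; lra.
Qed.

Let updn z i : Z z -> up i -> ~~ dn i.
Proof.
move=> Zz ui; apply/negP => di; have c := cd Zz.
have s0 : in_sect T 0 by rewrite /in_sect !normr0 mulr0 lexx.
have tt : t1 z <= t1 z <= t2 z by rewrite lexx ltW ?t12.
have := cd_up c ui tt s0; have := cd_dn c di tt s0.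
by have := cd_a c; lra.
Qed.

(** The boundary map, from the value at 0 to the boundary data: row j is the value at 0, where Y is
    the identity, and the other rows evaluate at +N or -N. Column j of its inverse is then the
    initial value whose boundary data are 1 for the j-th component and 0 otherwise. *)
Definition bvp (N : nat) v z : 'M[C]_n := \matrix_(i, k)
  if i == j then (j == k)%:R else
  if up i then Y z (Rc N%:R * dirv v) i k else Y z (Rc (- N%:R) * dirv v) i k.

Definition vN v (N : nat) z k := invmx (bvp N v z) k j.

Let Nge0 (N : nat) : 0 <= (N%:R : R). Proof. exact: ler0n. Qed.

Lemma bvp_rows N v z V : Z z -> bvp N v z *m (\col_k V k) = \col_i
  if i == j then V j else if up i then ysol V z i (Rc N%:R * dirv v)
  else ysol V z i (Rc (- N%:R) * dirv v).
Proof.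
move=> Zz; apply/colP => i; rewrite !mxE; have [->|ij] := eqVneq i j.
  rewrite (bigD1 j) //= !mxE !eqxx mul1r big1 ?addr0 // => k kj.
  by rewrite !mxE eqxx eq_sym (negPf kj) mul0r.
by case: ifP => ui; apply: eq_bigr => k _; rewrite !mxE (negPf ij) ui.
Qed.

(** A kernel vector starts a solution with zero boundary data, and [bvp_bound] with beta = 0 makes
    it vanish. *)
Lemma bvp_unit N v z : Z z -> t1 z <= v <= t2 z -> bvp N v z \in unitmx.
Proof.
move=> Zz vv; rewrite -unitmx_tr -row_free_unit -kermx_eq0.
apply/eqP/row_matrixP => i0; rewrite row0.
set x := row i0 _; have xk : x *m (bvp N v z)^T = 0.
  by rewrite /x -row_mul mulmx_ker row0.
clearbody x => {i0}.
have : bvp N v z *m x^T = 0 by rewrite -[LHS]trmxK trmx_mul trmxK xk trmx0.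
have -> : x^T = \col_k x 0 k by apply/colP => k; rewrite !mxE.
rewrite bvp_rows // => /colP E; have c := cd Zz.
have := @bvp_bound R n j up dn (kap z) (q z) T (a z) (sg z) (t1 z) (t2 z) c (ysol (fun k => x 0 k) z) v vv
  N%:R 0 (Nge0 N) (lexx _) _ _ _ _.
move=> H; apply/rowP => k; rewrite [RHS]mxE; apply/eqP; rewrite -cm_eq0 eq_le cm_ge0 andbT.
have -> : x 0 k = ysol (fun k => x 0 k) z k (Rc 0 * dirv v) by rewrite Rc0 mul0r ysol0.
rewrite -[leRHS](mulr0 2); apply: H => [u uN|i ui|i di||].
- by apply: ysol_sol; exact: U_cone.
- have := E i; rewrite !mxE; case: eqP => [ij|_]; first by move: ui; rewrite ij (negPf (upj Zz)).
  by rewrite ui => ->; rewrite cm0.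
- have := E i; rewrite !mxE; case: eqP => [ij|_]; first by move: di; rewrite ij (negPf (dnj Zz)).
  case: ifP => [ui|_ ->]; last by rewrite cm0.
  by move: di; rewrite (negPf (updn Zz ui)).
- by rewrite ysol0 //; have := E j; rewrite !mxE eqxx => ->; rewrite cm0.
- by rewrite Nge0 oppr_le0 Nge0.
Qed.

Lemma vN_bc N v z : Z z -> t1 z <= v <= t2 z ->
  [/\ vN v N z j = 1, forall i, up i -> ysol (vN v N z) z i (Rc N%:R * dirv v) = 0 &
   forall i, dn i -> ysol (vN v N z) z i (Rc (- N%:R) * dirv v) = 0].
Proof.
move=> Zz vv; have Un := bvp_unit N Zz vv.
have : bvp N v z *m (\col_k vN v N z k) = delta_mx j 0.
  have -> : \col_k vN v N z k = invmx (bvp N v z) *m delta_mx j 0.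
    apply/colP => k; rewrite !mxE (bigD1 j) //= big1 ?addr0 => [|l lj]; first by rewrite mxE !eqxx mulr1.
    by rewrite mxE (negPf lj) mulr0.
  by rewrite mulmxA mulmxV // mul1mx.
rewrite bvp_rows // => /colP E; split.
- by have := E j; rewrite !mxE !eqxx.
- move=> i ui; have := E i; rewrite !mxE; case: eqP => [ij|_]; first by move: ui; rewrite ij (negPf (upj Zz)).
  by rewrite ui.
- move=> i di; have := E i; rewrite !mxE; case: eqP => [ij|_]; first by move: di; rewrite ij (negPf (dnj Zz)).
  by case: ifP => [ui|//]; move: di; rewrite (negPf (updn Zz ui)).
Qed.

Let solline V z v u : Z z -> t1 z <= v <= t2 z -> colsol (kap z) (q z) (ysol V z) (Rc u * dirv v).
Proof. by move=> Zz vv; apply: ysol_sol; exact: U_cone. Qed.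

Lemma vN_bound N v z : Z z -> t1 z <= v <= t2 z -> forall i u, - N%:R <= u <= N%:R ->
  cm (ysol (vN v N z) z i (Rc u * dirv v)) <= 2.
Proof.
move=> Zz vv i u uN; have [E1 E2 E3] := vN_bc N Zz vv.
have := @bvp_bound R n j up dn (kap z) (q z) T (a z) (sg z) (t1 z) (t2 z) (cd Zz) (ysol (vN v N z) z) v vv
  N%:R 1 (Nge0 N) ler01.
rewrite mulr1; apply=> //.
- by move=> x _; exact: solline.
- by move=> k uk; rewrite E2 // cm0.
- by move=> k dk; rewrite E3 // cm0.
- by rewrite ysol0 // E1 cm1.
Qed.

Lemma vN_decay N v z : Z z -> t1 z <= v <= t2 z -> forall i, i != j -> forall u, - N%:R <= u <= N%:R ->
  cm (ysol (vN v N z) z i (Rc u * dirv v)) <= expR (- `|u|) * 2.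
Proof.
move=> Zz vv i ij u uN; have [E1 E2 E3] := vN_bc N Zz vv.
apply: (line_decay2 (cd Zz) vv (N := N%:R)) => // x xN; split; first exact: solline.
by move=> k; exact: vN_bound.
Qed.

(** On [-N, N] the difference solves the problem for N with boundary data of size 2 e^(-N), by the
    decay of the solution for N'; the a priori estimate doubles this. *)
Lemma vN_cauchy v z : Z z -> t1 z <= v <= t2 z -> forall N N' i, (N <= N')%N ->
  cm (vN v N' z i - vN v N z i) <= 4 * expR (- N%:R).
Proof.
move=> Zz vv N N' i NN; have [E1 E2 E3] := vN_bc N Zz vv; have [E1' E2' E3'] := vN_bc N' Zz vv.
have NR : (N%:R : R) <= N'%:R by rewrite ler_nat.
have N0 := Nge0 N.
have nj k : up k || dn k -> k != j.
  by move=> kk; apply/eqP => kj; move: kk; rewrite kj (negPf (upj Zz)) (negPf (dnj Zz)).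
have := @bvp_bound R n j up dn (kap z) (q z) T (a z) (sg z) (t1 z) (t2 z) (cd Zz)
  (ysol (fun k => vN v N' z k - vN v N z k) z) v vv N%:R (expR (- N%:R) * 2) N0.
have -> : 2 * (expR (- N%:R) * 2) = 4 * expR (- N%:R) :> R by ring.
move=> H; have -> : vN v N' z i - vN v N z i =
    ysol (fun k => vN v N' z k - vN v N z k) z i (Rc 0 * dirv v) by rewrite Rc0 mul0r ysol0.
apply: H; first by rewrite mulr_ge0 ?expR_ge0.
- by move=> x _; exact: solline.
- move=> k uk; rewrite ysolB E2 // subr0.
  have := @vN_decay N' v z Zz vv k (nj k _) N%:R; rewrite uk ger0_norm //; apply=> //.
  by rewrite NR andbT; lra.
- move=> k dk; rewrite ysolB E3 // subr0.
  have := @vN_decay N' v z Zz vv k (nj k _) (- N%:R); rewrite dk orbT normrN ger0_norm //; apply=> //.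
  by rewrite lerN2 NR /=; lra.
- by rewrite ysol0 // E1 E1' subrr cm0 mulr_ge0 ?expR_ge0.
- by rewrite oppr_le0 N0.
Qed.

Lemma tends_shift (s : nat -> C) l (N0 : nat) : tends s l -> tends (fun N => s (N0 + N)%N) l.
Proof.
move=> H e e0; have [k Hk] := H e e0; exists k => m km; apply: Hk.
by apply: leq_trans km _; rewrite leq_addl.
Qed.

Definition vv v z k : C := xget 0 [set l | tends (fun N => vN v N z k) l].

Lemma vvP v z k : Z z -> t1 z <= v <= t2 z -> tends (fun N => vN v N z k) (vv v z k).
Proof.
move=> Zz vt; rewrite /vv.
suff [l Hl] : exists l, tends (fun N => vN v N z k) l.
  by case: xgetP => [x _ //|/(_ l)]; elim.
apply: cauchy_tends => e e0.
have hb := @archi_boundP _ (4 / e); have e4 : 0 <= 4 / e by rewrite divr_ge0 // ltW.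
have {}hb := hb e4; set N := Num.bound _ in hb.
have W p p' : (N <= p)%N -> (p <= p')%N -> cm (vN v p' z k - vN v p z k) <= e.
  move=> Np pp; apply: le_trans (vN_cauchy Zz vt k pp) _.
  rewrite expRN ler_pdivrMr ?expR_gt0 //; apply: le_trans (ler_wpM2l (ltW e0) (expR_ge1Dx _)).
  have : N%:R <= p%:R :> R by rewrite ler_nat.
  rewrite [e * _]mulrC -ler_pdivrMr //; move: hb; move: (4 / e) => P; lra.
exists N => p m Np Nm; have [pm|mp] := leqP p m; first by rewrite cmBC; exact: W.
by apply: W => //; exact: ltnW.
Qed.

Lemma vv_ysol v z i w : Z z -> t1 z <= v <= t2 z ->
  tends (fun N => ysol (vN v N z) z i w) (ysol (vv v z) z i w).
Proof.
by move=> Zz vt; apply: tends_sum => k; apply: tends_Z; exact: vvP.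
Qed.

Let big_N u : exists N0 : nat, forall N, - (N0 + N)%:R <= u <= (N0 + N)%:R.
Proof.
have := archi_boundP (normr_ge0 u); set N := Num.bound _ => hb; exists N => m.
rewrite -ler_norml; apply: le_trans (ltW hb) _.
by rewrite ler_nat leq_addr.
Qed.

Lemma vv_bound v z i u : Z z -> t1 z <= v <= t2 z -> cm (ysol (vv v z) z i (Rc u * dirv v)) <= 2.
Proof.
move=> Zz vt; have [N0 HN] := big_N u.
apply: (tends_cm_le (tends_shift N0 (vv_ysol i _ Zz vt))) => N.
exact: vN_bound.
Qed.

Lemma vv_decay v z i u : Z z -> t1 z <= v <= t2 z -> i != j ->
  cm (ysol (vv v z) z i (Rc u * dirv v)) <= expR (- `|u|) * 2.
Proof.
move=> Zz vt ij; have [N0 HN] := big_N u.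
apply: (tends_cm_le (tends_shift N0 (vv_ysol i _ Zz vt))) => N.
exact: vN_decay.
Qed.

Lemma vv_j v z : Z z -> t1 z <= v <= t2 z -> vv v z j = 1.
Proof.
move=> Zz vt; apply: tends_uniq (vvP j Zz vt) _ => e e0; exists 0%N => N _.
by have [-> _ _] := vN_bc N Zz vt; rewrite subrr cm0 ltW.
Qed.

(** A growing component is followed back from its zero at +N, a decaying one forward from its zero
    at -N, so only forcing divided by rate remains. In the application the forcing is O(|sqrt(eps)|)
    and a is of order 1/|sqrt(eps)|, whence O(|eps|). *)
Lemma vv_small v z i : Z z -> t1 z <= v <= t2 z -> i != j ->
  cm (vv v z i) <= 4 * Fc n T (sg z) / a z.
Proof.
move=> Zz vt ij; apply: (tends_cm_le (vvP i Zz vt)) => N.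
have [E1 E2 E3] := vN_bc N Zz vt; have c := cd Zz.
have -> : vN v N z i = ysol (vN v N z) z i (Rc 0 * dirv v) by rewrite Rc0 mul0r ysol0.
have N0 := Nge0 N; have a2 := cd_a c.
have F0 := Fc_ge0 c.
have B0 : 0 <= 4 * Fc n T (sg z) / a z by apply: divr_ge0; [apply: mulr_ge0|lra].
have B1 : 2 * (Fc n T (sg z) * 2) / a z = 4 * Fc n T (sg z) / a z by field; rewrite gt_eqF //; lra.
have S u : - N%:R <= u <= N%:R -> colsol (kap z) (q z) (ysol (vN v N z) z) (Rc u * dirv v) /\
    forall k, cm (ysol (vN v N z) z k (Rc u * dirv v)) <= 2.
  by move=> uN; split; [exact: solline|move=> k; exact: vN_bound].
have := cd_cover c i; rewrite (negPf ij) /= => /orP[ui|di].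
  apply: le_trans (line_up c vt ui N0 (_ : 0 <= 2) _) _ => // [u uN|]; first by apply: S; lra.
  by rewrite E2 // cm0 ge_max B0 B1 lexx.
have N0' : - N%:R <= (0 : R) by lra.
apply: le_trans (line_dn c vt di N0' (_ : 0 <= 2) _) _ => // [u uN|]; first by apply: S; lra.
by rewrite E3 // cm0 ge_max B0 B1 lexx.
Qed.

Lemma vv_cone v z : Z z -> t1 z < v < t2 z -> forall i u v', t1 z <= v' <= t2 z ->
  cm (ysol (vv v z) z i (Rc u * dirv v')) <= 4.
Proof.
move=> Zz vt i u v' vt'; have c := cd Zz; have t12' := ltW (t12 Zz).
have vle : t1 z <= v <= t2 z by case/andP: vt => *; rewrite !ltW.
have B0 : 0 <= 2 :> R by [].
have -> : 4 = 2 * 2 :> R by ring.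
have [u0|u0] := leP 0 u.
  apply: (cone_bound c t12' _ vt B0 (h := ysol (vv v z) z)) => [x w x0 ww|k x x0|].
  - exact: solline.
  - exact: vv_bound.
  - by split; rewrite re_dirv ?im_dirv // mulrC [t2 z * u]mulrC !ler_wpM2l //; case/andP: vt'.
have u0' : 0 <= - u by lra.
have wN (x w : R) : - (Rc x * dirv w) = Rc (- x) * dirv w by rewrite RcN mulNr.
have -> : Rc u * dirv v' = - (Rc (- u) * dirv v') by rewrite wN opprK.
apply: (cone_bound (coldata_refl c) t12' _ vt B0 (h := fun i x => ysol (vv v z) z i (- x))) => [x w x0 ww|k x x0|].
- by apply: colsol_refl; rewrite wN; exact: solline.
- by rewrite wN; exact: vv_bound.
- by split; rewrite re_dirv ?im_dirv // mulrC [t2 z * _]mulrC !ler_wpM2l //; case/andP: vt'.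
Qed.

(** By the cone estimate the solution found on the line of slope v is bounded on the line of slope
    v', where uniqueness applies. Thus the slope can be frozen while z varies. *)
Lemma vv_indep v v' z i : Z z -> t1 z < v < t2 z -> t1 z < v' < t2 z -> vv v z i = vv v' z i.
Proof.
move=> Zz vt vt'; have c := cd Zz.
have vle : t1 z <= v <= t2 z by case/andP: vt => *; rewrite !ltW.
have vle' : t1 z <= v' <= t2 z by case/andP: vt' => *; rewrite !ltW.
apply/eqP; rewrite -subr_eq0; apply/eqP.
have -> : vv v z i - vv v' z i = ysol (fun k => vv v z k - vv v' z k) z i (Rc 0 * dirv v').
  by rewrite Rc0 mul0r ysol0.
apply: (line_uniq c vle' (M := 4 + 2)) => [u|].
  split=> [|k]; first exact: solline.
  rewrite ysolB; apply: le_trans (cmB _ _) _; apply: lerD; first exact: vv_cone.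
  exact: vv_bound.
by rewrite ysol0 // !vv_j // subrr.
Qed.

Definition mid z := (t1 z + t2 z) / 2.

Definition colV k z := vv (mid z) z k.

Lemma midP z : Z z -> t1 z < mid z < t2 z.
Proof. by move=> /t12 h; rewrite /mid; apply/andP; split; lra. Qed.

Let midP' z : Z z -> t1 z <= mid z <= t2 z.
Proof. by move=> /midP /andP[h1 h2]; rewrite !ltW. Qed.

Let near_mid z : Z z -> exists2 d, 0 < d & forall x, cm x < d ->
  [/\ Z (z + x), t1 (z + x) < mid z < t2 (z + x) & forall k, colV k (z + x) = vv (mid z) (z + x) k].
Proof.
move=> Zz; have [d1 d10 H1] := Z_open Zz; have [d2 d20 H2] := slope Zz (midP Zz).
exists (Num.min d1 d2); first by rewrite lt_min d10.
move=> x; rewrite lt_min => /andP[x1 x2]; have Zx := H1 x x1; have sx := H2 x x2.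
by split; [exact: Zx|exact: sx|move=> k; rewrite /colV; exact: (vv_indep k Zx (midP Zx) sx)].
Qed.

(** Near z the slope [mid z] is admissible for all parameters, and the column becomes a bounded
    limit of columns of inverses of matrices with holomorphic entries. *)
Lemma colV_diff z k : Z z -> cdiff (colV k) z.
Proof.
move=> Zz; have [d d0 Hd] := near_mid Zz.
apply: (@cdiff_ext (fun y => vv (mid z) y k)).
  exists d; first exact: d0.
  by move=> x xd; have [_ _ e] := Hd x xd; exact/esym/e.
have le3 (p p' r : R) : p < p' < r -> p <= p' <= r by case/andP => *; rewrite !ltW.
have [||l [Hl _]] := @bounded_limit R (fun N y => vN (mid z) N y k) (fun y => vv (mid z) y k) z d 2 d0.
- move=> N x xd; have [Zx sx _] := Hd x xd; have sx' := le3 _ _ _ sx; split.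
    apply: cdiff_invmx => [i l|].
      apply: (@cdiff_ext (fun y => if i == j then (j == l)%:R else
        if up i then Y y (Rc N%:R * dirv (mid z)) i l else Y y (Rc (- N%:R) * dirv (mid z)) i l)).
        by exists 1 => // y _; rewrite !mxE.
      case: (i == j); first exact: cdiff_cst.
      case: (up i).
        by have [] := hY i l (U_cone N%:R Zx sx').
      by have [] := hY i l (U_cone (- N%:R) Zx sx').
    have [d1 d10 H1] := Z_open Zx; have [d2 d20 H2] := slope Zx sx.
    exists (Num.min d1 d2); first by rewrite lt_min d10.
    by move=> y; rewrite lt_min => /andP[y1 y2]; apply: bvp_unit; [exact: H1|exact: le3 (H2 _ y2)].
  have := @vN_bound N (mid z) (z + x) Zx sx' k 0; rewrite Rc0 mul0r ysol0 //; apply.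
  by rewrite oppr_le0 Nge0.
- by move=> x xd; have [Zx sx _] := Hd x xd; apply: vvP => //; exact: le3.
by exists l.
Qed.

(** [ep] selects the end: false for Re w -> +oo, true for Re w -> -oo, the latter by reflection. The
    bound on K - 1 is the rate of convergence read at u = 0, where the component equals 1. *)
Lemma colV_limit (ep : bool) : exists K : C -> C, forall z, Z z ->
  [/\ cdiff K z, cm (K z - 1) <= 4 * Fc n T (sg z) &
   forall u, 0 <= u -> cm (ysol (colV^~ z) z j (Rc ((-1) ^+ ep * u) * dirv (mid z)) - K z) <=
     4 * Fc n T (sg z) * expR (- u)].
Proof.
have E z : exists K, Z z -> forall u v, 0 <= u -> t1 z <= v <= t2 z ->
    cm (ysol (colV^~ z) z j (Rc ((-1) ^+ ep * u) * dirv v) - K) <= 4 * Fc n T (sg z) * expR (- u).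
  have [Zz|nZ] := pselect (Z z); last by exists 0.
  have c := cd Zz; have t12' := ltW (t12 Zz); have M0 : 0 <= 4 :> R by [].
  case: ep.
    have wN (x w : R) : - (Rc x * dirv w) = Rc (- x) * dirv w by rewrite RcN mulNr.
    have [||K HK] := @cone_limit R n j dn up _ _ T (a z) (sg z) (t1 z) (t2 z) (coldata_refl c)
      (fun i x => ysol (colV^~ z) z i (- x)) t12' _ 4 M0.
    - by move=> x v x0 vt; apply: colsol_refl; rewrite wN; exact: solline.
    - by move=> i x v x0 vt; rewrite wN; exact: vv_cone (midP Zz) _ _ _ vt.
    exists K => _ u v u0 vt; have := HK u v u0 vt; rewrite wN expr1 mulN1r.
    by rewrite [4 * _]mulrC.
  have [||K HK] := @cone_limit R n j up dn _ _ T (a z) (sg z) (t1 z) (t2 z) c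
    (ysol (colV^~ z) z) t12' _ 4 M0.
  - by move=> x v x0 vt; exact: solline.
  - by move=> i x v x0 vt; exact: vv_cone (midP Zz) _ _ _ vt.
  exists K => _ u v u0 vt; have := HK u v u0 vt; rewrite expr0 mul1r.
  by rewrite [4 * _]mulrC.
have [K HK] := choice E; exists K => z Zz.
have B x : Z x -> 4 * Fc n T (sg x) <= 2^-1.
  by move=> Zx; have := cd_small (cd Zx); rewrite /Fc; lra.
have K1 x : Z x -> cm (K x - 1) <= 4 * Fc n T (sg x).
  move=> Zx; have := HK x Zx 0 (mid x) (lexx _) (midP' Zx).
  rewrite mulr0 Rc0 mul0r oppr0 expR0 mulr1 (ysol0 _ _ Zx) [colV j x](vv_j Zx (midP' Zx)).
  by rewrite cmBC.
split; [|exact: K1|by move=> u u0; exact: HK (midP' Zz)].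
have [d d0 Hd] := near_mid Zz.
have le3 (p p' r : R) : p < p' < r -> p <= p' <= r by case/andP => *; rewrite !ltW.
pose w (N : nat) := Rc ((-1) ^+ ep * N%:R) * dirv (mid z).
have [||l [Hl _]] := @bounded_limit R (fun N y => ysol (colV^~ y) y j (w N)) K z d 4 d0.
- move=> N x xd; have [Zx sx _] := Hd x xd; have sx' := le3 _ _ _ sx; split.
    apply: cdiff_sum => k; apply: cdiffM; last exact: colV_diff.
    by have [] := hY j k (U_cone ((-1) ^+ ep * N%:R) Zx sx').
  exact: vv_cone (midP Zx) _ _ _ sx'.
- move=> x xd; have [Zx sx _] := Hd x xd; have sx' := le3 _ _ _ sx => e e0.
  have hb := @archi_boundP _ (1 / e); have e4 : 0 <= 1 / e by rewrite divr_ge0 // ltW.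
  have {}hb := hb e4; exists (Num.bound (1 / e)) => N NN.
  apply: le_trans (HK _ Zx N%:R _ (Nge0 N) sx') _.
  apply: le_trans (_ : 1 * expR (- N%:R) <= _).
    by rewrite ler_wpM2r ?expR_ge0 //; have := B _ Zx; lra.
  rewrite expRN ler_pdivrMr ?expR_gt0 //; apply: le_trans (ler_wpM2l (ltW e0) (expR_ge1Dx _)).
  have : (Num.bound (1 / e))%:R <= N%:R :> R by rewrite ler_nat.
  rewrite [e * _]mulrC -ler_pdivrMr //; move: hb; move: (1 / e) (Num.bound _)%:R => P Q; lra.
by exists l.
Qed.

Lemma colV_props z : Z z -> [/\ colV j z = 1,
  forall i, i != j -> cm (colV i z) <= 4 * Fc n T (sg z) / a z &
  forall i u, i != j -> cm (ysol (colV^~ z) z i (Rc u * dirv (mid z))) <= expR (- `|u|) * 2].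
Proof.
move=> Zz; have m := midP' Zz; split=> [|i ij|i u ij]; [exact: vv_j|exact: vv_small|exact: vv_decay].
Qed.

End Family.

End ColumnFamily.

(** * The coordinate w *)

Section Hyperbolic.
Context {R : realType}.
Local Notation C := (cplx R).
Implicit Types (z w a b l : C) (u v e d M : R).
Opaque cexp.

Lemma im_csinh w : im (csinh w) = (expR (re w) + expR (- re w)) / 2 * sin (im w).
Proof.
rewrite /csinh -[2^-1](_ : Rc 2^-1 = _); last by rewrite RcV Rc_nat.
by rewrite mulrC imM re_Rc im_Rc !imB !im_cexp reN imN sinN; ring.
Qed.

Lemma ccoshN w : ccosh (- w) = ccosh w.
Proof. by rewrite /ccosh opprK addrC. Qed.

Lemma csinhN w : csinh (- w) = - csinh w.
Proof. by rewrite /csinh opprK; ring. Qed.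

Lemma csinh0 : csinh 0 = 0 :> C.
Proof. by rewrite /csinh oppr0 subrr mul0r. Qed.

Lemma ccosh_sqr w : ccosh w ^+ 2 - csinh w ^+ 2 = 1.
Proof. by rewrite /ccosh /csinh cexpN; field; exact: cexp_neq0. Qed.

Lemma cm_half (z : C) : cm (z / 2) = cm z / 2.
Proof. by rewrite cmM -[2^-1](_ : Rc 2^-1 = _) ?cm_Rc ?RcV ?Rc_nat // ger0_norm. Qed.

Lemma cexp_absle w : cm (cexp w) <= expR `|re w|.
Proof. by rewrite cm_cexp ler_expR ler_norm. Qed.

Lemma ccosh_le w : cm (ccosh w) <= expR `|re w|.
Proof.
rewrite cm_half ler_pdivrMr // mulrDr mulr1; apply: le_trans (cmD _ _) _.
by apply: lerD; rewrite ?cexp_absle // -(normrN (re w)) -reN cexp_absle.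
Qed.

Lemma csinh_le w : cm (csinh w) <= expR `|re w|.
Proof.
rewrite cm_half ler_pdivrMr // mulrDr mulr1; apply: le_trans (cmB _ _) _.
by apply: lerD; rewrite ?cexp_absle // -(normrN (re w)) -reN cexp_absle.
Qed.

Let exp_gap w : expR `|re w| - expR (- `|re w|) <= cm (cexp w + cexp (- w)) /\
  expR `|re w| - expR (- `|re w|) <= cm (cexp w - cexp (- w)).
Proof.
have H (a b : C) : cm a - cm b <= cm (a + b) /\ cm a - cm b <= cm (a - b).
  have := cmD (a - b) b; have := cmB (a + b) b.
  by rewrite addrK subrK; lra.
have [w0|w0] := leP 0 (re w).
  rewrite ger0_norm //; have [h1 h2] := H (cexp w) (cexp (- w)).
  by rewrite !cm_cexp reN in h1 h2.
rewrite ltr0_norm // opprK; have [h1 h2] := H (cexp (- w)) (cexp w).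
rewrite !cm_cexp reN in h1 h2; rewrite (cmBC (cexp w)).
by have -> : cexp w + cexp (- w) = cexp (- w) + cexp w by ring.
Qed.

Lemma ccosh_ge w : (expR `|re w| - expR (- `|re w|)) / 2 <= cm (ccosh w).
Proof. by rewrite cm_half ler_pM2r ?invr_gt0 //; have [] := exp_gap w. Qed.

Lemma csinh_ge w : (expR `|re w| - expR (- `|re w|)) / 2 <= cm (csinh w).
Proof. by rewrite cm_half ler_pM2r ?invr_gt0 //; have [] := exp_gap w. Qed.

Lemma exp_gap_lb (x0 x : R) : 0 < x0 -> x0 <= x ->
  (1 - expR (- (2 * x0))) / 2 * expR x <= (expR x - expR (- x)) / 2.
Proof.
move=> x00 xx; have -> : expR (- x) = expR (- (2 * x)) * expR x by rewrite -expRD; congr expR; ring.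
have h : expR (- (2 * x)) <= expR (- (2 * x0)) by rewrite ler_expR; lra.
have h2 : expR (- (2 * x)) * expR x <= expR (- (2 * x0)) * expR x by rewrite ler_wpM2r ?expR_ge0.
lra.
Qed.

Lemma exp_gap_pos (x0 : R) : 0 < x0 -> 0 < (1 - expR (- (2 * x0))) / 2.
Proof.
move=> x00; have : expR (- (2 * x0)) < expR 0 by rewrite ltr_expR; lra.
by rewrite expR0; lra.
Qed.

Lemma csinh_near0 w : cm w <= 1 -> cm (csinh w - w) <= expR 1 * cm w ^+ 2.
Proof.
move=> w1; have h1 := cexp_quad w1; have := @cexp_quad _ (- w); rewrite cmN => /(_ w1) h2.
have -> : csinh w - w = ((cexp w - 1 - w) - (cexp (- w) - 1 - (- w))) / 2 by rewrite /csinh; field.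
by rewrite cm_half ler_pdivrMr //; apply: le_trans (cmB _ _) _; lra.
Qed.

Lemma ccosh_near0 w : cm w <= 1 -> cm (ccosh w - 1) <= expR 1 * cm w.
Proof.
move=> w1; have h1 := cexp_lip w1; have := @cexp_lip _ (- w); rewrite cmN => /(_ w1) h2.
have -> : ccosh w - 1 = ((cexp w - 1) + (cexp (- w) - 1)) / 2 by rewrite /ccosh; field.
by rewrite cm_half ler_pdivrMr //; apply: le_trans (cmD _ _) _; lra.
Qed.

(** The zeros of cosh lie on the imaginary axis, which the sector meets only at 0. For |Re w|
    bounded below the triangle inequality suffices; otherwise the sector condition makes |w| small
    and cosh w close to 1. *)
Lemma sect_ccosh (T : R) : 0 <= T -> exists2 c, 0 < c &
  forall w, in_sect T w -> c * expR `|re w| <= cm (ccosh w).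
Proof.
move=> T0; have e1 : 1 < expR 1 :> R by rewrite -expR0 ltr_expR.
(* For |Re w| < x1 this gives e |w| <= 1/2, hence |cosh w - 1| <= 1/2. *)
pose x1 : R := (2 * expR 1 * (2 + T))^-1; have x10 : 0 < x1.
  by rewrite invr_gt0 mulr_gt0 ?mulr_gt0 ?expR_gt0 // ltr_wpDr.
have x1e : x1 * (2 * expR 1 * (2 + T)) = 1 by rewrite mulVf // gt_eqF // -invr_gt0.
exists (Num.min ((1 - expR (- (2 * x1))) / 2) (2 * expR 1)^-1).
  by rewrite lt_min exp_gap_pos // invr_gt0 mulr_gt0 ?expR_gt0.
move=> w ws; have [xw|xw] := leP x1 `|re w|.
  apply: le_trans (ccosh_ge w); apply: le_trans (exp_gap_lb x10 xw).
  by rewrite ler_wpM2r ?expR_ge0 // ge_min lexx.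
have x11 : x1 <= 1.
  rewrite /x1 invf_le1; last by rewrite -invr_gt0.
  have h1 : expR 1 * 1 <= expR 1 * (2 + T) :> R by rewrite ler_wpM2l ?expR_ge0 //; lra.
  by rewrite -mulrA; lra.
have cw : cm w <= (1 + T) * x1.
  apply: le_trans (cm_le_reim w) _; rewrite mulrDl mul1r lerD ?(ltW xw) //.
  by apply: le_trans ws _; rewrite ler_wpM2l // ltW.
have p1 : expR 1 * ((1 + T) * x1) <= 2^-1.
  have q : 0 <= expR 1 * x1 :> R by rewrite mulr_ge0 ?expR_ge0 // ltW.
  by move: x1e; nra.
have cw1 : cm w <= 1.
  apply: le_trans cw _; have : (1 + T) * x1 <= expR 1 * ((1 + T) * x1).
    by rewrite ler_peMl ?(ltW e1) // mulr_ge0 ?(ltW x10) // addr_ge0.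
  lra.
have h1 := ccosh_near0 cw1.
have h2 : expR 1 * cm w <= 2^-1 by apply: le_trans p1; rewrite ler_wpM2l ?expR_ge0.
have h3 : 2^-1 <= cm (ccosh w) by have := cmB (ccosh w - 1) (ccosh w); rewrite addrAC subrr add0r cmN cm1; lra.
apply: le_trans h3; apply: le_trans (_ : (2 * expR 1)^-1 * expR 1 <= _).
  apply: ler_pM; rewrite ?expR_ge0 //.
  - by rewrite le_min (ltW (exp_gap_pos x10)) invr_ge0 mulr_ge0 ?expR_ge0.
  - by rewrite ge_min lexx orbT.
  - by rewrite ler_expR; lra.
by rewrite invfM -mulrA mulVf ?mulr1 // lt0r_neq0 ?expR_gt0.
Qed.

Let cder_cexpN w : cder (fun x => cexp (- x)) w (- cexp (- w)).
Proof.
apply: gder_eq (gder_comp (g := fun x => - x) (cder_cexp _) (gderN (cder_id w))) _.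
by rewrite mulrN1.
Qed.

Lemma cder_ccosh w : cder ccosh w (csinh w).
Proof.
have -> : ccosh = (fun x : C => 2^-1 * (cexp x + cexp (- x))).
  by apply/funext => x; rewrite /ccosh mulrC.
by apply: gder_eq (gderZ 2^-1 (gderD (cder_cexp w) (cder_cexpN w))) _; rewrite mulrC.
Qed.

Lemma cder_csinh w : cder csinh w (ccosh w).
Proof.
have -> : csinh = (fun x : C => 2^-1 * (cexp x - cexp (- x))).
  by apply/funext => x; rewrite /csinh mulrC.
by apply: gder_eq (gderZ 2^-1 (gderB (cder_cexp w) (cder_cexpN w))) _; rewrite opprK mulrC.
Qed.

Definition cth w := csinh w / ccosh w.

Lemma cthN w : cth (- w) = - cth w.
Proof. by rewrite /cth csinhN ccoshN mulNr. Qed.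

Lemma cth0 : cth 0 = 0.
Proof. by rewrite /cth csinh0 mul0r. Qed.

Lemma cth_sqr w : ccosh w != 0 -> 1 - cth w ^+ 2 = ccosh w ^- 2.
Proof.
move=> n0; have E : csinh w ^+ 2 = ccosh w ^+ 2 - 1 by rewrite -(ccosh_sqr w); ring.
by rewrite /cth expr_div_n E; field.
Qed.

Lemma cder_cth w : ccosh w != 0 -> cder cth w (ccosh w ^- 2).
Proof.
move=> n0; have D := gder_comp (g := ccosh) (cderV n0) (cder_ccosh w).
apply: gder_eq (gderM (cder_csinh w) D) _.
have E := ccosh_sqr w; rewrite -[RHS]mul1r -[in RHS]E; field; exact: n0.
Qed.

(** The Moebius form of tanh: x / sqrt(eps) determines e^(-2w), hence w up to multiples of pi i. *)
Lemma cexp_cth w : ccosh w != 0 -> cexp (- (2 * w)) * (1 + cth w) = 1 - cth w.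
Proof.
move=> n0; have E : cexp w * cexp (- w) = 1 by rewrite -cexpD subrr cexp0.
have -> : - (2 * w) = - w + - w by ring.
have n1 : cexp w + cexp (- w) != 0 by apply: contraNneq n0 => h; rewrite /ccosh h mul0r.
rewrite cexpD /cth /csinh /ccosh; field: E; exact: n1.
Qed.

Local Notation rt := (@Pilot.Defs.sqrte R).

Lemma re_cis u : re (cis u : C) = cos u. Proof. by []. Qed.

Lemma im_cis u : im (cis u : C) = sin u. Proof. by []. Qed.

Lemma cisD u v : cis (u + v) = cis u * cis v :> C.
Proof.
apply: C_eqP; first by rewrite reM !re_cis !im_cis cosD.
by rewrite imM !re_cis !im_cis sinD; ring.
Qed.

Lemma cis0 : cis 0 = 1 :> C.
Proof. by apply: C_eqP; rewrite ?re_cis ?im_cis ?cos0 ?sin0. Qed.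

Lemma cisNK u : cis u * cis (- u) = 1 :> C.
Proof. by rewrite -cisD subrr cis0. Qed.

Lemma cm_cis u : cm (cis u : C) = 1.
Proof.
have E : cis u = cexp (ci * Rc u) :> C.
  by apply: C_eqP; rewrite ?re_cexp ?im_cexp reM imM re_Rc im_Rc /= !mul0r !mul1r ?subrr ?addr0 ?add0r expR0 !mul1r.
by rewrite E cm_cexp reM re_Rc im_Rc /= mul0r mul1r subrr expR0.
Qed.

Lemma cis_neq0 u : cis u != 0 :> C.
Proof. by rewrite -cm_gt0 cm_cis. Qed.

Lemma cisN_V u : cis (- u) = (cis u)^-1 :> C.
Proof. by apply: (mulfI (cis_neq0 u)); rewrite cisNK mulfV // cis_neq0. Qed.

Lemma dirv_tan u : cos u != 0 -> dirv (tan u) = Rc (cos u)^-1 * cis u :> C.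
Proof.
move=> cu; apply: C_eqP; rewrite /dirv !(reD, imD, reM, imM, re_Rc, im_Rc) re_cis ?im_cis /= /tan.
  by field.
by field.
Qed.

Lemma cm_rt z : cm (rt z) = expR (re z / 2).
Proof.
rewrite cm_cexp; congr expR.
rewrite -[2^-1](_ : Rc 2^-1 = _); last by rewrite RcV Rc_nat.
by rewrite mulrC reM re_Rc im_Rc mul0r subr0 mulrC.
Qed.

Lemma rt_sqr z : rt z ^+ 2 = cexp z.
Proof. by rewrite expr2 -cexpD -splitr. Qed.

Lemma cm_eps z : cm (cexp z) = cm (rt z) ^+ 2.
Proof. by rewrite -rt_sqr cmX. Qed.

Lemma rt_neq0 z : rt z != 0.
Proof. exact: cexp_neq0. Qed.

(** The argument of - sqrt(hat-eps). S is symmetric about phi = 0, where hat_theta = 0 and the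
    domains are not tilted. *)
Definition phi z := im z / 2 - pi.

Lemma rt_cis z : rt z = - (Rc (cm (rt z)) * cis (phi z)).
Proof.
have E1 : re (z / 2) = re z / 2 /\ im (z / 2) = im z / 2.
  rewrite -[2^-1](_ : Rc 2^-1 = _); last by rewrite RcV Rc_nat.
  by rewrite mulrC reM imM re_Rc im_Rc !mul0r subr0 addr0; split; rewrite mulrC.
have Ep : im z / 2 = phi z + pi by rewrite /phi subrK.
rewrite cm_rt; apply: C_eqP.
  rewrite re_cexp (proj1 E1) (proj2 E1) Ep cosDpi.
  by rewrite reN reM re_Rc im_Rc mul0r subr0 re_cis mulrN.
rewrite im_cexp (proj1 E1) (proj2 E1) Ep sinDpi.
by rewrite imN imM re_Rc im_Rc mul0r addr0 im_cis mulrN.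
Qed.

(** * Angles attached to the sector S *)

Section Angles.
Variable gamma : R.
Hypothesis gamma0 : 0 < gamma.
(** The supremum of |hat_theta| over S, approached as |phi| tends to pi/2 + gamma. *)
Definition bigT : R := gamma * (1 + 2 * gamma / pi).
Hypothesis gammaT : bigT < pi / 2.

Lemma cos_decr (u v : R) : 0 <= u -> u <= v -> v <= pi -> cos v <= cos u.
Proof.
move=> u0; rewrite le_eqVlt => /orP[/eqP -> //|uv vp]; apply: ltW.
rewrite ltr_cos // in_itv /=; lra.
Qed.

(** The tilt of the strip in the coordinate w: in the time t the tilt is hat_theta, and
    multiplication by sqrt(eps) rotates lines by phi. *)
Definition psi z := phi z * (1 - 2 * gamma / pi).

Definition thet z := psi z - phi z.

Definition arg_ok z := pi - 2 * gamma < im z < 3 * pi + 2 * gamma.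

Let pp : 0 < (pi : R). Proof. exact: pi_gt0. Qed.

Lemma thetE z : thet z = hat_theta gamma z.
Proof. by rewrite /thet /psi /hat_theta /phi; have := lt0r_neq0 (pi_gt0 R); move: (pi : R) => P P0; field. Qed.

Lemma angle_gap : exists2 x, 2 * gamma ^+ 2 / pi = x & [/\ 0 < x, gamma + x = bigT & gamma + x < pi / 2].
Proof.
have E : gamma + 2 * gamma ^+ 2 / pi = bigT by rewrite /bigT; have := lt0r_neq0 (pi_gt0 R); move: (pi : R) => P P0; field.
exists (2 * gamma ^+ 2 / pi) => //; split=> //; last by rewrite E.
by rewrite divr_gt0 ?mulr_gt0 ?exprn_gt0.
Qed.

(** Since |psi| < (pi/2 + gamma)(1 - 2 gamma/pi) = pi/2 - 2 gamma^2/pi, this is a positive lower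
    bound for cos psi. The tilt is what keeps cos psi positive although |phi| may exceed pi/2. *)
Definition del0 : R := sin (2 * gamma ^+ 2 / pi).

Lemma del0_gt0 : 0 < del0.
Proof.
rewrite /del0; have [x -> [x0 _ xE]] := angle_gap; apply: sin_gt0_pi.
by rewrite x0 /=; move: gamma0 pp; lra.
Qed.

Lemma phi_lt z : arg_ok z -> `|phi z| < pi / 2 + gamma.
Proof. by rewrite /arg_ok /phi ltr_norml => /andP[h1 h2]; apply/andP; split; lra. Qed.

Let lamE : exists2 x, 2 * gamma / pi = x & 0 < x /\ x < 1.
Proof.
have [y yE [y0 _ yT]] := angle_gap; exists (2 * gamma / pi) => //.
rewrite divr_gt0 ?mulr_gt0 //; split=> //; rewrite ltr_pdivrMr // mul1r; move: gamma0 pp; lra.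
Qed.

Lemma thet_le z : arg_ok z -> `|thet z| <= bigT.
Proof.
move=> /phi_lt h; have [x xE [x0 x1]] := lamE.
have -> : thet z = - (x * phi z) by rewrite /thet /psi -xE; ring.
rewrite normrN normrM gtr0_norm //; apply: le_trans (ler_wpM2l (ltW x0) (ltW h)) _.
by rewrite le_eqVlt; apply/orP; left; apply/eqP; rewrite -xE /bigT; have := lt0r_neq0 (pi_gt0 R); move: (pi : R) => P P0; field.
Qed.

Lemma psi_lt z : arg_ok z -> `|psi z| < pi / 2 - 2 * gamma ^+ 2 / pi.
Proof.
move=> /phi_lt h; have [x xE [x0 x1]] := lamE.
rewrite /psi xE normrM (@gtr0_norm _ (1 - x)); last by lra.
have -> : pi / 2 - 2 * gamma ^+ 2 / pi = (pi / 2 + gamma) * (1 - x).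
  by rewrite -xE; have := lt0r_neq0 (pi_gt0 R); move: (pi : R) => P P0; field.
by rewrite ltr_pM2r //; lra.
Qed.

Lemma cos_psi z : arg_ok z -> del0 <= cos (psi z) <= 1.
Proof.
move=> az; rewrite cos_le1 andbT; have := psi_lt az.
have [x xE [x0 _ xT]] := angle_gap; rewrite /del0 xE => h.
have -> : sin x = cos (pi / 2 - x) by rewrite cosB cos_pihalf sin_pihalf mul0r add0r mul1r.
have Ec : cos (psi z) = cos `|psi z|.
  by have [p0|p0] := leP 0 (psi z); [rewrite (ger0_norm p0)|rewrite (ltr0_norm p0) cosN].
rewrite Ec; apply: cos_decr => //; move: gamma0 pp; lra.
Qed.

Lemma cos_psi_gt0 z : arg_ok z -> 0 < cos (psi z).
Proof. by move=> /cos_psi/andP[h _]; apply: lt_le_trans h; exact: del0_gt0. Qed.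

Lemma tan_psi z : arg_ok z -> `|tan (psi z)| <= del0^-1.
Proof.
move=> az; have c0 := cos_psi_gt0 az; have /andP[c1 _] := cos_psi az.
rewrite /tan normrM normfV (gtr0_norm c0).
apply: le_trans (_ : 1 * (cos (psi z))^-1 <= _).
  by rewrite ler_wpM2r ?invr_ge0 ?(ltW c0) // ler_norml sin_geN1 sin_le1.
by rewrite mul1r lef_pV2 ?posrE // del0_gt0.
Qed.

Lemma cos_thet z : arg_ok z -> 0 < cos bigT /\ cos bigT <= cos (thet z).
Proof.
move=> az; have h := thet_le az; have T0 : 0 <= bigT by apply: le_trans h.
have gT := gammaT; split; first by apply: cos_gt0_pihalf; rewrite gammaT andbT; move: T0 pp; move: (bigT) => b; lra.
have Ec : cos (thet z) = cos `|thet z|.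
  by have [p0|p0] := leP 0 (thet z); [rewrite (ger0_norm p0)|rewrite (ltr0_norm p0) cosN].
rewrite Ec; apply: cos_decr => //; move: h T0 gT pp; move: (bigT) => b; lra.
Qed.

Lemma arg_ok_open z : arg_ok z -> exists2 d, 0 < d & forall x, cm x < d -> arg_ok (z + x).
Proof.
rewrite /arg_ok => /andP[h1 h2].
exists (Num.min (im z - (pi - 2 * gamma)) (3 * pi + 2 * gamma - im z)).
  by rewrite lt_min; apply/andP; split; lra.
move=> x; rewrite lt_min imD => /andP[x1 x2]; have := im_le_cm x.
by rewrite ler_norml => /andP[y1 y2]; apply/andP; split; lra.
Qed.

Lemma tan_psi_cont z : arg_ok z -> forall e, 0 < e -> exists2 d, 0 < d &
  forall x, cm x < d -> `|tan (psi (z + x)) - tan (psi z)| < e.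
Proof.
move=> az e e0; have [x xE [x0 x1]] := lamE.
have /(continuous_tan)/cvgrPdist_lt/(_ e e0) := lt0r_neq0 (cos_psi_gt0 az).
rewrite near_simpl -nbhs_nearE => /nbhs_ballP[d /= d0 H].
exists d => // y yd; rewrite distrC; apply: H; rewrite /ball /=.
have -> : psi z - psi (z + y) = - (im y / 2 * (1 - x)) by rewrite /psi /phi imD -xE; ring.
rewrite normrN normrM normrM; apply: le_lt_trans yd; apply: le_trans (im_le_cm y).
rewrite (@gtr0_norm _ (1 - x)); last by lra.
rewrite (@ger0_norm _ 2^-1) //; have := normr_ge0 (im y).
by move: (`|im y|) => Q Q0; nra.
Qed.

End Angles.

(** x = sqrt(eps) tanh w is finite and |x| < r1, written without a quotient so that openness follows
    from the continuity of sinh and cosh. *)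
Definition good (r1 : R) z w := ccosh w != 0 /\ cm (rt z * csinh w) < r1 * cm (ccosh w).

Lemma good_cth r1 z w : good r1 z w -> cm (rt z * cth w) < r1.
Proof.
move=> [n0 h]; have c0 : 0 < cm (ccosh w) by rewrite cm_gt0.
by rewrite /cth mulrA cmM cmV // ltr_pdivrMr.
Qed.

Lemma good_of_cth r1 z w : ccosh w != 0 -> cm (rt z * cth w) < r1 -> good r1 z w.
Proof.
move=> n0; have c0 : 0 < cm (ccosh w) by rewrite cm_gt0.
by rewrite /cth mulrA cmM cmV // ltr_pdivrMr.
Qed.

Lemma hol2_rt (U : C -> C -> Prop) : opn2 U -> hol2 U (fun z _ => rt z).
Proof.
move=> oU; apply: (hol2_cexp oU (f := fun z _ => z / 2)).
by apply: hol2_M; [exact: hol2_fst|exact: hol2_cst].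
Qed.

Lemma hol2_ccosh (U : C -> C -> Prop) f : opn2 U -> hol2 U f -> hol2 U (fun p w => ccosh (f p w)).
Proof.
move=> oU hf; apply: (hol2_comp1 (W := fun=> True) oU _ _ hf) => // x _; first by exists 1.
by eexists; exact: cder_ccosh.
Qed.

Lemma hol2_csinh (U : C -> C -> Prop) f : opn2 U -> hol2 U f -> hol2 U (fun p w => csinh (f p w)).
Proof.
move=> oU hf; apply: (hol2_comp1 (W := fun=> True) oU _ _ hf) => // x _; first by exists 1.
by eexists; exact: cder_csinh.
Qed.

Lemma opn2T : opn2 (fun _ _ : C => True).
Proof. by move=> p w _; exists 1. Qed.

Lemma good_open r1 : opn2 (good r1).
Proof.
move=> z w [n0 h]; pose T2 := fun _ _ : C => True.
have hs : hol2 T2 (fun z w => rt z * csinh w).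
  by apply: hol2_M; [exact: hol2_rt opn2T|exact: (hol2_csinh (f := fun _ w => w) opn2T (@hol2_snd _ _))].
have hc : hol2 T2 (fun _ w => ccosh w) by exact: (hol2_ccosh (f := fun _ w => w) opn2T (@hol2_snd _ _)).
have c0 : 0 < cm (ccosh w) by rewrite cm_gt0.
have r0 : 0 < r1 by rewrite -(pmulr_lgt0 _ c0); apply: le_lt_trans h; exact: cm_ge0.
pose gp := r1 * cm (ccosh w) - cm (rt z * csinh w).
have g0 : 0 < gp by rewrite subr_gt0.
have e0 : 0 < Num.min (cm (ccosh w)) (gp / (2 * (r1 + 1))).
  by rewrite lt_min c0 divr_gt0 // mulr_gt0 //; lra.
have [d1 d10 H1] := @hol2_cont R T2 _ z w opn2T hs I _ (divr_gt0 g0 (ltr0Sn _ 1)).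
have [d2 d20 H2] := @hol2_cont R T2 _ z w opn2T hc I _ e0.
exists (Num.min d1 d2); first by rewrite lt_min d10.
move=> x y; rewrite !lt_min => /andP[x1 x2] /andP[y1 y2].
have := H2 x y x2 y2; rewrite lt_min => /andP[h2 h3]; have h1 := H1 x y x1 y1.
have t1 := cm_tri (ccosh w) 0 (ccosh (w + y)); rewrite !subr0 (cmBC (ccosh w)) in t1.
split; first by rewrite -cm_gt0; lra.
have t2 := cm_tri (rt (z + x) * csinh (w + y)) 0 (rt z * csinh w); rewrite !subr0 in t2.
have h4 : r1 * cm (ccosh (w + y) - ccosh w) <= gp / 2.
  apply: le_trans (ler_wpM2l (ltW r0) (ltW h3)) _.
  have -> : r1 * (gp / (2 * (r1 + 1))) = gp / 2 * (r1 / (r1 + 1)) by field; rewrite gt_eqF //; clear -r0; lra.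
  rewrite ler_piMr ?divr_ge0 ?(ltW g0) // ler_pdivrMr; clear -r0; lra.
have h5 : r1 * cm (ccosh w) <= r1 * cm (ccosh (w + y) - ccosh w) + r1 * cm (ccosh (w + y)).
  by rewrite -mulrDr ler_wpM2l // ltW.
move: h1 h4 h5 t2; rewrite /gp; clear exp_gap cder_cexpN n0 h hs hc c0 r0 g0 e0 d10 H1 d20 H2 x1 x2 y1 y2
    h2 h3 t1; lra.
Qed.

(** * Growth rates and coefficients over S *)

Section SectorData.
Variables (gamma : R) (n : nat) (L0 L1 : 'I_n -> C -> C) (Rm : 'I_n -> 'I_n -> C -> C -> C) (r1 MB c1 : R).
Hypotheses (gamma0 : 0 < gamma) (gammaT : bigT gamma < pi / 2) (r1_gt0 : 0 < r1) (MB_ge0 : 0 <= MB) (c1_gt0 : 0 < c1).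
Hypothesis L0_cont : forall e, 0 < e -> exists2 d, 0 < d & forall i x, cm x < d -> cm (L0 i x - L0 i 0) <= e.
Hypothesis B_bound : forall i k x y, cm x < r1 -> cm y < r1 ->
  [/\ cm (L0 i x) <= MB, cm (L1 i x) <= MB & cm (Rm i k x y) <= MB].
Hypothesis gap_lb : forall (i k : 'I_n) th, (i < k)%N -> `|th| <= bigT gamma ->
  2 * c1 <= re (cis th * (L0 i 0 - L0 k 0)).

(* With x = sqrt(eps) tanh w the system (x^2 - eps) y' = B y becomes
   dy_i/dw = - lambda_i / sqrt(eps) y_i + sum_k qf_ik y_k; dividing the j-th
   column by the j-th model solution replaces the exponents by [kapf j]. *)
Definition kapf (j : 'I_n) z i w := - (rt z)^-1 * (L0 i (cexp z) - L0 j (cexp z) +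
  (L1 i (cexp z) - L1 j (cexp z)) * (rt z * cth w)).

Definition qf z i k w := rt z * ccosh w ^- 2 * Rm i k (cexp z) (rt z * cth w).

Lemma kapf_swap j z i w : kapf j z i w = - kapf i z j w.
Proof. by rewrite /kapf; ring. Qed.

Let cm_rt_gt0 z : 0 < cm (rt z). Proof. by rewrite cm_gt0 cexp_neq0. Qed.

Lemma abs_range (t e v d : R) : `|t| <= d -> e <= 1 -> t - e <= v <= t + e -> `|v| <= d + 1.
Proof. by rewrite !ler_norml => /andP[t1 t2] e1 /andP[v1 v2]; apply/andP; split; lra. Qed.

Let gdiff (i k : 'I_n) := L0 i 0 - L0 k 0.

Let g2 i k : cm (gdiff i k) <= 2 * MB.
Proof.
have r10 := r1_gt0; have z0 : cm (0 : C) < r1 by rewrite cm0.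
have [b1 _ _] := B_bound i i z0 z0; have [b2 _ _] := B_bound k i z0 z0.
apply: le_trans (cmB _ _) _; have -> : 2 * MB = MB + MB by ring.
exact: lerD.
Qed.

(** The direction 1 + i tan psi is e^(i psi) / cos psi and -1/sqrt(eps) is e^(-i phi) / s, so the
    gap at 0 is rotated by psi - phi = hat_theta and has real part at least 2 c1. Half of this pays
    for the errors: c1/2 for the deviation of the slope, c1/4 each for [D] and [E], the dependence
    of the exponents on eps and on x. *)
Let up_est z s T eta (i k : 'I_n) v w D E : cm (rt z) = s -> 0 < s -> arg_ok gamma z -> 0 <= T ->
  `|v| <= T -> `|v - tan (psi gamma z)| <= eta -> (i < k)%N -> eta * (2 * MB) <= c1 / 2 ->
  D = L0 i (cexp z) - L0 i 0 - (L0 k (cexp z) - L0 k 0) ->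
  E = (L1 i (cexp z) - L1 k (cexp z)) * (rt z * cth w) ->
  (1 + T) * cm D <= c1 / 4 -> (1 + T) * cm E <= c1 / 4 ->
  c1 / s <= re (dirv v * kapf k z i w).
Proof.
move=> sE s0 az T0 v1 vv ik eM DE EE D2 E2; have c10 := c1_gt0.
have cp0 := cos_psi_gt0 gamma0 gammaT az; have /andP[_ cp1] := cos_psi gamma0 gammaT az.
have sinv : - (rt z)^-1 = Rc s^-1 * cis (- phi z).
  by rewrite rt_cis sE invrN opprK invfM cisN_V RcV.
have kE : kapf k z i w = Rc s^-1 * cis (- phi z) * (gdiff i k + (D + E)).
  by rewrite /kapf sinv DE EE /gdiff; ring.
have dE : dirv v = Rc (cos (psi gamma z))^-1 * cis (psi gamma z) + ci * Rc (v - tan (psi gamma z)).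
  by rewrite -dirv_tan ?(lt0r_neq0 cp0) // /dirv RcB; ring.
have gl := gap_lb ik (thet_le gamma0 gammaT az); rewrite -/(gdiff i k) in gl.
have gg := g2 i k; move: (gdiff i k) kE gl gg => g kE gl gg.
have tE : cis (thet gamma z) = cis (psi gamma z) * cis (- phi z) :> C by rewrite /thet cisD.
have dv : cm (dirv v) <= 1 + T.
  by apply: le_trans (cmD _ _) _; rewrite cm1 cmM cm_ci mul1r cm_Rc lerD2l.
have [X XE] : exists X, X = cis (- phi z) * (ci * Rc (v - tan (psi gamma z))) * g + cis (- phi z) * dirv v * (D + E).
  by eexists.
have -> : dirv v * kapf k z i w =
   Rc (s^-1 * (cos (psi gamma z))^-1) * (cis (thet gamma z) * g) + Rc s^-1 * X.
  by rewrite kE XE tE RcM dE; ring.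
rewrite reD reM re_Rc im_Rc mul0r subr0.
have X1 : cm X <= c1.
  rewrite XE; apply: le_trans (cmD _ _) _; rewrite !cmM !cm_cis !mul1r cm_ci mul1r cm_Rc.
  have h3 : `|v - tan (psi gamma z)| * cm g <= eta * (2 * MB) by apply: ler_pM; rewrite ?cm_ge0.
  have h4 : cm (dirv v) * cm (D + E) <= (1 + T) * (cm D + cm E) by apply: ler_pM; rewrite ?cm_ge0 ?cmD.
  move: h3 h4 D2 E2 eM; move: (_ * cm g) (cm (dirv v) * _) (cm D) (cm E) => x1 x2 x3 x4; clear exp_gap
    cder_cexpN gamma0 gammaT r1_gt0 MB_ge0 c1_gt0 L0_cont B_bound gap_lb cm_rt_gt0 g2 sE s0 T0 v1 vv ik DE
    EE c10 cp0 cp1 sinv dE kE gl gg tE dv XE; lra.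
have q1 : 1 <= (cos (psi gamma z))^-1 by rewrite invf_ge1.
have q0 : 0 <= re (cis (thet gamma z) * g) by exact: (le_trans (mulr_ge0 (ler0n _ 2) (ltW c10)) gl).
have q2 := ler_peMl q0 q1.
have si0 : 0 <= s^-1 by rewrite invr_ge0 ltW.
have h5 : s^-1 * (2 * c1) <= s^-1 * (cos (psi gamma z))^-1 * re (cis (thet gamma z) * g).
  by rewrite -mulrA; apply: ler_wpM2l => //; exact: le_trans gl q2.
have h6 : - (s^-1 * c1) <= re (Rc s^-1 * X).
  have := re_le_cm (Rc s^-1 * X); rewrite cm_Rc_mul // ler_norml => /andP[h _].
  by apply: le_trans h; rewrite lerN2; exact: ler_wpM2l.
rewrite [c1 / s]mulrC; move: h5 h6; move: (s^-1 * _ * _) (re (Rc _ * X)) => y1 y2; clear exp_gap cder_cexpN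
    gamma0 gammaT r1_gt0 MB_ge0 c1_gt0 L0_cont B_bound gap_lb cm_rt_gt0 g2 sE s0 T0 v1 vv ik eM DE EE D2 E2
    c10 cp0 cp1 sinv dE kE gl gg tE dv XE X1 q1 q0 q2 si0; lra.
Qed.

Lemma sector_data : exists T eta C1 s1 : R, [/\ 0 < eta, 0 <= C1, 0 < s1 &
  forall z, cm (rt z) < s1 -> arg_ok gamma z ->
   (forall w, in_sect T w -> good r1 z w) /\
   forall j : 'I_n, coldata j (fun i : 'I_n => (i < j)%N) (fun i : 'I_n => (j < i)%N) (kapf j z) (qf z) T
     (c1 / cm (rt z)) (C1 * cm (rt z)) (tan (psi gamma z) - eta) (tan (psi gamma z) + eta)].
Proof.
have c10 := c1_gt0; have MB0 := MB_ge0; have r10 := r1_gt0.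
(* T dominates every slope in use: |tan psi| <= 1/del0 and eta <= 1. *)
have d00 := del0_gt0 gamma0 gammaT; have [T TE] : exists T : R, T = (del0 gamma)^-1 + 1 by eexists.
have T0 : 0 <= T by rewrite TE addr_ge0 // invr_ge0 ltW.
have [c c0 Hc] := sect_ccosh T0.
have [eta etaE] : exists eta : R, eta = Num.min 1 (c1 / (4 * (MB + 1))) by eexists.
have M1 : 0 < MB + 1 by lra.
have eta0 : 0 < eta by rewrite etaE lt_min ltr01 divr_gt0 // mulr_gt0.
have etaM : eta * (4 * (MB + 1)) <= c1.
  by rewrite -ler_pdivlMr ?mulr_gt0 // etaE ge_min lexx orbT.
have e2M : eta * (2 * MB) <= c1 / 2 by move: etaM eta0; lra.
have eta1 : eta <= 1 by rewrite etaE ge_min lexx.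
have T1 : 0 < 1 + T by lra.
have e0 : 0 < c1 / (8 * (1 + T)) by rewrite divr_gt0 // mulr_gt0.
have [d dd0 Hd] := L0_cont e0.
have [C1 C1E] : exists C1 : R, C1 = c ^- 2 * MB by eexists.
have C10 : 0 <= C1 by rewrite C1E mulr_ge0 // invr_ge0 exprn_ge0 // ltW.
(* Each summand of K is the reciprocal of one bound that |sqrt(eps)| has to respect, so |sqrt(eps)|
   < 1/K enforces all of them at once. *)
have [K KE] : exists K : R, K = 1 + d^-1 + r1^-1 + (c * r1)^-1 + 2 * MB / c * (4 * (1 + T) / c1) + 2 / c1 + 8 * ((1 + T) * (n%:R * C1)) by eexists.
have K1 : [/\ 0 <= d^-1, 0 <= r1^-1, 0 <= (c * r1)^-1, 0 <= 2 * MB / c * (4 * (1 + T) / c1) &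
   0 <= 2 / c1 /\ 0 <= 8 * ((1 + T) * (n%:R * C1))].
  split; try split.
  - by rewrite invr_ge0 ltW.
  - by rewrite invr_ge0 ltW.
  - by rewrite invr_ge0 mulr_ge0 // ltW.
  - by rewrite !mulr_ge0 ?invr_ge0 ?(ltW c0) ?(ltW c1_gt0) ?(ltW T1).
  - by rewrite divr_ge0 // ltW.
  - by apply: mulr_ge0 => //; apply: mulr_ge0; [exact: ltW|apply: mulr_ge0].
have K0 : 0 < K by move: K1 => [? ? ? ? [? ?]]; rewrite KE; clear exp_gap cder_cexpN gamma0 gammaT r1_gt0
    MB_ge0 c1_gt0 L0_cont B_bound gap_lb cm_rt_gt0 g2 c10 MB0 r10 d00 TE T0 c0 Hc etaE M1 eta0 etaM e2M
    eta1 T1 e0 dd0 Hd C1E C10 KE; lra.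
exists T, eta, C1, K^-1; split=> //; first by rewrite invr_gt0.
move=> z; have [s sE] : exists s, cm (rt z) = s by eexists.
have := cm_rt_gt0 z; rewrite sE => s0 sK az.
have {}sK : s * K < 1 by rewrite -ltr_pdivlMr // mul1r.
have sKi x : x <= K -> s * x < 1 by move=> xK; apply: le_lt_trans sK; rewrite ler_wpM2l // ltW.
have [s1 sd sr [scr sE'] [sa sg]] : [/\ s < 1, s < d, s < r1, s < c * r1 /\
   s * (2 * MB / c * (4 * (1 + T) / c1)) < 1 & s * (2 / c1) < 1 /\ s * (8 * ((1 + T) * (n%:R * C1))) < 1].
  move: K1 => [k1 k2 k3 k4 [k5 k6]].
  split; first by rewrite -[s]mulr1; apply: sKi; rewrite KE; lra.
  - by rewrite -[d]mul1r -ltr_pdivrMr //; apply: sKi; rewrite KE; clear exp_gap cder_cexpN gamma0 gammaT r1_gt0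
    MB_ge0 c1_gt0 L0_cont B_bound gap_lb cm_rt_gt0 g2 c10 MB0 r10 d00 TE T0 c0 Hc etaE M1 eta0 etaM e2M
    eta1 T1 e0 dd0 Hd C1E C10 KE K0 sE s0 sK k1; lra.
  - by rewrite -[r1]mul1r -ltr_pdivrMr //; apply: sKi; rewrite KE; clear exp_gap cder_cexpN gamma0 gammaT
    r1_gt0 MB_ge0 c1_gt0 L0_cont B_bound gap_lb cm_rt_gt0 g2 c10 MB0 r10 d00 TE T0 c0 Hc etaE M1 eta0 etaM
    e2M eta1 T1 e0 dd0 Hd C1E C10 KE K0 sE s0 sK k2; lra.
  - split; last by apply: sKi; rewrite KE; lra.
    by rewrite -[c * r1]mul1r -ltr_pdivrMr ?mulr_gt0 //; apply: sKi; rewrite KE; clear exp_gap cder_cexpN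
    gamma0 gammaT r1_gt0 MB_ge0 c1_gt0 L0_cont B_bound gap_lb cm_rt_gt0 g2 c10 MB0 r10 d00 TE T0 c0 Hc etaE
    M1 eta0 etaM e2M eta1 T1 e0 dd0 Hd C1E C10 KE K0 sE s0 sK k3; lra.
  - by split; apply: sKi; rewrite KE; clear exp_gap cder_cexpN gamma0 gammaT r1_gt0 MB_ge0 c1_gt0 L0_cont
    B_bound gap_lb cm_rt_gt0 g2 c10 MB0 r10 d00 TE T0 c0 Hc etaE M1 eta0 etaM e2M eta1 T1 e0 dd0 Hd C1E C10
    KE K0 sE s0 sK; lra.
have es : cm (cexp z) <= s by rewrite cm_eps sE expr2 ler_piMl ?(ltW s0) ?(ltW s1).
have cw w : in_sect T w -> [/\ c * expR `|re w| <= cm (ccosh w), ccosh w != 0 & cm (cth w) <= c^-1].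
  move=> ws; have h := Hc w ws.
  have h0 : 0 < cm (ccosh w) by apply: lt_le_trans h; rewrite mulr_gt0 ?expR_gt0.
  split=> //; first by rewrite -cm_gt0.
  rewrite /cth cmM cmV ler_pdivrMr // mulrC ler_pdivlMr //.
  by apply: le_trans h; rewrite mulrC ler_wpM2l ?csinh_le // ltW.
have xw w : in_sect T w -> cm (rt z * cth w) <= s / c.
  by move=> /cw[_ _ h]; rewrite cmM sE ler_wpM2l // ltW.
have scr' : s / c < r1 by rewrite ltr_pdivrMr // mulrC.
have gw w : in_sect T w -> good r1 z w.
  by move=> ws; apply: good_of_cth; [have [] := cw w ws|apply: le_lt_trans (xw w ws) scr'].
split=> // j.
have er : cm (cexp z) < r1 by apply: le_lt_trans es sr.
have z0 : cm (0 : C) < r1 by rewrite cm0.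
have tp := tan_psi gamma0 gammaT az.
have vT v : tan (psi gamma z) - eta <= v <= tan (psi gamma z) + eta -> `|v| <= T.
  by rewrite TE; exact: abs_range.
have up (i k : 'I_n) v w : (i < k)%N -> tan (psi gamma z) - eta <= v <= tan (psi gamma z) + eta ->
    in_sect T w -> c1 / s <= re (dirv v * kapf k z i w).
  move=> ik vv ws.
  have hv : `|v - tan (psi gamma z)| <= eta by rewrite ler_distl.
  apply: (up_est sE s0 az T0 (vT v vv) hv ik e2M erefl erefl).
    have h1 := Hd i (cexp z) (le_lt_trans es sd); have h2 := Hd k (cexp z) (le_lt_trans es sd).
    apply: le_trans (ler_wpM2l (ltW T1) (le_trans (cmB _ _) (lerD h1 h2))) _.
    by rewrite le_eqVlt; apply/orP; left; apply/eqP; field; rewrite gt_eqF.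
  have [_ b1 _] := B_bound i i er z0; have [_ b2 _] := B_bound k i er z0.
  rewrite cmM; apply: le_trans (ler_wpM2l (ltW T1) (ler_pM (cm_ge0 _) (cm_ge0 _) (le_trans (cmB _ _) (lerD b1 b2)) (xw w ws))) _.
  have -> : (1 + T) * ((MB + MB) * (s / c)) = s * (2 * MB / c * (4 * (1 + T) / c1)) * (c1 / 4).
    by field; rewrite !gt_eqF.
  by rewrite -[leRHS]mul1r ler_wpM2r ?(ltW sE') // divr_ge0 // ltW.
split=> //.
- by move=> i; rewrite -val_eqE /=; case: ltngtP.
- rewrite (ler_pdivlMr _ _ s0) -[leRHS]mul1r.
  have -> : 2 * s = s * (2 / c1) * c1 by rewrite mulrA divfK ?(lt0r_neq0 c10) // mulrC.
  exact: (ler_wpM2r (ltW c10) (ltW sa)).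
- exact: (mulr_ge0 C10 (ltW s0)).
- by move=> i v w ij vv ws; exact: up.
- move=> i v w ij vv ws; rewrite kapf_swap mulrN reN lerN2; exact: up.
- by move=> w; rewrite /kapf !subrr mul0r add0r mulr0.
- move=> i k w ws; have [h1 h2 h3] := cw w ws.
  have [_ _ hR] := B_bound i k er (le_lt_trans (xw w ws) scr').
  have e1' : 1 <= expR `|re w| by rewrite -[X in X <= _]expR0 ler_expR.
  have e0' := lt_le_trans ltr01 e1'.
  have hX : (cm (ccosh w) ^+ 2)^-1 <= c ^- 2 * expR (- `|re w|).
    have cc0 : 0 < cm (ccosh w) by rewrite cm_gt0.
    rewrite expRN -invfM lef_pV2 ?posrE ?mulr_gt0 ?exprn_gt0 //.
    apply: le_trans (_ : (c * expR `|re w|) ^+ 2 <= _).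
      rewrite exprMn; apply: ler_wpM2l; first by rewrite exprn_ge0 // ltW.
      by rewrite expr2 ler_peMr // ltW.
    by rewrite ler_pXn2r ?nnegrE ?mulr_ge0 ?(ltW c0) ?(ltW e0') ?cm_ge0.
  have -> : C1 * s * expR (- `|re w|) = s * (c ^- 2 * expR (- `|re w|)) * MB by rewrite C1E; ring.
  have s0' := ltW s0; rewrite /qf cmM cmM cmV cmX sE; apply: ler_pM => //.
  - by apply: (mulr_ge0 s0'); rewrite invr_ge0 exprn_ge0 ?cm_ge0.
  - exact: cm_ge0.
  - exact: ler_wpM2l.
- have -> : 8 * ((1 + T) * (n%:R * (C1 * s))) = s * (8 * ((1 + T) * (n%:R * C1))) by ring.
  exact: ltW.
Qed.

End SectorData.

End Hyperbolic.

(** * Continuation of solutions *)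

Section Continuation.
Context {R : realType}.
Local Notation C := (cplx R).
Implicit Types (z w a b l : C) (u v e d M : R).
Opaque cexp.

Lemma opn2_pre (V : C -> C -> Prop) (a b : C -> C -> C) : opn2 V ->
  hol2 (fun _ _ => True) a -> hol2 (fun _ _ => True) b -> opn2 (fun p w => V (a p w) (b p w)).
Proof.
move=> oV ha hb p w Vp; have [d d0 Hd] := oV _ _ Vp.
have oT : opn2 (fun _ _ : C => True) by move=> ? ? _; exists 1.
have [d1 d10 H1] := @hol2_cont R _ _ p w oT ha I _ d0.
have [d2 d20 H2] := @hol2_cont R _ _ p w oT hb I _ d0.
exists (Num.min d1 d2); first by rewrite lt_min d10.
move=> x y; rewrite !lt_min => /andP[x1 x2] /andP[y1 y2].
have := Hd _ _ (H1 _ _ x1 y1) (H2 _ _ x2 y2).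
by rewrite !(addrC _ (_ - _)) !subrK.
Qed.

Lemma hol2_entire (c : C -> C) : (forall z, cdiff c z) -> hol2 (fun _ _ => True) (fun z _ => c z).
Proof. by move=> hc; apply: (hol1 (W := fun=> True)) => x _; exact: hc. Qed.

Section Glue.
Variables (n : nat) (G : C -> C -> Prop) (A : C -> C -> 'M[C]_n).
Hypotheses (oG : opn2 G) (hA : hol2mx G A).

Lemma seg_bound z a b : (forall u, 0 <= u <= 1 -> G z (segp a b u)) ->
  exists2 M, 0 <= M & forall i k u, 0 <= u <= 1 -> cm (A z (segp a b u) i k) <= M.
Proof.
move=> Hs.
have [M HM] : exists M, forall i (x : 'I_n * {u : R | 0 <= u <= 1}),
    cm (A z (segp a b (sval x.2)) i x.1) <= M.
  apply: bounded_fin => i.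
  have [M HM] : exists M, forall k (x : {u : R | 0 <= u <= 1}), cm (A z (segp a b (sval x)) i k) <= M.
    apply: bounded_fin => k.
    have [|M HM] := @path_bounded R (fun u => A z (segp a b u) i k) 0 1 ler01.
      move=> u u01; have [_ [l Hl] _] := hA i k (Hs u u01).
      by exists (l * (b - a)); exact: cder_line Hl.
    by exists M => -[u u01]; exact: HM.
  by exists M => -[k x]; exact: HM.
exists (Num.max M 0); first by rewrite le_max lexx orbT.
by move=> i k u u01; rewrite le_max; apply/orP; left; exact: (HM i (k, exist _ u u01)).
Qed.

(** Gronwall's inequality with zero initial value. Uniqueness along segments is all that the gluing
    uses. *)
Lemma seg_uniq z a b (f : 'I_n -> C -> C) : (forall u, 0 <= u <= 1 -> G z (segp a b u)) ->
  (forall i u, 0 <= u <= 1 -> cder (f i) (segp a b u) (\sum_k A z (segp a b u) i k * f k (segp a b u))) ->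
  (forall i, f i a = 0) -> forall i, f i b = 0.
Proof.
move=> Hs df f0 i; have [M M0 HM] := seg_bound Hs.
apply/eqP; rewrite -cm_eq0 eq_le cm_ge0 andbT.
pose dg i u := (\sum_k A z (segp a b u) i k * f k (segp a b u)) * (b - a).
have u1 : 0 <= (1 : R) <= 1 by rewrite ler01 lexx.
have := @gronwall R n (fun i u => f i (segp a b u)) dg (M * cm (b - a)) 0 0.
rewrite addr0 mulr0 mul0r => H.
have := H _ (lexx 0) (lexx 0) _ _ _ i 1 u1; rewrite segp1; apply.
- by rewrite mulr_ge0 ?cm_ge0.
- by move=> k u u01; exact: cder_line (df k u u01).
- by move=> k; rewrite segp0 f0 cm0.
- move=> k u u01; rewrite addr0 /dg cmM.
  have -> : M * cm (b - a) * \sum_k cm (f k (segp a b u)) = (M * \sum_k cm (f k (segp a b u))) * cm (b - a).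
    by ring.
  apply: ler_wpM2r; first exact: cm_ge0.
  rewrite mulr_sumr; apply: le_trans (cm_sum _ _) _; apply: ler_sum => l _.
  by rewrite cmM; apply: ler_wpM2r; [exact: cm_ge0|exact: HM].
Qed.

Lemma seg_agree z a b (Y1 Y2 : C -> 'M[C]_n) : (forall u, 0 <= u <= 1 -> G z (segp a b u)) ->
  (forall i k u, 0 <= u <= 1 -> cder (fun x => Y1 x i k) (segp a b u) ((A z (segp a b u) *m Y1 (segp a b u)) i k)) ->
  (forall i k u, 0 <= u <= 1 -> cder (fun x => Y2 x i k) (segp a b u) ((A z (segp a b u) *m Y2 (segp a b u)) i k)) ->
  Y1 a = Y2 a -> Y1 b = Y2 b.
Proof.
move=> Hs d1 d2 E; apply/matrixP => i k; apply/eqP; rewrite -subr_eq0; apply/eqP.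
apply: (seg_uniq (f := fun i x => Y1 x i k - Y2 x i k) Hs) => [i' u u01|i'].
  apply: gder_eq (gderB (d1 i' k u u01) (d2 i' k u u01)) _.
  by rewrite !mxE -sumrB; apply: eq_bigr => l _; rewrite mulrBr.
by rewrite E subrr.
Qed.

(** The largest part of the fibre of G that is star-shaped about c z, in coordinates centred there;
    compactness of segments makes it open. *)
Definition core (c : C -> C) z w := forall u, 0 <= u <= 1 -> G z (c z + Rc u * w).

Lemma core_star c : star2 (core c).
Proof.
move=> p w u H /andP[u0 u1] v /andP[v0 v1]; rewrite mulrA -RcM; apply: H.
by rewrite mulr_ge0 //= mulr_ile1.
Qed.

Lemma core_open c : (forall z, cdiff c z) -> opn2 (core c).
Proof.
move=> hc p w H.
have [u d d' Q dd|u0 u01|d d0 Hd] := @unit_compact R (fun u d => forall x y, cm x < d -> cm y < d ->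
  G (p + x) (c (p + x) + Rc u * (w + y))).
- by move=> x y xd yd; apply: Q; exact: lt_le_trans dd.
- have [d d0 Hd] := oG (H u0 u01).
  have d2 : 0 < d / 2 by rewrite divr_gt0.
  have [d1 d10 H1] := cdiff_ccont (hc p) d2.
  have W0 : 0 < 1 + cm w by have := cm_ge0 w; lra.
  have q0 : 0 < d / (4 * (1 + cm w)) by rewrite divr_gt0 // mulr_gt0.
  exists (Num.min (Num.min d d1) (Num.min (d / 8) (d / (4 * (1 + cm w))))).
    by rewrite !lt_min d0 d10 q0 divr_gt0.
  move=> v /andP[v0 v1]; rewrite !lt_min => /andP[/andP[_ _] /andP[_ v3]] x y.
  rewrite !lt_min => /andP[/andP[x1 x2] _] /andP[/andP[_ _] /andP[y3 _]].
  have -> : c (p + x) + Rc v * (w + y) = (c p + Rc u0 * w) +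
      ((c (p + x) - c p) + (Rc (v - u0) * w + Rc v * y)) by rewrite RcB; ring.
  apply: Hd => //; apply: le_lt_trans (cmD _ _) _.
  have h1 := H1 x x2.
  have h2 : cm (Rc (v - u0) * w + Rc v * y) < d / 2.
    apply: le_lt_trans (cmD _ _) _; rewrite !cmM !cm_Rc (ger0_norm v0).
    have a1 : v * cm y <= cm y by rewrite ler_piMl ?cm_ge0.
    have a2 : `|v - u0| * cm w <= d / 4.
      apply: le_trans (_ : d / (4 * (1 + cm w)) * (1 + cm w) <= _).
        by apply: ler_pM; rewrite ?cm_ge0 ?(ltW v3) // lerDr.
      by rewrite le_eqVlt; apply/orP; left; apply/eqP; field; rewrite gt_eqF.
    lra.
  lra.
exists d => // x y xd yd u u01; exact: Hd.
Qed.

Definition reach c z w := core c z (w - c z).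

Let oT : opn2 (fun _ _ : C => True).
Proof. by move=> ? ? _; exists 1. Qed.

Let hshift c : (forall z, cdiff c z) -> hol2 (fun _ _ => True) (fun z w => w - c z).
Proof. by move=> hc; apply: hol2_B; [exact: hol2_snd|exact: hol2_entire]. Qed.

Lemma reach_open c : (forall z, cdiff c z) -> opn2 (reach c).
Proof.
move=> hc; apply: (opn2_pre (V := core c) (a := fun z _ => z) (b := fun z w => w - c z)).
- exact: core_open.
- exact: hol2_fst.
- exact: hshift.
Qed.

Lemma reach_seg c z w u : reach c z w -> 0 <= u <= 1 -> reach c z (segp (c z) w u).
Proof.
move=> H u01; rewrite /reach /segp addrAC subrr add0r; exact: core_star.
Qed.

Lemma reach_G c z w : reach c z w -> G z w /\ G z (c z).
Proof.
move=> H; split.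
  by have := H 1; rewrite Rc1 mul1r addrC subrK lexx ler01; apply.
by have := H 0; rewrite Rc0 mul0r addr0 lexx ler01; apply.
Qed.

Definition solves (P : C -> C -> Prop) (Y : C -> C -> 'M[C]_n) :=
  forall z w i k, P z w -> cder (fun x => Y z x i k) w ((A z w *m Y z w) i k).

(** For the invertibility, a kernel vector at w starts a solution that vanishes at w, hence, back
    along the segment, at the centre, where the matrix is the identity. *)
Lemma chart c : (forall z, cdiff c z) -> exists Y, [/\ hol2mx (reach c) Y,
  forall z, G z (c z) -> Y z (c z) = 1%:M, solves (reach c) Y &
  forall z w, reach c z w -> Y z w \in unitmx].
Proof.
move=> hc; have oC := core_open hc.
pose A' z w := A z (c z + w).
have hA' : hol2mx (core c) A'.
  move=> i k; apply: (hol2_comp (f := fun p w => A p w i k) (a := fun p _ => p)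
    (b := fun p w => c p + w) oC oG (hA i k)).
  - exact: hol2_fst.
  - apply: hol2_D; last exact: hol2_snd.
    by apply: hol2_sub (hol2_entire hc).
  - by move=> p w H; have := H 1; rewrite Rc1 mul1r lexx ler01; apply.
have [Y' [h1 h2 h3]] := linear_ode oC (@core_star c) hA'.
pose Y z w := Y' z (w - c z).
have sY : solves (reach c) Y.
  move=> z w i k H; have := h3 z _ i k H; rewrite /A' [c z + _]addrC subrK => D.
  have D2 : cder (fun x => x - c z) w (1 - 0) by apply: gderB; [exact: cder_id|exact: gder_cst].
  by apply: gder_eq (gder_comp (g := fun x => x - c z) D D2) _; rewrite subr0 mulr1.
have Y1 z : G z (c z) -> Y z (c z) = 1%:M.
  by move=> H; rewrite /Y subrr h2 // => u _; rewrite mulr0 addr0.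
exists Y; split=> //.
- move=> i k; apply: (hol2_comp (f := fun p w => Y' p w i k) (a := fun p _ => p)
    (b := fun p w => w - c p) (reach_open hc) oC (h1 i k)) => //; first exact: hol2_fst.
  exact: hol2_sub (hshift hc).
move=> z w H; rewrite -unitmx_tr -row_free_unit -kermx_eq0.
apply/eqP/row_matrixP => i0; rewrite row0.
set x := row i0 _; have xk : x *m (Y z w)^T = 0 by rewrite /x -row_mul mulmx_ker row0.
clearbody x => {i0}.
have Yx : Y z w *m x^T = 0 by rewrite -[LHS]trmxK trmx_mul trmxK xk trmx0.
pose f i y := \sum_k Y z y i k * x 0 k.
have f0 i : f i w = 0.
  have /matrixP/(_ i 0) := Yx; rewrite !mxE => <-; apply: eq_bigr => k _; by rewrite mxE.
have sg u : 0 <= u <= 1 -> reach c z (segp w (c z) u).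
  move=> /andP[u0 u1]; have -> : segp w (c z) u = segp (c z) w (1 - u).
    by rewrite /segp RcB Rc1; ring.
  by apply: reach_seg => //; apply/andP; split; lra.
have fc := seg_uniq (f := f) (fun u u01 => proj1 (reach_G (sg u u01))) _ f0.
apply/rowP => k; rewrite [RHS]mxE; have := fc _ k; rewrite /f.
rewrite Y1; last by have [] := reach_G H.
rewrite (bigD1 k) //= mxE eqxx mul1r big1 ?addr0 => [E|l lk]; last by rewrite mxE eq_sym (negPf lk) mul0r.
apply: E => i u u01.
apply: gder_eq (gder_sum _ _) _ => [l|].
  by apply: gderM; [exact: (sY z _ i l (sg u u01))|exact: gder_cst].
rewrite /=.
under eq_bigr do rewrite mulr0 addr0 mxE mulr_suml.
rewrite exchange_big /=; apply: eq_bigr => l _.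
by rewrite mulr_sumr; apply: eq_bigr => l' _; rewrite mulrA.
Qed.

Section Charts.
Variables (P0 P1 P2 : C -> C -> Prop) (c0 c1 c2 m : C -> C).
Hypotheses (oP0 : opn2 P0) (oP1 : opn2 P1) (oP2 : opn2 P2).
Hypotheses (hc0 : forall z, cdiff c0 z) (hc1 : forall z, cdiff c1 z) (hc2 : forall z, cdiff c2 z)
  (hm : forall z, cdiff m z).
Hypotheses (P0r : forall z w, P0 z w -> reach c0 z w) (P1r : forall z w, P1 z w -> reach c1 z w)
  (P2r : forall z w, P2 z w -> reach c2 z w).
Hypotheses (P1m : forall z w, P1 z w -> P0 z (m z) /\ P1 z (m z))
  (P2m : forall z w, P2 z w -> P0 z (m z) /\ P2 z (m z)).
Hypothesis P01 : forall z w u, P0 z w -> P1 z w -> 0 <= u <= 1 ->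
  P0 z (segp (m z) w u) /\ P1 z (segp (m z) w u).
Hypothesis P02 : forall z w u, P0 z w -> P2 z w -> 0 <= u <= 1 ->
  P0 z (segp (m z) w u) /\ P2 z (segp (m z) w u).
Hypothesis P12 : forall z w, P1 z w -> P2 z w -> exists2 w', P0 z w' &
  forall u, 0 <= u <= 1 -> P1 z (segp w' w u) /\ P2 z (segp w' w u).
Variable Y0 : C -> C -> 'M[C]_n.
Hypotheses (hY0 : hol2mx (reach c0) Y0) (sY0 : solves (reach c0) Y0)
  (uY0 : forall z w, reach c0 z w -> Y0 z w \in unitmx).

Let hol_m (P : C -> C -> Prop) (W : C -> C -> Prop) f : opn2 P -> opn2 W -> hol2 W f ->
  (forall z w, P z w -> W z (m z)) -> hol2 P (fun z _ => f z (m z)).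
Proof.
move=> oP oW hf H; apply: (hol2_comp (a := fun p _ => p) (b := fun p _ => m p) oP oW hf) => //.
  exact: hol2_fst.
exact: hol2_sub (hol2_entire hm).
Qed.

(** The solution of the chart is multiplied by the constant matrix [K z] that matches it with Y0 at
    m z; the overlap with P0 is star-shaped about m z, so the two agree on all of it. *)
Let side (P : C -> C -> Prop) c : opn2 P -> (forall z, cdiff c z) -> (forall z w, P z w -> reach c z w) ->
  (forall z w, P z w -> P0 z (m z) /\ P z (m z)) ->
  (forall z w u, P0 z w -> P z w -> 0 <= u <= 1 -> P0 z (segp (m z) w u) /\ P z (segp (m z) w u)) ->
  exists Y, [/\ hol2mx P Y, solves P Y, forall z w, P z w -> Y z w \in unitmx &
    forall z w, P0 z w -> P z w -> Y z w = Y0 z w].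
Proof.
move=> oP hc Pr Pm Pseg; have [Y [h1 h2 h3 h4]] := chart hc.
pose K z := invmx (Y z (m z)) *m Y0 z (m z).
have uK z w : P z w -> K z \in unitmx.
  move=> H; have [H0 H1] := Pm z w H.
  by rewrite unitmx_mul unitmx_inv (h4 _ _ (Pr _ _ H1)) uY0 //; exact: P0r.
have sK : solves P (fun z w => Y z w *m K z).
  move=> z w i k H.
  have -> : (A z w *m (Y z w *m K z)) i k = \sum_l (A z w *m Y z w) i l * K z l k by rewrite mulmxA mxE.
  have -> : (fun x => (Y z x *m K z) i k) = (fun x => \sum_l Y z x i l * K z l k).
    by apply/funext => x; rewrite mxE.
  apply: gder_eq (gder_sum _ _) _ => [l|].
    by apply: gderM; [exact: (h3 z w i l (Pr _ _ H))|exact: gder_cst].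
  by apply: eq_bigr => l _; rewrite mulr0 addr0.
exists (fun z w => Y z w *m K z); split=> //.
- have hI : hol2mx P (fun z _ => invmx (Y z (m z))).
    move=> i k z w H; have [H0 H1] := Pm z w H.
    have hYm i' k' : hol2 P (fun z _ => Y z (m z) i' k').
      apply: (hol_m oP (reach_open hc) (h1 i' k')) => z' w' H'.
      by have [_ /Pr] := Pm _ _ H'.
    have cd x : P x w -> cdiff (fun y => invmx (Y y (m y)) i k) x.
      move=> Hx; apply: cdiff_invmx => [i' k'|]; first by have [] := hYm i' k' _ _ Hx.
      have [d d0 Hd] := oP _ _ Hx; exists d => // y yd.
      have := Hd y 0 yd; rewrite cm0 addr0 => /(_ d0) /Pm [_ Hy].
      by apply: h4; exact: Pr.
    split; [exact: cd|exact: cdiff_cst|].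
    have [d d0 Hd] := cdiff_ccont (cd z H) ltr01.
    exists d, (1 + cm (invmx (Y z (m z)) i k)); split=> // x y xd _.
    rewrite -[X in cm X](subrK (invmx (Y z (m z)) i k)); apply: le_trans (cmD _ _) _.
    by rewrite lerD2r Hd.
  have hYm i' k' : hol2 P (fun z _ => Y0 z (m z) i' k').
    apply: (hol_m oP (reach_open hc0) (hY0 i' k')) => z' w' H'.
    by have [/P0r] := Pm _ _ H'.
  move=> i k; have -> : (fun z w => (Y z w *m K z) i k) =
    (fun z w => \sum_l Y z w i l * \sum_l' invmx (Y z (m z)) l l' * Y0 z (m z) l' k).
    by apply/funext => z; apply/funext => w; rewrite mxE; apply: eq_bigr => l _; rewrite mxE.
  apply: hol2_sum => l; apply: hol2_M; first exact: hol2_sub (h1 i l).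
  by apply: hol2_sum => l'; apply: hol2_M; [exact: hI|exact: hYm].
- by move=> z w H; rewrite unitmx_mul (uK z w H) (h4 _ _ (Pr _ _ H)).
move=> z w H0 H; apply: (@seg_agree z (m z) w (fun w => Y z w *m K z) (Y0 z)) => [u u01|i k u u01|i k u u01|].
- by have [/P0r/reach_G[]] := Pseg z w u H0 H u01.
- by apply: sK; have [] := Pseg z w u H0 H u01.
- by apply: sY0; apply: P0r; have [] := Pseg z w u H0 H u01.
by have [_ Hm] := Pm z w H; rewrite mulmxA mulmxV ?mul1mx // h4 //; exact: Pr.
Qed.

Definition dom z w := [\/ P0 z w, P1 z w | P2 z w].

(** There is no monodromy: P1 and P2 meet P0 in sets that are star-shaped about a common point, and
    each point of P1 and P2 is joined inside both of them to a point of P0. Hence the three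
    solutions agree on every overlap. *)
Lemma glue : exists Y, [/\ hol2mx dom Y, solves dom Y, forall z w, dom z w -> Y z w \in unitmx &
  forall z w, P0 z w -> Y z w = Y0 z w].
Proof.
have [Y1 [a1 b1 u1 e1]] := side oP1 hc1 P1r P1m P01.
have [Y2 [a2 b2 u2 e2]] := side oP2 hc2 P2r P2m P02.
have e12 z w : P1 z w -> P2 z w -> Y1 z w = Y2 z w.
  move=> H1 H2; have [w' H0 Hs] := P12 H1 H2.
  apply: (@seg_agree z w' w (Y1 z) (Y2 z)) => [u u01|i k u u01|i k u u01|].
  - by have [/P1r/reach_G[]] := Hs u u01.
  - by apply: b1; have [] := Hs u u01.
  - by apply: b2; have [] := Hs u u01.
  have := Hs 0; rewrite segp0 lexx ler01 => /(_ isT)[h1 h2].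
  by rewrite e1 // e2.
pose Y z w := if `[<P0 z w>] then Y0 z w else if `[<P1 z w>] then Y1 z w else Y2 z w.
have E0 z w : P0 z w -> Y z w = Y0 z w by move=> H; rewrite /Y asboolT.
have E1 z w : P1 z w -> Y z w = Y1 z w.
  move=> H; rewrite /Y; case: asboolP => [H0|_]; first by rewrite e1.
  by rewrite asboolT.
have E2 z w : P2 z w -> Y z w = Y2 z w.
  move=> H; rewrite /Y; case: asboolP => [H0|_]; first by rewrite e2.
  by case: asboolP => [H1|//]; rewrite e12.
have K (P : C -> C -> Prop) Z z w : opn2 P -> P z w -> (forall z w, P z w -> Y z w = Z z w) ->
    hol2mx P Z -> solves P Z ->
    (forall i k, [/\ cdiff (fun x => Y x w i k) z, cdiff (fun x => Y z x i k) w & lbnd (fun z w => Y z w i k) z w]) /\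
    forall i k, cder (fun x => Y z x i k) w ((A z w *m Y z w) i k).
  move=> oP H E hZ sZ; have [d d0 Hd] := oP z w H.
  have Ed x y : cm x < d -> cm y < d -> Y (z + x) (w + y) = Z (z + x) (w + y) by move=> *; apply: E; exact: Hd.
  have Ew y : cm y < d -> Y z (w + y) = Z z (w + y) by move=> yd; have := Ed 0 y; rewrite cm0 addr0; apply.
  have Ez x : cm x < d -> Y (z + x) w = Z (z + x) w by move=> xd; have := Ed x 0; rewrite cm0 addr0; apply.
  split=> i k.
    have [p1 p2 [d' [M [d'0 HM]]]] := hZ i k z w H; split.
    - by apply: cdiff_ext p1; exists d => // x xd; rewrite Ez.
    - by apply: cdiff_ext p2; exists d => // x xd; rewrite Ew.
    - exists (Num.min d d'), M; rewrite lt_min d0 d'0; split=> // x y.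
      by rewrite !lt_min => /andP[x1 x2] /andP[y1 y2]; rewrite Ed //; exact: HM.
  rewrite E //; apply: gder_ext (sZ z w i k H) => //.
  by exists d => // y yd; rewrite Ew.
have H3 z w : dom z w ->
    (forall i k, [/\ cdiff (fun x => Y x w i k) z, cdiff (fun x => Y z x i k) w & lbnd (fun z w => Y z w i k) z w]) /\
    forall i k, cder (fun x => Y z x i k) w ((A z w *m Y z w) i k).
  case=> H; [apply: (K P0 Y0)|apply: (K P1 Y1)|apply: (K P2 Y2)] => //.
  - by move=> i k; exact: hol2_sub (hY0 i k).
  - by move=> z' w' i k /P0r; exact: sY0.
exists Y; split=> //.
- by move=> i k z w /H3[].
- by move=> z w i k /H3[].
- by move=> z w [H|H|H]; [rewrite E0 //; apply: uY0; exact: P0r|rewrite E1 //; exact: u1 H|rewrite E2 //; exact: u2 H].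
Qed.

End Charts.

End Glue.

End Continuation.

(** * Geometry of the sectorial domains *)

Section Geometry.
Context {R : realType}.
Local Notation C := (cplx R).
Implicit Types (z w a b l t : C) (u v e d M : R).
Local Notation rt := (@Pilot.Defs.sqrte R).
Opaque cexp.

Definition rcont (F : C -> C -> R) := forall p w e, 0 < e -> exists2 d, 0 < d &
  forall x y, cm x < d -> cm y < d -> `|F (p + x) (w + y) - F p w| < e.

Lemma rcont_lt F G : rcont F -> rcont G -> opn2 (fun p w => F p w < G p w).
Proof.
move=> hF hG p w H; have e0 : 0 < (G p w - F p w) / 2 by rewrite divr_gt0 // subr_gt0.
have [d1 d10 H1] := hF p w _ e0; have [d2 d20 H2] := hG p w _ e0.
exists (Num.min d1 d2); first by rewrite lt_min d10.
move=> x y; rewrite !lt_min => /andP[x1 x2] /andP[y1 y2].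
have := H1 x y x1 y1; have := H2 x y x2 y2; rewrite !ltr_norml => /andP[a1 a2] /andP[b1 b2]; lra.
Qed.

Lemma opn2_and (U V : C -> C -> Prop) : opn2 U -> opn2 V -> opn2 (fun p w => U p w /\ V p w).
Proof.
move=> hU hV p w [H1 H2]; have [d1 d10 K1] := hU p w H1; have [d2 d20 K2] := hV p w H2.
exists (Num.min d1 d2); first by rewrite lt_min d10.
by move=> x y; rewrite !lt_min => /andP[x1 x2] /andP[y1 y2]; split; [exact: K1|exact: K2].
Qed.

Lemma opn2_or (U V : C -> C -> Prop) : opn2 U -> opn2 V -> opn2 (fun p w => U p w \/ V p w).
Proof.
move=> hU hV p w [H|H].
  by have [d d0 K] := hU p w H; exists d => // x y xd yd; left; exact: K.
by have [d d0 K] := hV p w H; exists d => // x y xd yd; right; exact: K.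
Qed.

Lemma rcont_cst c : rcont (fun _ _ => c).
Proof. by move=> p w e e0; exists 1 => // x y _ _; rewrite subrr normr0. Qed.

Lemma rcontD F G : rcont F -> rcont G -> rcont (fun p w => F p w + G p w).
Proof.
move=> hF hG p w e e0; have e2 : 0 < e / 2 by rewrite divr_gt0.
have [d1 d10 H1] := hF p w _ e2; have [d2 d20 H2] := hG p w _ e2.
exists (Num.min d1 d2); first by rewrite lt_min d10.
move=> x y; rewrite !lt_min => /andP[x1 x2] /andP[y1 y2].
have := H1 x y x1 y1; have := H2 x y x2 y2; rewrite !ltr_norml => /andP[a1 a2] /andP[b1 b2].
by apply/andP; split; lra.
Qed.

Lemma rcont_comp1 (f : R -> R) F : continuous f -> rcont F -> rcont (fun p w => f (F p w)).
Proof.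
move=> cf hF p w e e0; have /cvgrPdist_lt/(_ e e0) := cf (F p w).
rewrite near_simpl -nbhs_nearE => /nbhs_ballP[d /= d0 H].
have [d1 d10 H1] := hF p w d d0; exists d1 => // x y xd yd.
by rewrite distrC; apply: H; rewrite /ball /= distrC; exact: H1.
Qed.

Lemma rcontM F G : rcont F -> rcont G -> rcont (fun p w => F p w * G p w).
Proof.
move=> hF hG.
(* Polarization reduces a product to sums and squares, that is, to continuous functions of one real
   variable. *)
have E : (fun p w => F p w * G p w) = (fun p w => ((F p w + G p w) ^+ 2 + (- 1 * (F p w + - 1 * G p w) ^+ 2)) * 4^-1).
  by apply/funext => p; apply/funext => w; field.
have Z c K : rcont K -> rcont (fun p w => c * K p w).
  by move=> hK; apply: (rcont_comp1 (f := fun x => c * x)) => // x; exact: mulrl_continuous.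
have S K : rcont K -> rcont (fun p w => K p w ^+ 2).
  by move=> hK; apply: (rcont_comp1 (f := fun x => x ^+ 2)) => // x; exact: exprn_continuous.
rewrite E; under eq_fun do under eq_fun do rewrite mulrC.
apply: (Z); apply: rcontD; first by apply: S; exact: rcontD.
by apply: (Z); apply: S; apply: rcontD => //; exact: Z.
Qed.

Lemma rcontN F : rcont F -> rcont (fun p w => - F p w).
Proof. by move=> hF; under eq_fun do under eq_fun do rewrite -mulN1r; apply: rcontM => //; exact: rcont_cst. Qed.

Lemma rcontB F G : rcont F -> rcont G -> rcont (fun p w => F p w - G p w).
Proof. by move=> hF hG; apply: rcontD => //; exact: rcontN. Qed.

Lemma rcont_re f : hol2 (fun _ _ => True) f -> rcont (fun p w => re (f p w)).
Proof.
move=> hf p w e e0; have oT : opn2 (fun _ _ : C => True) by move=> ? ? _; exists 1.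
have [d d0 H] := @hol2_cont R _ _ p w oT hf I _ e0; exists d => // x y xd yd.
by rewrite -reB; apply: le_lt_trans (re_le_cm _) _; exact: H.
Qed.

Lemma rcont_im f : hol2 (fun _ _ => True) f -> rcont (fun p w => im (f p w)).
Proof.
move=> hf p w e e0; have oT : opn2 (fun _ _ : C => True) by move=> ? ? _; exists 1.
have [d d0 H] := @hol2_cont R _ _ p w oT hf I _ e0; exists d => // x y xd yd.
by rewrite -imB; apply: le_lt_trans (im_le_cm _) _; exact: H.
Qed.

Lemma rcont_cmrt : rcont (fun z _ => cm (rt z)).
Proof.
have -> : (fun z (_ : C) => cm (rt z)) = (fun z _ => expR (2^-1 * re z)).
  by apply/funext => z; apply/funext => _; rewrite cm_rt mulrC.
apply: (rcont_comp1 (f := expR)); first exact: continuous_expR.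
by apply: rcontM; [exact: rcont_cst|apply: rcont_re; exact: hol2_fst].
Qed.

(** Shifting sqrt(eps) t by pi i / 2 turns - coth into tanh; w = 0 is then the time halfway between
    the pole 0 and a neighbouring pole. *)
Definition hpi : C := ci * Rc (pi / 2).

Lemma cexp_hpi : cexp hpi = ci.
Proof.
have [e1 e2] : re hpi = 0 /\ im hpi = pi / 2.
  by rewrite /hpi reM imM re_Rc im_Rc /=; split; ring.
by apply: C_eqP; rewrite ?re_cexp ?im_cexp e1 e2 expR0 ?cos_pihalf ?sin_pihalf mul1r.
Qed.

Lemma ci2 : ci * ci = -1 :> C.
Proof. by apply: C_eqP; rewrite ?reM ?imM ?reN ?imN /=; ring. Qed.

Lemma ccosh_hpi w : ccosh (hpi - w) = - ci * csinh w.
Proof.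
rewrite /ccosh /csinh opprB cexpD (cexpD w) (cexpN hpi) cexp_hpi.
have -> : (ci : C)^-1 = - ci.
  have n0 : (ci : C) != 0 by rewrite -cm_gt0 cm_ci.
  by apply: (mulfI n0); rewrite mulfV // mulrN ci2 opprK.
by ring.
Qed.

Lemma csinh_hpi w : csinh (hpi - w) = ci * ccosh w.
Proof.
rewrite /ccosh /csinh opprB cexpD (cexpD w) (cexpN hpi) cexp_hpi.
have -> : (ci : C)^-1 = - ci.
  have n0 : (ci : C) != 0 by rewrite -cm_gt0 cm_ci.
  by apply: (mulfI n0); rewrite mulfV // mulrN ci2 opprK.
by ring.
Qed.

Definition sgn (s : bool) : C := (-1) ^+ s.

Lemma sgn2 s : sgn s * sgn s = 1.
Proof. by case: s; rewrite /sgn ?expr0 ?expr1; ring. Qed.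

(* [ww] is the coordinate w of the time t; for the sector U, t and the
   orientation of w are reversed, so that both sectors become lower ones. *)
Definition tt (s : bool) z w : C := (hpi - sgn s * w) / rt z.

Definition ww (s : bool) z t : C := sgn s * (hpi - rt z * t).

Lemma wwK s z t : tt s z (ww s z t) = t.
Proof.
rewrite /tt /ww mulrA sgn2 mul1r; field; exact: cexp_neq0.
Qed.

Lemma ttK s z w : ww s z (tt s z w) = w.
Proof.
rewrite /tt /ww [rt z * _]mulrC divfK ?cexp_neq0 //.
have -> : hpi - (hpi - sgn s * w) = sgn s * w by ring.
by rewrite mulrA sgn2 mul1r.
Qed.

Lemma tt_seg s z a b u : tt s z (segp a b u) = segp (tt s z a) (tt s z b) u.
Proof. by rewrite /tt /segp; ring. Qed.

Lemma good_ww r1 s z t : csinh (rt z * t) != 0 -> cm (rt z) * cm (ccosh (rt z * t)) < r1 * cm (csinh (rt z * t)) ->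
  good r1 z (ww s z t).
Proof.
move=> h1 h2; have E1 : cm (ccosh (ww s z t)) = cm (csinh (rt z * t)).
  have -> : ccosh (ww s z t) = ccosh (hpi - rt z * t).
    by rewrite /ww /sgn; case: s; rewrite ?expr0 ?expr1 ?mulN1r ?mul1r ?ccoshN.
  by rewrite ccosh_hpi cmM cmN cm_ci mul1r.
have E2 : cm (csinh (ww s z t)) = cm (ccosh (rt z * t)).
  have -> : cm (csinh (ww s z t)) = cm (csinh (hpi - rt z * t)).
    by rewrite /ww /sgn; case: (s); rewrite ?expr0 ?expr1 ?mulN1r ?mul1r ?csinhN ?cmN.
  by rewrite csinh_hpi cmM cm_ci mul1r.
by split; [rewrite -cm_gt0 E1 cm_gt0|rewrite cmM E2 E1].
Qed.

Lemma xtime_ww z t s : sgn s * xtime z t = rt z * cth (ww s z t).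
Proof.
have E : cth (ww s z t) = sgn s * cth (hpi - rt z * t).
  by rewrite /ww /sgn; case: s; rewrite ?expr0 ?expr1 ?mulN1r ?mul1r ?cthN.
rewrite E /xtime /cth csinh_hpi ccosh_hpi.
have n0 : (ci : C) != 0 by rewrite -cm_gt0 cm_ci.
have -> : ci * ccosh (rt z * t) / (- ci * csinh (rt z * t)) = - (ccosh (rt z * t) / csinh (rt z * t)).
  by rewrite mulNr invrN mulrN invfM mulrA -[ci * _ / ci]mulrA [_ / ci]mulrC mulrA mulfV // mul1r.
by ring.
Qed.

Lemma rt_diff z : cdiff rt z.
Proof.
have D : cder (fun x => 2^-1 * x) z (2^-1 * 1) by apply: gderZ; exact: cder_id.
have E : rt = (fun y => cexp (2^-1 * y)) by apply/funext => y; congr cexp; exact: mulrC.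
rewrite E; eexists; exact: (gder_comp (g := fun x => 2^-1 * x) (cder_cexp _) D).
Qed.

Lemma ww_diff s t z : cdiff (fun z => ww s z t) z.
Proof.
have [l Hl] := rt_diff z; eexists; apply: gderZ; apply: gderB; first exact: gder_cst.
by apply: gderM Hl _; exact: gder_cst.
Qed.

Lemma hol2_tt s : hol2 (fun _ _ => True) (tt s).
Proof.
have oT : opn2 (fun _ _ : C => True) by move=> ? ? _; exists 1.
apply: hol2_M.
  apply: hol2_B; first exact: hol2_cst.
  by apply: hol2_M; [exact: hol2_cst|exact: hol2_snd].
apply: hol2_V => //; first exact: hol2_rt.
by move=> p w _; exact: cexp_neq0.
Qed.

Lemma cexp_eq1 (d : C) : cexp d = 1 -> `|im d| < 2 * pi -> d = 0.
Proof.
move=> E; have r0 : re d = 0.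
  have := cm_cexp d; rewrite E cm1 => h; apply: expR_inj; rewrite expR0; exact: esym.
have c1 : cos (im d) = 1 by have := re_cexp d; rewrite E r0 expR0 mul1r.
move=> hd; apply: C_eqP; rewrite ?re0 ?im0 //.
have [y [yE yp]] : exists y, im d = y + y /\ `|y| < pi.
  exists (im d / 2); split; first by field.
  by rewrite normrM (@ger0_norm _ 2^-1) // ltr_pdivrMr // mulrC.
have s0 : sin y = 0.
  have h1 := cosD y y; rewrite -yE c1 in h1; have h2 := cos2Dsin2 y; rewrite !expr2 in h2.
  by apply/eqP; rewrite -sqrf_eq0 expr2; apply/eqP; lra.
suff : y = 0 by move=> y0; rewrite yE y0 addr0.
have S (x : R) : sin x = 0 -> 0 < x < pi -> False by move=> h /sin_gt0_pi; rewrite h ltxx.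
move: yp; rewrite ltr_norml => /andP[y1 y2].
have [y0|y0|//] := ltgtP y 0; exfalso.
  by apply: (S (- y)); rewrite ?sinN ?s0 ?oppr0 //; lra.
by apply: (S y) => //; rewrite y0.
Qed.

(** Equal values of tanh force w - w' to be a multiple of pi i, and a nonzero multiple has tilted
    height at least pi cos ps. *)
Lemma cth_inj w w' (ps : R) : ccosh w != 0 -> ccosh w' != 0 -> cth w = cth w' -> 0 < cos ps ->
  `|im ((w - w') * cis (- ps))| < pi * cos ps -> w = w'.
Proof.
move=> n n' E c0 h; have e1 := cexp_cth n; have e2 := cexp_cth n'; rewrite -E in e2.
have n1 : 1 + cth w != 0.
  apply/eqP => e; have : cth w = -1 by apply/eqP; rewrite -addr_eq0 addrC e.
  move=> ew; move: e1; rewrite ew subrr mulr0 opprK => /eqP; rewrite eq_sym.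
  by rewrite -[_ + _]mulr2n pnatr_eq0.
have e3 : cexp (- (2 * w)) = cexp (- (2 * w')) by apply: (mulIf n1); rewrite e1 e2.
have e4 : cexp (2 * (w - w')) = 1.
  have -> : 2 * (w - w') = - (2 * w') + - - (2 * w) by ring.
  by rewrite cexpD -e3 -cexpD addrN cexp0.
have r0 : re (w - w') = 0.
  have := cm_cexp (2 * (w - w')); rewrite e4 cm1 => k.
  have : re (2 * (w - w')) = 0 by apply: expR_inj; rewrite expR0; exact: esym.
  have -> : 2 * (w - w') = (w - w') + (w - w') by ring.
  by rewrite reD; lra.
move: h; rewrite imM re_cis im_cis r0 mul0r add0r cosN normrM (gtr0_norm c0) ltr_pM2r // => h.
have : 2 * (w - w') = 0.
  apply: cexp_eq1 => //; have -> : 2 * (w - w') = (w - w') + (w - w') by ring.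
  rewrite imD; apply: le_lt_trans (ler_normD _ _) _; lra.
by move/eqP; rewrite mulf_eq0 pnatr_eq0 /= subr_eq0 => /eqP.
Qed.

(** * Strips, fans and their overlaps *)

Section Strip.
Variables (gamma kap : R).
Hypotheses (gamma0 : 0 < gamma) (gammaT : bigT gamma < pi / 2) (kap0 : 0 < kap) (kap2 : kap < 2^-1).

(** Height of t above the line through 0 in the direction hat_theta. *)
Definition eta z t : R := im (t * cis (- thet gamma z)).

Lemma etaE z t : eta z t = im t * cos (thet gamma z) - re t * sin (thet gamma z).
Proof. by rewrite /eta imM re_cis im_cis cosN sinN; ring. Qed.

Lemma eta_le z t : `|eta z t| <= cm t.
Proof. by apply: le_trans (im_le_cm _) _; rewrite cmM cm_cis mulr1. Qed.

Lemma eta_seg z a b u : eta z (segp a b u) = (1 - u) * eta z a + u * eta z b.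
Proof. by rewrite !etaE /segp !reD !imD !reM !imM !reB !imB re_Rc im_Rc; ring. Qed.

Lemma eta_rot z t : cm (rt z) * eta z t = - im (rt z * t * cis (- psi gamma z)).
Proof.
have E : rt z * t * cis (- psi gamma z) = - (Rc (cm (rt z)) * (t * cis (- thet gamma z))).
  have -> : - thet gamma z = phi z + - psi gamma z by rewrite /thet; ring.
  by rewrite {1}(rt_cis z) (cisD (phi z)); ring.
by rewrite E imN imM re_Rc im_Rc mul0r addr0 opprK.
Qed.

(** The lower line is the one in the definition of [Gam]. A period has scaled height pi cos psi, so
    nu <= (1/2 - kap) pi del0 makes the strip no wider than a period. *)
Definition strip (nu : R) z t := - ((2^-1 + kap) * pi * cos (psi gamma z)) < cm (rt z) * eta z t < nu.

Lemma strip_seg nu z a b u : strip nu z a -> strip nu z b -> 0 <= u <= 1 -> strip nu z (segp a b u).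
Proof.
rewrite /strip eta_seg; move: (_ * cos _) (cm _) (eta z a) (eta z b) => q s x y.
move=> /andP[a1 a2] /andP[b1 b2] /andP[u0 u1].
have -> : s * ((1 - u) * x + u * y) = (1 - u) * (s * x) + u * (s * y) by ring.
move: (s * x) (s * y) a1 a2 b1 b2 => X Y a1 a2 b1 b2.
have [e|ne] := eqVneq u 0; first by rewrite e; apply/andP; split; lra.
have up : 0 < u by rewrite lt_def ne.
have p1 : u * - q < u * Y by rewrite ltr_pM2l.
have p2 : u * Y < u * nu by rewrite ltr_pM2l.
have p3 : (1 - u) * - q <= (1 - u) * X by rewrite ler_wpM2l ?subr_ge0 // ltW.
have p4 : (1 - u) * X <= (1 - u) * nu by rewrite ler_wpM2l ?subr_ge0 // ltW.
by apply/andP; split; lra.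
Qed.

Let pp : 0 < (pi : R). Proof. exact: pi_gt0. Qed.

Lemma strip_injective (nu : R) s z t t' : arg_ok gamma z -> nu <= (2^-1 - kap) * pi * del0 gamma ->
  strip nu z t -> strip nu z t' -> ccosh (ww s z t) != 0 -> ccosh (ww s z t') != 0 ->
  cth (ww s z t) = cth (ww s z t') -> t = t'.
Proof.
move=> az hnu st st' n n' E; have c0 := cos_psi_gt0 gamma0 gammaT az; have /andP[c1 _] := cos_psi gamma0 gammaT az.
suff Ew : ww s z t = ww s z t' by rewrite -(wwK s z t) Ew wwK.
apply: (cth_inj n n' E c0).
have -> : (ww s z t - ww s z t') * cis (- psi gamma z) =
    sgn s * (rt z * t' * cis (- psi gamma z) - rt z * t * cis (- psi gamma z)) by rewrite /ww; ring.
have -> : `|im (sgn s * (rt z * t' * cis (- psi gamma z) - rt z * t * cis (- psi gamma z)))| =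
    `|cm (rt z) * eta z t - cm (rt z) * eta z t'|.
  rewrite !eta_rot /sgn; case: (s); rewrite ?expr0 ?expr1 ?mulN1r ?mul1r ?imN imB; last by congr `|_|; ring.
  by rewrite normrN; congr `|_|; ring.
move: st st'; rewrite /strip => /andP[a1 a2] /andP[b1 b2].
have k2 := kap2; have p0 := pp.
have h1 : nu <= (2^-1 - kap) * pi * cos (psi gamma z).
  by apply: le_trans hnu _; apply: ler_wpM2l => //; rewrite mulr_ge0 ?subr_ge0 // ltW.
have Ea : (2^-1 + kap) * pi * cos (psi gamma z) = 2^-1 * (pi * cos (psi gamma z)) + kap * (pi * cos (psi gamma z)).
  by move: (pi : R) => P'; ring.
have Eb : (2^-1 - kap) * pi * cos (psi gamma z) = 2^-1 * (pi * cos (psi gamma z)) - kap * (pi * cos (psi gamma z)).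
  by move: (pi : R) => P'; ring.
rewrite Ea in a1 b1; rewrite Eb in h1.
move: (pi * cos _) (kap * _) a1 b1 h1 => P' B a1 b1 h1.
move: (cm _ * _) (cm _ * _) a1 a2 b1 b2 => x y a1 a2 b1 b2.
by rewrite ltr_norml; apply/andP; split; clear -h1 a1 a2 b1 b2; lra.
Qed.

(* Away from the poles [k pi i], [|coth|] is bounded on the strip; near 0 it is
   at most [2 / |p|]. *)
Lemma strip_good (r1 : R) : 0 < r1 -> exists nu s1 : R, [/\ 0 < nu, 0 < s1,
  nu <= (2^-1 - kap) * pi * del0 gamma &
  forall vr z t s, 2 <= vr * r1 -> cm (rt z) < s1 -> arg_ok gamma z -> strip nu z t -> vr < cm t ->
    good r1 z (ww s z t)].
Proof.
move=> r10; have p00 := pp; have k2 := kap2; have k0 := kap0; have d00 := del0_gt0 gamma0 gammaT.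
have e1 : 0 < expR 1 :> R := expR_gt0 1.
(* For |p| <= 1/(8e) the estimates near 0 give |sinh p - p| <= |p|/8 and |cosh p - 1| <= 1/8. *)
have [p0 p0E] : exists p0 : R, p0 = (8 * expR 1)^-1 by eexists.
have p0p : 0 < p0 by rewrite p0E invr_gt0 mulr_gt0.
have ep : expR 1 * p0 = 8^-1 by rewrite p0E invfM mulrCA mulfV ?mulr1 // gt_eqF.
(* For |p| > p0 and |Re p| < nu this margin confines Im p to [p0/2, pi - 3 mu], where sin has a
   positive minimum. *)
have [mu muE] : exists mu : R, mu = Num.min ((2^-1 - kap) * pi / 4) (p0 / 8) by eexists.
have mu0 : 0 < mu by rewrite muE lt_min !divr_gt0 // mulr_gt0 // subr_gt0.
have mu1 : 4 * mu <= (2^-1 - kap) * pi.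
  by rewrite mulrC -ler_pdivlMr // muE ge_min lexx.
have mu2 : 8 * mu <= p0 by rewrite mulrC -ler_pdivlMr // muE ge_min lexx orbT.
have [nu nuE] : exists nu : R, nu = mu * del0 gamma by eexists.
have nu0 : 0 < nu by rewrite nuE mulr_gt0.
have ll : p0 / 2 <= pi - 3 * mu.
  have e1' : 1 <= expR 1 :> R by rewrite -[X in X <= _]expR0 ler_expR.
  have : p0 <= 8^-1 by rewrite -ep ler_peMl // ltW.
  have := @pi_ge2 R; lra.
have cs : {within `[p0 / 2, pi - 3 * mu], continuous (sin : R -> R)}.
  by apply: continuous_subspaceT => x; exact: continuous_sin.
have [y0 y0in y0min] := EVT_min ll cs.
have sy0 : 0 < sin y0.
  move: y0in; rewrite in_itv /= => /andP[q1 q2]; apply: sin_gt0_pi; apply/andP; split; clear gamma0 gammaT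
    kap0 kap2 pp r10 p00 k2 k0 d00 e1 p0E p0p ep muE mu1 nuE nu0 ll y0min; lra.
have [c2 c2E] : exists c2 : R, c2 = Num.min ((1 - expR (- (2 * nu))) / 2) (sin y0 / 2) by eexists.
have c20 : 0 < c2 by rewrite c2E lt_min exp_gap_pos // divr_gt0.
exists nu, (r1 * c2); split=> //; first by rewrite mulr_gt0.
  rewrite nuE ler_wpM2r ?(ltW d00) //; lra.
move=> vr z t s vr1 sz az st vt; have s0 : 0 < cm (rt z) by rewrite cm_gt0 cexp_neq0.
have [p pE] : exists p, p = rt z * t by eexists.
have cp : cm p = cm (rt z) * cm t by rewrite pE cmM.
suff Hlt : cm (rt z) * cm (ccosh p) < r1 * cm (csinh p).
  apply: good_ww; rewrite -pE // -cm_gt0 -(pmulr_rgt0 _ r10); apply: le_lt_trans Hlt.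
  by rewrite mulr_ge0 ?cm_ge0.
have [pp0|pp0] := leP (cm p) p0.
  have e8 : expR 1 * cm p <= 8^-1 by rewrite -ep ler_wpM2l // ltW.
  have p1 : cm p <= 1.
  apply: le_trans pp0 _; have e1' : 1 <= expR 1 :> R by rewrite -[X in X <= _]expR0 ler_expR.
  have : p0 <= 8^-1 by rewrite -ep ler_peMl // ltW.
  clear gamma0 gammaT kap0 kap2 pp r10 p00 k2 k0 d00 e1 p0E p0p ep muE mu0 mu1 mu2 nuE nu0 ll y0min sy0 c2E
    c20 vr1 sz vt s0 pE cp e8 e1'; lra.
  have h1 := csinh_near0 p1; have h2 := ccosh_near0 p1.
  have h3 : expR 1 * cm p ^+ 2 <= cm p / 8.
  by rewrite expr2 mulrA [cm p / 8]mulrC ler_wpM2r ?cm_ge0.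
  have h4 := cm_tri p 0 (csinh p); rewrite !subr0 (cmBC p) in h4.
  have h5 := cm_tri (ccosh p) 0 1; rewrite !subr0 cm1 in h5.
  have h6 : cm (rt z) * (2 * cm (csinh p)) <= cm (rt z) * (2 * cm (csinh p)) by [].
  have h7 : cm (rt z) * vr < cm p by rewrite cp ltr_pM2l.
  have h8 : 2 * cm (rt z) <= r1 * (cm (rt z) * vr).
  by rewrite mulrCA [r1 * vr]mulrC [2 * _]mulrC ler_wpM2l // ltW.
  have h9 : r1 * (cm (rt z) * vr) < r1 * cm p by rewrite ltr_pM2l.
  have h10 : r1 * (7 / 8 * cm p) <= r1 * cm (csinh p) by rewrite ler_wpM2l ?(ltW r10) //; clear gamma0 gammaT
    kap0 kap2 pp r10 p00 k2 k0 d00 e1 p0E p0p ep muE mu0 mu1 mu2 nuE nu0 ll y0min sy0 c2E c20 vr1 sz vt s0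
    pE cp pp0 e8 p1 h2 h5 h6 h7 h8 h9; lra.
  have h11 : cm (rt z) * cm (ccosh p) <= cm (rt z) * (9 / 8) by rewrite ler_wpM2l ?(ltW s0) //; clear gamma0
    gammaT kap0 kap2 pp r10 p00 k2 k0 d00 e1 p0E p0p ep muE mu0 mu1 mu2 nuE nu0 ll y0min sy0 c2E c20 vr1 sz
    vt s0 pE cp pp0 p1 h1 h3 h4 h6 h7 h8 h9 h10; lra.
  clear -s0 h8 h9 h10 h11; lra.
suff H : c2 * expR `|re p| <= cm (csinh p).
  have h1 : cm (rt z) * cm (ccosh p) <= cm (rt z) * expR `|re p| by rewrite ler_wpM2l ?(ltW s0) ?ccosh_le.
  have h2 : cm (rt z) * expR `|re p| < r1 * c2 * expR `|re p| by rewrite ltr_pM2r ?expR_gt0.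
  have h3 : r1 * (c2 * expR `|re p|) <= r1 * cm (csinh p) by rewrite ler_wpM2l // ltW.
  by apply: le_lt_trans h1 (lt_le_trans h2 _); rewrite -mulrA.
have [xn|xn] := leP nu `|re p|.
  apply: le_trans (csinh_ge p); apply: le_trans (exp_gap_lb nu0 xn).
  by rewrite ler_wpM2r ?expR_ge0 // c2E ge_min lexx.
have c0 := cos_psi_gt0 gamma0 gammaT az; have /andP[c1 c1'] := cos_psi gamma0 gammaT az.
have xs : `|re p * sin (psi gamma z)| <= nu.
  rewrite normrM; apply: le_trans (ltW xn); rewrite ler_piMr // ler_norml sin_geN1 sin_le1 //.
move: xs; rewrite ler_norml => /andP[x1 x2].
have nuc : nu <= mu * cos (psi gamma z) by rewrite nuE ler_wpM2l // ltW.
have nm : nu <= mu by rewrite nuE ler_piMr ?(ltW mu0) //; apply: le_trans c1 c1'.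
have Er : cm (rt z) * eta z t = - (im p * cos (psi gamma z) - re p * sin (psi gamma z)).
  by rewrite eta_rot -pE imM re_cis im_cis cosN sinN; ring.
move: st; rewrite /strip Er => /andP[st1 st2].
have y1 : - (2 * mu) < im p by rewrite -(ltr_pM2r c0); move: st2 x1 nuc; clear gamma0 gammaT kap0 kap2 pp
    r10 p00 k2 k0 d00 e1 p0E p0p ep muE mu0 mu1 mu2 nuE nu0 ll y0min sy0 c2E c20 vr1 sz vt s0 pE cp pp0 xn
    c0 c1 c1' x2 nm Er st1; lra.
have y2 : im p < (2^-1 + kap) * pi + mu by rewrite -(ltr_pM2r c0) mulrDl; move: st1 x2 nuc; clear gamma0
    gammaT kap0 kap2 pp r10 p00 k2 k0 d00 e1 p0E p0p ep muE mu0 mu1 mu2 nuE nu0 ll y0min sy0 c2E c20 vr1 sz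
    vt s0 pE cp pp0 xn c0 c1 c1' x1 nm Er st2 y1; lra.
have y3 : p0 - mu < `|im p| by have := cm_le_reim p; move: pp0 xn nm; clear gamma0 gammaT kap0 kap2 pp r10
    p00 k2 k0 d00 e1 p0E p0p ep muE mu0 mu1 mu2 nuE nu0 ll y0min sy0 c2E c20 vr1 sz vt s0 pE cp c0 c1 c1'
    x1 x2 nuc Er st1 st2 y1 y2; lra.
have y4 : 0 < im p.
  have [//|yn] := ltP 0 (im p); move: y3; rewrite ler0_norm // => y3.
  by move: y1 y3 mu2 mu0; clear gamma0 gammaT kap0 kap2 pp r10 p00 k2 k0 d00 e1 p0E p0p ep muE mu1 nuE nu0 ll
    y0min sy0 c2E c20 vr1 sz vt s0 pE cp pp0 xn c0 c1 c1' x1 x2 nuc nm Er st1 st2 y2 yn; lra.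
have y5 : im p \in `[p0 / 2, pi - 3 * mu].
  rewrite in_itv /=; move: y3; rewrite gtr0_norm // => y3; apply/andP; split.
    by move: y3 mu2 mu0; clear gamma0 gammaT kap0 kap2 pp r10 p00 k2 k0 d00 e1 p0E p0p ep muE mu1 nuE nu0 ll
    y0min sy0 c2E c20 vr1 sz vt s0 pE cp pp0 xn c0 c1 c1' x1 x2 nuc nm Er st1 st2 y1 y2 y4; lra.
  by move: y2 mu1; move: (pi : R) => P; clear gamma0 gammaT kap0 kap2 pp r10 p00 k2 k0 d00 e1 p0E p0p ep muE
    mu0 mu2 nuE nu0 ll y0min sy0 c2E c20 vr1 sz vt s0 pE cp pp0 xn c0 c1 c1' x1 x2 nuc nm Er st1 st2 y1 y4
    y3; lra.
have y6 := y0min _ y5.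
apply: le_trans (im_le_cm (csinh p)); rewrite im_csinh normrM.
apply: le_trans (_ : expR `|re p| / 2 * sin y0 <= _).
  rewrite mulrC -mulrA; apply: ler_wpM2l; first exact: expR_ge0.
  by rewrite mulrC c2E ge_min lexx orbT.
have sp : 0 <= sin (im p) by apply: le_trans y6; exact: ltW.
apply: ler_pM; rewrite ?divr_ge0 ?expR_ge0 ?(ltW sy0) //; last by rewrite ger0_norm.
rewrite ger0_norm ?divr_ge0 ?addr_ge0 ?expR_ge0 //.
rewrite ler_pM2r ?invr_gt0 //.
have [r0|r0] := leP 0 (re p); first by rewrite ger0_norm // lerDl expR_ge0.
by rewrite ltr0_norm // lerDr expR_ge0.
Qed.

Lemma thet_tan z : arg_ok gamma z -> [/\ 0 < cos (thet gamma z), `|tan (thet gamma z)| <= (cos (bigT gamma))^-1 &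
  sin (thet gamma z) = tan (thet gamma z) * cos (thet gamma z)].
Proof.
move=> az; have [b0 bc] := cos_thet gamma0 gammaT az; have c0 := lt_le_trans b0 bc.
split=> //; last by rewrite /tan divfK // gt_eqF.
rewrite /tan normrM normfV (gtr0_norm c0); apply: le_trans (_ : 1 * (cos (thet gamma z))^-1 <= _).
  by rewrite ler_wpM2r ?invr_ge0 ?(ltW c0) // ler_norml sin_geN1 sin_le1.
by rewrite mul1r lef_pV2 ?posrE.
Qed.

Definition side (s : bool) t : R := if s then - re t else re t.

(** A fan: the part of the outside of the disc of radius vr on one side of the imaginary axis and
    under a line of slope mm, together with the half-plane below the disc. The boolean is true for
    the left side. *)
Definition oset (vr mm : R) s t := im t < - vr \/
  [/\ 0 < side s t, vr ^+ 2 < re t ^+ 2 + im t ^+ 2 & im t < mm * side s t].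

Lemma side_seg s a b u : side s (segp a b u) = (1 - u) * side s a + u * side s b.
Proof. by rewrite /side /segp; case: s; rewrite !reD !reM !reB re_Rc im_Rc; ring. Qed.

Lemma im_seg a b u : im (segp a b u) = (1 - u) * im a + u * im b.
Proof. by rewrite /segp !imD !imM !imB re_Rc im_Rc; ring. Qed.

Lemma side_sqr s t : side s t ^+ 2 = re t ^+ 2.
Proof. by rewrite /side; case: s; rewrite ?sqrrN. Qed.

Lemma cm_gt_sqr vr t : 0 <= vr -> (vr < cm t) = (vr ^+ 2 < re t ^+ 2 + im t ^+ 2).
Proof. by move=> v0; rewrite -cm_sqr ltr_pXn2r ?nnegrE ?cm_ge0. Qed.

Lemma oset_cm vr mm s t : 0 < vr -> oset vr mm s t -> vr < cm t.
Proof.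
move=> v0 [h|[_ h _]]; last by rewrite cm_gt_sqr // ltW.
by apply: lt_le_trans (im_le_cm t); rewrite ltr_normr; apply/orP; right; lra.
Qed.

(** Centre of the fan, far to its side on a descending ray of slope 1/(2 mm); for X0 large it lies
    beyond the tangents to the disc in all directions of the fan. *)
Definition ctr (X0 mm : R) (s : bool) : C := Rc (if s then - X0 else X0) - ci * Rc (X0 / (2 * mm)).

Lemma im_ctr X0 mm s : im (ctr X0 mm s) = - (X0 / (2 * mm)).
Proof. by rewrite /ctr imB imM re_Rc im_Rc !im_Rc /=; ring. Qed.

Lemma side_ctr X0 mm s : side s (ctr X0 mm s) = X0.
Proof. by rewrite /side /ctr; case: s; rewrite reB reM !re_Rc im_Rc /=; ring. Qed.

Let cvx (x y u : R) e : 0 <= u <= 1 -> e < x -> e < y -> e < (1 - u) * x + u * y.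
Proof.
move=> /andP[u0 u1] hx hy; have [->|ne] := eqVneq u 0; first by rewrite subr0 mul1r mul0r addr0.
have up : 0 < u by rewrite lt_def ne.
have p1 : u * e < u * y by rewrite ltr_pM2l.
have p2 : (1 - u) * e <= (1 - u) * x by rewrite ler_wpM2l ?subr_ge0 // ltW.
lra.
Qed.

Let cvxl (x y u : R) e : 0 <= u <= 1 -> x < e -> y < e -> (1 - u) * x + u * y < e.
Proof.
move=> u01 hx hy; have := @cvx (- x) (- y) u (- e) u01; rewrite !ltrN2 => /(_ hx hy); lra.
Qed.

(* The tangent half-plane at the direction of [t] contains the center and [t],
   hence the whole segment avoids the disc. *)
Lemma oset_star vr mm X0 s t u : 0 < vr -> 1 <= mm -> vr * (2 * mm) < X0 -> vr * (2 * (1 + mm)) < X0 ->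
  oset vr mm s t -> 0 <= u <= 1 -> oset vr mm s (segp (ctr X0 mm s) t u).
Proof.
move=> v0 m1 hX1 hX2 ot u01; have m0 : 0 < mm by lra.
have X00 : 0 < X0 by apply: lt_trans hX1; rewrite !mulr_gt0.
have [yb ybE] : exists yb, yb = X0 / (2 * mm) by eexists.
have m2 : 0 < 2 * mm by rewrite mulr_gt0.
have yb1 : vr < yb by rewrite ybE ltr_pdivlMr.
have ybm : yb * (2 * mm) = X0 by rewrite ybE divfK // gt_eqF.
have imc := im_ctr X0 mm s; have sc := side_ctr X0 mm s; rewrite -ybE in imc.
case: ot => [h|[h1 h2 h3]].
  by left; rewrite im_seg imc; apply: cvxl => //; lra.
right; split.
- by rewrite side_seg sc; exact: cvx.
- have [X [Y [XE YE]]] : exists X Y, X = side s t /\ Y = im t by do 2 eexists.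
  rewrite -(side_sqr s) side_seg im_seg sc imc -XE -YE; rewrite -XE in h1 h3; rewrite -YE in h3.
  rewrite -(side_sqr s) -XE -YE in h2.
  have [N [N0 NN]] : exists N, 0 < N /\ N ^+ 2 = X ^+ 2 + Y ^+ 2.
    exists (Num.sqrt (X ^+ 2 + Y ^+ 2)); rewrite sqrtr_gt0 sqr_sqrtr ?addr_ge0 ?sqr_ge0 //.
    by split=> //; apply: le_lt_trans h2; exact: sqr_ge0.
  have vN : vr < N by rewrite -(ltr_pXn2r (n := 2)) ?nnegrE ?(ltW v0) ?(ltW N0) // NN.
  have NX : N <= X + `|Y|.
    rewrite -(ler_pXn2r (n := 2)) ?nnegrE ?(ltW N0) ?addr_ge0 ?(ltW h1) // NN sqrrD real_normK ?num_real //.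
    have : 0 <= X * `|Y| *+ 2 by rewrite mulrn_wge0 // mulr_ge0 // ltW.
    lra.
  have cb : vr * N < X0 * X - yb * Y.
    have [y0|y0] := leP Y 0.
      rewrite ler0_norm // in NX.
      have k1 : vr * N <= vr * (X - Y) by rewrite ler_wpM2l ?(ltW v0).
      have k2 : vr * X < X0 * X by rewrite ltr_pM2r //; apply: lt_trans hX1; rewrite ltr_pMr //; lra.
      have k3 : vr * - Y <= yb * - Y by rewrite ler_wpM2r ?oppr_ge0 // ltW.
      lra.
    rewrite gtr0_norm // in NX.
    have k1 : yb * Y <= yb * (mm * X) by rewrite ler_wpM2l ?(ltW h3) // ltW // (lt_trans v0).
    have k2 : vr * N <= vr * (X * (1 + mm)) by rewrite ler_wpM2l ?(ltW v0) //; lra.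
    have k3 : vr * (2 * (1 + mm)) * X < X0 * X by rewrite ltr_pM2r.
    have k4 : yb * (2 * mm) * X = X0 * X by rewrite ybm.
    lra.
  have D : vr * N < ((1 - u) * X0 + u * X) * X + ((1 - u) * - yb + u * Y) * Y.
    have -> : ((1 - u) * X0 + u * X) * X + ((1 - u) * - yb + u * Y) * Y =
      (1 - u) * (X0 * X - yb * Y) + u * N ^+ 2 by rewrite NN; ring.
    by apply: cvx => //; rewrite expr2 ltr_pM2r.
  move: D; move: ((1 - u) * X0 + _) ((1 - u) * - yb + _) => P Q D.
  rewrite ltNge; apply/negP => le.
  (* Cauchy-Schwarz: the component of (P, Q) in the direction of t exceeds vr, hence so does its
     modulus. *)
  have K : (P * X + Q * Y) ^+ 2 <= (P ^+ 2 + Q ^+ 2) * N ^+ 2.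
    rewrite NN -subr_ge0; have -> : (P ^+ 2 + Q ^+ 2) * (X ^+ 2 + Y ^+ 2) - (P * X + Q * Y) ^+ 2 = (P * Y - Q * X) ^+ 2 by ring.
    exact: sqr_ge0.
  have vN0 : 0 <= vr * N by rewrite mulr_ge0 // ltW.
  have K2 : (vr * N) ^+ 2 < (P * X + Q * Y) ^+ 2.
    by rewrite ltr_pXn2r ?nnegrE //; apply: le_trans vN0 (ltW D).
  have K3 : (P ^+ 2 + Q ^+ 2) * N ^+ 2 <= vr ^+ 2 * N ^+ 2 by rewrite ler_wpM2r ?sqr_ge0.
  by move: (lt_le_trans K2 (le_trans K K3)); rewrite exprMn ltxx.
rewrite side_seg im_seg sc imc.
have k0 : 0 < (1 - u) * (mm * X0 + yb) + u * (mm * side s t - im t).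
  apply: cvx => //; last by lra.
  by rewrite addr_gt0 ?mulr_gt0 // (lt_trans v0).
lra.
Qed.

(* Half-planes below the tilted line meet the set [oset] in a set that is
   star-shaped about points deep below the disc. *)
Lemma low_star vr mm L s z t u : 0 < vr -> (cos (bigT gamma))^-1 <= mm -> vr < L -> arg_ok gamma z ->
  eta z t < - vr -> eta z (- (ci * Rc L)) < - vr -> oset vr mm s t -> 0 <= u <= 1 ->
  eta z (segp (- (ci * Rc L)) t u) < - vr /\ oset vr mm s (segp (- (ci * Rc L)) t u).
Proof.
move=> v0 hm vL az h1 h2 ot u01; have [c0 tb sE] := thet_tan az.
have es : eta z (segp (- (ci * Rc L)) t u) < - vr.
  by rewrite eta_seg; exact: cvxl.
split=> //.
have imL : im (- (ci * Rc L)) = - L by rewrite imN imM re_Rc im_Rc /=; ring.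
have reL : re (- (ci * Rc L)) = 0 by rewrite reN reM re_Rc im_Rc /=; ring.
have sL : side s (- (ci * Rc L)) = 0 by rewrite /side; case: (s); rewrite reL ?oppr0.
case: ot => [h|[k1 k2 k3]].
  by left; rewrite im_seg imL; apply: cvxl => //; lra.
have [u0|un] := eqVneq u 0.
  by left; rewrite im_seg u0 imL subr0 mul1r mul0r addr0; lra.
have up : 0 < u by rewrite lt_def un; case/andP: u01.
right; have sp : 0 < side s (segp (- (ci * Rc L)) t u).
  by rewrite side_seg sL mulr0 add0r mulr_gt0.
split=> //.
  rewrite -cm_gt_sqr ?(ltW v0) //; apply: lt_le_trans (eta_le z _).
  by rewrite ltr_normr; apply/orP; right; lra.
move: es sp; move: (segp _ _ _) => y es sp.
have e1 : im y * cos (thet gamma z) < re y * tan (thet gamma z) * cos (thet gamma z).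
  by move: es; rewrite etaE sE; lra.
rewrite ltr_pM2r // in e1; apply: lt_le_trans e1 _.
apply: le_trans (ler_norm _) _; rewrite normrM mulrC.
have -> : `|re y| = side s y.
  by move: sp; rewrite /side; case: (s) => sp; [rewrite ltr0_norm //; lra|rewrite gtr0_norm].
by rewrite ler_wpM2r ?(ltW sp) //; exact: le_trans tb hm.
Qed.

Lemma oset_both vr mm t : 0 < vr -> oset vr mm false t -> oset vr mm true t -> im t < - vr.
Proof. by move=> v0 [//|[h1 _ _]] [//|[h2 _ _]]; move: h1 h2; rewrite /side; lra. Qed.

Definition sec_b (s : sector) : bool := if s is U then true else false.

Lemma tline z t k : above_line (- (Rc k * period z)) (hat_theta gamma z) t ->
  - (k * pi * cos (psi gamma z)) < cm (rt z) * eta z t.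
Proof.
have s0 : 0 < cm (rt z) by rewrite cm_gt0 cexp_neq0.
rewrite /above_line -thetE => h.
have E : cm (rt z) * im ((t - - (Rc k * period z)) * cis (- thet gamma z)) =
    cm (rt z) * eta z t + k * pi * cos (psi gamma z).
  rewrite /eta opprK mulrDl imD mulrDr; congr (_ + _).
  have -> : Rc k * period z * cis (- thet gamma z) = Rc (k * pi * (cm (rt z))^-1) * (ci * cis (- psi gamma z)).
    have iv : (rt z)^-1 = - (Rc (cm (rt z))^-1 * cis (- phi z)).
      by rewrite {1}rt_cis invrN invfM cisN_V RcV.
    have -> : - psi gamma z = - phi z + - thet gamma z by rewrite /thet; ring.
    by rewrite /period iv (cisD (- phi z)) !RcM; ring.
  rewrite !imM re_Rc im_Rc !reM !re_cis !im_cis cosN sinN /=.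
  by field; rewrite gt_eqF.
by have := mulr_gt0 s0 h; rewrite E; lra.
Qed.

Lemma sigmaN c0 z u : Pilot.Defs.sigma gamma c0 z (- u) = - Pilot.Defs.sigma gamma c0 z u.
Proof.
rewrite /Pilot.Defs.sigma normrN sgrN; case: ifP => _; first by rewrite oppr0.
by ring.
Qed.

(** For U the time is negated: sigma is odd and the bounding lines of the two sectors are opposite,
    so both satisfy the inequalities of D. *)
Lemma gam_facts r h c0 vr s z t : (forall t, cm t <= vr -> Nset r z t) -> Gam gamma r h kap c0 s z t ->
  let t' := sgn (sec_b s) * t in
  [/\ vr < cm t', im t' < h + Pilot.Defs.sigma gamma c0 z (re t') &
      - ((2^-1 + kap) * pi * cos (psi gamma z)) < cm (rt z) * eta z t'].
Proof.
move=> disc; have nd t' : ~ Nset r z t' -> vr < cm t' by move=> h'; rewrite ltNge; apply/negP => /disc.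
case: s => /= -[h1 h2 h3]; rewrite /sgn ?expr0 ?expr1 ?mul1r ?mulN1r.
  by split; [exact: nd|exact: h2|exact: tline].
split; first by rewrite cmN; exact: nd.
  by rewrite imN reN sigmaN; lra.
apply: tline; move: h3; rewrite /above_line /below_line.
have -> : (- t - - (Rc (2^-1 + kap) * period z)) * cis (- hat_theta gamma z) =
  - ((t - Rc (2^-1 + kap) * period z) * cis (- hat_theta gamma z)) by ring.
by rewrite imN oppr_gt0.
Qed.

Lemma sqrt_eps z : Num.sqrt (expR (re z)) = cm (rt z).
Proof.
have -> : expR (re z) = cm (rt z) ^+ 2 by rewrite -cm_eps cm_cexp.
by rewrite sqrtr_sqr ger0_norm // cm_ge0.
Qed.

(** Measured in the tilted direction and scaled by |sqrt(eps)|, the upper boundary h + sigma stays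
    below nu, since c0 and |sqrt(eps)| h use at most half of it each. Outside the disc, points under
    this boundary lie under slope mm on their side. *)
Lemma cover h c0 vr nu mm z t : arg_ok gamma z -> 0 < h < vr -> h ^+ 2 < mm ^+ 2 * (vr ^+ 2 - h ^+ 2) ->
  (cos (bigT gamma))^-1 + 1 <= mm -> cm (rt z) * h <= c0 -> c0 <= nu / 2 -> cm (rt z) * h < nu / 2 ->
  vr < cm t -> im t < h + Pilot.Defs.sigma gamma c0 z (re t) ->
  - ((2^-1 + kap) * pi * cos (psi gamma z)) < cm (rt z) * eta z t ->
  strip nu z t /\ (oset vr mm false t \/ oset vr mm true t).
Proof.
move=> az /andP[h0 hv] hm tm hc cn hn vt ht hl; have [ct tb sE] := thet_tan az.
have s0 : 0 < cm (rt z) by rewrite cm_gt0 cexp_neq0.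
have v0 : 0 < vr by apply: lt_trans hv.
have c00 : 0 < c0 by apply: lt_le_trans hc; rewrite mulr_gt0.
move: ht; rewrite /Pilot.Defs.sigma sqrt_eps -thetE.
have [a aE] : exists a : R, a = c0 / cm (rt z) by eexists.
have sa : cm (rt z) * a = c0 by rewrite aE mulrC divfK // gt_eqF.
have ha : h <= a by rewrite aE ler_pdivlMr // mulrC.
have a0 : 0 < a by rewrite aE divr_gt0.
rewrite -aE; have vt2 := vt; rewrite cm_gt_sqr ?(ltW v0) // in vt2.
have [X XE] : exists X : R, X = re t by eexists.
have [Y YE] : exists Y : R, Y = im t by eexists.
have [c cE] : exists c, c = cos (thet gamma z) by eexists.
have [k kE] : exists k, k = tan (thet gamma z) by eexists.
rewrite -XE -YE -kE => ht; rewrite -kE -cE in sE; rewrite -kE in tb; rewrite -cE in ct; rewrite -XE -YE in vt2.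
have c1 : c <= 1 by rewrite cE cos_le1.
have kc : `|k * c| <= 1 by rewrite -sE ler_norml sin_geN1 sin_le1.
have sg0 := @normr_ge0 _ _ X.
split.
  rewrite /strip hl /= etaE -XE -YE -cE sE.
  have -> : Y * c - X * (k * c) = c * (Y - X * k) by ring.
  suff : c * (Y - X * k) < h + a.
    move=> q; have : cm (rt z) * (c * (Y - X * k)) < cm (rt z) * (h + a) by rewrite ltr_pM2l.
    have q3 : cm (rt z) * (h + a) = cm (rt z) * h + c0 by rewrite mulrDr sa.
    clear -cn hn q3; lra.
  have hch : c * h <= h by rewrite ler_piMl // ltW.
  have [aX|aX] := leP `|X| a.
    move: ht; rewrite aX addr0 => ht.
    have q1 : c * Y < c * h by rewrite ltr_pM2l.
    have q2 : `|X * (k * c)| <= a * 1 by rewrite normrM; apply: ler_pM.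
    by move: q2; rewrite ler_norml mulr1 => /andP[q2 _]; clear -hch q1 q2; lra.
  move: ht; rewrite leNgt aX /= => ht.
  have q1 : c * (Y - X * k) < c * (h - Num.sg X * a * k) by rewrite ltr_pM2l //; clear gamma0 gammaT kap0
    kap2 pp cvx cvxl h0 hv hm tm hc cn hn vt hl s0 v0 c00 aE sa ha a0 XE YE cE kE sE tb ct vt2 c1 kc sg0
    hch aX; lra.
  have q2 : `|Num.sg X * a * (k * c)| <= a * 1.
    rewrite normrM; apply: ler_pM => //.
    rewrite normrM (gtr0_norm a0) ler_piMl ?(ltW a0) // normr_sg; by case: (_ != _).
  by move: q2; rewrite ler_norml mulr1 => /andP[q2 _]; clear -hch q1 q2; lra.
have mm1 : 1 <= mm by have := le_trans (normr_ge0 _) tb; clear gamma0 gammaT kap0 kap2 pp cvx cvxl h0 hv hm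
    hc cn hn vt hl s0 v0 c00 aE sa ha a0 XE YE cE kE ht sE tb ct vt2 c1 kc sg0; lra.
have mm0 : 0 < mm by clear gamma0 gammaT kap0 kap2 pp cvx cvxl h0 hv hm tm hc cn hn vt hl s0 v0 c00 aE sa
    ha a0 XE YE cE kE ht sE tb ct vt2 c1 kc sg0; lra.
have tbm : `|k| <= mm - 1 by clear gamma0 gammaT kap0 kap2 pp cvx cvxl h0 hv hm hc cn hn vt hl s0 v0 c00 aE
    sa ha a0 XE YE cE kE ht sE ct vt2 c1 kc sg0 mm1 mm0; lra.
(* Up to abscissa a the height is below h, and for positive height lying outside the disc means x^2
   > vr^2 - h^2, so [hm] puts h under mm x. Beyond a the boundary rises with slope at most mm - 1,
   and h <= a < x accounts for the rest. *)
have key (x : R) : 0 < x -> x ^+ 2 = X ^+ 2 -> (x <= a -> Y < h) -> (a < x -> Y < h + (x - a) * (mm - 1)) -> Y < mm * x.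
  move=> x0 xX h1 h2; have [xa|xa] := leP x a.
    have Yh := h1 xa; have [y0|y0] := leP Y 0; first by apply: le_lt_trans y0 _; rewrite mulr_gt0.
    rewrite -(ltr_pXn2r (n := 2)) ?nnegrE ?(ltW y0) ?mulr_ge0 ?(ltW mm0) ?(ltW x0) // exprMn.
    have y2 : Y ^+ 2 < h ^+ 2 by rewrite ltr_pXn2r ?nnegrE ?(ltW y0) ?(ltW h0).
    have x2 : vr ^+ 2 - h ^+ 2 < x ^+ 2 by rewrite xX; clear gamma0 gammaT kap0 kap2 pp cvx cvxl h0 hv hm tm hc
    cn hn vt hl s0 v0 c00 aE sa ha a0 XE YE cE kE ht sE tb ct c1 kc sg0 mm1 mm0 tbm x0 xX h1 h2 xa Yh y0; lra.
    have : mm ^+ 2 * (vr ^+ 2 - h ^+ 2) < mm ^+ 2 * x ^+ 2 by rewrite ltr_pM2l // exprn_gt0.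
    clear gamma0 gammaT kap0 kap2 pp cvx cvxl h0 hv tm hc cn hn vt hl s0 v0 c00 aE sa ha a0 XE YE cE kE ht sE
    tb ct vt2 c1 kc sg0 mm1 mm0 tbm x0 xX h1 h2 xa Yh y0 x2; lra.
  have Yh := h2 xa; have q : (x - a) * (mm - 1) <= x * (mm - 1) by rewrite ler_wpM2r //; clear gamma0 gammaT
    kap0 kap2 pp cvx cvxl h0 hv hm tm hc cn hn vt hl s0 v0 c00 aE sa ha XE YE cE kE ht sE tb ct vt2 c1 kc
    sg0 mm0 tbm x0 xX h1 h2 xa; lra.
  have -> : mm * x = x + x * (mm - 1) by ring.
  clear -ha xa Yh q; lra.
have [X0|X0|X0] := ltgtP X 0.
- right; right; rewrite /side -XE -YE; split=> //; first by rewrite oppr_gt0.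
  apply: key; rewrite ?sqrrN ?oppr_gt0 // => xa.
    by move: ht; rewrite ltr0_norm // xa addr0.
  move: ht; rewrite ltr0_norm // leNgt xa /= ltr0_sg // => ht.
  have : (- X - a) * - k <= (- X - a) * (mm - 1).
    rewrite ler_wpM2l ?subr_ge0 ?(ltW xa) //; apply: le_trans (ler_norm _) _; by rewrite normrN.
  clear gamma0 gammaT kap0 kap2 pp cvx cvxl h0 hv hm tm hc cn hn vt hl s0 v0 c00 aE sa ha a0 XE YE cE kE sE
    tb ct vt2 c1 kc sg0 mm1 mm0 tbm X0 xa; lra.
- left; right; rewrite /side -XE -YE; split=> //.
  apply: key => // xa; first by move: ht; rewrite gtr0_norm // xa addr0.
  move: ht; rewrite gtr0_norm // leNgt xa /= gtr0_sg // mul1r => ht.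
  have : (X - a) * k <= (X - a) * (mm - 1).
    by rewrite ler_wpM2l ?subr_ge0 ?(ltW xa) //; apply: le_trans (ler_norm _) _.
  clear gamma0 gammaT kap0 kap2 pp cvx cvxl h0 hv hm tm hc cn hn vt hl s0 v0 c00 aE sa ha a0 XE YE cE kE sE
    tb ct vt2 c1 kc sg0 mm1 mm0 tbm X0 xa; lra.
left; left; rewrite -YE; move: ht; rewrite X0 normr0 (ltW a0) addr0 => Yh.
rewrite X0 expr0n /= add0r in vt2; have [y0|y0] := leP 0 Y.
  exfalso; move: vt2; rewrite ltr_pXn2r ?nnegrE ?(ltW v0) //; clear gamma0 gammaT kap0 kap2 pp cvx cvxl h0 hm
    tm hc cn hn vt hl s0 v0 c00 aE sa ha a0 XE YE cE kE sE tb ct c1 kc sg0 mm1 mm0 tbm key X0 y0; lra.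
have : vr < - Y by rewrite -(ltr_pXn2r (n := 2)) ?nnegrE ?(ltW v0) ?sqrrN // oppr_ge0 ltW.
clear gamma0 gammaT kap0 kap2 pp cvx cvxl h0 hv hm tm hc cn hn vt hl s0 v0 c00 aE sa ha a0 XE YE cE kE sE
    tb ct c1 kc sg0 mm1 mm0 tbm key X0 Yh vt2 y0; lra.
Qed.

Lemma bigT_ge0 : 0 <= bigT gamma.
Proof.
have g0 := gamma0; have p0 := pp; have q0 : 0 <= 2 * gamma / pi by rewrite divr_ge0 ?mulr_ge0 // ltW.
by rewrite /bigT mulr_ge0 ?addr_ge0 // ltW.
Qed.

Lemma ww_seg s z t t' u : ww s z (segp t t' u) = segp (ww s z t) (ww s z t') u.
Proof. by rewrite /ww /segp; ring. Qed.

Definition zdom (s1 : R) z := cm (rt z) < s1 /\ arg_ok gamma z.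

(** The half-strip below the disc in the tilted sense. It is convex and contains w = 0 with the
    whole line on which the columns are constructed. *)
Definition low (s1 nu vr : R) o z w := (zdom s1 z /\ strip nu z (tt o z w)) /\ eta z (tt o z w) < - vr.

Definition fan (s1 nu vr mm : R) s o z w := (zdom s1 z /\ strip nu z (tt o z w)) /\ oset vr mm s (tt o z w).

Definition wdom (s1 nu vr mm : R) o := dom (low s1 nu vr o) (fan s1 nu vr mm false o) (fan s1 nu vr mm true o).

Let rc_angle k : rcont (fun z _ => phi z * k).
Proof.
have -> : (fun z (_ : C) => phi z * k) = (fun z _ => im z * (2^-1 * k) + - pi * k).
  by apply/funext => z; apply/funext => _; rewrite /phi; ring.
apply: rcontD; last exact: rcont_cst.
by apply: rcontM; [apply: rcont_im; exact: hol2_fst|exact: rcont_cst].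
Qed.

Let rc_psi : rcont (fun z _ => psi gamma z). Proof. exact: rc_angle. Qed.

Let rc_thet : rcont (fun z _ => thet gamma z).
Proof.
have -> : (fun z (_ : C) => thet gamma z) = (fun z _ => phi z * (1 - 2 * gamma / pi) - phi z * 1).
  by apply/funext => z; apply/funext => _; rewrite /thet /psi mulr1.
by apply: rcontB; exact: rc_angle.
Qed.

Let rc_eta o : rcont (fun z w => eta z (tt o z w)).
Proof.
have -> : (fun z w => eta z (tt o z w)) =
    (fun z w => im (tt o z w) * cos (thet gamma z) - re (tt o z w) * sin (thet gamma z)).
  by apply/funext => z; apply/funext => w; rewrite etaE.
have ht := hol2_tt o; apply: rcontB; apply: rcontM.
- exact: rcont_im.
- by apply: (rcont_comp1 (f := cos)); [exact: continuous_cos|exact: rc_thet].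
- exact: rcont_re.
- by apply: (rcont_comp1 (f := sin)); [exact: continuous_sin|exact: rc_thet].
Qed.

Lemma zdom_open s1 : opn2 (fun z _ => zdom s1 z).
Proof.
apply: opn2_and; first by apply: rcont_lt; [exact: rcont_cmrt|exact: rcont_cst].
by move=> p w /arg_ok_open[d d0 Hd]; exists d => // x y xd _; exact: Hd.
Qed.

Let base_open s1 nu o : opn2 (fun z w => zdom s1 z /\ strip nu z (tt o z w)).
Proof.
apply: opn2_and; first exact: zdom_open.
have E : (fun z w => is_true (strip nu z (tt o z w))) =
  (fun z w => - ((2^-1 + kap) * pi * cos (psi gamma z)) < cm (rt z) * eta z (tt o z w) /\
     cm (rt z) * eta z (tt o z w) < nu).
  by apply/funext => z; apply/funext => w; apply/propext; rewrite /strip; split => [/andP|/andP].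
have h1 : rcont (fun z w => cm (rt z) * eta z (tt o z w)).
  by apply: rcontM; [exact: rcont_cmrt|exact: rc_eta].
rewrite E; apply: opn2_and; apply: rcont_lt => //; last exact: rcont_cst.
apply: rcontN; apply: rcontM; first exact: rcont_cst.
by apply: (rcont_comp1 (f := cos)); [exact: continuous_cos|exact: rc_psi].
Qed.

Lemma low_open s1 nu vr o : opn2 (low s1 nu vr o).
Proof.
apply: opn2_and; first exact: base_open.
by apply: rcont_lt; [exact: rc_eta|exact: rcont_cst].
Qed.

Lemma fan_open s1 nu vr mm s o : opn2 (fan s1 nu vr mm s o).
Proof.
have ht := hol2_tt o; have hi := rcont_im ht; have hr := rcont_re ht.
have hs : rcont (fun z w => side s (tt o z w)) by rewrite /side; case: (s) => //; exact: rcontN.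
apply: opn2_and; first exact: base_open.
have E : (fun z w => oset vr mm s (tt o z w)) = (fun z w => im (tt o z w) < - vr \/
    (0 < side s (tt o z w) /\ (vr ^+ 2 < re (tt o z w) ^+ 2 + im (tt o z w) ^+ 2 /\
     im (tt o z w) < mm * side s (tt o z w)))).
  apply/funext => z; apply/funext => w; apply/propext; rewrite /oset.
  by split=> [[h|[h1 h2 h3]]|[h|[h1 [h2 h3]]]]; [left|right|left|right].
rewrite E; apply: opn2_or; first by apply: rcont_lt => //; exact: rcont_cst.
apply: opn2_and; first by apply: rcont_lt => //; exact: rcont_cst.
apply: opn2_and; apply: rcont_lt => //; first exact: rcont_cst.
  by apply: rcontD; under eq_fun do under eq_fun do rewrite expr2; exact: rcontM.
by apply: rcontM => //; exact: rcont_cst.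
Qed.

Lemma strip_small nu z t : arg_ok gamma z -> cm (rt z) * `|eta z t| < nu ->
  cm (rt z) * `|eta z t| < del0 gamma -> strip nu z t.
Proof.
move=> az h1 h2; have /andP[c1 _] := cos_psi gamma0 gammaT az; have c0 := cos_psi_gt0 gamma0 gammaT az.
have k0 := kap0; have p2 := pihalf_ge1 R.
have h3 : del0 gamma <= (2^-1 + kap) * pi * cos (psi gamma z).
  apply: le_trans c1 _; rewrite ler_peMl ?(ltW c0) //.
  have : 0 <= kap * pi by rewrite mulr_ge0 ?(ltW k0) // ltW.
  by rewrite mulrDl [2^-1 * pi]mulrC; lra.
have s0 := cm_ge0 (rt z).
have h4 : `|cm (rt z) * eta z t| = cm (rt z) * `|eta z t| by rewrite normrM ger0_norm.
have := ler_norm (cm (rt z) * eta z t); have := ler_norm (- (cm (rt z) * eta z t)); rewrite normrN h4 => q1 q2.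
by rewrite /strip; apply/andP; split; lra.
Qed.

(** w = 0 has scaled height - (pi/2) cos psi: inside the strip because kap > 0, and below the disc
    once |sqrt(eps)| vr < del0. *)
Lemma center_low s1 nu vr o z : zdom s1 z -> 0 < nu -> cm (rt z) * vr < del0 gamma -> low s1 nu vr o z 0.
Proof.
move=> zz nu0 hv; have [_ az] := zz.
have /andP[c1 _] := cos_psi gamma0 gammaT az; have c0 := cos_psi_gt0 gamma0 gammaT az.
have s0 : 0 < cm (rt z) by rewrite cm_gt0 cexp_neq0.
have E : cm (rt z) * eta z (tt o z 0) = - (pi / 2 * cos (psi gamma z)).
  rewrite eta_rot /tt mulr0 subr0 [rt z * _]mulrC divfK ?cexp_neq0 // /hpi.
  by rewrite !imM !reM re_Rc im_Rc re_cis im_cis cosN /=; ring.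
have p2 := pihalf_ge1 R; have k0 := kap0.
have q1 : cos (psi gamma z) <= pi / 2 * cos (psi gamma z) by rewrite ler_peMl // ltW.
split; last first.
  rewrite -(ltr_pM2l s0) E mulrN ltrN2; lra.
split=> //; rewrite /strip E.
have q2 : 0 < kap * (pi * cos (psi gamma z)) by rewrite !mulr_gt0.
have -> : (2^-1 + kap) * pi * cos (psi gamma z) = pi / 2 * cos (psi gamma z) + kap * (pi * cos (psi gamma z)).
  by move: (pi : R) => P; ring.
by apply/andP; split; lra.
Qed.

Lemma cm_ctr X0 mm s : 0 < X0 -> 1 <= mm -> cm (ctr X0 mm s) <= 2 * X0.
Proof.
move=> X00 m1; apply: le_trans (cm_le_reim _) _.
have m2 : 0 < 2 * mm by lra.
have -> : `|re (ctr X0 mm s)| = X0.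
  rewrite /ctr reB reM !re_Rc im_Rc /= mul0r mulr0 subr0 subr0.
  by case: (s); rewrite ?normrN gtr0_norm.
rewrite im_ctr normrN gtr0_norm; last by rewrite divr_gt0.
have : X0 / (2 * mm) <= X0 by rewrite ler_pdivrMr // ler_peMr ?(ltW X00) //; lra.
lra.
Qed.

Lemma eta_depth z L : eta z (- (ci * Rc L)) = - (L * cos (thet gamma z)).
Proof. by rewrite etaE imN imM reN reM re_Rc im_Rc /=; ring. Qed.

Lemma im_depth L : im (- (ci * Rc L) : C) = - L.
Proof. by rewrite imN imM re_Rc im_Rc /=; ring. Qed.

Lemma cm_depth L : 0 < L -> cm (- (ci * Rc L) : C) = L.
Proof. by move=> L0; rewrite cmN cmM cm_ci mul1r cm_Rc gtr0_norm. Qed.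

Lemma eta_cm vr z t : eta z t < - vr -> vr < cm t.
Proof. by move=> h; apply: lt_le_trans (eta_le z t); rewrite ltr_normr; apply/orP; right; lra. Qed.

(** The two fans overlap below the disc in the vertical sense, which need not be below it in the
    tilted sense; a vertical descent leads from there into [low]. *)
Lemma descend vr z t : arg_ok gamma z -> 0 < vr -> im t < - vr -> exists t',
  [/\ t' = t \/ `|eta z t'| <= vr + 1, eta z t' < - vr & im t' < - vr].
Proof.
move=> az v0 hY; have [h|h] := ltP (eta z t) (- vr); first by exists t; split=> //; left.
have [c0 _ _] := thet_tan az.
have [U UE] : exists U : R, U = (eta z t + vr + 1) / cos (thet gamma z) by eexists.
have UC : U * cos (thet gamma z) = eta z t + vr + 1 by rewrite UE divfK // gt_eqF.
have U0 : 0 <= U by rewrite UE divr_ge0 ?(ltW c0) //; lra.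
exists (t - ci * Rc U).
have [e1 e2] : im (t - ci * Rc U) = im t - U /\ re (t - ci * Rc U) = re t.
  by rewrite imB reB imM reM re_Rc im_Rc /=; split; ring.
have ee : eta z (t - ci * Rc U) = - vr - 1.
  have e3 := etaE z t; rewrite (etaE z (t - _)) e1 e2 mulrBl UC; lra.
rewrite ee e1; split; [right|lra|lra].
by rewrite -opprD normrN gtr0_norm //; lra.
Qed.

Definition gd (r1 : R) z w := good r1 z w /\ cm (rt z) < r1.

Lemma gd_open r1 : opn2 (gd r1).
Proof.
apply: opn2_and; first exact: good_open.
by apply: rcont_lt; [exact: rcont_cmrt|exact: rcont_cst].
Qed.

(** [nu] is fixed before the radius, the slope and the parameter bound, because c0 is chosen against
    it. Size and system are quantified last: the n x n system and the scalar equations of the model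
    solutions are continued over the same domain. *)
Lemma continuation (r1 : R) : 0 < r1 -> exists nu : R, [/\ 0 < nu, nu <= (2^-1 - kap) * pi * del0 gamma &
  forall vr mm, 0 < vr -> 2 <= vr * r1 -> (cos (bigT gamma))^-1 + 1 <= mm -> exists2 s0 : R, 0 < s0 &
  forall s1, s1 <= s0 ->
  (forall z w, wdom s1 nu vr mm false z w \/ wdom s1 nu vr mm true z w -> gd r1 z w) /\
  (forall o z, zdom s1 z -> low s1 nu vr o z 0) /\
  forall o n (A Y0 : C -> C -> 'M[C]_n), hol2mx (gd r1) A ->
   hol2mx (reach (gd r1) (fun=> 0)) Y0 -> solves A (reach (gd r1) (fun=> 0)) Y0 ->
   (forall z w, reach (gd r1) (fun=> 0) z w -> Y0 z w \in unitmx) ->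
   exists Y, [/\ hol2mx (wdom s1 nu vr mm o) Y, solves A (wdom s1 nu vr mm o) Y,
     forall z w, wdom s1 nu vr mm o z w -> Y z w \in unitmx &
     forall z w, low s1 nu vr o z w -> Y z w = Y0 z w]].
Proof.
move=> r10; have [nu [sg [nu0 sg0 nuk sgood]]] := strip_good r10; exists nu; split=> // vr mm v0 vr1 hmm.
have d00 := del0_gt0 gamma0 gammaT.
have cT : 0 < cos (bigT gamma).
  apply: cos_gt0_pihalf; rewrite gammaT andbT; have := bigT_ge0; have := pp; move: (bigT gamma) => q; lra.
have tb0 : 0 < (cos (bigT gamma))^-1 by rewrite invr_gt0.
have mm1 : 1 <= mm by lra.
have [X0 X0E] : exists X0 : R, X0 = vr * (2 * (1 + mm)) + 1 by eexists.
have vm : 0 <= vr * mm by rewrite mulr_ge0 ?(ltW v0) //; lra.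
have hX1 : vr * (2 * mm) < X0 by rewrite X0E; lra.
have hX2 : vr * (2 * (1 + mm)) < X0 by rewrite X0E; lra.
have X00 : 0 < X0 by rewrite X0E; lra.
(* Deep enough for - i L to lie below the disc under every admissible tilt, since cos hat_theta >=
   cos bigT. *)
have [L LE] : exists L : R, L = (vr + 1) * (cos (bigT gamma))^-1 by eexists.
have L0 : 0 < L by rewrite LE mulr_gt0 //; lra.
have LT : L * cos (bigT gamma) = vr + 1 by rewrite LE divfK // gt_eqF.
have vL : vr < L.
  have : L * cos (bigT gamma) <= L by rewrite ler_piMr ?(ltW L0) // cos_le1.
  lra.
(* K bounds the tilted heights of all auxiliary points: the fan centres, the meeting point - i L and
   the points produced by [descend]. Then |sqrt(eps)| K < min(nu, del0) places them in the strip. *)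
have [K KE] : exists K : R, K = (vr + 1) + L + 2 * X0 by eexists.
have K0 : 0 < K by rewrite KE; lra.
have KX : 2 * X0 <= K by rewrite KE; lra.
have KL : L <= K by rewrite KE; lra.
have Kv : vr + 1 <= K by rewrite KE; lra.
have Kv' : vr <= K by lra.
have vr1' : vr < vr + 1 by lra.
have tm : (cos (bigT gamma))^-1 <= mm by lra.
have [m mE] : exists m : R, m = Num.min nu (del0 gamma) by eexists.
have m0 : 0 < m by rewrite mE lt_min nu0.
have mn : m <= nu by rewrite mE ge_min lexx.
have md : m <= del0 gamma by rewrite mE ge_min lexx orbT.
exists (Num.min (Num.min sg r1) (m / K)); first by rewrite !lt_min sg0 r10 divr_gt0.
move=> s1; rewrite !le_min => /andP[/andP[s1g s1r] s1K].
have zK z x : zdom s1 z -> 0 <= x -> x <= K -> cm (rt z) * x < m.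
  move=> [h _] x0 xK; have : cm (rt z) * K < m by rewrite -ltr_pdivlMr //; exact: lt_le_trans s1K.
  by apply: le_lt_trans; rewrite ler_wpM2l // cm_ge0.
have zsmall z t : zdom s1 z -> `|eta z t| <= K -> strip nu z t.
  move=> zz et; have [_ az] := zz; have h := zK z `|eta z t| zz (normr_ge0 _) et.
  by apply: strip_small => //; [exact: lt_le_trans mn|exact: lt_le_trans md].
have Sgood o z t : zdom s1 z -> strip nu z t -> vr < cm t -> gd r1 z (ww o z t).
  move=> [h az] st vt; split; last exact: lt_le_trans s1r.
  by apply: (sgood vr) => //; exact: lt_le_trans s1g.
have low0 o z : zdom s1 z -> low s1 nu vr o z 0.
  move=> zz; apply: center_low => //; apply: lt_le_trans md; exact: (zK _ _ zz (ltW v0) Kv').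
have lowr o z w : low s1 nu vr o z w -> reach (gd r1) (fun=> 0) z w.
  move=> [[zz st] he] u u01; have -> : 0 + Rc u * (w - 0) = ww o z (segp (tt o z 0) (tt o z w) u) by rewrite ww_seg !ttK.
  have [[_ st0] he0] := low0 o z zz.
  apply: Sgood => //; first exact: strip_seg.
  by apply: (@eta_cm vr z); rewrite eta_seg; exact: cvxl.
have Cst s z : zdom s1 z -> strip nu z (ctr X0 mm s).
  move=> zz; apply: (zsmall _ _ zz); apply: le_trans (eta_le z _) _.
  apply: le_trans (cm_ctr s X00 mm1) _; exact: KX.
have fanr s o z w : fan s1 nu vr mm s o z w -> reach (gd r1) (fun z => ww o z (ctr X0 mm s)) z w.
  move=> [[zz st] ot] u u01; have -> : ww o z (ctr X0 mm s) + Rc u * (w - ww o z (ctr X0 mm s)) = ww o z (segp (ctr X0 mm s) (tt o z w) u).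
    by rewrite ww_seg ttK.
  apply: Sgood => //; first by apply: strip_seg => //; exact: Cst.
  by apply: (@oset_cm vr mm s) => //; exact: oset_star.
have Leta z : zdom s1 z -> eta z (- (ci * Rc L)) < - vr.
  move=> [_ az]; have [_ cc] := cos_thet gamma0 gammaT az; rewrite eta_depth ltrN2.
  apply: lt_le_trans (ler_wpM2l (ltW L0) cc); rewrite LT; exact: vr1'.
have Lst z : zdom s1 z -> strip nu z (- (ci * Rc L)).
  move=> zz; apply: (zsmall _ _ zz); apply: le_trans (eta_le z _) _.
  rewrite cm_depth //; exact: KL.
pose mw o z := ww o z (- (ci * Rc L)).
have lowm o z : zdom s1 z -> low s1 nu vr o z (mw o z).
  by move=> zz; rewrite /low /mw wwK; split; [split=> //; exact: Lst|exact: Leta].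
have fanm s o z : zdom s1 z -> fan s1 nu vr mm s o z (mw o z).
  by move=> zz; rewrite /fan /mw wwK; split; [split=> //; exact: Lst|left; rewrite im_depth ltrN2].
have P01 s o z w u : low s1 nu vr o z w -> fan s1 nu vr mm s o z w -> 0 <= u <= 1 ->
    low s1 nu vr o z (segp (mw o z) w u) /\ fan s1 nu vr mm s o z (segp (mw o z) w u).
  move=> [[zz st] he] [_ ot] u01; have [_ az] := zz.
    have [h1 h2] := low_star v0 tm vL az he (Leta z zz) ot u01.
  have h3 := strip_seg (Lst z zz) st u01.
  by rewrite /low /fan !tt_seg wwK; split.
have P12 o z w : fan s1 nu vr mm false o z w -> fan s1 nu vr mm true o z w ->
    exists2 w', low s1 nu vr o z w' & forall u, 0 <= u <= 1 ->
    fan s1 nu vr mm false o z (segp w' w u) /\ fan s1 nu vr mm true o z (segp w' w u).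
  move=> [[zz st] o1] [_ o2]; have [_ az] := zz; have hY := oset_both v0 o1 o2.
  have [t tE] : exists t, t = tt o z w by eexists.
  rewrite -tE in st hY.
  have [t' [e' lt' it']] := descend az v0 hY.
  have ht' : strip nu z t' by case: e' => [-> //|e']; apply: (zsmall _ _ zz); exact: le_trans e' Kv.
  exists (ww o z t'); first by rewrite /low wwK.
  move=> u u01; have h1 : strip nu z (segp t' t u) by exact: strip_seg.
  have h2 : im (segp t' t u) < - vr by rewrite im_seg; exact: cvxl.
  by rewrite /fan !tt_seg wwK -tE; split; split=> //; left.
split; [|split=> //].
  have G o z w : wdom s1 nu vr mm o z w -> gd r1 z w.
    by case=> H; [case: (reach_G (lowr _ _ _ H))|case: (reach_G (fanr _ _ _ _ H))|case: (reach_G (fanr _ _ _ _ H))].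
  by move=> z w [/G|/G].
move=> o n A Y0 hA h1 h2 h3.
have pm s z w : fan s1 nu vr mm s o z w -> low s1 nu vr o z (mw o z) /\ fan s1 nu vr mm s o z (mw o z).
  by move=> [[zz _] _]; split; [exact: lowm|exact: fanm].
exact: (glue (@gd_open r1) hA (@low_open s1 nu vr o) (@fan_open s1 nu vr mm false o)
  (@fan_open s1 nu vr mm true o) (cdiff_cst 0) (ww_diff o (ctr X0 mm false)) (ww_diff o (ctr X0 mm true))
  (ww_diff o (- (ci * Rc L))) (lowr o) (fanr false o) (fanr true o) (pm false) (pm true)
  (fun z w u => @P01 false o z w u) (fun z w u => @P01 true o z w u) (P12 o) h1 h2 h3).
Qed.

End Strip.

End Geometry.

(** * From moduli to limits, derivatives and analyticity in normed spaces *)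

Section Bridge.
Context {R : realType}.
Local Notation C := (cplx R).
Implicit Types (z w a b l t : C) (u v e d M : R).
Local Notation rt := (@Pilot.Defs.sqrte R).
Opaque cexp.

Lemma posC (e : C) : 0 < e -> exists2 d : R, 0 < d & e = Rc d.
Proof.
case: e => x y; rewrite ltcE /= => /andP[/eqP yE x0]; exists x => //.
by apply: C_eqP => //=; rewrite yE.
Qed.

Lemma normC_le (z : C) M : (`|z| <= Rc M) = (cm z <= M).
Proof. by rewrite normE Rc_le. Qed.

Lemma nbhsCP (z : C) (P : set C) : nbhs z P <-> exists2 d, 0 < d & forall k, cm k < d -> P (z + k).
Proof.
split=> [/nbhs_ballP[e /= e0 H]|[d d0 H]].
  have [d d0 dE] := posC e0; exists d => // k kd; apply: H; rewrite /ball /= opprD addrA subrr sub0r normrN.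
  by rewrite normE dE Rc_lt.
apply/nbhs_ballP; exists (Rc d); first by rewrite /= -Rc0 Rc_lt.
move=> y; rewrite /ball /= normE Rc_lt cmBC => yd; have := H _ yd.
by rewrite addrC subrK.
Qed.

Lemma normCC_lt (h : C * C) d : (`|h| < Rc d) = (cm h.1 < d) && (cm h.2 < d).
Proof.
rewrite prod_normE /= !normE /Order.max Rc_lt; case: ifP => k; rewrite Rc_lt.
  by case: (ltP (cm h.2) d) => [q|]; rewrite ?andbT ?andbF // (lt_trans k q).
by case: (ltP (cm h.1) d) => [q|] //=; apply/esym; apply: le_lt_trans q; rewrite leNgt k.
Qed.

Lemma nbhsCCP (q : C * C) (P : set (C * C)) : nbhs q P <->
  exists2 d, 0 < d & forall x y, cm x < d -> cm y < d -> P (q.1 + x, q.2 + y).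
Proof.
split=> [/nbhs_ballP[e /= e0 H]|[d d0 H]].
  have [d d0 dE] := posC e0; exists d => // x y xd yd; apply: H; rewrite -ball_normE /= dE normCC_lt /=.
  by rewrite !opprD !addrA !subrr !sub0r !cmN xd.
apply/nbhs_ballP; exists (Rc d); first by rewrite /= -Rc0 Rc_lt.
move=> [y1 y2] [/= b1 b2].
have h1 : cm (y1 - q.1) < d by move: b1; rewrite /ball /= normE Rc_lt cmBC.
have h2 : cm (y2 - q.2) < d by move: b2; rewrite /ball /= normE Rc_lt cmBC.
by have := H _ _ h1 h2; rewrite [q.1 + _]addrC [q.2 + _]addrC !subrK.
Qed.

Lemma mxnorm_le m n (A : 'M[C]_(m, n)) M : 0 <= M -> (forall i j, cm (A i j) <= M) -> `|A| <= Rc M.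
Proof.
move=> M0 H; have [e|ne] := eqVneq (mx_norm A) 0; first by rewrite [`|A|]e -Rc0 Rc_le.
by have [i ->] := mx_norm_neq0 ne : exists i, `|A| = _; rewrite normC_le.
Qed.

Lemma fin_min (I : finType) (P : I -> R -> Prop) : (forall i d d', P i d -> d' <= d -> P i d') ->
  (forall i, exists2 d, 0 < d & P i d) -> exists2 d, 0 < d & forall i, P i d.
Proof.
move=> mono H; have [f Hf] := choice (fun i => let: ex_intro2 d p q := H i in ex_intro (fun d => 0 < d /\ P i d) d (conj p q)).
suff [d d0 Hd] : exists2 d, 0 < d & forall i, i \in enum I -> d <= f i.
  by exists d => // i; apply: mono (proj2 (Hf i)) _; apply: Hd; rewrite mem_enum.
elim: (enum I) => [|i s [d d0 IH]]; first by exists 1.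
exists (Num.min d (f i)); first by rewrite lt_min d0 (proj1 (Hf i)).
move=> k; rewrite in_cons => /orP[/eqP ->|ks]; first by rewrite ge_min lexx orbT.
by rewrite ge_min IH.
Qed.

Lemma mx_derive m n (M : C -> 'M[C]_(m, n)) z (D : 'M[C]_(m, n)) :
  (forall i j, cder (fun x => M x i j) z (D i j)) -> is_derive z 1 M D.
Proof.
move=> H.
have L : h^-1 *: ((M \o shift z) (h *: 1) - M z) @[h --> 0^'] --> D.
  apply/cvgrPdist_le => e e0; have [e' e'0 eE] := posC e0.
  have [[i j] d d' P dd'|[i j]|d d0 Hd] := @fin_min ('I_m * 'I_n)%type (fun p d => forall k, cm k < d ->
    cm (M (z + k) p.1 p.2 - M z p.1 p.2 - D p.1 p.2 * k) <= e' * cm k).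
  - by move=> k kd; apply: P; exact: lt_le_trans dd'.
  - exact: H.
  rewrite near_withinE near_simpl; apply/nbhsCP; exists d => // k kd; rewrite add0r => k0.
  rewrite eE; apply: mxnorm_le; first exact: ltW.
  move=> i j; rewrite !mxE /= [k *: 1]mulr1 [k + z]addrC.
  have k0' : 0 < cm k by rewrite cm_gt0.
  have := Hd (i, j) k kd; rewrite -ler_pdivrMr //= -cmV -cmM cmBC => h.
  apply: le_trans h; rewrite le_eqVlt; apply/orP; left; apply/eqP; congr cm.
  by field.
have dv : derivable M z 1 by apply/cvg_ex; exists D.
by apply: DeriveDef => //; exact: cvg_lim L.
Qed.

Lemma derivable_cder (f : C -> C) z : derivable f z 1 -> cdiff f z.
Proof.
move=> /cvg_ex[l] /= Hl.
have H := @cvgr_dist_le _ C _ _ _ _ l Hl.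
exists l => e e0.
have e1 : 0 < Rc e by rewrite -Rc0 Rc_lt.
have [d d0 Hd] := iffLR (nbhsCP _ _) (H _ _ e1); exists d => // k kd.
have [->|k0] := eqVneq k 0; first by rewrite cm0 !mulr0 addr0 subrr subr0 cm0.
have := Hd k kd; rewrite add0r => /(_ k0); rewrite normC_le [k *: 1]mulr1 => h.
have -> : f (z + k) - f z - l * k = - ((l - k^-1 * (f (k + z) - f z)) * k).
  by rewrite [k + z]addrC; field.
by rewrite cmN cmM ler_wpM2r ?cm_ge0.
Qed.

Lemma diff_of_linear (V W : normedModType C) (f : V -> W) (df : {linear V -> W}) x :
  continuous df -> f \o shift x = cst (f x) + df +o_ 0 id -> differentiable f x.
Proof. by move=> c E; apply/diff_locallyP; rewrite (diff_unique c E). Qed.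

Lemma diff_cder2 (f : C -> C -> C) p w l m : cder2 f p w l m ->
  differentiable (fun q : C * C => f q.1 q.2) (p, w).
Proof.
move=> H; pose df (h : C * C) : C := l * h.1 + m * h.2.
have lin : linear df by move=> a x y; rewrite /df /= scalerDr; change (l * (a * x.1 + y.1) + m * (a * x.2 + y.2) = a * (l * x.1) + a * (m * x.2) + (l * y.1 + m * y.2)); ring.
pose dfM := GRing.isLinear.Build _ _ _ _ _ lin.
pose dfL : {linear _ -> _} := HB.pack df dfM.
apply: (@diff_of_linear _ _ _ dfL).
  move=> x; apply: cvgD; apply: cvgM; try exact: cvg_cst; [exact: cvg_fst|exact: cvg_snd].
apply/eqaddoP => e e0; have [e' e'0 ->] := posC e0.
have e2 : 0 < e' / 2 by rewrite divr_gt0.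
have [d d0 Hd] := H _ e2.
rewrite near_simpl; apply/nbhsCCP; exists d => // x y xd yd; rewrite /= !add0r.
have -> : ((fun q : C * C => f q.1 q.2) \o shift (p, w) - (cst (f p w) + df)) (x, y) =
   f (p + x) (w + y) - f p w - l * x - m * y.
  by rewrite !fctE /= /df /= (addrC x) (addrC y); ring.
have h := Hd x y xd yd.
have [M ME] : exists M, `|(x, y)| = Rc M :> C.
  by rewrite prod_normE /= !normE /Order.max; case: ifP; eexists.
have nM : cm x <= M /\ cm y <= M.
  move: ME; rewrite prod_normE /= !normE /Order.max Rc_lt; case: ifP => k /(congr1 re); rewrite !re_Rc => <-.
    by rewrite lexx ltW.
  by rewrite lexx leNgt k.
rewrite ME -RcM normC_le; apply: le_trans h _.
have : cm x + cm y <= 2 * M by move: nM => [? ?]; lra.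
move=> q; have := ler_wpM2l (ltW e2) q; lra.
Qed.

Lemma diff_mx (V : normedModType C) m n (M : V -> 'M[C]_(m, n)) x :
  (forall i j, differentiable (fun y => M y i j) x) -> differentiable M x.
Proof.
move=> H; have -> : M = \sum_(i < m) \sum_(j < n) (fun y => M y i j *: delta_mx i j).
  apply/funext => y; rewrite {1}[M y]matrix_sum_delta fct_sumE; apply: eq_bigr => i _.
  by rewrite fct_sumE.
by apply: differentiable_sum => i; apply: differentiable_sum => j; exact: differentiableZl.
Qed.

Lemma analytic_hol2 n (U : C -> C -> Prop) (Y : C -> C -> 'M[C]_n) z w : opn2 U -> hol2mx U Y -> U z w ->
  analytic_at (fun p : C * C => Y p.1 p.2) (z, w).
Proof.
move=> oU hY Uz; have [d d0 Hd] := oU z w Uz.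
apply/nbhsCCP; exists d => // x y xd yd /=; apply: diff_mx => i j.
by have [l [m]] := hol2_der_ex oU (hY i j) (Hd x y xd yd); exact: (@diff_cder2 (fun p w => Y p w i j)).
Qed.

Lemma analytic_row n (f : C -> 'rV[C]_n) z : (exists2 d, 0 < d & forall k, cm k < d ->
  forall i, cdiff (fun x => f x 0 i) (z + k)) -> analytic_at f z.
Proof.
move=> [d d0 H]; apply/nbhsCP; exists d => // k kd; apply/derivable1_diffP.
have [D HD] := choice (fun i => H k kd i).
have : is_derive (z + k) 1 f (\row_i D i).
  by apply: mx_derive => i j; rewrite ord1 mxE; exact: HD.
by case.
Qed.

Lemma diff_hol2 n (f : C -> C -> 'M[C]_n) z w : differentiable (fun p : C * C => f p.1 p.2) (z, w) ->
  forall i j, [/\ cdiff (fun x => f x w i j) z, cdiff (fun y => f z y i j) w & lbnd (fun z w => f z w i j) z w].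
Proof.
move=> H i j; have Hc : differentiable (fun p : C * C => f p.1 p.2 i j) (z, w).
  exact: (@differentiable_comp _ _ _ _ _ (fun N : 'M[C]_n => N i j : C) (z, w) H (differentiable_coord _ _ _)).
have sh (phi : C -> C) (c : C) : derivable (fun h => phi (h + c)) 0 1 -> cdiff phi c.
  move=> /derivable_cder[l Hl]; exists l => e e0; have [d d0 Hd] := Hl e e0; exists d => // k kd.
  by have := Hd k kd; rewrite !add0r (addrC k).
split.
- apply: sh; have /derivable1P := diff_derivable (v := (1, 0) : C * C) Hc.
  rewrite (_ : (fun h => _) = (fun h : C => f (h + z) w i j)) //.
  apply/funext => h; rewrite /=.
  by rewrite scaler0 add0r; congr (f (_ + _) w i j); exact: mulr1.
- apply: sh; have /derivable1P := diff_derivable (v := (0, 1) : C * C) Hc.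
  rewrite (_ : (fun h => _) = (fun h : C => f z (h + w) i j)) //.
  apply/funext => h; rewrite /=.
  by rewrite scaler0 add0r; congr (f z (_ + _) i j); exact: mulr1.
have /cvgrPdist_lt/(_ 1 ltr01) := differentiable_continuous Hc.
rewrite near_simpl => /nbhsCCP[d d0 Hd]; exists d, (1 + cm (f z w i j)); split=> // x y xd yd.
have := Hd x y xd yd; rewrite /= normE -Rc1 Rc_lt => h.
have := cm_tri (f (z + x) (w + y) i j) 0 (f z w i j); rewrite !subr0 cmBC; lra.
Qed.

Lemma diff_hol1 n (f : C -> 'rV[C]_n) z : differentiable f z -> forall i, cdiff (fun x => f x 0 i) z.
Proof.
move=> H i; apply: derivable_cder; apply: diff_derivable.
exact: (@differentiable_comp _ _ _ _ _ (fun N : 'rV[C]_n => N 0 i : C) z H (differentiable_coord _ _ _)).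
Qed.

(** The disc is a union of segments issuing from 0, so it lies in the component of 0. *)
Lemma disc_Nset r vr z : 0 < r -> (forall t, cm t <= vr -> pole z t \/ r <= cm (xtime z t)) ->
  forall t, cm t <= vr -> Nset r z t.
Proof.
move=> r0 H t tv; rewrite /Nset.
have C0 : connected ((fun u : R => Rc u * t) @` `[0, 1]%classic).
  apply: connected_continuous_connected; first exact: segment_connected.
  apply: continuous_subspaceT => u; apply/cvgrPdist_lt => e e0; have [e' e'0 ->] := posC e0.
  have c1 : 0 < 1 + cm t by have := cm_ge0 t; lra.
  rewrite near_simpl; apply/nbhs_ballP; exists (e' / (1 + cm t)); first by rewrite /= divr_gt0.
  move=> v; rewrite /ball /= ltr_pdivlMr // => uv; rewrite normE Rc_lt -mulrBl -RcB cmM cm_Rc.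
  by apply: le_lt_trans uv; rewrite ler_wpM2l // lerDr.
apply: (connected_component_max _ _ C0).
- by exists 0; rewrite ?Rc0 ?mul0r //= in_itv /= lexx ler01.
- move=> y [u /=]; rewrite in_itv /= => /andP[u0 u1] <-.
  have : cm (Rc u * t) <= vr by rewrite cm_Rc_mul //; apply: le_trans tv; rewrite ler_piMl ?cm_ge0.
  by move=> /H[h|h]; [left|right; rewrite normE Rc_le].
by exists 1; rewrite ?Rc1 ?mul1r //= in_itv /= lexx ler01.
Qed.

End Bridge.

(** * The normalizing transformation *)

Section Assembly.
Context {R : realType}.
Local Notation C := (cplx R).
Implicit Types (z w a b l t : C) (u v e d M : R).
Local Notation rt := (@Pilot.Defs.sqrte R).
Opaque cexp.

(** In the l^1 norm, closeness to the identity gives |v| <= |vM| + n e |v|, and the last term is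
    absorbed. Invertibility and the bound on the inverse both come from this. *)
Lemma near_id_row (n : nat) (M : 'M[C]_n) e (v w : 'rV[C]_n) : n%:R * e <= 2^-1 ->
  (forall i j, cm (M i j - (i == j)%:R) <= e) -> v *m M = w -> \sum_k cm (v 0 k) <= 2 * \sum_k cm (w 0 k).
Proof.
move=> ne H E; have Ek k : v 0 k = w 0 k - \sum_i v 0 i * (M i k - (i == k)%:R).
  rewrite -E mxE.
  under [X in _ = _ - X]eq_bigr do rewrite mulrBr.
  rewrite big_split /= sumrN opprB addrCA subrr addr0 (bigD1 k) //= eqxx mulr1 big1 ?addr0 // => i /negPf ->.
  by rewrite mulr0.
have [S SE] : exists S : R, S = \sum_k cm (v 0 k) by eexists.
have S0 : 0 <= S by rewrite SE sumr_ge0 // => i _; exact: cm_ge0.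
have h k : cm (v 0 k) <= cm (w 0 k) + S * e.
  rewrite Ek; apply: le_trans (cmB _ _) _; rewrite lerD2l; apply: (le_trans (cm_sum _ _)).
  rewrite SE mulr_suml; apply: ler_sum => i _; rewrite cmM ler_wpM2l ?cm_ge0 //.
have : S <= \sum_k (cm (w 0 k) + S * e) by rewrite {1}SE; apply: ler_sum => l _; exact: h.
rewrite big_split /= sumr_const card_ord -SE -[S * e *+ n]mulr_natl.
have := ler_wpM2l S0 ne; move: (n%:R) => N; lra.
Qed.

Lemma near_id_unit (n : nat) (M : 'M[C]_n) e : n%:R * e <= 2^-1 ->
  (forall i j, cm (M i j - (i == j)%:R) <= e) -> M \in unitmx /\ forall i j, cm (invmx M i j) <= 2.
Proof.
move=> ne H; have uM : M \in unitmx.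
  rewrite unitmxE unitfE; apply/det0P => -[v v0 E]; move/negP: v0; apply; apply/eqP/rowP => k.
  have := near_id_row ne H E; rewrite [X in _ <= 2 * X]big1 => [|i _]; last by rewrite mxE cm0.
  rewrite mulr0 (bigD1 k) //= mxE => h; apply/eqP; apply/contraT; rewrite -cm_gt0 => h'; move: h; rewrite leNgt => /negP; case.
  apply: lt_le_trans h' _; rewrite lerDl sumr_ge0 // => i _; exact: cm_ge0.
split=> // i j; have E : row i (invmx M) *m M = row i 1%:M by rewrite -row_mul mulVmx.
have := near_id_row ne H E; rewrite (bigD1 j) //= [X in _ <= 2 * X](bigD1 i) //=.
rewrite [X in _ <= 2 * (_ + X)]big1 => [|k ki]; last first.
  by rewrite !mxE eq_sym (negPf ki) cm0.
rewrite !mxE eqxx cm1 addr0 mulr1 => h; apply: le_trans h; rewrite lerDl sumr_ge0 // => k _; exact: cm_ge0.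
Qed.

(** A primitive of 1/(1 + x) on the unit disc: e^(-lg) (1 + x) has derivative 0 and equals 1 at the
    centre. *)
Lemma log_near1 : exists lg : C -> C, lg 1 = 0 /\ forall u : C, cm (u - 1) < 1 -> cexp (lg u) = u /\ cdiff lg u.
Proof.
pose V (x : C) : Prop := cm x < 1; pose f x : C := (1 + x)^-1.
have n0 x : V x -> 1 + x != 0.
  move=> Vx; rewrite -cm_gt0; have := cm_dist 1 (- x); rewrite cm1 cmN opprK; move: Vx; rewrite /V; lra.
have oV x : V x -> exists2 d, 0 < d & forall k, cm k < d -> V (x + k).
  move=> Vx; exists (1 - cm x); first by rewrite subr_gt0.
  by move=> k kd; have := cmD x k; rewrite /V; lra.
have sV x u : V x -> 0 <= u <= 1 -> V (Rc u * x).
  by move=> Vx /andP[u0 u1]; apply: le_lt_trans Vx; rewrite cmM cm_Rc ger0_norm // ler_piMl // cm_ge0.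
have fd x : V x -> cder f x (- (1 + x) ^- 2).
  move=> Vx; apply: gder_eq (gder_comp (g := fun x => 1 + x) (cderV (n0 x Vx)) _) _.
    by apply: gderD; [exact: gder_cst|exact: cder_id].
  by rewrite add0r mulr1.
have Jd x : V x -> cder (J f 0) x (f x).
  apply: star_prim => // y Vy; last by move=> _; eexists; exact: fd.
  exact: cder_ccont (fd y Vy).
have J0 : J f 0 0 = 0 by apply: J_refl; apply: (cder_ccont (fd 0 _)); rewrite /V cm0.
exists (fun y : C => J f 0 (y - 1)); split=> [|u u1]; first by rewrite subrr.
have Vu : V (u - 1) by [].
have gd0 x : V x -> cder (fun x => cexp (- J f 0 x) * (1 + x)) x 0.
  move=> Vx; apply: gder_eq.
    apply: gderM; last by apply: gderD; [exact: gder_cst|exact: cder_id].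
    by apply: (gder_comp (cder_cexp _)); apply: gderN; exact: Jd.
  by rewrite add0r mulr1 mulrN mulNr -mulrA [f x * _]mulVf ?n0 // mulr1 addNr.
split; last first.
  have [l Hl] : cdiff (J f 0) (u - 1) by eexists; exact: Jd.
  eexists; apply: (gder_comp (g := fun x => x - 1) Hl).
  by apply: gderB; [exact: cder_id|exact: gder_cst].
have E : cexp (- J f 0 (u - 1)) * (1 + (u - 1)) = 1.
  apply/eqP; rewrite -subr_eq0; apply/contraT; rewrite -cm_gt0.
  have hb : forall (s : R), 0 <= s <= 1 -> V (0 + Rc s * (u - 1 - 0)) by move=> s s01; rewrite add0r subr0; exact: sV.
  have := @cder_bound R (fun x => cexp (- J f 0 x) * (1 + x)) (fun=> 0) 0 (u - 1) 0 (fun s hs => gd0 _ (hb s hs)).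
  rewrite J0 oppr0 cexp0 addr0 mulr1 mul0r cm0 => /(_ (fun _ _ => lexx _)) h1 h2.
  by move: (lt_le_trans h2 h1); rewrite ltxx.
have E1 : 1 + (u - 1) = u by ring.
rewrite E1 cexpN in E.
move: (cexp_neq0 (J f 0 (u - 1))) E; move: (cexp _) => q q0 E.
by rewrite -[q]mulr1 -E mulrA divff // mul1r.
Qed.

Section Columns.
Variables (gamma : R) (n : nat) (L0 L1 : 'I_n -> C -> C) (Rm : 'I_n -> 'I_n -> C -> C -> C) (r1 MB c1 : R).
Hypotheses (gamma0 : 0 < gamma) (gammaT : bigT gamma < pi / 2) (r1_gt0 : 0 < r1) (r1_le1 : r1 <= 1)
  (MB_ge0 : 0 <= MB) (c1_gt0 : 0 < c1).
Hypothesis L0_cont : forall e, 0 < e -> exists2 d, 0 < d & forall i x, cm x < d -> cm (L0 i x - L0 i 0) <= e.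
Hypothesis B_bound : forall i k x y, cm x < r1 -> cm y < r1 ->
  [/\ cm (L0 i x) <= MB, cm (L1 i x) <= MB & cm (Rm i k x y) <= MB].
Hypothesis gap_lb : forall (i k : 'I_n) th, (i < k)%N -> `|th| <= bigT gamma ->
  2 * c1 <= re (cis th * (L0 i 0 - L0 k 0)).
Hypotheses (dL0 : forall i x, cm x < r1 -> cdiff (L0 i) x) (dL1 : forall i x, cm x < r1 -> cdiff (L1 i) x)
  (hRm : forall i k, hol2 (fun x y => cm x < r1 /\ cm y < r1) (Rm i k)).

(** Minus the logarithmic derivative of the j-th model solution with respect to w. *)
Definition lamf j z w := (rt z)^-1 * (L0 j (cexp z) + L1 j (cexp z) * (rt z * cth w)).

Lemma kapfE j z i w : kapf L0 L1 j z i w = lamf j z w - lamf i z w.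
Proof. by rewrite /kapf /lamf; ring. Qed.

(** The coefficient matrix of the original system in the coordinate w, before any division by model
    solutions. *)
Definition Af z w : 'M[C]_n := \matrix_(i, k) (qf Rm z i k w - (i == k)%:R * lamf i z w).

Lemma eps_lt z : cm (rt z) < r1 -> cm (cexp z) < r1.
Proof.
move=> h; rewrite cm_eps expr2; have h0 := cm_ge0 (rt z).
have : cm (rt z) * cm (rt z) <= cm (rt z) * 1 by rewrite ler_wpM2l // (le_trans (ltW h)).
lra.
Qed.

Lemma hol_cth : hol2 (gd r1) (fun z w => rt z * cth w).
Proof.
have o := @gd_open R r1; apply: hol2_M; first exact: hol2_rt.
apply: hol2_M; first by apply: (hol2_csinh (f := fun _ w => w) o); exact: hol2_snd.
apply: hol2_V => //; first by apply: (hol2_ccosh (f := fun _ w => w) o); exact: hol2_snd.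
by move=> p w [[]].
Qed.

Lemma hol_eps (f : C -> C) : (forall x, cm x < r1 -> cdiff f x) -> hol2 (gd r1) (fun z _ => f (cexp z)).
Proof.
move=> df; have o := @gd_open R r1; apply: (hol2_comp1 (W := fun x => cm x < r1) (a := fun z _ => cexp z) o) => //.
- move=> x xr; exists (r1 - cm x); first by rewrite subr_gt0.
  by move=> k kd; have := cmD x k; lra.
- by apply: (hol2_cexp (f := fun z _ => z) o); exact: hol2_fst.
by move=> p w [_ h]; exact: eps_lt.
Qed.

Lemma hol_lamf j : hol2 (gd r1) (lamf j).
Proof.
have o := @gd_open R r1; apply: hol2_M; first by apply: hol2_V => //; [exact: hol2_rt|move=> p _ _; exact: rt_neq0].
by apply: hol2_D; [exact: (hol_eps (f := L0 j) (dL0 j))|apply: hol2_M; [exact: (hol_eps (f := L1 j) (dL1 j))|exact: hol_cth]].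
Qed.

Lemma hol_qf i k : hol2 (gd r1) (fun z w => qf Rm z i k w).
Proof.
have o := @gd_open R r1; apply: hol2_M.
  apply: hol2_M; first exact: hol2_rt.
  have hc : hol2 (gd r1) (fun _ w => ccosh w) by apply: (hol2_ccosh (f := fun _ w => w) o); exact: hol2_snd.
  apply: (hol2_V (f := fun _ w => ccosh w ^+ 2) o); first by apply: hol2_M; exact: hc.
  by move=> p w [[h _] _]; rewrite expf_neq0.
apply: (hol2_comp (V := fun x y => cm x < r1 /\ cm y < r1) (a := fun z _ => cexp z) (b := fun z w => rt z * cth w) o) => //.
- move=> x y [xr yr]; exists (Num.min (r1 - cm x) (r1 - cm y)); first by rewrite lt_min !subr_gt0 xr.
  move=> x' y'; rewrite !lt_min => /andP[h1 _] /andP[_ h2].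
  by have := cmD x x'; have := cmD y y'; split; lra.
- by apply: (hol2_cexp (f := fun z _ => z) o); exact: hol2_fst.
- exact: hol_cth.
by move=> p w [h1 h2]; split; [exact: eps_lt|exact: good_cth].
Qed.

Lemma hol_Af : hol2mx (gd r1) Af.
Proof.
move=> i k; have E : (fun p w => Af p w i k) = (fun p w => qf Rm p i k w - (i == k)%:R * lamf i p w).
  by apply/funext => p; apply/funext => w; rewrite mxE.
rewrite E; apply: hol2_B; first exact: hol_qf.
by apply: hol2_M; [exact: hol2_cst|exact: hol_lamf].
Qed.

Definition sect0 := reach (gd r1) (fun=> 0).

(** [E j] is the reciprocal of the j-th model solution, normalized to 1 at w = 0. *)
Lemma charts : exists (Y0 : C -> C -> 'M[C]_n) (E : 'I_n -> C -> C -> 'M[C]_1),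
  [/\ hol2mx sect0 Y0, solves Af sect0 Y0, forall z w, sect0 z w -> Y0 z w \in unitmx,
   forall j, [/\ hol2mx sect0 (E j), solves (fun z w => (lamf j z w)%:M) sect0 (E j) &
      forall z w, sect0 z w -> E j z w \in unitmx] &
   forall z, gd r1 z 0 -> Y0 z 0 = 1%:M /\ forall j, E j z 0 = 1%:M].
Proof.
have [Y0 [h1 h2 h3 h4]] := chart (@gd_open R r1) hol_Af (cdiff_cst 0).
have hE j : hol2mx (gd r1) (fun z w => (lamf j z w)%:M : 'M[C]_1).
  move=> i k; rewrite !ord1; have -> : (fun p w => ((lamf j p w)%:M : 'M[C]_1) 0 0) = lamf j.
    by apply/funext => p; apply/funext => w; rewrite mxE mulr1n.
  exact: hol_lamf.
have [E HE] := choice (fun j => chart (@gd_open R r1) (hE j) (cdiff_cst 0)).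
exists Y0, E; split=> // [j|z z0]; first by have [] := HE j.
by split=> [|j]; [exact: h2|have [_ h _ _] := HE j; exact: h].
Qed.

Lemma sector_cone : exists T eta C1 sa : R, [/\ 0 < eta, 0 <= C1, 0 < sa <= 1,
  forall z, zdom gamma sa z -> gd r1 z 0 /\ forall w, in_sect T w -> sect0 z w &
  forall z j, zdom gamma sa z -> coldata j (fun i : 'I_n => (i < j)%N) (fun i : 'I_n => (j < i)%N)
      (kapf L0 L1 j z) (qf Rm z) T
      (c1 / cm (rt z)) (C1 * cm (rt z)) (tan (psi gamma z) - eta) (tan (psi gamma z) + eta)].
Proof.
have [T [eta [C1 [s1 [e0 C10 s10 H]]]]] := sector_data gamma0 gammaT r1_gt0 MB_ge0 c1_gt0 L0_cont B_bound gap_lb.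
exists T, eta, C1, (Num.min s1 (Num.min r1 1)); split=> //.
- by rewrite !lt_min s10 r1_gt0 ltr01 /= !ge_min lexx !orbT.
- move=> z [zs az]; move: zs; rewrite !lt_min => /and3P[z1 z2 z3]; have [h1 _] := H z z1 az.
  have h2 w : in_sect T w -> gd r1 z w by move=> ws; split=> //; exact: h1.
  split; first by apply: h2; rewrite /in_sect !(im0, re0) normr0 mulr0.
  move=> w ws u /andP[u0 u1]; rewrite subr0 add0r; apply: h2.
  rewrite /in_sect; have -> : re (Rc u * w) = u * re w by rewrite reM re_Rc im_Rc mul0r subr0.
  have -> : im (Rc u * w) = u * im w by rewrite imM re_Rc im_Rc mul0r addr0.
  by rewrite !normrM mulrCA ler_wpM2l.
move=> z j [zs az]; move: zs; rewrite !lt_min => /and3P[z1 z2 z3]; have [_ h] := H z z1 az.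
exact: h.
Qed.

Lemma columns : exists (sa Cb : R) (Y0 : C -> C -> 'M[C]_n) (E : 'I_n -> C -> C -> 'M[C]_1)
    (V : C -> 'M[C]_n) (K : bool -> 'I_n -> C -> C),
  [/\ [/\ 0 < sa, sa <= 1, 0 <= Cb & forall z, zdom gamma sa z -> sect0 z 0],
   [/\ hol2mx sect0 Y0, solves Af sect0 Y0 & forall z w, sect0 z w -> Y0 z w \in unitmx],
   forall j, [/\ hol2mx sect0 (E j), solves (fun z w => (lamf j z w)%:M) sect0 (E j) &
      forall z w, sect0 z w -> E j z w \in unitmx],
   forall z, zdom gamma sa z -> Y0 z 0 = 1%:M /\ forall j, E j z 0 = 1%:M &
   forall z, zdom gamma sa z ->
     [/\ forall i j, cdiff (fun y => V y i j) z,
      forall i j, cm (V z i j - (i == j)%:R) <= Cb * cm (rt z) ^+ 2,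
      forall (o : bool) j, cdiff (K o j) z /\ cm (K o j z - 1) <= Cb * cm (rt z) &
      forall (o : bool) i j u, 0 <= u -> let w := Rc ((-1) ^+ o * u) * dirv (tan (psi gamma z)) in
        cm ((Y0 z w *m V z) i j * E j z w 0 0 - (i == j)%:R * K o j z) <= Cb * expR (- u)]].
Proof.
have [T [eta [C1 [sa [e0 C10 /andP[sa0 sa1] cone cd]]]]] := sector_cone.
have [Y0 [E [h1 h2 h3 hE h0]]] := charts.
(* Multiplication by the reciprocal model solution turns a fundamental matrix of the system into one
   of the j-th column system. *)
pose Yj j z w : 'M[C]_n := E j z w 0 0 *: Y0 z w.
pose Z := zdom gamma sa; pose t1 z := tan (psi gamma z) - eta; pose t2 z := tan (psi gamma z) + eta.
have t12 z : Z z -> t1 z < t2 z by move=> _; rewrite /t1 /t2; lra.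
have Zo z : Z z -> exists2 d, 0 < d & forall x, cm x < d -> Z (z + x).
  move=> Zz; have [d d0 Hd] := @zdom_open R gamma sa z 0 Zz; exists d => // x xd.
  by apply: (Hd x 0); rewrite ?cm0.
have sl z v : Z z -> t1 z < v < t2 z -> exists2 d, 0 < d & forall x, cm x < d -> t1 (z + x) < v < t2 (z + x).
  move=> [_ az] /andP[v1 v2]; have [|d d0 Hd] := tan_psi_cont gamma0 gammaT az (e := Num.min (v - t1 z) (t2 z - v)).
    by rewrite lt_min !subr_gt0 v1.
  exists d => // x xd; have := Hd x xd; rewrite lt_min !ltr_norml /t1 /t2 => /andP[/andP[a1 a2] /andP[a3 a4]].
  by apply/andP; split; clear gamma0 gammaT r1_gt0 r1_le1 MB_ge0 c1_gt0 L0_cont B_bound gap_lb dL0 dL1 hRm e0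
    C10 sa0 sa1 cd hE h0 t12 Zo v1 v2 d0 Hd xd a1 a4; lra.
have cdj j z : Z z -> coldata j (fun i : 'I_n => (i < j)%N) (fun i : 'I_n => (j < i)%N) (kapf L0 L1 j z) (qf Rm z) T
    (c1 / cm (rt z)) (C1 * cm (rt z)) (t1 z) (t2 z) by exact: cd.
have Uc (j : 'I_n) z u v : Z z -> t1 z <= v <= t2 z -> sect0 z (Rc u * dirv v).
  move=> Zz vv; have [_ c] := cone z Zz; apply: c; apply: in_sect_dirv; exact: cd_dir (cdj j z Zz) _ vv.
have hYj j : hol2mx sect0 (Yj j).
  move=> i k; have -> : (fun p w => Yj j p w i k) = (fun p w => E j p w 0 0 * Y0 p w i k).
    by apply/funext => p; apply/funext => w; rewrite mxE.
  by apply: hol2_M; [have [h _ _] := hE j; exact: h|exact: h1].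
have Yj0 j z : Z z -> Yj j z 0 = 1%:M.
  by move=> /cone[/h0[e1 e2] _]; rewrite /Yj e1 e2 mxE eqxx scale1r.
have dYj j z w i k : sect0 z w -> cder (fun x => Yj j z x i k) w
    (kapf L0 L1 j z i w * Yj j z w i k + \sum_l qf Rm z i l w * Yj j z w l k).
  move=> Uz; have -> : (fun x => Yj j z x i k) = (fun x => E j z x 0 0 * Y0 z x i k).
    by apply/funext => x; rewrite mxE.
  have [_ hs _] := hE j; apply: gder_eq (gderM (hs z w 0 0 Uz) (h2 z w i k Uz)) _.
  rewrite mul_scalar_mx !mxE kapfE.
  have -> : \sum_l Af z w i l * Y0 z w l k = \sum_l qf Rm z i l w * Y0 z w l k - lamf i z w * Y0 z w i k.
    under eq_bigr do rewrite mxE mulrBl; rewrite big_split /= sumrN; congr (_ - _).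
    rewrite (bigD1 i) //= eqxx mul1r big1 ?addr0 // => l li.
    by rewrite eq_sym (negPf li) !mul0r.
  have -> : \sum_l qf Rm z i l w * Yj j z w l k = E j z w 0 0 * \sum_l qf Rm z i l w * Y0 z w l k.
    by rewrite mulr_sumr; apply: eq_bigr => l _; rewrite mxE; ring.
  by move: (\sum_l _) => S; ring.
pose V z : 'M[C]_n := \matrix_(k, j) colV j (fun i : 'I_n => (i < j)%N) t1 t2 (Yj j) k z.
have V_diff z k j : Z z -> cdiff (colV j (fun i : 'I_n => (i < j)%N) t1 t2 (Yj j) k) z.
  exact: (@colV_diff R n j _ _ (kapf L0 L1 j) (qf Rm) T (fun z => c1 / cm (rt z)) (fun z => C1 * cm (rt z)) t1 t2 Z sect0 (Yj j) Zo (cdj j) t12 sl (Uc j) (hYj j) (Yj0 j) (dYj j)).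
have V_props z j := @colV_props R n j _ _ (kapf L0 L1 j) (qf Rm) T (fun z => c1 / cm (rt z)) (fun z => C1 * cm (rt z)) t1 t2 Z sect0 (Yj j) (cdj j) t12 (Uc j) (Yj0 j) (dYj j) z.
have V_lim (p : bool * 'I_n) := @colV_limit R n p.2 _ _ (kapf L0 L1 p.2) (qf Rm) T (fun z => c1 / cm (rt z)) (fun z => C1 * cm (rt z)) t1 t2 Z sect0 (Yj p.2) Zo (cdj p.2) t12 sl (Uc p.2) (hYj p.2) (Yj0 p.2) (dYj p.2) p.1.
have [K HK] := choice V_lim.
have [P PE] : exists P : R, P = `|(1 + T) * (n%:R * C1)| by eexists.
have P0 : 0 <= P by rewrite PE.
have FP z : 4 * Fc n T (C1 * cm (rt z)) <= 4 * P * cm (rt z).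
  rewrite -mulrA ler_pM2l // /Fc PE; have -> : (1 + T) * (n%:R * (C1 * cm (rt z))) = (1 + T) * (n%:R * C1) * cm (rt z) by ring.
  by rewrite ler_wpM2r ?cm_ge0 // ler_norm.
have ci0 : 0 <= c1^-1 by rewrite invr_ge0 ltW.
have Pc : 0 <= P * c1^-1 by rewrite mulr_ge0.
(* 4 P serves for the limits at the ends, 4 P / c1 for the values at 0, where the rate c1 /
   |sqrt(eps)| divides, and 2 for the decay of the other components. *)
have [Cb CbE] : exists Cb : R, Cb = 4 * P + 4 * (P * c1^-1) + 2 by eexists.
have midE z : mid t1 t2 z = tan (psi gamma z) by rewrite /mid /t1 /t2; lra.
have s0 z : 0 < cm (rt z) by rewrite cm_gt0 rt_neq0.
exists sa, Cb, Y0, E, V, (fun o j => K (o, j)); split=> //.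
- split=> //; first by rewrite CbE; lra.
  by move=> z Zz; have [h _] := cone z Zz => u u01; rewrite subr0 mulr0 addr0.
- by move=> z /cone[/h0].
move=> z Zz; have ss : cm (rt z) <= 1 by move: Zz => [h _]; apply: le_trans (ltW h) sa1.
split.
- by move=> i j; apply: cdiff_ext (V_diff z i j Zz); exists 1 => // k _; rewrite mxE.
- move=> i j; rewrite mxE; have [v1 v2 _] := V_props z j Zz; case: eqVneq => [->|ij].
    by rewrite v1 subrr cm0 mulr_ge0 ?sqr_ge0 // CbE; clear gamma0 gammaT r1_gt0 r1_le1 MB_ge0 c1_gt0 L0_cont
    B_bound gap_lb dL0 dL1 hRm e0 C10 sa0 sa1 cd hE h0 t12 Zo sl cdj Uc Yj0 dYj V_diff V_props V_lim HK PE
    FP ci0 CbE midE s0 ss v1 v2; lra.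
  rewrite subr0; apply: le_trans (v2 i ij) _; rewrite invf_div mulrA ler_pdivrMr //.
  apply: le_trans (ler_wpM2r (ltW (s0 z)) (FP z)) _; have -> : 4 * P * cm (rt z) * cm (rt z) = 4 * P * cm (rt z) ^+ 2 by ring.
  have -> : Cb * cm (rt z) ^+ 2 * c1 = Cb * c1 * cm (rt z) ^+ 2 by ring.
  have cc : Cb * c1 = 4 * (P * c1) + 4 * P + 2 * c1 by rewrite CbE; field; rewrite gt_eqF.
  rewrite ler_wpM2r ?sqr_ge0 // cc; have := mulr_ge0 P0 (ltW c1_gt0); have := c1_gt0; clear gamma0 gammaT
    r1_gt0 r1_le1 MB_ge0 c1_gt0 L0_cont B_bound gap_lb dL0 dL1 hRm e0 C10 sa0 sa1 cd hE h0 t12 Zo sl cdj Uc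
    Yj0 dYj V_diff V_props V_lim HK PE P0 FP ci0 Pc CbE midE s0 ss v1 v2 ij cc; lra.
- move=> o j; have [k1 k2 _] := HK (o, j) z Zz; split=> //; apply: le_trans k2 _.
  by apply: le_trans (FP z) _; rewrite ler_wpM2r ?cm_ge0 // CbE; clear gamma0 gammaT r1_gt0 r1_le1 MB_ge0
    c1_gt0 L0_cont B_bound gap_lb dL0 dL1 hRm e0 C10 sa0 sa1 cd hE h0 t12 Zo sl cdj Uc Yj0 dYj V_diff
    V_props V_lim HK PE P0 FP ci0 CbE midE s0 ss; lra.
move=> o i j u u0 /=; set w := Rc _ * dirv _.
have ysE k : ysol (Yj j) ((colV j (fun i : 'I_n => (i < j)%N) t1 t2 (Yj j))^~ z) z k w = (Y0 z w *m V z) k j * E j z w 0 0.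
  by rewrite /ysol mxE mulr_suml; apply: eq_bigr => l _; rewrite !mxE; ring.
have e0' : 0 < expR (- u) by exact: expR_gt0.
have [->|ij] := eqVneq i j.
  have [_ _ k3] := HK (o, j) z Zz; have := k3 u u0; rewrite midE /= -/w ysE mul1r => h.
  apply: le_trans h _; rewrite ler_wpM2r ?(ltW e0') //; apply: le_trans (FP z) _.
  have : 4 * P * cm (rt z) <= 4 * P * 1 by rewrite ler_wpM2l // mulr_ge0.
  by rewrite CbE; clear gamma0 gammaT r1_gt0 r1_le1 MB_ge0 c1_gt0 L0_cont B_bound gap_lb dL0 dL1 hRm e0 C10
    sa0 sa1 cd hE h0 t12 Zo sl cdj Uc Yj0 dYj V_diff V_props V_lim HK PE P0 FP ci0 CbE midE s0 ss u0 ysE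
    e0' k3; lra.
rewrite mul0r subr0 -ysE; have [_ _ v3] := V_props z j Zz.
have := v3 i ((-1) ^+ o * u) ij; rewrite midE -/w normrM normrX normrN1 expr1n mul1r (ger0_norm u0) => h.
apply: le_trans h _; rewrite mulrC ler_wpM2r ?(ltW e0') // CbE; lra.
Qed.

Variable kap : R.
Hypotheses (kap0 : 0 < kap) (kap2 : kap < 2^-1).

Lemma eta_tt o z w : arg_ok gamma z -> cm (rt z) * eta gamma z (tt o z w) =
  (((-1) ^+ o * (im w - re w * tan (psi gamma z))) - pi / 2) * cos (psi gamma z).
Proof.
move=> az; have c0 := cos_psi_gt0 gamma0 gammaT az.
have sE : sin (psi gamma z) = tan (psi gamma z) * cos (psi gamma z) by rewrite /tan divfK // gt_eqF.
rewrite eta_rot; have -> : rt z * tt o z w = hpi - sgn o * w by rewrite /tt mulrC divfK // rt_neq0.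
rewrite imM re_cis im_cis cosN sinN reB imB sE /hpi reM imM re_Rc im_Rc re_ci im_ci.
have [-> ->] : re (sgn o * w) = (-1) ^+ o * re w /\ im (sgn o * w) = (-1) ^+ o * im w.
  by rewrite /sgn; case: (o); rewrite ?expr0 ?expr1 ?mulN1r ?mul1r ?reN ?imN.
move: (tan _) (cos _) (pi : R) ((-1) ^+ o) => a b P q; ring.
Qed.

(** The line of slope tan psi through w = 0 is parallel to the strip; it stays in [low], where the
    continued solution is the original one. *)
Lemma eta_axis o z u : arg_ok gamma z ->
  eta gamma z (tt o z (Rc u * dirv (tan (psi gamma z)))) = eta gamma z (tt o z 0).
Proof.
move=> az; have s0 : cm (rt z) != 0 by rewrite gt_eqF // cm_gt0 rt_neq0.
apply: (mulfI s0); rewrite !eta_tt // re_dirv im_dirv.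
have -> : re (0 : C) = 0 by []; have -> : im (0 : C) = 0 by [].
by rewrite subrr mul0r subrr.
Qed.

Lemma low_axis s1 nu vr o z u : low gamma kap s1 nu vr o z 0 ->
  low gamma kap s1 nu vr o z (Rc u * dirv (tan (psi gamma z))).
Proof. by move=> [[[h az] st] he]; rewrite /low /strip eta_axis. Qed.

(** Bounds the length of the vertical segments used in [decay]; the 2 stands for pi/2. *)
Lemma strip_off nu o z w : 0 < nu -> arg_ok gamma z -> strip gamma kap nu z (tt o z w) ->
  `|im w - re w * tan (psi gamma z)| <= (nu + 2) / cos (psi gamma z).
Proof.
move=> nu0 az; have c0 := cos_psi_gt0 gamma0 gammaT az; have /andP[_ c1'] := cos_psi gamma0 gammaT az.
have p4 : pi <= 4 :> R by have := @pihalf_lt2 R; lra.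
have p0 := @pi_gt0 R; have k0 := kap0; have k2 := kap2.
have [y yE] : exists y : R, y = im w - re w * tan (psi gamma z) by eexists.
rewrite /strip eta_tt // ler_pdivlMr // -yE; have -> : `|y| * cos (psi gamma z) = `|y * cos (psi gamma z)|.
  by rewrite normrM (gtr0_norm c0).
move: c0 c1' p4 p0; move: (cos _) (pi : R) => c P c0 c1' p4 p0 /andP[].
have h1 : P * c <= 4 by have := ler_wpM2l (ltW p0) c1'; lra.
have h2 : 0 < P * c by rewrite mulr_gt0.
have h3 : kap * (P * c) <= 2^-1 * (P * c) by rewrite ler_wpM2r ?(ltW h2) // ltW.
have h4 : 0 < kap * (P * c) by rewrite mulr_gt0.
have -> : (2^-1 + kap) * P * c = 2^-1 * (P * c) + kap * (P * c) by ring.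
have -> : ((-1) ^+ o * y - P / 2) * c = (-1) ^+ o * (y * c) - 2^-1 * (P * c) by ring.
move: (P * c) (y * c) h1 h2 h3 h4 => Q q h1 h2 h3 h4 a1 a2.
have -> : `|q| = `|(-1) ^+ o * q| by rewrite normrM normrX normrN1 expr1n mul1r.
rewrite ler_norml; move: (kap * Q) h3 h4 a1 => y' h3 h4 a1; move: (_ * q) a1 a2 => x a1 a2; apply/andP; split; lra.
Qed.

(** Far out in the strip |t| is large while the tilted height stays bounded, so t is far to one side
    of the disc and under the slope mm. *)
Lemma strip_far nu vr mm z : 0 < nu -> 0 < vr -> (cos (bigT gamma))^-1 + 1 <= mm -> arg_ok gamma z ->
  exists X : R, forall o w, strip gamma kap nu z (tt o z w) -> X <= `|re w| ->
    oset vr mm (re (tt o z w) < 0) (tt o z w).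
Proof.
move=> nu0 vr0 hmm az; have [ct tb sE] := thet_tan gamma0 gammaT az.
have s0 : 0 < cm (rt z) by rewrite cm_gt0 rt_neq0.
have p4 : pi <= 4 :> R by have := @pihalf_lt2 R; lra.
have p0 := @pi_gt0 R; have k0 := kap0; have k2 := kap2.
have [Eb EbE] : exists Eb : R, Eb = (nu + 4) / cm (rt z) / cos (thet gamma z) by eexists.
have Eb0 : 0 < Eb by rewrite EbE !divr_gt0 //; lra.
have tm : `|tan (thet gamma z)| <= mm - 1 by lra.
have mm1 : 1 <= mm by have := normr_ge0 (tan (thet gamma z)); lra.
have [N NE] : exists N : R, N = mm * (vr + Eb + 1) + Eb by eexists.
exists (N * cm (rt z) + 3) => o w st hX; set t := tt o z w.
have et : `|eta gamma z t| <= Eb * cos (thet gamma z).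
  rewrite EbE divfK ?gt_eqF // ler_pdivlMr // mulrC -[X in X * _](gtr0_norm s0) -normrM.
  have /andP[_ c1'] := cos_psi gamma0 gammaT az; have c0 := cos_psi_gt0 gamma0 gammaT az.
  move: st; rewrite /strip -/t; move: (_ * eta _ _ _) c1' c0 p4 p0; move: (cos _) (pi : R) => c P x c1' c0 p4 p0 /andP[a1 a2].
  have h1 : P * c <= 4 by have := ler_wpM2l (ltW p0) c1'; lra.
  have h2 : 0 < P * c by rewrite mulr_gt0.
  have h3 : kap * (P * c) <= 2^-1 * (P * c) by rewrite ler_wpM2r ?(ltW h2) // ltW.
  move: a1; have -> : (2^-1 + kap) * P * c = 2^-1 * (P * c) + kap * (P * c) by ring.
  move: (P * c) h1 h2 h3 => Q h1 h2 h3 a1; move: (kap * Q) h3 a1 => kq h3 a1; rewrite ler_norml; apply/andP;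
    split; clear gamma0 gammaT r1_gt0 r1_le1 MB_ge0 c1_gt0 L0_cont B_bound gap_lb dL0 dL1 hRm kap0 kap2 vr0
    hmm ct tb sE s0 k0 k2 EbE Eb0 tm mm1 NE hX c1' c0 p4 p0 h2; lra.
have iE : im t * cos (thet gamma z) = (eta gamma z t / cos (thet gamma z) + re t * tan (thet gamma z)) * cos (thet gamma z).
  by rewrite mulrDl divfK ?gt_eqF // etaE sE; ring.
have {}iE := mulIf (lt0r_neq0 ct) iE.
have it : `|im t| <= Eb + (mm - 1) * `|re t|.
  rewrite iE; apply: le_trans (ler_normD _ _) _; apply: lerD.
    by rewrite normrM normrV ?unitfE ?gt_eqF // (gtr0_norm ct) ler_pdivrMr.
  by rewrite normrM mulrC ler_wpM2r.
have ct' : N < cm t.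
  have h : cm (rt z) * cm t = cm (hpi - sgn o * w) by rewrite -cmM /t /tt mulrC divfK // rt_neq0.
  have h2 := cm_dist (sgn o * w) hpi; rewrite cmBC -h in h2.
  have h3 : cm (sgn o * w) = cm w by rewrite cmM /sgn cmX cmN cm1 expr1n mul1r.
  have h4 : cm (hpi : C) = pi / 2 by rewrite /hpi cmM cm_ci mul1r cm_Rc ger0_norm //; clear gamma0 gammaT
    r1_gt0 r1_le1 MB_ge0 c1_gt0 L0_cont B_bound gap_lb dL0 dL1 hRm kap0 kap2 nu0 vr0 hmm ct tb sE s0 p4 k0
    k2 EbE Eb0 tm mm1 NE hX et iE it h h2; lra.
  have h5 := re_le_cm w; rewrite -(ltr_pM2l s0) [_ * N]mulrC; rewrite h3 h4 in h2; clear gamma0 gammaT r1_gt0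
    r1_le1 MB_ge0 c1_gt0 L0_cont B_bound gap_lb dL0 dL1 hRm kap0 kap2 nu0 vr0 hmm ct tb sE s0 p0 k0 k2 EbE
    Eb0 tm mm1 NE et iE it h h3 h4; lra.
have rt' : vr + Eb + 1 < `|re t|.
  have h : cm t <= `|re t| + `|im t| by exact: cm_le_reim.
  have : mm * (vr + Eb + 1) < mm * `|re t| by move: NE it h ct'; move: (cm t) => c NE it h ct'; clear gamma0
    gammaT r1_gt0 r1_le1 MB_ge0 c1_gt0 L0_cont B_bound gap_lb dL0 dL1 hRm kap0 kap2 nu0 vr0 hmm ct tb sE s0
    p4 p0 k0 k2 EbE Eb0 tm mm1 hX et iE; lra.
  by rewrite ltr_pM2l //; clear gamma0 gammaT r1_gt0 r1_le1 MB_ge0 c1_gt0 L0_cont B_bound gap_lb dL0 dL1 hRm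
    kap0 kap2 nu0 vr0 hmm ct tb sE s0 p4 p0 k0 k2 EbE Eb0 tm NE hX et iE it ct'; lra.
have sd : side (re t < 0) t = `|re t|.
  by rewrite /side; case: ltP => h; [rewrite ltr0_norm|rewrite ger0_norm].
right; rewrite sd; split; first by clear gamma0 gammaT r1_gt0 r1_le1 MB_ge0 c1_gt0 L0_cont B_bound gap_lb
    dL0 dL1 hRm kap0 kap2 nu0 hmm ct tb sE s0 p4 p0 k0 k2 EbE tm mm1 NE hX et iE it ct' sd; lra.
- have : vr ^+ 2 < `|re t| ^+ 2 by rewrite ltr_pXn2r ?nnegrE ?(ltW vr0) ?normr_ge0 //; clear gamma0 gammaT
    r1_gt0 r1_le1 MB_ge0 c1_gt0 L0_cont B_bound gap_lb dL0 dL1 hRm kap0 kap2 nu0 vr0 hmm ct tb sE s0 p4 p0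
    k0 k2 EbE tm mm1 NE hX et iE it ct' sd; lra.
  by rewrite real_normK ?num_real // => h; have := sqr_ge0 (im t); clear gamma0 gammaT r1_gt0 r1_le1 MB_ge0
    c1_gt0 L0_cont B_bound gap_lb dL0 dL1 hRm kap0 kap2 nu0 vr0 hmm ct tb sE s0 p4 p0 k0 k2 EbE Eb0 tm mm1
    NE hX et iE it ct' rt'; lra.
by have := ler_norm (im t); clear gamma0 gammaT r1_gt0 r1_le1 MB_ge0 c1_gt0 L0_cont B_bound gap_lb dL0 dL1
    hRm kap0 kap2 nu0 hmm ct tb sE s0 p4 p0 k0 k2 EbE Eb0 tm mm1 NE hX et iE ct' sd; lra.
Qed.

Lemma kapf_bound j z i w : gd r1 z w -> cm (kapf L0 L1 j z i w) <= (cm (rt z))^-1 * (4 * MB).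
Proof.
move=> [g h]; have s0 : 0 < cm (rt z) by rewrite cm_gt0 rt_neq0.
have el := eps_lt h; have z0 : cm (0 : C) < r1 by rewrite cm0.
have xl : cm (rt z * cth w) <= 1 by apply: le_trans (ltW (good_cth g)) r1_le1.
rewrite /kapf cmM cmN cmV ler_wpM2l ?invr_ge0 ?(ltW s0) //.
have [a1 b1 _] := B_bound i j el z0; have [a2 b2 _] := B_bound j i el z0.
have h1 := cmD (L0 i (cexp z) - L0 j (cexp z)) ((L1 i (cexp z) - L1 j (cexp z)) * (rt z * cth w)).
have h2 := cmB (L0 i (cexp z)) (L0 j (cexp z)); have h3 := cmB (L1 i (cexp z)) (L1 j (cexp z)).
have h4 : cm ((L1 i (cexp z) - L1 j (cexp z)) * (rt z * cth w)) <= cm (L1 i (cexp z) - L1 j (cexp z)).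
  by rewrite cmM ler_piMr ?cm_ge0.
lra.
Qed.

Lemma qf_bound z i k w : gd r1 z w -> 1 <= `|re w| -> cm (qf Rm z i k w) <= 16 * MB * expR (- `|re w|).
Proof.
move=> [g h] w1; have s0 := cm_ge0 (rt z); have el := eps_lt h.
have [_ _ hR] := B_bound i k el (good_cth g).
have [y yE] : exists y : R, y = expR `|re w| by eexists.
have y0 : 0 < y by rewrite yE expR_gt0.
have yi : expR (- `|re w|) = y^-1 by rewrite expRN yE.
have y2 : 2 <= y by rewrite yE; apply: le_trans (expR_ge1Dx _); lra.
have yi2 : y^-1 <= 2^-1 by rewrite lef_pV2 ?posrE.
have hc : y / 4 <= cm (ccosh w) by have := ccosh_ge w; rewrite yi -yE; lra.
have c0 : 0 < cm (ccosh w) by apply: lt_le_trans hc; rewrite divr_gt0.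
have hi : cm (ccosh w) ^- 2 <= 16 * y^-1.
  have h1 : (cm (ccosh w))^-1 <= 4 * y^-1 by rewrite -[4 * _]invrK lef_pV2 ?posrE ?invr_gt0 ?mulr_gt0 ?invr_gt0 // invfM invrK mulrC.
  rewrite -exprVn expr2; have h2 : 0 <= (cm (ccosh w))^-1 by rewrite invr_ge0 ltW.
  apply: le_trans (ler_pM h2 h2 h1 h1) _.
  have yv0 : 0 < y^-1 by rewrite invr_gt0.
  by have := ler_wpM2l (ltW yv0) yi2; lra.
have -> : cm (qf Rm z i k w) = cm (rt z) * cm (ccosh w) ^- 2 * cm (Rm i k (cexp z) (rt z * cth w)).
  by rewrite /qf [LHS]cmM; congr (_ * _); rewrite [LHS]cmM cmV cmX.
rewrite yi.
have h1 : cm (rt z) * cm (ccosh w) ^- 2 <= 1 * (16 * y^-1).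
  by apply: ler_pM => //; [rewrite invr_ge0 exprn_ge0 // ltW|apply: le_trans (ltW h) r1_le1].
have := ler_pM (mulr_ge0 s0 _) (cm_ge0 _) h1 hR; rewrite invr_ge0 exprn_ge0 ?(ltW c0) // => /(_ isT) h2.
by apply: le_trans h2 _; rewrite le_eqVlt; apply/orP; left; apply/eqP; ring.
Qed.

(** Subtracting the limit K e_j costs only a forcing of size e^(-|Re w|), because the j-th exponent
    is 0. On a vertical segment Re w is constant, so this factor passes through Gronwall's
    inequality. *)
Lemma decay s1 nu vr mm o z (H : C -> 'M[C]_n) (K : bool -> 'I_n -> C) (Cb : R) : 0 < nu -> 0 < vr ->
  (cos (bigT gamma))^-1 + 1 <= mm -> zdom gamma s1 z -> low gamma kap s1 nu vr o z 0 -> 0 <= Cb ->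
  (forall w, wdom gamma kap s1 nu vr mm o z w -> gd r1 z w) ->
  (forall w i j, wdom gamma kap s1 nu vr mm o z w ->
    cder (fun x => H x i j) w (kapf L0 L1 j z i w * H w i j + \sum_l qf Rm z i l w * H w l j)) ->
  (forall (p : bool) i j u, 0 <= u -> let w := Rc ((-1) ^+ p * u) * dirv (tan (psi gamma z)) in
     cm (H w i j - (i == j)%:R * K p j) <= Cb * expR (- u)) ->
  exists M X : R, 0 <= M /\ forall w, strip gamma kap nu z (tt o z w) -> X <= `|re w| ->
    wdom gamma kap s1 nu vr mm o z w /\ forall i j, cm (H w i j - (i == j)%:R * K (re w < 0) j) <= M * expR (- `|re w|).
Proof.
move=> nu0 vr0 hmm zz l0 Cb0 wg dH lim; have [_ az] := zz.
have [X0 HX] := strip_far nu0 vr0 hmm az.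
have c0 := cos_psi_gt0 gamma0 gammaT az.
have s0 : 0 < cm (rt z) by rewrite cm_gt0 rt_neq0.
have [B BE] : exists B : R, B = (nu + 2) / cos (psi gamma z) by eexists.
have B0 : 0 <= B by rewrite BE divr_ge0 ?(ltW c0) //; lra.
have MB0 := MB_ge0.
have [k kE] : exists k : R, k = (cm (rt z))^-1 * (4 * MB) by eexists.
have k0 : 0 <= k by rewrite kE mulr_ge0 ?invr_ge0 ?(ltW s0) ?mulr_ge0.
have [KK KKE] : exists KK : R, KK = \sum_j (cm (K true j) + cm (K false j)) by eexists.
have KK0 : 0 <= KK by rewrite KKE sumr_ge0 // => j _; rewrite addr_ge0 ?cm_ge0.
have hK p j : cm (K p j) <= KK.
  have h : cm (K true j) + cm (K false j) <= KK.
    by rewrite KKE (bigD1 j) //= lerDl sumr_ge0 // => l _; rewrite addr_ge0 ?cm_ge0.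
  by apply: le_trans h; case: p; [rewrite lerDl cm_ge0|rewrite lerDr cm_ge0].
have [Q QE] : exists Q : R, Q = 16 * MB by eexists.
have Q0 : 0 <= Q by rewrite QE mulr_ge0.
have [L LE] : exists L : R, L = B * (k + Q) by eexists.
have L0' : 0 <= L by rewrite LE mulr_ge0 // addr_ge0.
have M0 : 0 <= 2 * (Cb + B * (Q * KK)) * expR (2 * (n%:R * L) + 1).
  by rewrite mulr_ge0 ?expR_ge0 // mulr_ge0 // addr_ge0 // !mulr_ge0.
exists (2 * (Cb + B * (Q * KK)) * expR (2 * (n%:R * L) + 1)), (Num.max X0 1); split=> // w st.
rewrite ge_max => /andP[wX w1].
have dom' y : strip gamma kap nu z (tt o z y) -> X0 <= `|re y| -> wdom gamma kap s1 nu vr mm o z y.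
  by move=> sy yX; have := HX o y sy yX; case: (_ < 0) => h; [constructor 3|constructor 2].
split=> [|i j]; first exact: dom'.
have [p pE] : exists p : bool, p = (re w < 0) by eexists.
have rE : (-1) ^+ p * `|re w| = re w.
  by rewrite pE; case: ltP => h; rewrite ?expr1 ?expr0 ?mulN1r ?mul1r ?(ltr0_norm h) ?opprK // ger0_norm.
have [w1' w1E] : exists y, y = Rc (re w) * dirv (tan (psi gamma z)) by eexists.
have lim' h0 : cm (H w1' h0 j - (h0 == j)%:R * K p j) <= Cb * expR (- `|re w|).
  by have := lim p h0 j `|re w| (normr_ge0 _); rewrite /= rE -w1E.
have re1 : re w1' = re w by rewrite w1E re_dirv.
have wB : cm (w - w1') <= B.
  have := strip_off nu0 az st; rewrite -BE; have -> : im w - re w * tan (psi gamma z) = im (w - w1').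
    by rewrite imB w1E im_dirv.
  apply: le_trans; apply: le_trans (cm_le_reim _) _; by rewrite reB re1 subrr normr0 add0r.
have [[_ st1] _] : low gamma kap s1 nu vr o z w1' by rewrite w1E; exact: low_axis.
have seg u : 0 <= u <= 1 -> wdom gamma kap s1 nu vr mm o z (segp w1' w u) /\ re (segp w1' w u) = re w.
  move=> u01; have rs : re (segp w1' w u) = re w.
    by rewrite /segp reD reM re_Rc im_Rc reB re1 subrr mulr0 mul0r subrr addr0.
  by split=> //; apply: dom'; rewrite ?rs // tt_seg; exact: strip_seg.
have [e eE] : exists e : R, e = expR (- `|re w|) by eexists.
have e0 : 0 < e by rewrite eE expR_gt0.
have e1 : e <= 1 by rewrite eE -expR0 ler_expR oppr_le0.
pose g h0 u := H (segp w1' w u) h0 j - (h0 == j)%:R * K p j.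
pose dg h0 u := (kapf L0 L1 j z h0 (segp w1' w u) * H (segp w1' w u) h0 j +
  \sum_m qf Rm z h0 m (segp w1' w u) * H (segp w1' w u) m j) * (w - w1').
have gd' h0 u : 0 <= u <= 1 -> pder (g h0) u (dg h0 u).
  move=> /seg[d _]; apply: gder_eq (gderB (cder_line (dH _ h0 j d)) (gder_cst _ _ _)) _.
  by rewrite subr0.
have bound h0 u : 0 <= u <= 1 -> cm (dg h0 u) <= L * \sum_m cm (g m u) + B * (Q * KK) * e.
  move=> /seg[d rs]; have gy := wg _ d.
  have [y yE] : exists y, y = segp w1' w u by eexists.
  have HE m : H y m j = g m u + (m == j)%:R * K p j by rewrite /g yE subrK.
  have S0 : 0 <= \sum_m cm (g m u) by rewrite sumr_ge0 // => m _; exact: cm_ge0.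
  rewrite /dg -yE in gy rs *; rewrite cmM mulrC.
  have q m : cm (qf Rm z h0 m y) <= Q * e by rewrite QE eE -rs; apply: qf_bound; rewrite ?rs.
  have Qe : Q * e <= Q by rewrite ler_piMr.
  have h1 : cm (kapf L0 L1 j z h0 y * H y h0 j) <= k * \sum_m cm (g m u).
    rewrite HE mulrDr; have -> : kapf L0 L1 j z h0 y * ((h0 == j)%:R * K p j) = 0.
      by case: eqVneq => [->|_]; rewrite ?mul0r ?mulr0 // kapfE subrr mul0r.
    rewrite addr0 cmM ler_pM ?cm_ge0 // ?kE; first exact: kapf_bound.
    by rewrite (bigD1 h0) //= lerDl sumr_ge0 // => m _; exact: cm_ge0.
  have h2 : cm (\sum_m qf Rm z h0 m y * H y m j) <= Q * (\sum_m cm (g m u)) + Q * KK * e.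
    have -> : \sum_m qf Rm z h0 m y * H y m j = \sum_m qf Rm z h0 m y * g m u + qf Rm z h0 j y * K p j.
      under eq_bigr do rewrite HE mulrDr; rewrite big_split /=; congr (_ + _).
      by rewrite (bigD1 j) //= eqxx mul1r big1 ?addr0 // => m /negPf ->; rewrite mul0r mulr0.
    apply: le_trans (cmD _ _) _; apply: lerD.
      apply: (le_trans (cm_sum _ _)); rewrite mulr_sumr; apply: ler_sum => m _.
      by rewrite cmM ler_wpM2r ?cm_ge0 //; apply: le_trans (q m) Qe.
    by rewrite cmM mulrAC ler_pM ?cm_ge0.
  have h3 : cm (kapf L0 L1 j z h0 y * H y h0 j + \sum_m qf Rm z h0 m y * H y m j) <=
     (k + Q) * (\sum_m cm (g m u)) + Q * KK * e.
    by apply: le_trans (cmD _ _) _; rewrite mulrDl -addrA; exact: lerD.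
  apply: le_trans (ler_pM (cm_ge0 _) (cm_ge0 _) wB h3) _.
  by rewrite LE; move: (\sum_m _) => S; rewrite le_eqVlt; apply/orP; left; apply/eqP; ring.
have := @gronwall R n g dg L (B * (Q * KK) * e) (Cb * e) L0' _ _ gd' _ bound i 1.
rewrite !mulr_ge0 ?(ltW e0) // ler01 lexx /= => /(_ isT isT) h.
have hh : cm (g i 1) <= 2 * (Cb * e + B * (Q * KK) * e) * expR (2 * (n%:R * L) + 1).
  by apply: h => // h0; rewrite /g /segp Rc0 mul0r addr0 eE; exact: lim'.
have s1' : segp w1' w 1 = w by rewrite /segp Rc1 mul1r addrC subrK.
move: hh; rewrite /g s1' -pE -eE => hh; apply: le_trans hh _.
by rewrite le_eqVlt; apply/orP; left; apply/eqP; ring.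
Qed.

Lemma wdom_zdom s1 nu vr mm o z w : wdom gamma kap s1 nu vr mm o z w ->
  zdom gamma s1 z /\ strip gamma kap nu z (tt o z w).
Proof. by case=> [[[h st] _]|[[h st] _]|[[h st] _]]. Qed.

Lemma wdom_open s1 nu vr mm o : opn2 (wdom gamma kap s1 nu vr mm o).
Proof.
move=> p w [h|h|h].
- have [d d0 H] := @low_open R gamma kap s1 nu vr o p w h.
  by exists d => // x y xd yd; constructor 1; exact: H.
- have [d d0 H] := @fan_open R gamma kap s1 nu vr mm false o p w h.
  by exists d => // x y xd yd; constructor 2; exact: H.
have [d d0 H] := @fan_open R gamma kap s1 nu vr mm true o p w h.
by exists d => // x y xd yd; constructor 3; exact: H.
Qed.

(** V and K are quantified before the orientation [o]: both sectors are served by the same initial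
    columns and the same limits. *)
Lemma solution : exists nu : R, [/\ 0 < nu, nu <= (2^-1 - kap) * pi * del0 gamma &
  forall vr mm, 0 < vr -> 2 <= vr * r1 -> (cos (bigT gamma))^-1 + 1 <= mm ->
  exists (s1 Cb : R) (V : C -> 'M[C]_n) (K : bool -> 'I_n -> C -> C), [/\ [/\ 0 < s1, s1 <= 1, 0 <= Cb & s1 * Cb <= 2^-1],
   forall z, zdom gamma s1 z -> [/\ forall i j, cm (V z i j - (i == j)%:R) <= Cb * cm (rt z) ^+ 2,
     V z \in unitmx, forall i j, cm (invmx (V z) i j) <= 2 &
     forall p j, cdiff (K p j) z /\ cm (K p j z - 1) <= Cb * cm (rt z)] &
   forall o, exists H : C -> C -> 'M[C]_n, [/\ hol2mx (wdom gamma kap s1 nu vr mm o) H,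
     forall z w, wdom gamma kap s1 nu vr mm o z w -> [/\ gd r1 z w, H z w \in unitmx & forall i j,
       cder (fun x => H z x i j) w (kapf L0 L1 j z i w * H z w i j + \sum_l qf Rm z i l w * H z w l j)],
     forall z, zdom gamma s1 z -> wdom gamma kap s1 nu vr mm o z 0 /\ H z 0 = V z &
     forall z, zdom gamma s1 z -> exists M X : R, 0 <= M /\
       forall w, strip gamma kap nu z (tt o z w) -> X <= `|re w| -> wdom gamma kap s1 nu vr mm o z w /\
         forall i j, cm (H z w i j - (i == j)%:R * K (re w < 0) j z) <= M * expR (- `|re w|)]]].
Proof.
have [nu [nu0 nuk cont]] := continuation gamma0 gammaT kap0 kap2 r1_gt0; exists nu; split=> // vr mm vr0 vr1 hmm.
have [s0 s00 {}cont] := cont vr mm vr0 vr1 hmm.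
have [sa [Cb [Y0 [E [V [K [[sa0 sa1 Cb0 z0] [hY sY uY] hE e0 hV]]]]]]] := columns.
have N0 : 0 < 2 * (n%:R + 1) * (Cb + 1) :> R.
  by rewrite !mulr_gt0 //; have := ler0n R n; lra.
(* The last bound yields n Cb s1 <= 1/2, for the invertibility of V, and s1 Cb <= 1/2, which keeps
   the limits away from 0. *)
have [s1 s1E] : exists s1 : R, s1 = Num.min s0 (Num.min sa (2 * (n%:R + 1) * (Cb + 1))^-1) by eexists.
have s10 : 0 < s1 by rewrite s1E !lt_min s00 sa0 invr_gt0.
have s1s : s1 <= s0 by rewrite s1E ge_min lexx.
have s1a : s1 <= sa by rewrite s1E !ge_min lexx orbT.
have s1N : s1 * (2 * (n%:R + 1) * (Cb + 1)) <= 1 by rewrite -ler_pdivlMr // mul1r s1E !ge_min lexx !orbT.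
have n0 := ler0n R n.
have s1n : n%:R * (Cb * s1) <= 2^-1 /\ s1 * Cb <= 2^-1.
  have a1 : 0 <= s1 * Cb by rewrite mulr_ge0 // ltW.
  have a2 : 0 <= s1 * n%:R by rewrite mulr_ge0 // ltW.
  have a3 : 0 <= n%:R * (Cb * s1) by rewrite !mulr_ge0 // ltW.
  have a4 : s1 * (2 * (n%:R + 1) * (Cb + 1)) = 2 * (n%:R * (Cb * s1)) + 2 * (s1 * Cb) + 2 * (s1 * n%:R) + 2 * s1 by ring.
  by move: a4 s1N a1 a2 a3 s10; move: (s1 * Cb) (n%:R * _) (s1 * n%:R) => x y y'; split; clear gamma0 gammaT
    r1_gt0 r1_le1 MB_ge0 c1_gt0 L0_cont B_bound gap_lb dL0 dL1 hRm kap0 kap2 nu0 nuk vr0 vr1 hmm s00 cont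
    sa0 sa1 Cb0 hE e0 N0 s1E s1s s1a n0; lra.
have zsa z : zdom gamma s1 z -> zdom gamma sa z by move=> [h az]; split=> //; exact: lt_le_trans s1a.
have [wgd [low0 {}cont]] := cont s1 s1s.
exists s1, Cb, V, K; split=> //.
- by split=> //; [exact: le_trans sa1|exact: s1n.2].
- move=> z zz; have [_ v2 v3 _] := hV z (zsa z zz); have [zs _] := zz.
  have h : n%:R * (Cb * cm (rt z) ^+ 2) <= 2^-1.
    apply: le_trans s1n.1; rewrite ler_wpM2l // ler_wpM2l // expr2.
    have := ler_wpM2l (cm_ge0 (rt z)) (ltW (lt_le_trans zs (le_trans s1a sa1))); clear gamma0 gammaT r1_gt0
    r1_le1 MB_ge0 c1_gt0 L0_cont B_bound gap_lb dL0 dL1 hRm kap0 kap2 nu0 nuk vr0 vr1 hmm s00 sa0 sa1 Cb0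
    hE e0 N0 s1E s10 s1s s1a s1N n0 s1n cont v2 v3; lra.
  by have [u1 u2] := near_id_unit h v2; split.
move=> o; have [Yc [hYc sYc uYc Yc0]] := cont o n Af Y0 hol_Af hY sY uY.
have hlam j : hol2mx (gd r1) (fun z w => (lamf j z w)%:M : 'M[C]_1).
  move=> i k; rewrite !ord1; have -> : (fun p w => ((lamf j p w)%:M : 'M[C]_1) 0 0) = lamf j.
    by apply/funext => p; apply/funext => w; rewrite mxE mulr1n.
  exact: hol_lamf.
have [Ec HEc] := choice (fun j => let: And3 a b c := hE j in cont o 1%N _ (E j) (hlam j) a b c).
(* Column j is the continued solution that starts from the j-th column of V at w = 0, divided by the
   j-th model solution. *)
pose H z w : 'M[C]_n := \matrix_(i, j) ((Yc z w *m V z) i j * Ec j z w 0 0).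
pose W := wdom gamma kap s1 nu vr mm o.
have dV i j : hol2 W (fun z _ => V z i j).
  apply: (@hol2_comp1 R W (zdom gamma s1) (fun z => V z i j) (fun z _ => z) (@wdom_open s1 nu vr mm o)).
  - move=> x zx; have [d d0 Hd] := @zdom_open R gamma s1 x 0 zx; exists d => // k kd.
    by apply: (Hd k 0); rewrite ?cm0.
  - by move=> x /zsa zx; have [h _ _ _] := hV x zx; exact: h.
  - exact: hol2_fst.
  by move=> p w /wdom_zdom[].
have HW z w : W z w -> [/\ gd r1 z w, H z w \in unitmx & forall i j,
    cder (fun x => H z x i j) w (kapf L0 L1 j z i w * H z w i j + \sum_l qf Rm z i l w * H z w l j)].
  move=> Wz; have [zz _] := wdom_zdom Wz; split.
  - by apply: wgd; move: Wz; rewrite /W; case: (o) => h; [right|left].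
  - have -> : H z w = Yc z w *m V z *m diag_mx (\row_j Ec j z w 0 0).
      by apply/matrixP => i j; rewrite mul_mx_diag !mxE.
    rewrite !unitmx_mul uYc //=; apply/andP; split.
      have [_ v2 _ _] := hV z (zsa z zz); have [zs _] := zz.
      have h : n%:R * (Cb * cm (rt z) ^+ 2) <= 2^-1.
        apply: le_trans s1n.1; rewrite ler_wpM2l // ler_wpM2l // expr2.
        have := ler_wpM2l (cm_ge0 (rt z)) (ltW (lt_le_trans zs (le_trans s1a sa1))); clear gamma0 gammaT r1_gt0
    r1_le1 MB_ge0 c1_gt0 L0_cont B_bound gap_lb dL0 dL1 hRm kap0 kap2 nu0 nuk vr0 vr1 hmm s00 sa0 sa1 Cb0
    hE e0 N0 s1E s10 s1s s1a s1N n0 s1n cont Yc0 hlam HEc dV v2; lra.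
      by have [] := near_id_unit h v2.
    rewrite unitmxE det_diag unitfE; apply/prodf_neq0 => j _; rewrite mxE.
    by have [_ _ u _] := HEc j; have := u z w Wz; rewrite unitmxE det_mx11 unitfE.
  move=> i j; have [_ sE _ _] := HEc j.
  have -> : (fun x => H z x i j) = (fun x => (\sum_k Yc z x i k * V z k j) * Ec j z x 0 0).
    by apply/funext => x; rewrite mxE mxE.
  apply: gder_eq (gderM (gder_sum _ (fun k => gderM (sYc z w i k Wz) (gder_cst _ (V z k j) _))) (sE z w 0 0 Wz)) _.
  rewrite mul_scalar_mx !mxE kapfE.
  have -> : \sum_k ((Af z w *m Yc z w) i k * V z k j + Yc z w i k * 0) =
      \sum_l qf Rm z i l w * (\sum_k Yc z w l k * V z k j) - lamf i z w * \sum_k Yc z w i k * V z k j.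
    under eq_bigr do rewrite mulr0 addr0.
    have := congr1 (fun N : 'M[C]_n => N i j) (mulmxA (Af z w) (Yc z w) (V z)); rewrite ![in X in X -> _]mxE => <-.
    under eq_bigr do rewrite mxE mulrBl; rewrite big_split /= sumrN; congr (_ - _).
      by apply: eq_bigr => l _; rewrite mxE.
    rewrite (bigD1 i) //= eqxx mul1r [X in _ + X]big1 => [|l li]; first by rewrite addr0 mxE.
    by rewrite eq_sym (negPf li) !mul0r.
  have -> : \sum_l qf Rm z i l w * H z w l j = (\sum_l qf Rm z i l w * (\sum_k Yc z w l k * V z k j)) * Ec j z w 0 0.
    by rewrite mulr_suml; apply: eq_bigr => l _; rewrite mxE mxE; ring.
  by move: (\sum_l _ * _) (\sum_k _ * _) => S S'; ring.
have W0 z : zdom gamma s1 z -> W z 0 by move=> zz; constructor 1; exact: low0.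
have lowE z w : low gamma kap s1 nu vr o z w -> H z w = \matrix_(i, j) ((Y0 z w *m V z) i j * E j z w 0 0).
  by move=> lw; apply/matrixP => i j; rewrite [LHS]mxE [RHS]mxE Yc0 //; have [_ _ _ h] := HEc j; rewrite h.
exists H; split=> //.
- move=> i j; have -> : (fun p w => H p w i j) = (fun p w => (\sum_k Yc p w i k * V p k j) * Ec j p w 0 0).
    by apply/funext => p; apply/funext => w; rewrite mxE mxE.
  apply: hol2_M; last by have [h _ _ _] := HEc j; exact: h.
  by apply: hol2_sum => k; apply: hol2_M; [exact: hYc|exact: dV].
- move=> z zz; split; first exact: W0.
  have [e1 e2] := e0 z (zsa z zz); rewrite lowE; last exact: low0.
  by apply/matrixP => i j; rewrite mxE e1 e2 mul1mx mxE mulr1.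
move=> z zz; have [_ _ _ lim] := hV z (zsa z zz).
apply: (@decay s1 nu vr mm o z (H z) (fun p j => K p j z) Cb) => //.
- exact: low0.
- by move=> w /HW[].
- by move=> w i j /HW[_ _]; exact.
move=> p i j u u0 /=; rewrite lowE; last by apply: low_axis; exact: low0.
by rewrite mxE; exact: lim.
Qed.

End Columns.

End Assembly.

(** * Return to the variable x *)

Section ReturnToX.
Context {R : realType}.
Local Notation C := (cplx R).
Implicit Types (z w a b l t x : C) (u v e d M : R).
Local Notation rt := (@Pilot.Defs.sqrte R).
Opaque cexp.

Lemma cth_of_cexp w c : 1 + c != 0 -> cexp (- (2 * w)) * (1 + c) = 1 - c -> ccosh w != 0 /\ cth w = c.
Proof.
move=> c1 E; have e0 := cexp_neq0 w; have two : (2 : C) != 0 by rewrite pnatr_eq0.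
have E2 : cexp (- w) = cexp w * cexp (- (2 * w)) by rewrite -cexpD; congr cexp; ring.
have E3 : cexp (- (2 * w)) = (1 - c) / (1 + c) by rewrite -E mulfK.
have Ec : ccosh w = cexp w / (1 + c) by rewrite /ccosh E2 E3; field.
have Es : csinh w = cexp w * c / (1 + c) by rewrite /csinh E2 E3; field.
have c0 : ccosh w != 0 by rewrite Ec mulf_neq0 ?invr_neq0.
split=> //; rewrite /cth Ec Es; field; by rewrite c1 e0.
Qed.

Lemma rcont_cmf (f : C -> C -> C) : hol2 (fun _ _ => True) f -> rcont (fun p w => cm (f p w)).
Proof.
move=> hf p w e e0; have [d d0 Hd] := @hol2_cont R _ f p w (@opn2T R) hf I e e0.
exists d => // x y xd yd; apply: le_lt_trans (Hd x y xd yd).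
have h1 := cm_dist (f (p + x) (w + y)) (f p w); have h2 := cm_dist (f p w) (f (p + x) (w + y)).
by rewrite cmBC in h2; rewrite ler_norml; apply/andP; split; lra.
Qed.

(** The equation reads e^(-2w) = (sqrt(eps) - x)/(sqrt(eps) + x). After multiplication by e^(2 w0)
    the right-hand side is near 1, where the logarithm of [log_near1] solves it holomorphically in
    both variables. *)
Lemma local_inverse z0 w0 : ccosh w0 != 0 -> exists (U : C -> C -> Prop) (om : C -> C -> C),
  [/\ opn2 U, U z0 (rt z0 * cth w0), hol2 U om, om z0 (rt z0 * cth w0) = w0 &
   forall z x, U z x -> ccosh (om z x) != 0 /\ rt z * cth (om z x) = x].
Proof.
move=> n0; have [lg [lg1 Hlg]] := @log_near1 R; pose e := cexp (2 * w0); pose TT := fun _ _ : C => True.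
pose U z x : Prop := cm ((rt z - x) * e - (rt z + x)) < cm (rt z + x).
pose f z x := (rt z - x) * e / (rt z + x).
have hT := @opn2T R; have hr : hol2 TT (fun z _ => rt z) by exact: hol2_rt.
have h1 : hol2 TT (fun z x => rt z + x) by apply: hol2_D => //; exact: hol2_snd.
have h2 : hol2 TT (fun z x => (rt z - x) * e).
  by apply: hol2_M; [apply: hol2_B => //; exact: hol2_snd|exact: hol2_cst].
have oU : opn2 U by apply: rcont_lt; apply: rcont_cmf => //; exact: hol2_B.
have Un z x : U z x -> rt z + x != 0 by move=> h; rewrite -cm_gt0; apply: le_lt_trans h; exact: cm_ge0.
have Uf z x : U z x -> cm (f z x - 1) < 1.
  move=> h; have n := Un z x h; have p0 : 0 < cm (rt z + x) by rewrite cm_gt0.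
  have -> : f z x - 1 = ((rt z - x) * e - (rt z + x)) / (rt z + x) by rewrite /f; field.
  by rewrite cmM cmV ltr_pdivrMr // mul1r.
have E0 := cexp_cth n0.
have c1 : 1 + cth w0 != 0.
  apply/eqP => c1; move: E0; rewrite c1 mulr0 => E0.
  have : (1 + cth w0) + (1 - cth w0) = 2 by ring.
  by rewrite -E0 c1 addr0 => /esym/eqP; rewrite pnatr_eq0.
have e2 : e * (1 - cth w0) = 1 + cth w0.
  by rewrite -E0 mulrA /e -cexpD subrr cexp0 mul1r.
have f0 : (rt z0 - rt z0 * cth w0) * e = rt z0 + rt z0 * cth w0.
  have -> : (rt z0 - rt z0 * cth w0) * e = rt z0 * (e * (1 - cth w0)) by ring.
  by rewrite e2 mulrDr mulr1.
have n1 : rt z0 + rt z0 * cth w0 != 0.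
  by rewrite -{1}[rt z0]mulr1 -mulrDr mulf_neq0 // rt_neq0.
exists U, (fun z x => w0 - lg (f z x) / 2); split=> //.
- by rewrite /U f0 subrr cm0 cm_gt0.
- apply: hol2_B; first exact: hol2_cst.
  apply: hol2_M; last exact: hol2_cst.
  apply: (hol2_comp1 (W := fun u : C => cm (u - 1) < 1) oU).
  + move=> x xr; exists (1 - cm (x - 1)); first by rewrite subr_gt0.
    move=> k kd; have := cmD (x - 1) k; have -> : x - 1 + k = x + k - 1 by ring.
    by move: kd; lra.
  + by move=> x /Hlg[].
  + apply: hol2_M; first exact: hol2_sub h2.
    by apply: hol2_V => //; exact: hol2_sub h1.
  by move=> p w /Uf.
- by rewrite /f f0 divff // lg1 mul0r subr0.
move=> z x Ux; have n := Un z x Ux; have [lE _] := Hlg _ (Uf z x Ux).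
have r0 := rt_neq0 z.
have c' : 1 + x / rt z != 0 by have -> : 1 + x / rt z = (rt z + x) / rt z by [field]; rewrite mulf_neq0 ?invr_neq0.
have [|h3 h4] := @cth_of_cexp (w0 - lg (f z x) / 2) (x / rt z) c'.
  have -> : - (2 * (w0 - lg (f z x) / 2)) = - (2 * w0) + lg (f z x) by field.
  rewrite cexpD lE cexpN -/e /f; have e0 : e != 0 by exact: cexp_neq0.
  by field; rewrite r0 n e0.
by split=> //; rewrite h4 mulrC divfK.
Qed.

Lemma hol2_ext (U : C -> C -> Prop) (f g : C -> C -> C) : opn2 U -> (forall p w, U p w -> f p w = g p w) -> hol2 U g -> hol2 U f.
Proof.
move=> oU E hg p w Up; have [d d0 Hd] := oU p w Up; have [h1 h2 [d' [M [d'0 HM]]]] := hg p w Up.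
split.
- apply: cdiff_ext h1; exists d => // k kd; have := Hd k 0 kd; rewrite cm0 addr0 => /(_ d0) /E ->//.
- apply: cdiff_ext h2; exists d => // k kd; have := Hd 0 k; rewrite cm0 addr0 => /(_ d0 kd) /E ->//.
exists (Num.min d d'), M; split; first by rewrite lt_min d0.
move=> x y; rewrite !lt_min => /andP[x1 x2] /andP[y1 y2]; rewrite E; last exact: Hd.
exact: HM.
Qed.

Section Patch.
Variables (n : nat) (W : C -> C -> Prop) (H : C -> C -> 'M[C]_n).
Hypotheses (oW : opn2 W) (hH : hol2mx W H) (Wn : forall z w, W z w -> ccosh w != 0)
  (Winj : forall z w w', W z w -> W z w' -> cth w = cth w' -> w = w').

(** The inverse of x = sqrt(eps) tanh w on the fibre of W, with default 0 off its image; [patch]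
    identifies it locally with a holomorphic branch. *)
Definition winv z x : C := xget 0 [set w | W z w /\ rt z * cth w = x].

Definition Hx z x := H z (winv z x).

Lemma winvE z w : W z w -> winv z (rt z * cth w) = w.
Proof.
move=> Ww; rewrite /winv; case: xgetP => [y _ [Wy E]|/(_ w)[]//].
exact/(Winj Wy Ww)/(mulfI (rt_neq0 z)).
Qed.

Lemma patch z0 w0 : W z0 w0 -> exists (U : C -> C -> Prop) (om : C -> C -> C),
  [/\ opn2 U, U z0 (rt z0 * cth w0), hol2 U om, om z0 (rt z0 * cth w0) = w0 &
   forall z x, U z x -> [/\ W z (om z x), rt z * cth (om z x) = x & winv z x = om z x]].
Proof.
move=> W0; have [U [om [oU U0 hU o0 HU]]] := local_inverse z0 (Wn W0).
exists (fun z x => U z x /\ W z (om z x)), om; split=> //; try by rewrite o0.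
- move=> p w [Up Wp]; have [d d0 Hd] := oU p w Up; have [d1 d10 H1] := oW Wp.
  have [d2 d20 H2] := hol2_cont oU hU Up d10.
  exists (Num.min d (Num.min d1 d2)); first by rewrite !lt_min d0 d10.
  move=> x y; rewrite !lt_min => /and3P[x1 x2 x3] /and3P[y1 y2 y3]; split; first exact: Hd.
  by have := H1 x (om (p + x) (w + y) - om p w) x2 (H2 x y x3 y3); rewrite [om p w + _]addrC subrK.
- exact: (@hol2_sub R _ U om (fun p w h => proj1 h) hU).
move=> z x [Ux Wx]; have [_ E] := HU z x Ux; split=> //.
by rewrite -{1}E winvE.
Qed.

Lemma Hx_analytic z w : W z w -> analytic_at (fun p : C * C => Hx p.1 p.2) (z, rt z * cth w).
Proof.
move=> Ww; have [U [om [oU U0 hU _ HU]]] := patch Ww.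
apply: (@analytic_hol2 R n U Hx z (rt z * cth w) oU _ U0) => i j.
apply: (@hol2_ext U _ (fun p x => H p (om p x) i j) oU).
  by move=> p x /HU[_ _ E]; rewrite /Hx E.
apply: (hol2_comp (V := W) (a := fun p _ => p) (b := om) oU oW (hH i j) _ hU); first exact: hol2_fst.
by move=> p x /HU[].
Qed.

Lemma local_om z w : W z w -> exists om : C -> C, [/\ om (rt z * cth w) = w,
  cder om (rt z * cth w) (ccosh w ^+ 2 / rt z) &
  exists2 d, 0 < d & forall k, cm k < d -> let x := rt z * cth w + k in
    [/\ W z (om x), rt z * cth (om x) = x & Hx z x = H z (om x)]].
Proof.
move=> Ww; have [U [om [oU U0 hU o0 HU]]] := patch Ww; exists (om z); split=> //; last first.
  have [d d0 Hd] := oU _ _ U0; exists d => // k kd /=.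
  have := Hd 0 k; rewrite cm0 addr0 => /(_ d0 kd) /HU[h1 h2 h3]; split=> //.
  by rewrite /Hx h3.
have [_ [m Hm] _] := hU _ _ U0; have n0 := Wn Ww; have r0 := rt_neq0 z.
have h1 : cder (fun x => rt z * cth (om z x)) (rt z * cth w) (rt z * (ccosh w ^- 2 * m)).
  by apply: gderZ; apply: gder_comp Hm; rewrite o0; exact: cder_cth.
have h2 : cder (fun x => rt z * cth (om z x)) (rt z * cth w) 1.
  apply: gder_ext _ _ (cder_id _) => //; have [d d0 Hd] := oU _ _ U0; exists d => // k kd /=.
  by have := Hd 0 k; rewrite cm0 addr0 => /(_ d0 kd) /HU[_ -> _].
have E := cder_uniq h1 h2; apply: gder_eq Hm _.
have -> : m = (rt z * (ccosh w ^- 2 * m)) * (ccosh w ^+ 2 / rt z) by field; rewrite r0 n0.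
by rewrite E mul1r.
Qed.

Variables (A : prenormal R n) (o : bool).
Local Notation lam0 := (fun i y => Lam0 A y 0 i).
Local Notation lam1 := (fun i y => Lam1 A y 0 i).
Local Notation rem := (fun i k y x => Rem A y x i k).
Hypothesis uH : forall z w, W z w -> H z w \in unitmx.
Hypothesis dH : forall z w i j, W z w ->
  cder (fun x => H z x i j) w (kapf lam0 lam1 j z i w * H z w i j + \sum_l qf rem z i l w * H z w l j).

(** The actual time of the sector, which for U is the negative of the one in [tt]. *)
Definition time z w := sgn o * tt o z w.

Lemma timeE z w : time z w = (sgn o * hpi - w) / rt z.
Proof.
rewrite /time /tt mulrA mulrBr; congr ((_ - _) / _).
by rewrite /sgn; case: (o); rewrite ?expr0 ?expr1 ?mulN1r ?opprK ?mul1r.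
Qed.

Lemma xtime_time z w : xtime z (time z w) = rt z * cth w.
Proof.
have E := xtime_ww z (tt o z w) o; rewrite ttK in E; rewrite -E /time /sgn.
case: (o); rewrite ?expr0 ?expr1 ?mul1r // !mulN1r /xtime mulrN ccoshN csinhN.
by rewrite invrN !mulrN.
Qed.

(** The diagonal factors of F have logarithmic derivative - [lamf] in w, so multiplying by F undoes
    the division by model solutions and restores the original system; the derivative of the local
    inverse converts it to the variable x. *)
Lemma fundamental_at z w0 (Gd : C -> Prop) (L : C -> C) (F : C -> 'M[C]_n) : W z w0 ->
  (exists2 d, 0 < d & forall k, cm k < d -> Gd (time z w0 + k)) -> cdiff L (time z w0) ->
  (forall t, Gd t -> cexp (2 * L t) = xtime z t ^+ 2 - cexp z /\
    F (xtime z t) = diag_mx (\row_i cexp (t * Lam0 A (cexp z) 0 i + L t * Lam1 A (cexp z) 0 i))) ->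
  let x0 := rt z * cth w0 in
  [/\ derivable (fun x => Hx z x *m F x) x0 1,
   (x0 ^+ 2 - cexp z) *: 'D_1 (fun x => Hx z x *m F x) x0 = Bmx A (cexp z) x0 *m (Hx z x0 *m F x0) &
   Hx z x0 *m F x0 \in unitmx].
Proof.
move=> W0 [dG dG0 HG] [Ld HL] HF x0; have n0 := Wn W0; have r0 := rt_neq0 z.
have [om [ o0 dom [d d0 Hd]]] := local_om W0; rewrite -/x0 in o0 dom.
pose ph j w := cexp (time z w * Lam0 A (cexp z) 0 j + L (time z w) * Lam1 A (cexp z) 0 j).
have dT : cder (time z) w0 (- (rt z)^-1).
  apply: gder_ext _ _ (_ : cder (fun w => (rt z)^-1 * (sgn o * hpi - w)) w0 _) => //.
    by exists 1 => // k _; rewrite timeE mulrC.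
  by apply: gder_eq (gderZ _ (gderB (gder_cst _ _ _) (cder_id _))) _; rewrite sub0r mulrN1.
have dL : cder (fun w => L (time z w)) w0 (Ld * - (rt z)^-1) by apply: gder_comp HL dT.
have [dW dW0 HW] := oW W0.
have [dt dt0 Ht] : exists2 dt, 0 < dt & forall k, cm k < dt -> Gd (time z (w0 + k)).
  have s0 : 0 < cm (rt z) by rewrite cm_gt0.
  exists (dG * cm (rt z)); first by rewrite mulr_gt0.
  move=> k kd; have -> : time z (w0 + k) = time z w0 + (- k / rt z) by rewrite !timeE; field.
  by apply: HG; rewrite cmM cmN cmV ltr_pdivrMr.
(* Differentiating e^(2L) = x^2 - eps in t, with x' = x^2 - eps, gives L' = x. *)
have LdE : Ld = rt z * cth w0.
  have h1 : cder (fun w => cexp (2 * L (time z w))) w0 (cexp (2 * L (time z w0)) * (2 * (Ld * - (rt z)^-1))).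
    by apply: (gder_comp (cder_cexp _)); exact: gderZ.
  have h2 : cder (fun w => cexp (2 * L (time z w))) w0 (rt z ^+ 2 * (2 * (cth w0 * ccosh w0 ^- 2))).
    apply: gder_ext _ _ (_ : cder (fun w => rt z ^+ 2 * (cth w * cth w) - cexp z) w0 _) => //.
      exists dt => // k /Ht /HF[-> _]; by rewrite xtime_time expr2 expr2; ring.
    apply: gder_eq (gderB (gderZ _ (gderM (cder_cth n0) (cder_cth n0))) (gder_cst _ _ _)) _; ring.
  have G0 : Gd (time z w0) by have := Ht 0; rewrite cm0 addr0; exact.
  have := cder_uniq h1 h2; have [-> _] := HF _ G0; rewrite xtime_time -rt_sqr.
  have -> : (rt z * cth w0) ^+ 2 - rt z ^+ 2 = - rt z ^+ 2 * ccosh w0 ^- 2 by rewrite -cth_sqr //; ring.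
  move=> E; have E1 : - rt z ^+ 2 * ccosh w0 ^- 2 * (2 * (Ld / - rt z)) * (ccosh w0 ^+ 2 / (2 * rt z)) =
    rt z ^+ 2 * (2 * (cth w0 / ccosh w0 ^+ 2)) * (ccosh w0 ^+ 2 / (2 * rt z)) by rewrite -E invrN.
  have two : (2 : C) != 0 by rewrite pnatr_eq0.
  have E2 : - rt z ^+ 2 * ccosh w0 ^- 2 * (2 * (Ld / - rt z)) * (ccosh w0 ^+ 2 / (2 * rt z)) = Ld.
    by field; rewrite r0 n0.
  rewrite -E2 E1; by field; rewrite r0 n0.
have dph j : cder (ph j) w0 (- lamf lam0 lam1 j z w0 * ph j w0).
  apply: gder_eq.
    apply: (gder_comp (cder_cexp _)).
    by apply: gderD; apply: gderM; [exact: dT|exact: gder_cst|exact: dL|exact: gder_cst].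
  by rewrite -/(ph j w0) LdE /lamf; field.
have oc : exists2 dd, 0 < dd & forall k, cm k < dd -> cm (om (x0 + k) - w0) < Num.min dW dt.
  have mm0 : 0 < Num.min dW dt by rewrite lt_min dW0.
  have [|dd dd0 Hdd] := cder_ccont dom (e := Num.min dW dt / 2); first by rewrite divr_gt0.
  by exists dd => // k kd; have := Hdd k kd; rewrite o0; lra.
have [dd dd0 Hdd] := oc.
pose Dm : 'M[C]_n := \matrix_(i, j) (((kapf lam0 lam1 j z i w0 * H z w0 i j + \sum_l qf rem z i l w0 * H z w0 l j) * ph j w0
  + H z w0 i j * (- lamf lam0 lam1 j z w0 * ph j w0)) * (ccosh w0 ^+ 2 / rt z)).
have FE k : cm k < Num.min d dd -> forall i j, (Hx z (x0 + k) *m F (x0 + k)) i j = H z (om (x0 + k)) i j * ph j (om (x0 + k)).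
  rewrite lt_min => /andP[k1 k2] i j; have [Wk xk Hk] := Hd k k1; rewrite -/x0 in Wk xk Hk.
  have := Hdd k k2; rewrite lt_min => /andP[_ hk].
  have := Ht _ hk; rewrite [w0 + _]addrC subrK => /HF[_]; rewrite xtime_time xk => Fk.
  by rewrite Hk Fk mul_mx_diag !mxE.
have mD0 : 0 < Num.min d dd by rewrite lt_min d0.
have D : is_derive x0 1 (fun x => Hx z x *m F x) Dm.
  apply: mx_derive => i j; rewrite mxE.
  apply: gder_ext _ _ (_ : cder (fun x => H z (om x) i j * ph j (om x)) x0 _) => //.
    by exists (Num.min d dd) => // k kd; rewrite FE.
  apply: (gder_comp (f := fun w => H z w i j * ph j w) _ dom); rewrite o0.
  by apply: gderM; [exact: dH|exact: dph].
have E0 i j : (Hx z x0 *m F x0) i j = H z w0 i j * ph j w0.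
  by have := FE 0; rewrite cm0 addr0 o0; apply.
split; first by case: D.
  case: D => _ ->; apply/matrixP => i j; rewrite [LHS]mxE [Dm i j]mxE [RHS]mxE.
  have e1 : x0 ^+ 2 - cexp z = - rt z ^+ 2 * ccosh w0 ^- 2 by rewrite /x0 -rt_sqr -cth_sqr //; ring.
  have BE : \sum_l Bmx A (cexp z) x0 i l * (Hx z x0 *m F x0) l j =
     (rt z * lamf lam0 lam1 i z w0) * (H z w0 i j * ph j w0) - rt z * (\sum_l qf rem z i l w0 * H z w0 l j) * ph j w0.
    have -> : \sum_l Bmx A (cexp z) x0 i l * (Hx z x0 *m F x0) l j = \sum_l (i == l)%:R * (rt z * lamf lam0 lam1 i z w0) * (H z w0 l j * ph j w0)
       - rt z * (\sum_l qf rem z i l w0 * H z w0 l j) * ph j w0.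
      rewrite mulr_sumr mulr_suml -sumrB; apply: eq_bigr => l _; rewrite E0 /Bmx e1 !mxE.
      have -> : rt z * lamf lam0 lam1 i z w0 = Lam0 A (cexp z) 0 i + x0 * Lam1 A (cexp z) 0 i by rewrite /lamf /x0; field.
      rewrite /qf -/x0; case: (i == l); rewrite ?mulr1n ?mulr0n; by field.
    by rewrite (bigD1 i) //= eqxx mul1r big1 ?addr0 // => l li; rewrite eq_sym (negPf li) !mul0r.
  rewrite BE e1 kapfE; move: (\sum_l _) => S; by field; rewrite r0 n0.
have -> : Hx z x0 *m F x0 = H z w0 *m diag_mx (\row_j ph j w0).
  by apply/matrixP => i j; rewrite E0 mul_mx_diag !mxE.
rewrite unitmx_mul uH //= unitmxE det_diag unitfE; apply/prodf_neq0 => j _; rewrite mxE; exact: cexp_neq0.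
Qed.

(** e^(-2 Re w) = |1 - tanh w| / |1 + tanh w|, and the denominator is at least 1. *)
Lemma cth_near1 w v : ccosh w != 0 -> 0 <= v -> cm (cth w - 1) <= expR (- (2 * v)) -> v <= re w.
Proof.
move=> n0 v0 h; have h1 : expR (- (2 * v)) <= 1.
  by apply: (le_trans (y := expR 0)); [rewrite ler_expR; lra|rewrite expR0].
have h2 : 1 <= cm (1 + cth w).
  have := cm_dist 2 (1 - cth w); have -> : 2 - (1 - cth w) = 1 + cth w by [ring].
  have -> : cm (2 : C) = 2 by rewrite -(@Rc_nat R 2) cm_Rc ger0_norm.
  rewrite cmBC in h; lra.
have := congr1 cm (cexp_cth n0); rewrite cmM cm_cexp [cm (1 - _)]cmBC => E.
have : expR (re (- (2 * w))) <= expR (- (2 * v)).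
  apply: le_trans h; rewrite -E ler_peMr // expR_ge0.
have -> : re (- (2 * w)) = - (2 * re w) by rewrite reN -(@Rc_nat R 2) reM re_Rc im_Rc mul0r subr0.
by rewrite ler_expR; lra.
Qed.

(** By [cth_near1], convergence of x to a singular point means Re w -> +oo or -oo; p records the
    sign of that point. *)
Lemma Hx_limit z (Ox : set C) (St : C -> Prop) (K : bool -> 'I_n -> C) (p : bool) :
  (forall x, Ox x -> exists w, [/\ W z w, St w & x = rt z * cth w]) ->
  (exists M X : R, 0 <= M /\ forall w, St w -> X <= `|re w| -> W z w /\
     forall i j, cm (H z w i j - (i == j)%:R * K (re w < 0) j) <= M * expR (- `|re w|)) ->
  Hx z x @[x --> within Ox (nbhs ((-1) ^+ p * rt z))] --> diag_mx (\row_j K p j).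
Proof.
move=> hO [M [X [M0 HX]]]; apply/cvgrPdist_le => e e0; have [e' e'0 ->] := posC e0.
(* v exceeds X, where the decay estimate starts, and M / e', which suffices because e^(-v) <=
   1/v. *)
have [v vE] : exists v : R, v = `|X| + M / e' + 1 by eexists.
have v1 : 0 <= M / e' by rewrite divr_ge0 // ltW.
have X0 := ler_norm X; have X1 := normr_ge0 X.
have v0 : 0 < v by rewrite vE; lra.
have Xv : X <= v by rewrite vE; lra.
have s0 : 0 < cm (rt z) by rewrite cm_gt0 rt_neq0.
rewrite near_withinE near_simpl; apply/nbhsCP; exists (expR (- (2 * v)) * cm (rt z)); first by rewrite mulr_gt0 ?expR_gt0.
move=> k kd /hO[w [Ww Sw E]]; rewrite E.
have n0 := Wn Ww; have sE : (-1) ^+ p * ((-1) ^+ p) = 1 :> C by rewrite -expr2 sqrr_sign.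
have c1 : cm ((-1) ^+ p * cth w - 1) <= expR (- (2 * v)).
  apply: ltW; rewrite -(ltr_pM2r s0); apply: le_lt_trans kd.
  have -> : k = (-1) ^+ p * (((-1) ^+ p * cth w - 1) * rt z).
    have -> : k = rt z * cth w - (-1) ^+ p * rt z by rewrite -E addrAC subrr add0r.
    have -> : (-1) ^+ p * (((-1) ^+ p * cth w - 1) * rt z) = (-1) ^+ p * (-1) ^+ p * cth w * rt z - (-1) ^+ p * rt z by ring.
    by rewrite sE; ring.
  have cs (y : C) : cm ((-1) ^+ p * y) = cm y by rewrite cmM cmX cmN cm1 expr1n mul1r.
  by rewrite [X in _ <= X]cs [X in _ <= X]cmM.
have [rw pw] : v <= `|re w| /\ (re w < 0) = p.
  move: c1; case: (p); rewrite ?expr0 ?expr1 ?mul1r ?mulN1r.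
    rewrite -cthN => c1; have := @cth_near1 (- w) v _ (ltW v0) c1; rewrite ccoshN reN => /(_ n0) h.
    by have h' : re w < 0 by [lra]; rewrite h' ltr0_norm.
  move=> c1; have h := cth_near1 n0 (ltW v0) c1.
  have h' : 0 < re w by lra.
  by rewrite (gtr0_norm h') ltNge (ltW h').
have [_ hb] := HX w Sw (le_trans Xv rw).
apply: mxnorm_le; first exact: ltW.
move=> i j; rewrite !mxE cmBC /Hx winvE //.
have -> : K p i *+ (i == j) = (i == j)%:R * K p j by case: eqVneq => [->|_]; rewrite ?mulr1n ?mulr0n ?mul1r ?mul0r.
rewrite -{1}pw; apply: le_trans (hb i j) _.
have h1 : expR (- `|re w|) <= v^-1.
  rewrite expRN lef_pV2 ?posrE ?expR_gt0 //; apply: le_trans rw _; have := expR_ge1Dx `|re w|; lra.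
apply: le_trans (ler_wpM2l M0 h1) _; rewrite ler_pdivrMr //.
rewrite vE !mulrDr mulr1 [e' * (M / e')]mulrC divfK ?gt_eqF //; have := mulr_ge0 (ltW e'0) X1; lra.
Qed.

End Patch.

Lemma lip_open (f : C -> R) (K : R) t : (forall k, `|f (t + k) - f t| <= K * cm k) -> 0 < f t ->
  exists2 d, 0 < d & forall k, cm k < d -> 0 < f (t + k).
Proof.
move=> Lf f0; have K0 : 0 < `|K| + 1 by have := normr_ge0 K; lra.
exists (f t / (`|K| + 1)); first by rewrite divr_gt0.
move=> k; rewrite ltr_pdivlMr // => kd; have := Lf k; rewrite ler_norml => /andP[h _].
have := ler_wpM2r (cm_ge0 k) (ler_norm K); have := cm_ge0 k; lra.
Qed.

Lemma xtime_diff z t : csinh (rt z * t) != 0 -> cdiff (xtime z) t.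
Proof.
move=> np; have dr : cder (fun y => rt z * y) t (rt z * 1) by apply: gderZ; exact: cder_id.
have ds : cder (fun y => csinh (rt z * y)) t (ccosh (rt z * t) * (rt z * 1)) by exact: (gder_comp (cder_csinh _) dr).
have dc : cder (fun y => ccosh (rt z * y)) t (csinh (rt z * t) * (rt z * 1)) by exact: (gder_comp (cder_ccosh _) dr).
have di := gder_comp (f := fun x => x^-1) (g := fun y => csinh (rt z * y)) (cderV np) ds.
have E : xtime z = (fun y => - rt z * (ccosh (rt z * y) * (csinh (rt z * y))^-1)) by [].
by rewrite E; eexists; exact: (gderZ (- rt z) (gderM dc di)).
Qed.

(** Poles and times with |x| >= r form a closed set, and components of a closed set are closed. *)
Lemma Nset_open r z t : ~ Nset r z t -> exists2 d, 0 < d & forall k, cm k < d -> ~ Nset r z (t + k).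
Proof.
have main (y : C) : ~ (pole z y \/ Rc r <= `|xtime z y|) -> nbhs y (fun t => ~ (pole z t \/ Rc r <= `|xtime z t|)).
  move=> ny; have np : csinh (rt z * y) != 0 by apply/eqP => h; apply: ny; left.
  have xr : cm (xtime z y) < r.
    by rewrite ltNge; apply/negP => h; apply: ny; right; rewrite normE Rc_le.
  have dr : cder (fun y => rt z * y) y (rt z * 1) by apply: gderZ; exact: cder_id.
  have ds : cder (fun t => csinh (rt z * t)) y (ccosh (rt z * y) * (rt z * 1)) by exact: (gder_comp (cder_csinh _) dr).
  have [l Hl] := xtime_diff np; have s0 : 0 < cm (csinh (rt z * y)) by rewrite cm_gt0.
  have [|d d0 Hd] := cder_ccont ds (e := cm (csinh (rt z * y)) / 2); first by rewrite divr_gt0.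
  have [|d' d'0 Hd'] := cder_ccont Hl (e := (r - cm (xtime z y)) / 2); first by rewrite divr_gt0 // subr_gt0.
  apply/nbhsCP; exists (Num.min d d'); first by rewrite lt_min d0.
  move=> k; rewrite lt_min => /andP[k1 k2] [] h.
    by have := Hd k k1; rewrite h sub0r cmN; lra.
  move: h; rewrite normE Rc_le; have := Hd' k k2; have := cm_dist (xtime z (y + k)) (xtime z y); lra.
have cl : closed (Nset r z).
  apply: component_closed; rewrite -[X in closed X]setCK; apply: open_closedC; rewrite openE => y ny.
  exact: main.
move=> nt; have := closed_openC cl; rewrite openE => /(_ t nt) /nbhsCP[d d0 Hd].
by exists d.
Qed.

(** Up to the factor tan hat_theta, sigma is soft thresholding, a 1-Lipschitz map: subtracting the
    threshold removes the jump at the ends of the flat part. *)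
Lemma sigma_lip gamma c0 z u v : 0 <= c0 ->
  `|Pilot.Defs.sigma gamma c0 z u - Pilot.Defs.sigma gamma c0 z v| <= `|tan (hat_theta gamma z)| * `|u - v|.
Proof.
move=> c00; rewrite /Pilot.Defs.sigma; have : 0 <= c0 / Num.sqrt (expR (re z)) by rewrite divr_ge0 // sqrtr_ge0.
move: (c0 / _) (tan _) => a k a0.
have E (x : R) : exists2 y : R, (if `|x| <= a then 0 else (x - Num.sg x * a) * k) = y * k &
    [\/ y = 0 /\ - a <= x <= a, y = x - a /\ a < x | y = x + a /\ x < - a].
  case: ifP => [|/negbT]; first by rewrite ler_norml => h; exists 0; [rewrite mul0r|constructor 1].
  rewrite -ltNge => h; exists (x - Num.sg x * a) => //; case: (ltgtP x 0) => x0.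
  - by constructor 3; rewrite ltr0_sg // mulN1r opprK; split=> //; rewrite ltr0_norm // in h; lra.
  - by constructor 2; rewrite gtr0_sg // mul1r; split=> //; rewrite gtr0_norm // in h.
  - by rewrite x0 normr0 in h; lra.
have [y -> hy] := E u; have [y' -> hy'] := E v; rewrite -mulrBl normrM mulrC ler_wpM2l //.
have h1 := ler_norm (u - v); have h2 := ler_norm (v - u); rewrite distrC in h2.
by rewrite ler_norml; case: hy => [[-> /andP[? ?]]|[-> ?]|[-> ?]]; case: hy' => [[-> /andP[? ?]]|[-> ?]|[-> ?]]; apply/andP; split; lra.
Qed.

Lemma Gam_open gamma r h kap c0 s z t : 0 <= c0 -> Gam gamma r h kap c0 s z t ->
  exists2 d, 0 < d & forall k, cm k < d -> Gam gamma r h kap c0 s z (t + k).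
Proof.
move=> c00; have sl k : `|Pilot.Defs.sigma gamma c0 z (re (t + k)) - Pilot.Defs.sigma gamma c0 z (re t)| <= `|tan (hat_theta gamma z)| * cm k.
  apply: le_trans (sigma_lip _ _ _ _ c00) _; rewrite ler_wpM2l // reD addrC addKr; exact: re_le_cm.
have il k : `|im (t + k) - im t| <= cm k by rewrite imD addrC addKr; exact: im_le_cm.
have ll a th k : `|im ((t + k - a) * cis (- th)) - im ((t - a) * cis (- th))| <= cm k.
  have -> : im ((t + k - a) * cis (- th)) - im ((t - a) * cis (- th)) = im (k * cis (- th)).
    by rewrite -imB; congr im; ring.
  by apply: le_trans (im_le_cm _) _; rewrite cmM cm_cis mulr1.
have comb (y y' k0 K : R) : `|y| <= k0 -> `|y'| <= K * k0 -> `|y + y'| <= (1 + K) * k0 /\ `|y - y'| <= (1 + K) * k0.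
  move=> h1 h2; have := ler_normD y y'; have := ler_normB y y'; by split; lra.
case: s => -[h1 h2 h3].
- have [d1 d10 H1] := Nset_open h1.
  have L2 k : `|(h + Pilot.Defs.sigma gamma c0 z (re (t + k)) - im (t + k)) - (h + Pilot.Defs.sigma gamma c0 z (re t) - im t)| <=
      (1 + `|tan (hat_theta gamma z)|) * cm k.
    have [_ hh] := comb _ _ _ _ (il k) (sl k); rewrite -normrN.
    by move: hh; congr (`|_| <= _); ring.
  have P2 : 0 < h + Pilot.Defs.sigma gamma c0 z (re t) - im t by rewrite subr_gt0.
  have [d2 d20 H2] := lip_open (f := fun t => h + Pilot.Defs.sigma gamma c0 z (re t) - im t) L2 P2.
  have [|d3 d30 H3] := lip_open (f := fun t => im ((t - - (Rc (2^-1 + kap) * period z)) * cis (- hat_theta gamma z))) (K := 1) _ h3.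
    by move=> k; rewrite mul1r; exact: ll.
  exists (Num.min d1 (Num.min d2 d3)); first by rewrite !lt_min d10 d20.
  move=> k; rewrite !lt_min => /and3P[k1 k2 k3]; split; [exact: H1| |exact: H3].
  by have := H2 k k2; rewrite subr_gt0.
have [d1 d10 H1] := Nset_open h1.
have L2 k : `|(im (t + k) - (- h + Pilot.Defs.sigma gamma c0 z (re (t + k)))) - (im t - (- h + Pilot.Defs.sigma gamma c0 z (re t)))| <=
    (1 + `|tan (hat_theta gamma z)|) * cm k.
  have [_ hh] := comb _ _ _ _ (il k) (sl k).
  by move: hh; congr (`|_| <= _); ring.
have P2 : 0 < im t - (- h + Pilot.Defs.sigma gamma c0 z (re t)) by rewrite subr_gt0.
have [d2 d20 H2] := lip_open (f := fun t => im t - (- h + Pilot.Defs.sigma gamma c0 z (re t))) L2 P2.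
have L3 k : `|- im ((t + k - Rc (2^-1 + kap) * period z) * cis (- hat_theta gamma z)) -
    - im ((t - Rc (2^-1 + kap) * period z) * cis (- hat_theta gamma z))| <= 1 * cm k.
  by rewrite mul1r -opprD normrN; exact: ll.
have P3 : 0 < - im ((t - Rc (2^-1 + kap) * period z) * cis (- hat_theta gamma z)) by rewrite oppr_gt0.
have [d3 d30 H3] := lip_open (f := fun t => - im ((t - Rc (2^-1 + kap) * period z) * cis (- hat_theta gamma z))) L3 P3.
exists (Num.min d1 (Num.min d2 d3)); first by rewrite !lt_min d10 d20.
move=> k; rewrite !lt_min => /and3P[k1 k2 k3]; split; [exact: H1| |].
  by have := H2 k k2; rewrite subr_gt0.
by have := H3 k k3; rewrite oppr_gt0.
Qed.

(** As sqrt(eps) -> 0, |x(t)| approaches 1/|t|, and 1/|t| >= 1/vr > r on the disc; the estimates of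
    sinh and cosh near 0 make this uniform. *)
Lemma disc_small r vr : 0 < r -> 0 < vr -> r * vr < 1 -> exists2 s2, 0 < s2 & forall z, cm (rt z) < s2 ->
  forall t, cm t <= vr -> Nset r z t.
Proof.
move=> r0 v0 rv; have e1 : 0 < expR (1 : R) by exact: expR_gt0.
have [K KE] : exists K : R, K = vr + 2 * expR 1 * vr / (1 - r * vr) by eexists.
have a0 : 0 < 2 * expR 1 * vr / (1 - r * vr) by rewrite divr_gt0 ?mulr_gt0 // subr_gt0.
have K0 : 0 < K by rewrite KE; lra.
exists K^-1; first by rewrite invr_gt0.
move=> z zs; apply: disc_Nset => // t tv; have [pz|np] := eqVneq (csinh (rt z * t)) 0; [by left|right].
have s0 : 0 < cm (rt z) by rewrite cm_gt0 rt_neq0.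
have sK : cm (rt z) * K < 1 by rewrite -ltr_pdivlMr // mul1r.
have [q qE] : exists q : R, q = cm (rt z) * vr by eexists.
have q0 : 0 <= q by rewrite qE mulr_ge0 ?ltW.
have sK1 : cm (rt z) * K = q + cm (rt z) * (2 * expR 1 * vr / (1 - r * vr)) by rewrite KE qE mulrDr.
have a1 : 0 < cm (rt z) * (2 * expR 1 * vr / (1 - r * vr)) by rewrite mulr_gt0.
have q1 : q <= 1 by lra.
have q2 : 2 * expR 1 * q <= 1 - r * vr.
  have : cm (rt z) * (2 * expR 1 * vr / (1 - r * vr)) <= 1 by lra.
  rewrite mulrA ler_pdivrMr ?subr_gt0 // mul1r qE => h; apply: le_trans h.
  by rewrite le_eqVlt; apply/orP; left; apply/eqP; ring.
have pq : cm (rt z * t) <= q by rewrite cmM qE ler_wpM2l ?(ltW s0).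
have p1 := le_trans pq q1; have p0 := cm_ge0 (rt z * t).
have hs := csinh_near0 p1; have hc := ccosh_near0 p1.
have hs' : cm (csinh (rt z * t)) <= cm (rt z * t) * (1 + expR 1 * q).
  have h1 := cm_tri (csinh (rt z * t)) 0 (rt z * t); rewrite !subr0 in h1.
  have h2 : expR 1 * cm (rt z * t) ^+ 2 <= cm (rt z * t) * (expR 1 * q).
    by rewrite expr2 mulrCA ler_wpM2l // ler_wpM2l // ltW.
  lra.
have hc' : 1 - expR 1 * q <= cm (ccosh (rt z * t)).
  have h1 := cm_dist 1 (ccosh (rt z * t)); rewrite cm1 in h1; rewrite cmBC in hc.
  have h2 := ler_wpM2l (ltW e1) pq; lra.
have ps : cm (rt z * t) <= cm (rt z) * vr by rewrite cmM ler_wpM2l // ltW.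
have sn0 : 0 < cm (csinh (rt z * t)) by rewrite cm_gt0.
rewrite /xtime cmM cmN cmM cmV mulrA ler_pdivlMr //.
apply: le_trans (ler_wpM2l (ltW r0) hs') _.
apply: le_trans (ler_wpM2l (ltW s0) hc').
have eq0 : 0 <= expR 1 * q by rewrite mulr_ge0 // ltW.
have h1 : cm (rt z * t) * (1 + expR 1 * q) <= cm (rt z) * vr * (1 + expR 1 * q) by rewrite ler_wpM2r //; lra.
apply: le_trans (ler_wpM2l (ltW r0) h1) _.
have -> : r * (cm (rt z) * vr * (1 + expR 1 * q)) = cm (rt z) * (r * vr * (1 + expR 1 * q)) by ring.
rewrite ler_wpM2l ?(ltW s0) //; have : r * vr * (expR 1 * q) <= 1 * (expR 1 * q) by rewrite ler_wpM2r // ltW.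
lra.
Qed.

(** * Constants extracted from the hypotheses *)

Lemma prenormal_data (n : nat) (A : prenormal R n) : exists r1 MB : R, [/\ 0 < r1, r1 <= 1, 0 <= MB &
  [/\ forall e, 0 < e -> exists2 d, 0 < d & forall i x, cm x < d -> cm (Lam0 A x 0 i - Lam0 A 0 0 i) <= e,
   forall i k x y, cm x < r1 -> cm y < r1 -> [/\ cm (Lam0 A x 0 i) <= MB, cm (Lam1 A x 0 i) <= MB & cm (Rem A x y i k) <= MB],
   forall i x, cm x < r1 -> cdiff (fun x => Lam0 A x 0 i) x, forall i x, cm x < r1 -> cdiff (fun x => Lam1 A x 0 i) x &
   forall i k, hol2 (fun x y => cm x < r1 /\ cm y < r1) (fun x y => Rem A x y i k)]].
Proof.
have [d0 d00 H0] := iffLR (nbhsCP _ _) (Lam0_analytic A).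
have [d1 d10 H1] := iffLR (nbhsCP _ _) (Lam1_analytic A).
have [d2 d20 H2] := iffLR (nbhsCCP _ _) (Rem_analytic A).
have D0 i x : cm x < d0 -> cdiff (fun x => Lam0 A x 0 i) x.
  by move=> xd; have := H0 x xd; rewrite add0r => /diff_hol1; exact.
have D1 i x : cm x < d1 -> cdiff (fun x => Lam1 A x 0 i) x.
  by move=> xd; have := H1 x xd; rewrite add0r => /diff_hol1; exact.
have D2 i k : hol2 (fun x y => cm x < d2 /\ cm y < d2) (fun x y => Rem A x y i k).
  by move=> x y [xd yd]; have := H2 x y xd yd; rewrite /= !add0r => /diff_hol2; exact.
have z0 d : 0 < d -> cm (0 : C) < d by rewrite cm0.
have cont e (i : 'I_n) : 0 < e -> exists2 d, 0 < d & forall x, cm x < d -> cm (Lam0 A x 0 i - Lam0 A 0 0 i) <= e.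
  move=> e0; have [d d' Hd] := cdiff_ccont (D0 i 0 (z0 _ d00)) e0; exists d => // x xd.
  by have := Hd x xd; rewrite add0r.
have cont1 (i : 'I_n) : exists2 d, 0 < d & forall x, cm x < d -> cm (Lam1 A x 0 i - Lam1 A 0 0 i) <= 1.
  have [d d' Hd] := cdiff_ccont (D1 i 0 (z0 _ d10)) (@ltr01 R); exists d => // x xd.
  by have := Hd x xd; rewrite add0r.
have HM (p : 'I_n * 'I_n) : exists M : R, exists2 d, 0 < d & forall x y, cm x < d -> cm y < d ->
    [/\ cm (Lam0 A x 0 p.1) <= M, cm (Lam1 A x 0 p.1) <= M & cm (Rem A x y p.1 p.2) <= M].
  have [a a0 Ha] := cont 1 p.1 ltr01; have [b b0 Hb] := cont1 p.1.
  have [_ _ [c [M [c0 HM]]]] := D2 p.1 p.2 0 0 (conj (z0 _ d20) (z0 _ d20)).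
  exists (cm (Lam0 A 0 0 p.1) + cm (Lam1 A 0 0 p.1) + 1 + `|M|), (Num.min a (Num.min b c)).
    by rewrite !lt_min a0 b0.
  move=> x y; rewrite !lt_min => /and3P[xa xb xc] /and3P[_ _ yc].
  have h1 := Ha x xa; have h2 := Hb x xb; have := HM x y xc yc; rewrite !add0r => h3.
  have t1 := cm_tri (Lam0 A x 0 p.1) 0 (Lam0 A 0 0 p.1); have t2 := cm_tri (Lam1 A x 0 p.1) 0 (Lam1 A 0 0 p.1).
  rewrite !subr0 in t1 t2; have := cm_ge0 (Lam0 A 0 0 p.1); have := cm_ge0 (Lam1 A 0 0 p.1).
  by have := ler_norm M; have := normr_ge0 M; split; lra.
have [Mf HMf] := choice HM.
have [p d d' Hd d'd|//|d3 d30 H3] := @fin_min R ('I_n * 'I_n)%type (fun p d => forall x y, cm x < d -> cm y < d ->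
    [/\ cm (Lam0 A x 0 p.1) <= Mf p, cm (Lam1 A x 0 p.1) <= Mf p & cm (Rem A x y p.1 p.2) <= Mf p]).
  by move=> x y xd yd; apply: Hd; exact: lt_le_trans d'd.
pose r1 := Num.min 1 (Num.min (Num.min d0 d1) (Num.min d2 d3)).
have rr x : cm x < r1 -> [/\ cm x < d0, cm x < d1, cm x < d2 & cm x < d3].
  by rewrite !lt_min => /andP[_ /andP[/andP[-> ->] /andP[-> ->]]].
exists r1, (\sum_p `|Mf p|); split.
- by rewrite !lt_min ltr01 d00 d10 d20.
- by rewrite ge_min lexx.
- by rewrite sumr_ge0.
split.
- move=> e e0; have [i d d' Hd d'd|i|d dd Hd] := @fin_min R 'I_n (fun i d => forall x, cm x < d -> cm (Lam0 A x 0 i - Lam0 A 0 0 i) <= e).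
  + by move=> x xd; apply: Hd; exact: lt_le_trans d'd.
  + exact: cont.
  by exists d.
- move=> i k x y /rr[_ _ _ xr] /rr[_ _ _ yr]; have [h1 h2 h3] := H3 (i, k) x y xr yr.
  have h : Mf (i, k) <= \sum_p `|Mf p|.
    by rewrite (bigD1 (i, k)) //=; apply: le_trans (ler_norm _) _; rewrite lerDl sumr_ge0.
  by split; apply: le_trans h.
- by move=> i x /rr[]; auto.
- by move=> i x /rr[]; auto.
by move=> i k x y [/rr[_ _ xr _] /rr[_ _ yr _]]; exact: D2.
Qed.

(** Some th1 > bigT lies in the set defining theta0, so every gap has argument at most pi/2 - th1 in
    absolute value; rotations by at most bigT leave the angular margin th1 - bigT, which gives a
    uniform lower bound on finitely many real parts. *)
Lemma theta_gap (n : nat) (A : prenormal R n) gamma : 0 < gamma -> bigT gamma < theta0 A ->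
  bigT gamma < pi / 2 /\ exists c1 : R, 0 < c1 /\ forall (i k : 'I_n) (th : R), (i < k)%N -> `|th| <= bigT gamma ->
    2 * c1 <= re (cis th * (Lam0 A 0 0 i - Lam0 A 0 0 k)).
Proof.
move=> g0 gT; have p0 := @pi_gt0 R.
have T0 : 0 < bigT gamma by rewrite /bigT mulr_gt0 // addr_gt0 // divr_gt0 // mulr_gt0.
have ne : [set th : R | 0 < th < pi / 2 /\ forall q j : 'I_n, (q < j)%N ->
    0 <= re (cis th * gap A q j) /\ 0 <= re (cis (- th) * gap A q j)] !=set0.
  (* The supremum of the empty set is 0 by default, which bigT > 0 excludes. *)
  apply/set0P/eqP => e; move: gT; rewrite /theta0 e sup0; lra.
have [th1 [/andP[t0 tp] Ht] tT] := sup_gt ne gT; split; first exact: lt_trans tp.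
have [p d d' Hd d'd ij|[i k]|c c0 Hc] := @fin_min R ('I_n * 'I_n)%type (fun p d => (p.1 < p.2)%N -> d <= re (Lam0 A 0 0 p.1 - Lam0 A 0 0 p.2)).
- exact: le_trans d'd (Hd ij).
- case: (boolP (i < k)%N) => ik; last by exists 1.
  by exists (re (Lam0 A 0 0 i - Lam0 A 0 0 k)) => //; exact: Lam_ordered.
have s1 : 0 < sin (th1 - bigT gamma) by apply: sin_gt0_pi; apply/andP; split; lra.
exists (c * sin (th1 - bigT gamma) / 2); split; first by rewrite divr_gt0 // mulr_gt0.
move=> i k th ik tt'; have := Hc (i, k) ik; have [] := Ht i k ik; rewrite /gap /lam !mxE !mul0r !addr0 /=.
move: (_ - _) => g h1 h2 cg; have gr0 : 0 < re g by apply: lt_le_trans cg.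
move: h1 h2; rewrite !reM !re_cis !im_cis cosN sinN => h1 h2.
have ct1 : 0 < cos th1 by apply: cos_gt0_pihalf; apply/andP; split; lra.
have st1 : 0 < sin th1 by apply: sin_gt0_pi; apply/andP; split; lra.
have cT : 0 < cos (bigT gamma) by apply: cos_gt0_pihalf; apply/andP; split; lra.
have sT : 0 < sin (bigT gamma) by apply: sin_gt0_pi; apply/andP; split; lra.
have ca : cos `|th| = cos th by case: (lerP 0 th) => h; [rewrite ger0_norm|rewrite ltr0_norm // cosN].
have cth : cos (bigT gamma) <= cos th by rewrite -ca; apply: cos_decr => //; lra.
have sth : `|sin th| <= sin (bigT gamma).
  rewrite -(@ler_pXn2r _ 2%N) ?nnegrE ?(ltW sT) // real_normK ?num_real //.
  have := cos2Dsin2 th; have := cos2Dsin2 (bigT gamma).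
  have : cos (bigT gamma) ^+ 2 <= cos th ^+ 2 by rewrite ler_pXn2r ?nnegrE ?(ltW cT) // (le_trans (ltW cT)).
  lra.
have gi : sin th1 * `|im g| <= cos th1 * re g by case: (lerP 0 (im g)) => h; rewrite ?(ger0_norm h) ?(ltr0_norm h); lra.
have h3 : cos (bigT gamma) * re g - sin (bigT gamma) * `|im g| <= cos th * re g - sin th * im g.
  have a1 : sin th * im g <= sin (bigT gamma) * `|im g|.
    by apply: le_trans (ler_norm _) _; rewrite normrM ler_wpM2r.
  have a2 : cos (bigT gamma) * re g <= cos th * re g by rewrite ler_wpM2r // ltW.
  lra.
apply: le_trans h3; rewrite -(ler_pM2l st1).
have h4 : sin (bigT gamma) * (sin th1 * `|im g|) <= sin (bigT gamma) * (cos th1 * re g) by rewrite ler_wpM2l // ltW.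
have h5 : re g * sin (th1 - bigT gamma) <= sin th1 * (cos (bigT gamma) * re g - sin (bigT gamma) * `|im g|).
  by rewrite sinB; lra.
apply: le_trans h5; have h6 : c * sin (th1 - bigT gamma) <= re g * sin (th1 - bigT gamma) by rewrite ler_wpM2r // ltW.
apply: le_trans h6; have -> : 2 * (c * sin (th1 - bigT gamma) / 2) = c * sin (th1 - bigT gamma) by field.
by rewrite ler_piMl ?sin_le1 // mulr_ge0 // ltW.
Qed.

Lemma cdiff_snd (f : C -> C -> C) z t : analytic_at (fun p : C * C => f p.1 p.2) (z, t) -> cdiff (f z) t.
Proof.
move=> /nbhs_singleton H.
have D : differentiable (fun p : C * C => \matrix_(i < 1, j < 1) f p.1 p.2) (z, t).
  apply: diff_mx => i j; rewrite (_ : (fun p : C * C => _) = (fun p => f p.1 p.2)) //.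
  by apply/funext => p; rewrite mxE.
have [_ h _] := @diff_hol2 R 1 (fun z w => \matrix_(i < 1, j < 1) f z w) z t D 0 0.
by apply: cdiff_ext h; exists 1 => // k _; rewrite mxE.
Qed.

(** The disc of radius vr must reach above height h, lie in N for small eps, that is r vr < 1, and
    be large enough for the bound on coth outside it, vr r1 >= 2. As r < r1/4, any vr between 1/(2r)
    and 1/r satisfies the last two. *)
Lemma radius_choice (r1 r h : R) : 0 < r -> r < r1 / 4 -> 0 < h -> h < r^-1 ->
  exists vr : R, [/\ h < vr, 0 < vr, 2 <= vr * r1 & r * vr < 1].
Proof.
move=> r0 rr1 h0 hr; have m1 : h <= Num.max h (2 * r)^-1 by rewrite le_max lexx.
have m2 : (2 * r)^-1 <= Num.max h (2 * r)^-1 by rewrite le_max lexx orbT.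
have m3 : Num.max h (2 * r)^-1 < r^-1.
  by rewrite gt_max hr /= ltf_pV2 ?posrE ?mulr_gt0 //; lra.
have m4 : 0 < (2 * r)^-1 by rewrite invr_gt0 mulr_gt0.
exists ((Num.max h (2 * r)^-1 + r^-1) / 2); move: (Num.max h _) m1 m2 m3 => m m1 m2 m3; split; try lra.
  have h1 : (2 * r)^-1 * (4 * r) = 2 by field; rewrite gt_eqF.
  have h2 : (2 * r)^-1 * (4 * r) <= (2 * r)^-1 * r1 by rewrite ler_wpM2l ?(ltW m4) //; lra.
  have h3 : (2 * r)^-1 * r1 <= (m + r^-1) / 2 * r1 by rewrite ler_wpM2r //; lra.
  lra.
by rewrite mulrC -ltr_pdivlMr // mul1r; lra.
Qed.

(** A point of height h on the circle of radius vr has abscissa sqrt(vr^2 - h^2) in modulus; the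
    slope has to pass above it and to exceed |tan hat_theta| + 1. *)
Lemma slope_choice gamma (h vr : R) : 0 < gamma -> bigT gamma < pi / 2 -> 0 < h -> h < vr ->
  exists mm : R, (cos (bigT gamma))^-1 + 1 <= mm /\ h ^+ 2 < mm ^+ 2 * (vr ^+ 2 - h ^+ 2).
Proof.
move=> g0 gT h0 hv; have vh : 0 < vr ^+ 2 - h ^+ 2.
  by rewrite subr_gt0 ltr_pXn2r ?nnegrE ?(ltW h0) // ltW // (lt_trans h0).
have T0 : 0 < bigT gamma by rewrite /bigT mulr_gt0 // addr_gt0 // divr_gt0 ?pi_gt0 // mulr_gt0.
have cT : 0 < (cos (bigT gamma))^-1.
  by rewrite invr_gt0 cos_gt0_pihalf // gT andbT (lt_trans _ T0) // oppr_lt0 divr_gt0 // pi_gt0.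
have q0 : 0 <= h ^+ 2 / (vr ^+ 2 - h ^+ 2) by rewrite divr_ge0 ?sqr_ge0 // ltW.
exists ((cos (bigT gamma))^-1 + 1 + h ^+ 2 / (vr ^+ 2 - h ^+ 2)); split; first by lra.
rewrite -ltr_pdivrMr //; move: (_ / _) ((cos _)^-1) cT q0 => q c cT q0.
have := mulr_ge0 q0 (ltW cT); have := mulr_ge0 q0 q0; have := mulr_ge0 (ltW cT) (ltW cT); rewrite expr2; lra.
Qed.

Lemma cvg_eps_to0 (n : nat) (S : set C) (f : C -> 'rV[C]_n) (B : R) : 0 <= B ->
  (forall z, S z -> forall j, cm (f z 0 j - 1) <= B * cm (rt z)) -> f z @[z --> eps_to0 S] --> (const_mx 1 : 'rV[C]_n).
Proof.
move=> B0 Hf P /nbhs_ballP[e /= e0 HP]; have [e' e'0 eE] := posC e0.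
have B1 : 0 < 2 * (B + 1) by lra.
have q0 : 0 < e' / (2 * (B + 1)) by rewrite divr_gt0.
have eq : B * (e' / (2 * (B + 1))) <= e' / 2.
  have -> : e' / 2 = (B + 1) * (e' / (2 * (B + 1))) by field; rewrite gt_eqF //; lra.
  by rewrite ler_wpM2r ?(ltW q0) //; lra.
have e2 : Rc (e' / 2) < Rc e' :> C by rewrite Rc_lt; lra.
apply/nbhsCP; exists ((e' / (2 * (B + 1))) ^+ 2); first by rewrite exprn_gt0.
move=> k kd z Sz zk; apply: HP; rewrite add0r in zk.
have sk : cm (rt z) < e' / (2 * (B + 1)).
  by rewrite -(@ltr_pXn2r _ 2%N) ?nnegrE ?cm_ge0 ?(ltW q0) // -cm_eps -/(eps_of z) zk.
rewrite -ball_normE /= eE; apply: le_lt_trans e2; apply: mxnorm_le; first by rewrite divr_ge0 // ltW.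
move=> i j; rewrite !mxE cmBC ord1; apply: le_trans (Hf z Sz j) _; apply: le_trans eq.
by rewrite ler_wpM2l // ltW.
Qed.

Lemma near_id_dist (n : nat) (N N' : 'M[C]_n) e : (forall i j, cm (N i j - (i == j)%:R) <= e) ->
  (forall i j, cm (N' i j - (i == j)%:R) <= e) -> forall i j, cm (N i j - N' i j) <= 2 * e /\ cm (N i j) <= e + 1.
Proof.
move=> h h' i j; have h1 := h i j; have := h' i j; rewrite (cmBC (N' i j)) => h2.
have t1 := cm_tri (N i j) (N' i j) (i == j)%:R; have t2 := cm_tri (N i j) 0 (i == j)%:R; rewrite !subr0 in t2.
have t3 : cm ((i == j)%:R : C) <= 1 by case: (i == j); rewrite ?cm1 ?cm0.
split; lra.
Qed.

End ReturnToX.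

Opaque cexp.

Theorem theorem4p22 (R : realType) (n : nat) (hn : (1 < n)%N)
  (A : prenormal R n) (gamma : R) (gamma_gt0 : 0 < gamma)
  (gamma_lt : gamma * (1 + 2 * gamma / pi) < theta0 A) :
  exists2 r0 : R, 0 < r0 &
  forall r : R, 0 < r < r0 ->
  forall delta : R, 0 < delta -> avoids_rays r delta A ->
  forall h : R, 0 < h < r^-1 ->
    (forall s : sector, Omega0 r h s `<=` Sect r delta s) ->
  forall kappa : R, 0 < kappa < 2^-1 ->
  exists2 c1 : R, 0 < c1 &
  forall c0 : R, 0 < c0 < c1 ->
  exists2 rho0 : R, 0 < rho0 &
  forall rho : R, 0 < rho < rho0 ->
  let S := param_sector gamma rho in
  let Om := Omega gamma r h kappa c0 in
  forall FD FU : cplx R -> cplx R -> 'M[cplx R]_n,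
    model_FD A gamma r delta h kappa c0 rho FD ->
    model_FU A gamma r h kappa c0 rho FD FU ->
  exists K : singpt -> cplx R -> 'rV[cplx R]_n,
    (forall l : singpt,
      [/\ (forall z, S z -> analytic_at (K l) z),
          (forall z, S z -> diag_mx (K l z) \in unitmx) &
          (exists2 K0 : 'rV[cplx R]_n, diag_mx K0 \in unitmx &
             K l z @[z --> eps_to0 S] --> K0)]) /\
    forall s : sector,
    exists H : cplx R -> cplx R -> 'M[cplx R]_n,
      [/\ (forall z x, S z -> Om s z x ->
             analytic_at (fun p : cplx R * cplx R => H p.1 p.2) (z, x)),
          (forall z, S z ->
             fundamental_on A (eps_of z) (Om s z)
               (fun x => H z x *m (match s with D => FD | U => FU end) z x)),
          (exists2 c : R, 0 < c &
             forall z, cap_pair gamma rho z ->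
               `|H z 0 - H (z + turn) 0| <= Rc c * `|eps_of z|),
          (exists M : R, forall z, Scap gamma rho z ->
             `|H z 0| <= Rc M /\ `|invmx (H z 0)| <= Rc M) &
          (forall z (l : singpt), S z ->
             H z x @[x --> within (Om s z) (nbhs (xsing l z))]
               --> diag_mx (K l z))].
Proof.
have [gammaT [c1 [c10 gap_lb]]] := theta_gap gamma_gt0 gamma_lt.
have [r1 [MB [r10 r11 MB0 [L0c Bb dL0 dL1 hR]]]] := prenormal_data A.
exists (r1 / 4); first by rewrite divr_gt0.
move=> r /andP[r0 rr1] delta delta0 _ h /andP[h0 hr] _ kap /andP[k0 k2].
have [nu [nu0 nuk sol]] := solution gamma_gt0 gammaT r10 r11 MB0 c10 L0c Bb gap_lb dL0 dL1 hR k0 k2.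
(* Half of the height nu is reserved for c0, the other half for |sqrt(eps)| h. *)
exists (nu / 2); first by rewrite divr_gt0.
move=> c0 /andP[c00 c0n].
have [vr [hv v0 v2 rv]] := radius_choice r0 rr1 h0 hr.
have [mm [hmm mh]] := slope_choice gamma_gt0 gammaT h0 hv.
have [s1 [Cb [V [K [[s10 s11 Cb0 sCb] HV HH]]]]] := sol vr mm v0 v2 hmm.
have [s2 s20 disc] := disc_small r0 v0 rv.
(* Besides the range of the solutions, |sqrt(eps)| must be small enough for the disc to lie in N,
   for h not to exceed the half-width c0 / |sqrt(eps)| of the flat part of sigma, and for
   |sqrt(eps)| h to stay below nu/2. *)
have [s3 s30 [s31 s32 s33 s34]] : exists2 s3 : R, 0 < s3 & [/\ s3 <= s1, s3 <= s2, s3 <= c0 / h & s3 <= nu / (2 * h)].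
  exists (Num.min (Num.min s1 s2) (Num.min (c0 / h) (nu / (2 * h)))).
    by rewrite !lt_min s10 s20 !divr_gt0 // mulr_gt0.
  by split; rewrite !ge_min lexx ?orbT.
exists (s3 ^+ 2); first by rewrite exprn_gt0.
move=> rho /andP[rho0 rhos] S Om FD FU mFD mFU.
have Ss z : S z -> cm (Pilot.Defs.sqrte z) < s3 /\ zdom gamma s1 z.
  move=> [h1 h2]; have h3 : cm (Pilot.Defs.sqrte z) < s3.
    rewrite -(@ltr_pXn2r _ 2%N) ?nnegrE ?cm_ge0 ?(ltW s30) // -cm_eps cm_cexp; exact: lt_trans rhos.
  by split=> //; split=> //; exact: lt_le_trans s31.
(* x_L = sqrt(eps) is the end Re w -> +oo, where tanh w -> 1. *)
pose side l := match l with SL => false | SR => true end.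
pose Kl l z : 'rV[cplx R]_n := \row_j K (side l) j z.
exists Kl; split.
  move=> l; split.
  - move=> z Sz; have [_ zz] := Ss z Sz; apply: analytic_row.
    have [d d0 Hd] := @zdom_open R gamma s1 z 0 zz; exists d => // k kd i.
    have zk := Hd k 0 kd; rewrite cm0 in zk; have [_ _ _ hK] := HV _ (zk d0); have [kd' _] := hK (side l) i.
    by apply: cdiff_ext kd'; exists 1 => // k' _; rewrite mxE.
  - move=> z Sz; have [_ zz] := Ss z Sz; have [_ _ _ hK] := HV z zz.
    rewrite unitmxE det_diag unitfE; apply/prodf_neq0 => j _; rewrite mxE; have [_ k1] := hK (side l) j.
    have [zs _] := zz; have h1 : Cb * cm (Pilot.Defs.sqrte z) <= Cb * s1 by rewrite ler_wpM2l // ltW.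
    apply/eqP => k00; move: k1; rewrite k00 sub0r cmN cm1 => /le_trans/(_ h1).
    by rewrite mulrC => /le_trans/(_ sCb); rewrite leNgt invf_lt1 // ltr1n.
  (* K - 1 = O(|sqrt(eps)|), so the limit at eps = 0 is the identity. *)
  exists (const_mx 1); first by rewrite diag_const_mx unitmx1.
  apply: cvg_eps_to0 Cb0 _ => z Sz j; have [_ zz] := Ss z Sz; have [_ _ _ hK] := HV z zz.
  by rewrite mxE; have [] := hK (side l) j.
move=> s; have [H [hH HW H0 Hlim]] := HH (sec_b s).
pose W := wdom gamma kap s1 nu vr mm (sec_b s).
have oW : opn2 W by move=> p w; exact: wdom_open.
have Wn z w : W z w -> ccosh w != 0 by move=> /HW[[[]]].
have Winj z w w' : W z w -> W z w' -> cth w = cth w' -> w = w'.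
  move=> Ww Ww' E; have [[_ az] st] := wdom_zdom Ww; have [_ st'] := wdom_zdom Ww'.
  rewrite -(ttK (sec_b s) z w) -(ttK (sec_b s) z w'); congr ww.
  by apply: (strip_injective gamma_gt0 gammaT k2 (s := sec_b s) az nuk st st'); rewrite !ttK //; [exact: Wn Ww|exact: Wn Ww'].
have HW2 z w : W z w -> H z w \in unitmx by move=> /HW[].
have HW3 z w i j : W z w -> cder (fun x => H z x i j) w (kapf (fun i y => Lam0 A y 0 i) (fun i y => Lam1 A y 0 i) j z i w * H z w i j +
    \sum_l qf (fun i k y x => Rem A y x i k) z i l w * H z w l j) by move=> /HW[_ _]; exact.
have gam z t : S z -> Gam gamma r h kap c0 s z t -> let w := ww (sec_b s) z (sgn (sec_b s) * t) in
    [/\ W z w, strip gamma kap nu z (tt (sec_b s) z w), xtime z t = Pilot.Defs.sqrte z * cth w & time (sec_b s) z w = t].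
  move=> Sz Gt w; have [zs zz] := Ss z Sz; have [_ az] := zz.
  have tw : tt (sec_b s) z w = sgn (sec_b s) * t by rewrite /w wwK.
  have tE : time (sec_b s) z w = t.
    by rewrite /time tw mulrA /sgn -expr2 sqrr_sign mul1r.
  have [g1 g2 g3] := gam_facts (disc z (lt_le_trans zs s32)) Gt.
  have sh : cm (Pilot.Defs.sqrte z) * h <= c0 by rewrite -ler_pdivlMr // ltW // (lt_le_trans zs).
  have sn : cm (Pilot.Defs.sqrte z) * h < nu / 2.
    by rewrite -ltr_pdivlMr // (lt_le_trans zs) // (le_trans s34) // le_eqVlt; apply/orP; left; apply/eqP; field; rewrite gt_eqF.
  have hv' : 0 < h < vr by rewrite h0.
  have [st os] := cover gamma_gt0 gammaT az hv' mh hmm sh (ltW c0n) sn g1 g2 g3.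
  split=> //; last by rewrite -{1}tE xtime_time.
    by rewrite /W; case: os => os; [constructor 2|constructor 3]; rewrite /fan tw.
  by rewrite tw.
have om z x : Om s z x -> S z -> exists w, [/\ W z w, strip gamma kap nu z (tt (sec_b s) z w) & x = Pilot.Defs.sqrte z * cth w].
  by move=> [t Gt <-] Sz; have [g1 g2 g3 _] := gam z t Sz Gt; eexists; split; [exact: g1|exact: g2|exact: g3].
(* x = 0 is the image of w = 0, where the continued matrix takes the value V. *)
have H00 z : S z -> Hx W H z 0 = V z.
  move=> Sz; have [_ zz] := Ss z Sz; have [W0 <-] := H0 z zz; rewrite /Hx.
  have c00' : cth (0 : cplx R) = 0 by exact: cth0.
  by rewrite -{1}[0](mulr0 (Pilot.Defs.sqrte z)) -{1}c00' winvE.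
exists (Hx W H); split.
- by move=> z x Sz /om[//|w [Ww _ ->]]; exact: Hx_analytic.
- move=> z Sz x [t Gt xE]; have [g1 _ g3 g4] := gam z t Sz Gt; have [_ zz] := Ss z Sz.
  have [L hL] : exists L : cplx R -> cplx R -> cplx R, model_branch A gamma r h kap c0 rho s L (match s with D => FD | U => FU end).
    by move: mFD mFU; case: (s) => [[L hL _] _|_ [[L hL] _]]; exists L.
  have [a1 _ _] := hL z t Sz Gt.
  have := @fundamental_at R n W H oW Wn Winj A (sec_b s) HW2 HW3 z _ (Gam gamma r h kap c0 s z) (L z)
     ((match s with D => FD | U => FU end) z) g1; rewrite g4 -g3 xE; apply.
  + exact: (Gam_open (ltW c00) Gt).
  + exact: cdiff_snd.
  by move=> t' Gt'; have [_ b2 b3] := hL z t' Sz Gt'.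
(* V at z and at z + turn are both within Cb |eps| of the identity; the summand 1 makes the constant
   positive. *)
- exists (2 * Cb + 1); first by rewrite ltr_wpDl // mulr_ge0.
  move=> z [Sz Sz']; rewrite !H00 // /eps_of normE cm_eps -RcM.
  have [_ zz] := Ss z Sz; have [_ zz'] := Ss _ Sz'; have [v1 _ _ _] := HV z zz; have [v1' _ _ _] := HV _ zz'.
  have st : cm (Pilot.Defs.sqrte (z + turn)) = cm (Pilot.Defs.sqrte z).
    by rewrite !cm_rt; congr (expR (_ / 2)); rewrite /turn reD reM re_ci im_ci re_Rc im_Rc mul0r mulr0 subr0 addr0.
  rewrite st in v1'; have q0 := sqr_ge0 (cm (Pilot.Defs.sqrte z)).
  apply: mxnorm_le => [|i j]; first by rewrite mulr_ge0 // addr_ge0 // mulr_ge0.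
  have [h1 _] := near_id_dist v1 v1' i j; rewrite !mxE; apply: le_trans h1 _.
  by rewrite mulrA ler_wpM2r // lerDl.
- have C2 : 0 <= Cb + 2 by rewrite addr_ge0.
  exists (Cb + 2) => z Sc.
  have Sz : S z by case: Sc => [[//]|[_]]; rewrite subrK.
  rewrite H00 //; have [_ zz] := Ss z Sz; have [v1 _ v3 _] := HV z zz; have [zs _] := zz.
  have s2' : Cb * cm (Pilot.Defs.sqrte z) ^+ 2 <= Cb.
    by rewrite ler_piMr // exprn_ile1 ?cm_ge0 //; exact: le_trans (ltW zs) s11.
  split; apply: mxnorm_le => // i j; last by apply: le_trans (v3 i j) _; rewrite lerDr.
  have [_ h1] := near_id_dist v1 v1 i j; apply: le_trans h1 _.
  by rewrite lerD // ler1n.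
move=> z l Sz; have [_ zz] := Ss z Sz.
have xE : xsing l z = (-1) ^+ side l * Pilot.Defs.sqrte z by case: l; rewrite /= ?expr0 ?expr1 ?mul1r ?mulN1r.
rewrite xE; apply: (@Hx_limit R n W H Wn Winj z (Om s z) (fun w => strip gamma kap nu z (tt (sec_b s) z w)) (fun p j => K p j z) (side l)).
  by move=> x /om; exact.
exact: Hlim.
Qed.
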